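(* Let $\mathbf{k}$ be an algebraically closed field of characteristic zero, let $\mathcal{C}$ be a weakly group-theoretical non-degenerate braided fusion category over $\mathbf{k}$, and let $d$ be a positive square-free integer. Assume that $\mathrm{FPdim}(\mathcal{C})=nd$ with $n$ a positive integer and $(n,d)=1$. If $(\mathrm{FPdim}(X)^2,d)=1$ for all simple objects $X$ of $\mathcal{C}$, then, for some non-degenerate quadratic form $q$ on $\mathbb{Z}_d$, $\mathcal{C}$ contains $\mathcal{C}(\mathbb{Z}_d,q)$ as a braided fusion subcategory and $\mathcal{C}\cong\mathcal{C}(\mathbb{Z}_d,q)\boxtimes\mathcal{C}(\mathbb{Z}_d,q)'_{\mathcal{C}}$ as braided fusion categories.
   Context: For a fusion subcategory $\mathcal{D}$ of a braided fusion category $\mathcal{C}$ with braiding $c$, the centralizer $\mathcal{D}'_{\mathcal{C}}$ is the fusion subcategory generated by the simple objects $Y$ of $\mathcal{C}$ with $c_{Y,X}c_{X,Y}=\mathrm{id}_{X\otimes Y}$ for all simple $X\in\mathcal{D}$; $\mathcal{C}$ is non-degenerate if $\mathcal{C}'_{\mathcal{C}}=\mathrm{Vec}$. $\mathrm{FPdim}$ denotes Frobenius-Perron dimension, $\mathrm{FPdim}(\mathcal{C})=\sum_X\mathrm{FPdim}(X)^2$ over isomorphism classes of simple objects. Since $\mathrm{FPdim}(\mathcal{C})$ is an integer, each $\mathrm{FPdim}(X)^2$, $X$ simple, is an integer; $(a,b)$ is the greatest common divisor. The adjoint subcategory $\mathcal{D}_{\mathrm{ad}}$ of a fusion category $\mathcal{D}$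 is generated by the simple objects contained in $X\otimes X^*$ for some simple $X\in\mathcal{D}$; with $\mathcal{D}^{(0)}=\mathcal{D}$, $\mathcal{D}^{(j)}=(\mathcal{D}^{(j-1)})_{\mathrm{ad}}$, $\mathcal{D}$ is nilpotent if $\mathcal{D}^{(m)}=\mathrm{Vec}$ for some $m$. A fusion category is weakly group-theoretical if it is Morita equivalent to a nilpotent fusion category (equivalently, its Drinfeld center is braided equivalent to that of a nilpotent fusion category). $\mathbb{Z}_d=\mathbb{Z}/d$. For a finite abelian group $B$ with non-degenerate quadratic form $q:B\to\mathbf{k}^*$, $\mathcal{C}(B,q)$ is the corresponding pointed non-degenerate braided fusion category (simple objects labelled by $B$, self-braiding of $b$ equal to $q(b)$). $\boxtimes$ is the Deligne tensor product. *)

(* Defs.v *)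
From HB Require Import structures.
From mathcomp Require Import all_boot all_order all_algebra all_field boolp.

Set Implicit Arguments.
Unset Strict Implicit.
Unset Printing Implicit Defensive.

Import Order.TTheory GRing.Theory Num.Theory.

Declare Scope cat_scope.
Delimit Scope cat_scope with cat.
Local Open Scope ring_scope.
Local Open Scope cat_scope.

Reserved Notation "g \oc f" (at level 40, left associativity).
Reserved Notation "X \ox Y" (at level 40, left associativity).
Reserved Notation "f \om g" (at level 40, left associativity).

Record lincat (k : fieldType) := LinCat {
  Ob :> Type;
  Hom : Ob -> Ob -> lmodType k;
  idm : forall X, Hom X X;
  comp : forall X Y Z, Hom Y Z -> Hom X Y -> Hom X Z;
  compA : forall X Y Z W (h : Hom Z W) (g : Hom Y Z) (f : Hom X Y),
    comp h (comp g f) = comp (comp h g) f;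
  comp1m : forall X Y (f : Hom X Y), comp (idm Y) f = f;
  compm1 : forall X Y (f : Hom X Y), comp f (idm X) = f;
  compPl : forall X Y Z (a : k) (g g' : Hom Y Z) (f : Hom X Y),
    comp (a *: g + g') f = a *: comp g f + comp g' f;
  compPr : forall X Y Z (a : k) (g : Hom Y Z) (f f' : Hom X Y),
    comp g (a *: f + f') = a *: comp g f + comp g f' }.

Arguments Hom {k l} X Y.
Arguments idm {k l} X.
Arguments comp {k l X Y Z} g f.
Notation "g \oc f" := (comp g f) : cat_scope.

Section LinCatTheory.
Variables (k : fieldType) (C : lincat k).
Implicit Types X Y Z : C.

Definition is_iso X Y (f : Hom X Y) : Prop :=
  exists g : Hom Y X, g \oc f = idm X /\ f \oc g = idm Y.

Definition isom X Y : Prop := exists f : Hom X Y, is_iso f.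

Definition mono X Y (f : Hom X Y) : Prop :=
  forall W (g h : Hom W X), f \oc g = f \oc h -> g = h.

Definition epi X Y (f : Hom X Y) : Prop :=
  forall W (g h : Hom Y W), g \oc f = h \oc f -> g = h.

Definition is_zero X : Prop := idm X = 0.

Definition is_kernel K X Y (i : Hom K X) (f : Hom X Y) : Prop :=
  f \oc i = 0 /\
  forall W (g : Hom W X), f \oc g = 0 -> exists! h : Hom W K, i \oc h = g.

Definition is_cokernel Q X Y (p : Hom Y Q) (f : Hom X Y) : Prop :=
  p \oc f = 0 /\
  forall W (g : Hom Y W), g \oc f = 0 -> exists! h : Hom Q W, h \oc p = g.

Definition biproduct n (S : 'I_n -> C) X : Prop :=
  exists (i : forall j, Hom (S j) X) (p : forall j, Hom X (S j)),
    [/\ forall j, p j \oc i j = idm (S j),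
        forall j l, j != l -> p j \oc i l = 0
      & \sum_j i j \oc p j = idm X].

(* The case n = 0 of the first clause is the existence of a zero object. *)
Definition abelian : Prop :=
  [/\ forall n (S : 'I_n -> C), exists X, biproduct S X,
      forall X Y (f : Hom X Y), exists K (i : Hom K X), is_kernel i f,
      forall X Y (f : Hom X Y), exists Q (p : Hom Y Q), is_cokernel p f,
      forall X Y (f : Hom X Y), mono f ->
        exists Z (g : Hom Y Z), is_kernel f g
    & forall X Y (f : Hom X Y), epi f ->
        exists Z (g : Hom Z X), is_cokernel f g].

Definition simple X : Prop :=
  ~ is_zero X /\
  forall Y (f : Hom Y X), mono f -> is_zero Y \/ is_iso f.

Definition semisimple : Prop :=
  forall X, exists n (S : 'I_n -> C),
    (forall j, simple (S j)) /\ biproduct S X.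

(* S is a complete irredundant list of the simple objects up to isomorphism. *)
Definition simple_reps n (S : 'I_n -> C) : Prop :=
  (forall j, simple (S j)) /\ forall X, simple X -> exists! j, isom X (S j).

Definition has_dim (V : lmodType k) (n : nat) : Prop :=
  inhabited (Vector.axiom n V).

Record finite_semisimple : Prop := FiniteSemisimple {
  fss_abelian : abelian;
  fss_semisimple : semisimple;
  fss_dim : forall X Y, exists n, has_dim (Hom X Y) n;
  fss_simples : exists nS : {n : nat & 'I_n -> C}, simple_reps (projT2 nS) }.

Lemma is_iso_id X : is_iso (idm X).
Proof. by exists (idm X); rewrite !comp1m. Qed.

Lemma is_iso_comp X Y Z (g : Hom Y Z) (f : Hom X Y) :
  is_iso g -> is_iso f -> is_iso (g \oc f).
Proof.
move=> [g' [g'g gg']] [f' [f'f ff']]; exists (f' \oc g'); split.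
- by rewrite -compA (compA g') g'g comp1m.
- by rewrite -compA (compA f) ff' comp1m.
Qed.

Lemma comp0m X Y Z (f : Hom X Y) : (0 : Hom Y Z) \oc f = 0.
Proof.
have := compPl 1 (0 : Hom Y Z) 0 f; rewrite scaler0 addr0 scale1r => /eqP.
by rewrite -subr_eq0 opprD addrA subrr add0r oppr_eq0 => /eqP.
Qed.

Lemma compm0 X Y Z (g : Hom Y Z) : g \oc (0 : Hom X Y) = 0.
Proof.
have := compPr 1 g (0 : Hom X Y) 0; rewrite scaler0 addr0 scale1r => /eqP.
by rewrite -subr_eq0 opprD addrA subrr add0r oppr_eq0 => /eqP.
Qed.

End LinCatTheory.

(* Linearity is kept separate because the functor A x B -> T underlying a
   bilinear bifunctor is not linear. *)
Record functor (k : fieldType) (A B : lincat k) := Functor {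
  fob :> A -> B;
  fmap : forall X Y, Hom X Y -> Hom (fob X) (fob Y);
  fmap1 : forall X, fmap (idm X) = idm (fob X);
  fmapM : forall X Y Z (g : Hom Y Z) (f : Hom X Y),
    fmap (g \oc f) = fmap g \oc fmap f }.

Arguments fmap {k A B} _ {X Y} _.

Definition linear_functor (k : fieldType) (A B : lincat k) (F : functor A B) :=
  forall X Y (a : k) (f g : Hom X Y),
    fmap F (a *: f + g) = a *: fmap F f + fmap F g.

Definition equivalence (k : fieldType) (A B : lincat k) (F : functor A B) :=
  (forall X Y : A, bijective (fun f : Hom X Y => fmap F f)) /\
  (forall Z : B, exists X : A, isom (F X) Z).

Definition right_exact (k : fieldType) (A B : lincat k) (F : functor A B) :=
  forall X Y Q (f : Hom X Y) (p : Hom Y Q),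
    is_cokernel p f -> is_cokernel (fmap F p) (fmap F f).

Definition natural (k : fieldType) (A B : lincat k) (F G : functor A B)
    (t : forall X, Hom (F X) (G X)) : Prop :=
  forall X Y (f : Hom X Y), t Y \oc fmap F f = fmap G f \oc t X.

Lemma fmap_iso (k : fieldType) (A B : lincat k) (F : functor A B)
    (X Y : A) (f : Hom X Y) : is_iso f -> is_iso (fmap F f).
Proof. by move=> [g [gf fg]]; exists (fmap F g); rewrite -!fmapM gf fg !fmap1. Qed.

Definition id_functor (k : fieldType) (A : lincat k) : functor A A :=
  @Functor k A A id (fun _ _ => id) (fun _ => erefl) (fun _ _ _ _ _ => erefl).

Section CompFunctor.
Variables (k : fieldType) (A B C : lincat k) (G : functor B C) (F : functor A B).
Fact comp_functor1 (X : A) : fmap G (fmap F (idm X)) = idm (G (F X)).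
Proof. by rewrite !fmap1. Qed.
Fact comp_functorM (X Y Z : A) (g : Hom Y Z) (f : Hom X Y) :
  fmap G (fmap F (g \oc f)) = fmap G (fmap F g) \oc fmap G (fmap F f).
Proof. by rewrite !fmapM. Qed.
Definition comp_functor : functor A C := Functor comp_functor1 comp_functorM.
End CompFunctor.

Record bifunctor (k : fieldType) (A B T : lincat k) := Bifunctor {
  bob :> A -> B -> T;
  bmap : forall X X' Y Y', Hom X X' -> Hom Y Y' -> Hom (bob X Y) (bob X' Y');
  bmap1 : forall X Y, bmap (idm X) (idm Y) = idm (bob X Y);
  bmapM : forall X X' X'' Y Y' Y'' (f' : Hom X' X'') (f : Hom X X')
      (g' : Hom Y' Y'') (g : Hom Y Y'),
    bmap (f' \oc f) (g' \oc g) = bmap f' g' \oc bmap f g;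
  bmapPl : forall X X' Y Y' (a : k) (f f' : Hom X X') (g : Hom Y Y'),
    bmap (a *: f + f') g = a *: bmap f g + bmap f' g;
  bmapPr : forall X X' Y Y' (a : k) (f : Hom X X') (g g' : Hom Y Y'),
    bmap f (a *: g + g') = a *: bmap f g + bmap f g' }.

Arguments bmap {k A B T} _ {X X' Y Y'} _ _.

Definition right_exact2 (k : fieldType) (A B T : lincat k)
    (F : bifunctor A B T) : Prop :=
  (forall X X' Q Y (f : Hom X X') (p : Hom X' Q), is_cokernel p f ->
     is_cokernel (bmap F p (idm Y)) (bmap F f (idm Y))) /\
  (forall X Y Y' Q (f : Hom Y Y') (p : Hom Y' Q), is_cokernel p f ->
     is_cokernel (bmap F (idm X) p) (bmap F (idm X) f)).

Lemma bmap_iso (k : fieldType) (A B T : lincat k) (F : bifunctor A B T)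
    X X' Y Y' (f : Hom X X') (g : Hom Y Y') :
  is_iso f -> is_iso g -> is_iso (bmap F f g).
Proof.
move=> [f' [f'f ff']] [g' [g'g gg']]; exists (bmap F f' g').
by rewrite -!bmapM f'f ff' g'g gg' !bmap1.
Qed.

Record moncat (k : fieldType) := MonCat {
  mcat :> lincat k;
  tens : bifunctor mcat mcat mcat;
  unit_ob : mcat;
  asso : forall X Y Z, Hom (tens (tens X Y) Z) (tens X (tens Y Z));
  assoV : forall X Y Z, Hom (tens X (tens Y Z)) (tens (tens X Y) Z);
  lun : forall X, Hom (tens unit_ob X) X;
  run : forall X, Hom (tens X unit_ob) X;
  assoK : forall X Y Z, assoV X Y Z \oc asso X Y Z = idm _;
  assoVK : forall X Y Z, asso X Y Z \oc assoV X Y Z = idm _;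
  lun_iso : forall X, is_iso (lun X);
  run_iso : forall X, is_iso (run X);
  asso_nat : forall X X' Y Y' Z Z' (f : Hom X X') (g : Hom Y Y') (h : Hom Z Z'),
    asso X' Y' Z' \oc bmap tens (bmap tens f g) h
    = bmap tens f (bmap tens g h) \oc asso X Y Z;
  lun_nat : forall X X' (f : Hom X X'),
    lun X' \oc bmap tens (idm unit_ob) f = f \oc lun X;
  run_nat : forall X X' (f : Hom X X'),
    run X' \oc bmap tens f (idm unit_ob) = f \oc run X;
  pentagon : forall X Y Z W,
    asso X Y (tens Z W) \oc asso (tens X Y) Z W
    = bmap tens (idm X) (asso Y Z W) \oc asso X (tens Y Z) W
      \oc bmap tens (asso X Y Z) (idm W);
  triangle : forall X Y,
    bmap tens (idm X) (lun Y) \oc asso X unit_ob Y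
    = bmap tens (run X) (idm Y) }.

Arguments tens {k m}.
Arguments unit_ob {k} m.
Arguments asso {k m} X Y Z.
Arguments assoV {k m} X Y Z.
Arguments lun {k m} X.
Arguments run {k m} X.
Notation "X \ox Y" := (tens X Y) : cat_scope.
Notation "f \om g" := (bmap tens f g) : cat_scope.

Record bmoncat (k : fieldType) := BMonCat {
  bmcat :> moncat k;
  braid : forall X Y : bmcat, Hom (X \ox Y) (Y \ox X);
  braid_iso : forall X Y, is_iso (braid X Y);
  braid_nat : forall X X' Y Y' (f : Hom X X') (g : Hom Y Y'),
    braid X' Y' \oc (f \om g) = (g \om f) \oc braid X Y;
  hexagon : forall X Y Z,
    asso Y Z X \oc braid X (Y \ox Z) \oc asso X Y Z
    = (idm Y \om braid X Z) \oc asso Y X Z \oc (braid X Y \om idm Z);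
  hexagonV : forall X Y Z,
    assoV Z X Y \oc braid (X \ox Y) Z \oc assoV X Y Z
    = (braid X Z \om idm Y) \oc assoV X Z Y \oc (idm X \om braid Y Z) }.

Arguments braid {k b} X Y.

Record monoidal_structure (k : fieldType) (A B : moncat k) (F : functor A B) :=
  MonoidalStructure {
  mJ : forall X Y, Hom (F X \ox F Y) (F (X \ox Y));
  mJ0 : Hom (unit_ob B) (F (unit_ob A));
  mJ_iso : forall X Y, is_iso (mJ X Y);
  mJ0_iso : is_iso mJ0;
  mJ_nat : forall X X' Y Y' (f : Hom X X') (g : Hom Y Y'),
    mJ X' Y' \oc (fmap F f \om fmap F g) = fmap F (f \om g) \oc mJ X Y;
  mJ_asso : forall X Y Z,
    fmap F (asso X Y Z) \oc mJ (X \ox Y) Z \oc (mJ X Y \om idm (F Z))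
    = mJ X (Y \ox Z) \oc (idm (F X) \om mJ Y Z) \oc asso (F X) (F Y) (F Z);
  mJ_lun : forall X,
    fmap F (lun X) \oc mJ (unit_ob A) X \oc (mJ0 \om idm (F X)) = lun (F X);
  mJ_run : forall X,
    fmap F (run X) \oc mJ X (unit_ob A) \oc (idm (F X) \om mJ0) = run (F X) }.

Definition braided_structure (k : fieldType) (A B : bmoncat k)
    (F : functor A B) (J : monoidal_structure F) : Prop :=
  forall X Y : A, fmap F (braid X Y) \oc mJ J X Y = mJ J Y X \oc braid (F X) (F Y).

Definition tensor_equivalent (k : fieldType) (A B : moncat k) : Prop :=
  exists F : functor A B,
    [/\ linear_functor F, equivalence F & inhabited (monoidal_structure F)].

Definition braided_equivalent (k : fieldType) (A B : bmoncat k) : Prop :=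
  exists (F : functor A B) (J : monoidal_structure F),
    [/\ linear_functor F, equivalence F & braided_structure J].

Section Fusion.
Variables (k : fieldType) (C : moncat k).
Implicit Types X Y : C.

(* Xd is a left dual of X: ev : Xd (x) X -> 1 and coev : 1 -> X (x) Xd. *)
Definition is_dual (Xd X : C) : Prop :=
  exists (ev : Hom (Xd \ox X) (unit_ob C)) (coev : Hom (unit_ob C) (X \ox Xd)),
    run X \oc (idm X \om ev) \oc asso X Xd X \oc (coev \om idm X) = lun X /\
    lun Xd \oc (ev \om idm Xd) \oc assoV Xd X Xd \oc (idm Xd \om coev) = run Xd.

Record fusion : Prop := FusionAxioms {
  fusion_fss : finite_semisimple C;
  fusion_ldual : forall X, exists Xd, is_dual Xd X;
  fusion_rdual : forall X, exists Xd, is_dual X Xd;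
  fusion_unit : simple (unit_ob C) }.

(* Full replete subcategories closed under direct sums, subobjects, tensor
   products and duals, given by their objects. *)
Record fusion_subcat (D : C -> Prop) : Prop := FusionSubcat {
  fsub_isom : forall X Y, isom X Y -> D X -> D Y;
  fsub_sum : forall n (S : 'I_n -> C) X,
    (forall j, D (S j)) -> biproduct S X -> D X;
  fsub_sub : forall X Y (f : Hom Y X), mono f -> D X -> D Y;
  fsub_unit : D (unit_ob C);
  fsub_tens : forall X Y, D X -> D Y -> D (X \ox Y);
  fsub_ldual : forall X Xd, is_dual Xd X -> D X -> D Xd;
  fsub_rdual : forall X Xd, is_dual X Xd -> D X -> D Xd }.

Definition generated (S : C -> Prop) : C -> Prop := fun X =>
  forall D, fusion_subcat D -> (forall Y, S Y -> D Y) -> D X.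

Lemma generated_fusion_subcat S : fusion_subcat (generated S).
Proof.
split.
- by move=> X Y XY gX D hD SD; apply: (fsub_isom hD XY); apply: gX.
- move=> n T X gT TX D hD SD; apply: (fsub_sum hD _ TX) => j; exact: gT.
- by move=> X Y f mf gX D hD SD; apply: (fsub_sub hD mf); apply: gX.
- by move=> D hD _; apply: fsub_unit hD.
- by move=> X Y gX gY D hD SD; apply: (fsub_tens hD); [apply: gX | apply: gY].
- by move=> X Xd XX gX D hD SD; apply: (fsub_ldual hD XX); apply: gX.
- by move=> X Xd XX gX D hD SD; apply: (fsub_rdual hD XX); apply: gX.
Qed.

Definition in_Vec X : Prop :=
  exists n, biproduct (fun _ : 'I_n => unit_ob C) X.

Definition adjoint_subcat (D : C -> Prop) : C -> Prop :=
  generated (fun Y => simple Y /\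
    exists X Xd, [/\ D X, simple X, is_dual Xd X
                   & exists f : Hom Y (X \ox Xd), mono f]).

Definition nilpotent : Prop :=
  exists m, forall X, iter m adjoint_subcat (fun _ => True) X <-> in_Vec X.

End Fusion.

Section FPdim.
Variables (k : fieldType) (C : moncat k) (hC : fusion C).

Definition hom_dim (X Y : C) : nat := sval (cid (fss_dim (fusion_fss hC) X Y)).

Definition simple_enum : {n : nat & 'I_n -> C} :=
  sval (cid (fss_simples (fusion_fss hC))).
Definition rank : nat := projT1 simple_enum.
Definition simple_ob : 'I_rank -> C := projT2 simple_enum.

(* Left multiplication by X on the Grothendieck ring, in the basis of simple
   objects: the multiplicity of S_i in X (x) S_j is dim Hom(S_i, X (x) S_j). *)
Definition fusion_mx (X : C) : 'M[algC]_rank :=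
  \matrix_(i, j) (hom_dim (simple_ob i) (X \ox simple_ob j))%:R.

Definition eigenvalues n (A : 'M[algC]_n) : seq algC :=
  sval (closed_field_poly_normal (char_poly A)).

Definition FPdim (X : C) : algC :=
  \big[Num.max/0]_(z <- eigenvalues (fusion_mx X) | 0 <= z) z.

Definition FPdim_cat : algC := \sum_(i < rank) FPdim (simple_ob i) ^+ 2.

End FPdim.

Record modcat (k : fieldType) (C : moncat k) := ModCat {
  modc :> lincat k;
  act : bifunctor C modc modc;
  mas : forall X Y m, Hom (act (X \ox Y) m) (act X (act Y m));
  mun : forall m, Hom (act (unit_ob C) m) m;
  mas_iso : forall X Y m, is_iso (mas X Y m);
  mun_iso : forall m, is_iso (mun m);
  mas_nat : forall X X' Y Y' m m' (f : Hom X X') (g : Hom Y Y') (h : Hom m m'),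
    mas X' Y' m' \oc bmap act (f \om g) h
    = bmap act f (bmap act g h) \oc mas X Y m;
  mun_nat : forall m m' (h : Hom m m'),
    mun m' \oc bmap act (idm (unit_ob C)) h = h \oc mun m;
  mas_pentagon : forall X Y Z m,
    mas X Y (act Z m) \oc mas (X \ox Y) Z m
    = bmap act (idm X) (mas Y Z m) \oc mas X (Y \ox Z) m
      \oc bmap act (asso X Y Z) (idm m);
  mas_triangle : forall X m,
    bmap act (idm X) (mun m) \oc mas X (unit_ob C) m
    = bmap act (run X) (idm m) }.

Arguments act {k C _}.
Arguments mas {k C _} X Y _.
Arguments mun {k C _} _.

(* P and Q are the objects of two complementary module subcategories. *)
Definition indecomposable (k : fieldType) (C : moncat k) (M : modcat C) : Prop :=
  (exists m : M, ~ is_zero m) /\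
  forall P Q : M -> Prop,
    (forall X m, P m -> P (act X m)) ->
    (forall X m, Q m -> Q (act X m)) ->
    (forall m n, P m -> Q n ->
       (forall f : Hom m n, f = 0) /\ (forall f : Hom n m, f = 0)) ->
    (forall m, exists m1 m2,
       [/\ P m1, Q m2 & biproduct (fun j : 'I_2 => if j == 0 then m1 else m2) m]) ->
    (forall m, P m -> is_zero m) \/ (forall m, Q m -> is_zero m).

Record modfunctor (k : fieldType) (C : moncat k) (M : modcat C) := ModFunctor {
  mf :> functor M M;
  mf_lin : linear_functor mf;
  mfs : forall X m, Hom (mf (act X m)) (act X (mf m));
  mfs_iso : forall X m, is_iso (mfs X m);
  mfs_nat : forall X X' m m' (f : Hom X X') (h : Hom m m'),
    mfs X' m' \oc fmap mf (bmap act f h) = bmap act f (fmap mf h) \oc mfs X m;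
  mfs_mas : forall X Y m,
    bmap act (idm X) (mfs Y m) \oc mfs X (act Y m) \oc fmap mf (mas X Y m)
    = mas X Y (mf m) \oc mfs (X \ox Y) m;
  mfs_mun : forall m, mun (mf m) \oc mfs (unit_ob C) m = fmap mf (mun m) }.

Arguments mfs {k C M} _ X _.

Record modnat (k : fieldType) (C : moncat k) (M : modcat C)
    (F G : modfunctor M) := ModNat {
  mn :> forall m, Hom (F m) (G m);
  mn_nat : natural mn;
  mn_act : forall X m,
    bmap act (idm X) (mn m) \oc mfs F X m = mfs G X m \oc mn (act X m) }.

Section ModNatLmod.
Variables (k : fieldType) (C : moncat k) (M : modcat C) (F G : modfunctor M).

Lemma modnatP (s t : modnat F G) : (forall m, s m = t m) -> s = t.
Proof.
case: s => s s1 s2; case: t => t t1 t2 /= st.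
have {}st : s = t by apply: functional_extensionality_dep.
by case: _ / st t1 t2 => t1 t2; congr ModNat; apply: Prop_irrelevance.
Qed.

HB.instance Definition _ := gen_eqMixin (modnat F G).
HB.instance Definition _ := gen_choiceMixin (modnat F G).

Fact modnat0_nat : natural (fun m => 0 : Hom (F m) (G m)).
Proof. by move=> m m' f; rewrite comp0m compm0. Qed.
Fact modnat0_act X m :
  bmap act (idm X) (0 : Hom (F m) (G m)) \oc mfs F X m = mfs G X m \oc 0.
Proof.
have := bmapPr act 1 (idm X) (0 : Hom (F m) (G m)) 0.
rewrite scaler0 addr0 scale1r => /eqP.
rewrite -subr_eq0 opprD addrA subrr add0r oppr_eq0 => /eqP ->.
by rewrite comp0m compm0.
Qed.
Definition modnat0 : modnat F G := ModNat modnat0_nat modnat0_act.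

Fact modnatP_nat (a : k) (s t : modnat F G) : natural (fun m => a *: s m + t m).
Proof. by move=> m m' f; rewrite compPl compPr !mn_nat. Qed.
Fact modnatP_act (a : k) (s t : modnat F G) X m :
  bmap act (idm X) (a *: s m + t m) \oc mfs F X m
  = mfs G X m \oc (a *: s (act X m) + t (act X m)).
Proof. by rewrite bmapPr compPl compPr !mn_act. Qed.
Definition modnat_lc (a : k) (s t : modnat F G) : modnat F G :=
  ModNat (modnatP_nat a s t) (modnatP_act a s t).

Definition modnat_add (s t : modnat F G) := modnat_lc 1 s t.
Definition modnat_scale (a : k) (s : modnat F G) := modnat_lc a s modnat0.
Definition modnat_opp (s : modnat F G) := modnat_scale (-1) s.

Fact modnat_addA : associative modnat_add.
Proof. by move=> r s t; apply: modnatP => m /=; rewrite !scale1r addrA. Qed.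
Fact modnat_addC : commutative modnat_add.
Proof. by move=> s t; apply: modnatP => m /=; rewrite !scale1r addrC. Qed.
Fact modnat_add0 : left_id modnat0 modnat_add.
Proof. by move=> s; apply: modnatP => m /=; rewrite scaler0 add0r. Qed.
Fact modnat_addN : left_inverse modnat0 modnat_opp modnat_add.
Proof.
by move=> s; apply: modnatP => m /=; rewrite scale1r addr0 scaleN1r addNr.
Qed.
HB.instance Definition _ := GRing.isZmodule.Build (modnat F G)
  modnat_addA modnat_addC modnat_add0 modnat_addN.

Fact modnat_scaleA a b (s : modnat F G) :
  modnat_scale a (modnat_scale b s) = modnat_scale (a * b) s.
Proof. by apply: modnatP => m /=; rewrite !addr0 scalerA. Qed.
Fact modnat_scale1 : left_id 1 modnat_scale.
Proof. by move=> s; apply: modnatP => m /=; rewrite addr0 scale1r. Qed.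
Fact modnat_scaleDr : right_distributive modnat_scale +%R.
Proof.
by move=> a s t; apply: modnatP => m /=; rewrite !addr0 !scale1r scalerDr.
Qed.
Fact modnat_scaleDl (s : modnat F G) :
  {morph modnat_scale^~ s : a b / a + b >-> a + b}.
Proof.
by move=> a b; apply: modnatP => m /=; rewrite !addr0 !scale1r scalerDl.
Qed.
HB.instance Definition _ := GRing.Zmodule_isLmodule.Build k (modnat F G)
  modnat_scaleA modnat_scale1 modnat_scaleDr modnat_scaleDl.

Lemma modnat_lcE (a : k) (s t : modnat F G) m :
  (a *: s + t : modnat F G) m = a *: s m + t m.
Proof. by rewrite /= addr0 scale1r. Qed.

End ModNatLmod.

Section DualCategory.
Variables (k : fieldType) (C : moncat k) (M : modcat C).
Implicit Types F G H : modfunctor M.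

Fact modid_nat F : natural (fun m => idm (F m)).
Proof. by move=> m m' f; rewrite comp1m compm1. Qed.
Fact modid_act F X m :
  bmap act (idm X) (idm (F m)) \oc mfs F X m = mfs F X m \oc idm (F (act X m)).
Proof. by rewrite bmap1 comp1m compm1. Qed.
Definition modid F : modnat F F := ModNat (@modid_nat F) (modid_act F).

Section Comp.
Variables (F G H : modfunctor M) (t : modnat G H) (s : modnat F G).
Fact modcomp_nat : natural (fun m => t m \oc s m).
Proof. by move=> m m' f; rewrite -compA mn_nat compA mn_nat -compA. Qed.
Fact modcomp_act X m :
  bmap act (idm X) (t m \oc s m) \oc mfs F X m
  = mfs H X m \oc (t (act X m) \oc s (act X m)).
Proof.
by rewrite -{1}(comp1m (idm X)) bmapM -compA mn_act compA mn_act compA.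
Qed.
Definition modcomp : modnat F H := ModNat modcomp_nat modcomp_act.
End Comp.

Fact modfunA F G H K (h : modnat H K) (g : modnat G H) (f : modnat F G) :
  modcomp h (modcomp g f) = modcomp (modcomp h g) f.
Proof. by apply: modnatP => m /=; rewrite compA. Qed.
Fact modfun1m F G (f : modnat F G) : modcomp (modid G) f = f.
Proof. by apply: modnatP => m /=; rewrite comp1m. Qed.
Fact modfunm1 F G (f : modnat F G) : modcomp f (modid F) = f.
Proof. by apply: modnatP => m /=; rewrite compm1. Qed.
Fact modfunPl F G H (a : k) (g g' : modnat G H) (f : modnat F G) :
  modcomp (a *: g + g') f = a *: modcomp g f + modcomp g' f.
Proof. by apply: modnatP => m; rewrite modnat_lcE /= addr0 scale1r compPl. Qed.
Fact modfunPr F G H (a : k) (g : modnat G H) (f f' : modnat F G) :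
  modcomp g (a *: f + f') = a *: modcomp g f + modcomp g f'.
Proof. by apply: modnatP => m; rewrite modnat_lcE /= addr0 scale1r compPr. Qed.

Definition modfun_cat : lincat k :=
  @LinCat k (modfunctor M) (fun F G => modnat F G : lmodType k)
    modid modcomp modfunA modfun1m modfunm1 modfunPl modfunPr.

Section CompModFunctor.
Variables F G : modfunctor M.
Let GF := comp_functor G F.
Let s X m : Hom (GF (act X m)) (act X (GF m)) :=
  mfs G X (F m) \oc fmap G (mfs F X m).
Fact mfcomp_lin : linear_functor GF.
Proof. by move=> X Y a f g; rewrite /= !mf_lin. Qed.
Fact mfcomp_iso X m : is_iso (s X m).
Proof. by apply: is_iso_comp (mfs_iso _ _ _) (fmap_iso _ (mfs_iso _ _ _)). Qed.
Fact mfcomp_nat X X' m m' (f : Hom X X') (h : Hom m m') :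
  s X' m' \oc fmap GF (bmap act f h) = bmap act f (fmap GF h) \oc s X m.
Proof. by rewrite /s /= -compA -fmapM mfs_nat fmapM compA mfs_nat compA. Qed.
Fact mfcomp_mas X Y m :
  bmap act (idm X) (s Y m) \oc s X (act Y m) \oc fmap GF (mas X Y m)
  = mas X Y (GF m) \oc s (X \ox Y) m.
Proof.
rewrite /s /= -{1}(comp1m (idm X)) bmapM.
rewrite (compA (mas _ _ _)) -mfs_mas -!compA; congr (_ \oc _).
rewrite (compA (bmap act _ (fmap G _))) -mfs_nat -!compA; congr (_ \oc _).
by rewrite -!fmapM compA mfs_mas.
Qed.
Fact mfcomp_mun m : mun (GF m) \oc s (unit_ob C) m = fmap GF (mun m).
Proof. by rewrite /s /= compA mfs_mun -fmapM mfs_mun. Qed.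
Definition mfcomp : modfunctor M :=
  ModFunctor mfcomp_lin mfcomp_iso mfcomp_nat mfcomp_mas mfcomp_mun.
End CompModFunctor.

Section IdModFunctor.
Let I := id_functor M.
Let s X m : Hom (I (act X m)) (act X (I m)) := idm (act X m).
Fact mfid_lin : linear_functor I. Proof. by []. Qed.
Fact mfid_iso X m : is_iso (s X m). Proof. exact: is_iso_id. Qed.
Fact mfid_nat X X' m m' (f : Hom X X') (h : Hom m m') :
  s X' m' \oc fmap I (bmap act f h) = bmap act f (fmap I h) \oc s X m.
Proof. by rewrite /s /= comp1m compm1. Qed.
Fact mfid_mas X Y m :
  bmap act (idm X) (s Y m) \oc s X (act Y m) \oc fmap I (mas X Y m)
  = mas X Y (I m) \oc s (X \ox Y) m.
Proof. by rewrite /s /= bmap1 !comp1m compm1. Qed.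
Fact mfid_mun m : mun (I m) \oc s (unit_ob C) m = fmap I (mun m).
Proof. by rewrite /s /= compm1. Qed.
Definition mfid : modfunctor M :=
  ModFunctor mfid_lin mfid_iso mfid_nat mfid_mas mfid_mun.
End IdModFunctor.

Section HComp.
Variables (F F' G G' : modfunctor M) (s : modnat F F') (t : modnat G G').
Fact hcomp_nat :
  @natural k M M (mfcomp F G) (mfcomp F' G') (fun m => t (F' m) \oc fmap G (s m)).
Proof.
move=> m m' f /=.
by rewrite !mn_nat -compA mn_nat !compA -!fmapM mn_nat.
Qed.
Fact hcomp_act X m :
  bmap act (idm X) (t (F' m) \oc fmap G (s m)) \oc mfs (mfcomp F G) X m
  = mfs (mfcomp F' G') X m \oc (t (F' (act X m)) \oc fmap G (s (act X m))).
Proof.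
rewrite /= -{1}(comp1m (idm X)) bmapM -!compA.
rewrite (compA (bmap act _ (fmap G _))) -mfs_nat -!compA -fmapM mn_act fmapM.
by rewrite !compA mn_act -!compA; congr (_ \oc _); rewrite !compA mn_nat.
Qed.
Definition hcomp : modnat (mfcomp F G) (mfcomp F' G') :=
  ModNat hcomp_nat hcomp_act.
End HComp.

Fact hcomp1 F G : hcomp (modid F) (modid G) = modid (mfcomp F G).
Proof. by apply: modnatP => m /=; rewrite fmap1 comp1m. Qed.
Fact hcompM F F' F'' G G' G'' (f' : modnat F' F'') (f : modnat F F')
    (g' : modnat G' G'') (g : modnat G G') :
  hcomp (modcomp f' f) (modcomp g' g) = modcomp (hcomp f' g') (hcomp f g).
Proof.
apply: modnatP => m /=; rewrite fmapM -!compA; congr (_ \oc _).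
by rewrite !compA mn_nat.
Qed.
Fact hcompPl F F' G G' (a : k) (f f' : modnat F F') (g : modnat G G') :
  hcomp (a *: f + f') g = a *: hcomp f g + hcomp f' g.
Proof.
by apply: modnatP => m; rewrite modnat_lcE /= addr0 scale1r mf_lin compPr.
Qed.
Fact hcompPr F F' G G' (a : k) (f : modnat F F') (g g' : modnat G G') :
  hcomp f (a *: g + g') = a *: hcomp f g + hcomp f g'.
Proof.
by apply: modnatP => m; rewrite modnat_lcE /= addr0 scale1r compPl.
Qed.

(* F (x) G is "F, then G": this is the monoidal opposite of Fun_C(M, M) with
   its composition product. *)
Definition mf_tens : bifunctor modfun_cat modfun_cat modfun_cat :=
  @Bifunctor k modfun_cat modfun_cat modfun_cat mfcomp hcomp
    hcomp1 hcompM hcompPl hcompPr.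

Fact mfas_act F G H X m :
  bmap act (idm X) (idm (H (G (F m)))) \oc mfs (mfcomp (mfcomp F G) H) X m
  = mfs (mfcomp F (mfcomp G H)) X m \oc idm (H (G (F (act X m)))).
Proof. by rewrite /= bmap1 comp1m compm1 fmapM compA. Qed.
Definition mfas F G H :
    modnat (mfcomp (mfcomp F G) H) (mfcomp F (mfcomp G H)) :=
  @ModNat k C M (mfcomp (mfcomp F G) H) (mfcomp F (mfcomp G H)) _
    (@modid_nat (mfcomp (mfcomp F G) H)) (mfas_act F G H).

Fact mfasV_act F G H X m :
  bmap act (idm X) (idm (H (G (F m)))) \oc mfs (mfcomp F (mfcomp G H)) X m
  = mfs (mfcomp (mfcomp F G) H) X m \oc idm (H (G (F (act X m)))).
Proof. by rewrite /= bmap1 comp1m compm1 fmapM compA. Qed.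
Definition mfasV F G H :
    modnat (mfcomp F (mfcomp G H)) (mfcomp (mfcomp F G) H) :=
  @ModNat k C M (mfcomp F (mfcomp G H)) (mfcomp (mfcomp F G) H) _
    (@modid_nat (mfcomp F (mfcomp G H))) (mfasV_act F G H).

Fact mflun_act F X m :
  bmap act (idm X) (idm (F m)) \oc mfs (mfcomp mfid F) X m
  = mfs F X m \oc idm (F (act X m)).
Proof. by rewrite /= bmap1 comp1m compm1 fmap1 compm1. Qed.
Definition mflun F : modnat (mfcomp mfid F) F :=
  @ModNat k C M (mfcomp mfid F) F _ (@modid_nat F) (mflun_act F).
Fact mflunV_act F X m :
  bmap act (idm X) (idm (F m)) \oc mfs F X m
  = mfs (mfcomp mfid F) X m \oc idm (F (act X m)).
Proof. by rewrite /= bmap1 comp1m compm1 fmap1 compm1. Qed.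
Definition mflunV F : modnat F (mfcomp mfid F) :=
  @ModNat k C M F (mfcomp mfid F) _ (@modid_nat F) (mflunV_act F).

Fact mfrun_act F X m :
  bmap act (idm X) (idm (F m)) \oc mfs (mfcomp F mfid) X m
  = mfs F X m \oc idm (F (act X m)).
Proof. by rewrite /= bmap1 compm1 !comp1m. Qed.
Definition mfrun F : modnat (mfcomp F mfid) F :=
  @ModNat k C M (mfcomp F mfid) F _ (@modid_nat F) (mfrun_act F).
Fact mfrunV_act F X m :
  bmap act (idm X) (idm (F m)) \oc mfs F X m
  = mfs (mfcomp F mfid) X m \oc idm (F (act X m)).
Proof. by rewrite /= bmap1 compm1 !comp1m. Qed.
Definition mfrunV F : modnat F (mfcomp F mfid) :=
  @ModNat k C M F (mfcomp F mfid) _ (@modid_nat F) (mfrunV_act F).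

Fact mfasK F G H : modcomp (mfasV F G H) (mfas F G H) = modid _.
Proof. by apply: modnatP => m /=; rewrite comp1m. Qed.
Fact mfasVK F G H : modcomp (mfas F G H) (mfasV F G H) = modid _.
Proof. by apply: modnatP => m /=; rewrite comp1m. Qed.
Fact mflun_iso F : @is_iso k modfun_cat _ _ (mflun F).
Proof.
by exists (mflunV F); split; apply: modnatP => m /=; rewrite comp1m.
Qed.
Fact mfrun_iso F : @is_iso k modfun_cat _ _ (mfrun F).
Proof.
by exists (mfrunV F); split; apply: modnatP => m /=; rewrite comp1m.
Qed.
Fact mfas_nat F F' G G' H H' (f : modnat F F') (g : modnat G G')
    (h : modnat H H') :
  modcomp (mfas F' G' H') (hcomp (hcomp f g) h)
  = modcomp (hcomp f (hcomp g h)) (mfas F G H).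
Proof. by apply: modnatP => m /=; rewrite comp1m compm1 fmapM compA. Qed.
Fact mflun_nat F F' (f : modnat F F') :
  modcomp (mflun F') (hcomp (modid mfid) f) = modcomp f (mflun F).
Proof. by apply: modnatP => m /=; rewrite fmap1 comp1m. Qed.
Fact mfrun_nat F F' (f : modnat F F') :
  modcomp (mfrun F') (hcomp f (modid mfid)) = modcomp f (mfrun F).
Proof. by apply: modnatP => m /=; rewrite !comp1m compm1. Qed.
Fact mf_pentagon F G H K :
  modcomp (mfas F G (mfcomp H K)) (mfas (mfcomp F G) H K)
  = modcomp (modcomp (hcomp (modid F) (mfas G H K)) (mfas F (mfcomp G H) K))
      (hcomp (mfas F G H) (modid K)).
Proof. by apply: modnatP => m /=; rewrite !fmap1 !comp1m. Qed.
Fact mf_triangle F G :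
  modcomp (hcomp (modid F) (mflun G)) (mfas F mfid G)
  = hcomp (mfrun F) (modid G).
Proof. by apply: modnatP => m /=; rewrite !fmap1 !comp1m. Qed.

(* The monoidal category Fun_C(M, M)^op *)
Definition dual_cat : moncat k :=
  @MonCat k modfun_cat mf_tens mfid mfas mfasV mflun mfrun mfasK mfasVK
    mflun_iso mfrun_iso mfas_nat mflun_nat mfrun_nat mf_pentagon mf_triangle.

End DualCategory.

Definition morita_equivalent (k : fieldType) (C D : moncat k) : Prop :=
  exists M : modcat C, [/\ finite_semisimple M, indecomposable M
                         & tensor_equivalent D (dual_cat M)].

Definition weakly_group_theoretical (k : fieldType) (C : moncat k) : Prop :=
  exists D : moncat k, [/\ fusion D, nilpotent D & morita_equivalent C D].

Section FullSub.
Variables (k : fieldType) (C : bmoncat k) (D : C -> Prop) (hD : fusion_subcat D).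

Definition sub_lincat : lincat k :=
  @LinCat k {X : C | D X} (fun X Y => Hom (sval X) (sval Y))
    (fun X => idm (sval X)) (fun _ _ _ g f => g \oc f)
    (fun _ _ _ _ => @compA _ _ _ _ _ _) (fun _ _ => @comp1m _ _ _ _)
    (fun _ _ => @compm1 _ _ _ _) (fun _ _ _ => @compPl _ _ _ _ _)
    (fun _ _ _ => @compPr _ _ _ _ _).

Definition sub_tens : bifunctor sub_lincat sub_lincat sub_lincat :=
  @Bifunctor k sub_lincat sub_lincat sub_lincat
    (fun X Y => exist D (sval X \ox sval Y) (fsub_tens hD (svalP X) (svalP Y)))
    (fun _ _ _ _ f g => f \om g)
    (fun _ _ => bmap1 tens _ _) (fun _ _ _ _ _ _ => @bmapM _ _ _ _ tens _ _ _ _ _ _)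
    (fun _ _ _ _ => @bmapPl _ _ _ _ tens _ _ _ _)
    (fun _ _ _ _ => @bmapPr _ _ _ _ tens _ _ _ _).

Definition sub_moncat : moncat k :=
  @MonCat k sub_lincat sub_tens (exist D (unit_ob C) (fsub_unit hD))
    (fun X Y Z => asso (sval X) (sval Y) (sval Z))
    (fun X Y Z => assoV (sval X) (sval Y) (sval Z))
    (fun X => lun (sval X)) (fun X => run (sval X))
    (fun X Y Z => assoK (sval X) (sval Y) (sval Z))
    (fun X Y Z => assoVK (sval X) (sval Y) (sval Z))
    (fun X => lun_iso (sval X)) (fun X => run_iso (sval X))
    (fun _ _ _ _ _ _ => @asso_nat _ _ _ _ _ _ _ _)
    (fun _ _ => @lun_nat _ _ _ _) (fun _ _ => @run_nat _ _ _ _)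
    (fun X Y Z W => pentagon (sval X) (sval Y) (sval Z) (sval W))
    (fun X Y => triangle (sval X) (sval Y)).

Definition sub_cat : bmoncat k :=
  @BMonCat k sub_moncat (fun X Y => braid (sval X) (sval Y))
    (fun X Y => braid_iso (sval X) (sval Y))
    (fun _ _ _ _ => @braid_nat _ _ _ _ _ _)
    (fun X Y Z => hexagon (sval X) (sval Y) (sval Z))
    (fun X Y Z => hexagonV (sval X) (sval Y) (sval Z)).

End FullSub.

Section Centralizer.
Variables (k : fieldType) (C : bmoncat k).

Definition centralizing (D : C -> Prop) (Y : C) : Prop :=
  simple Y /\ forall X, D X -> simple X -> braid Y X \oc braid X Y = idm (X \ox Y).

Definition centralizer (D : C -> Prop) : C -> Prop := generated (centralizing D).

Definition centralizer_fusion_subcat (D : C -> Prop) :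
    fusion_subcat (centralizer D) :=
  generated_fusion_subcat (centralizing D).

Definition braiding_nondegenerate : Prop :=
  forall X, centralizer (fun _ => True) X <-> in_Vec X.

End Centralizer.

Section ProdCat.
Variable k : fieldType.

Section Lin.
Variables A B : lincat k.
Definition prod_hom (X Y : A * B) : lmodType k := (Hom X.1 Y.1 * Hom X.2 Y.2)%type.
Definition prod_comp (X Y Z : A * B) (g : prod_hom Y Z) (f : prod_hom X Y) :
  prod_hom X Z := (g.1 \oc f.1, g.2 \oc f.2).
Fact prod_compA X Y Z W (h : prod_hom Z W) (g : prod_hom Y Z) (f : prod_hom X Y) :
  prod_comp h (prod_comp g f) = prod_comp (prod_comp h g) f.
Proof. by rewrite /prod_comp /= !compA. Qed.
Fact prod_comp1m X Y (f : prod_hom X Y) : prod_comp (idm Y.1, idm Y.2) f = f.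
Proof. by case: f => f g; rewrite /prod_comp /= !comp1m. Qed.
Fact prod_compm1 X Y (f : prod_hom X Y) : prod_comp f (idm X.1, idm X.2) = f.
Proof. by case: f => f g; rewrite /prod_comp /= !compm1. Qed.
Fact prod_compPl X Y Z (a : k) (g g' : prod_hom Y Z) (f : prod_hom X Y) :
  prod_comp (a *: g + g') f = a *: prod_comp g f + prod_comp g' f.
Proof. by rewrite /prod_comp /= !compPl. Qed.
Fact prod_compPr X Y Z (a : k) (g : prod_hom Y Z) (f f' : prod_hom X Y) :
  prod_comp g (a *: f + f') = a *: prod_comp g f + prod_comp g f'.
Proof. by rewrite /prod_comp /= !compPr. Qed.
Definition prod_lincat : lincat k :=
  @LinCat k (A * B) prod_hom (fun X => (idm X.1, idm X.2)) prod_comp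
    prod_compA prod_comp1m prod_compm1 prod_compPl prod_compPr.
Lemma prod_is_iso (X Y : prod_lincat) (f : Hom X Y) :
  is_iso f.1 -> is_iso f.2 -> is_iso f.
Proof.
case: f => f1 f2 [g1 [gf1 fg1]] [g2 [gf2 fg2]]; exists (g1, g2).
by split; congr pair.
Qed.
End Lin.

Section Mon.
Variables A B : moncat k.
Local Notation P := (prod_lincat A B).
Definition prod_tob (X Y : P) : P := (X.1 \ox Y.1, X.2 \ox Y.2).
Definition prod_tmap (X X' Y Y' : P) (f : Hom X X') (g : Hom Y Y') :
  Hom (prod_tob X Y) (prod_tob X' Y') := (f.1 \om g.1, f.2 \om g.2).
Fact prod_tmap1 X Y : prod_tmap (idm X) (idm Y) = idm (prod_tob X Y).
Proof. by congr pair; apply: bmap1. Qed.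
Fact prod_tmapM X X' X'' Y Y' Y'' (f' : Hom X' X'') (f : Hom X X')
    (g' : Hom Y' Y'') (g : Hom Y Y') :
  prod_tmap (f' \oc f) (g' \oc g) = prod_tmap f' g' \oc prod_tmap f g.
Proof. by congr pair; apply: bmapM. Qed.
Fact prod_tmapPl X X' Y Y' (a : k) (f f' : Hom X X') (g : Hom Y Y') :
  prod_tmap (a *: f + f') g = a *: prod_tmap f g + prod_tmap f' g.
Proof. by congr pair; apply: bmapPl. Qed.
Fact prod_tmapPr X X' Y Y' (a : k) (f : Hom X X') (g g' : Hom Y Y') :
  prod_tmap f (a *: g + g') = a *: prod_tmap f g + prod_tmap f g'.
Proof. by congr pair; apply: bmapPr. Qed.
Definition prod_tens : bifunctor P P P :=
  Bifunctor prod_tmap1 prod_tmapM prod_tmapPl prod_tmapPr.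

Local Notation "X *t Y" := (prod_tens X Y) (at level 40).
Definition prod_asso (X Y Z : P) : Hom ((X *t Y) *t Z) (X *t (Y *t Z)) :=
  (asso X.1 Y.1 Z.1, asso X.2 Y.2 Z.2).
Definition prod_assoV (X Y Z : P) : Hom (X *t (Y *t Z)) ((X *t Y) *t Z) :=
  (assoV X.1 Y.1 Z.1, assoV X.2 Y.2 Z.2).
Definition prod_unit : P := (unit_ob A, unit_ob B).
Definition prod_lun (X : P) : Hom (prod_unit *t X) X := (lun X.1, lun X.2).
Definition prod_run (X : P) : Hom (X *t prod_unit) X := (run X.1, run X.2).
Fact prod_assoK X Y Z : prod_assoV X Y Z \oc prod_asso X Y Z = idm _.
Proof. by congr pair; apply: assoK. Qed.
Fact prod_assoVK X Y Z : prod_asso X Y Z \oc prod_assoV X Y Z = idm _.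
Proof. by congr pair; apply: assoVK. Qed.
Fact prod_lun_iso X : is_iso (prod_lun X).
Proof. by apply: prod_is_iso; apply: lun_iso. Qed.
Fact prod_run_iso X : is_iso (prod_run X).
Proof. by apply: prod_is_iso; apply: run_iso. Qed.
Fact prod_asso_nat X X' Y Y' Z Z' (f : Hom X X') (g : Hom Y Y') (h : Hom Z Z') :
  prod_asso X' Y' Z' \oc bmap prod_tens (bmap prod_tens f g) h
  = bmap prod_tens f (bmap prod_tens g h) \oc prod_asso X Y Z.
Proof. by congr pair; apply: asso_nat. Qed.
Fact prod_lun_nat X X' (f : Hom X X') :
  prod_lun X' \oc bmap prod_tens (idm prod_unit) f = f \oc prod_lun X.
Proof. by congr pair; apply: lun_nat. Qed.
Fact prod_run_nat X X' (f : Hom X X') :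
  prod_run X' \oc bmap prod_tens f (idm prod_unit) = f \oc prod_run X.
Proof. by congr pair; apply: run_nat. Qed.
Fact prod_pentagon X Y Z W :
  prod_asso X Y (Z *t W) \oc prod_asso (X *t Y) Z W
  = bmap prod_tens (idm X) (prod_asso Y Z W) \oc prod_asso X (Y *t Z) W
    \oc bmap prod_tens (prod_asso X Y Z) (idm W).
Proof. by congr pair; apply: pentagon. Qed.
Fact prod_triangle X Y :
  bmap prod_tens (idm X) (prod_lun Y) \oc prod_asso X prod_unit Y
  = bmap prod_tens (prod_run X) (idm Y).
Proof. by congr pair; apply: triangle. Qed.
Definition prod_moncat : moncat k :=
  MonCat prod_assoK prod_assoVK prod_lun_iso prod_run_iso prod_asso_nat
    prod_lun_nat prod_run_nat prod_pentagon prod_triangle.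
End Mon.

Section Braided.
Variables A B : bmoncat k.
Local Notation P := (prod_moncat A B).
Definition prod_braid (X Y : P) : Hom (X \ox Y) (Y \ox X) :=
  (braid X.1 Y.1, braid X.2 Y.2).
Fact prod_braid_iso X Y : is_iso (prod_braid X Y).
Proof. by apply: prod_is_iso; apply: braid_iso. Qed.
Fact prod_braid_nat (X X' Y Y' : P) (f : Hom X X') (g : Hom Y Y') :
  prod_braid X' Y' \oc (f \om g) = (g \om f) \oc prod_braid X Y.
Proof. by congr pair; apply: braid_nat. Qed.
Fact prod_hexagon (X Y Z : P) :
  asso Y Z X \oc prod_braid X (Y \ox Z) \oc asso X Y Z
  = (idm Y \om prod_braid X Z) \oc asso Y X Z \oc (prod_braid X Y \om idm Z).
Proof. by congr pair; apply: hexagon. Qed.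
Fact prod_hexagonV (X Y Z : P) :
  assoV Z X Y \oc prod_braid (X \ox Y) Z \oc assoV X Y Z
  = (prod_braid X Z \om idm Y) \oc assoV X Z Y \oc (idm X \om prod_braid Y Z).
Proof. by congr pair; apply: hexagonV. Qed.
Definition prod_bmoncat : bmoncat k :=
  BMonCat prod_braid_iso prod_braid_nat prod_hexagon prod_hexagonV.
End Braided.

(* The (non-linear) functor A x B -> T underlying a bilinear bifunctor *)
Definition uncurry_bifunctor (A B T : lincat k) (F : bifunctor A B T) :
    functor (prod_lincat A B) T :=
  @Functor k (prod_lincat A B) T (fun X => F X.1 X.2)
    (fun _ _ f => bmap F f.1 f.2)
    (fun X => bmap1 F X.1 X.2)
    (fun _ _ _ g f => bmapM F g.1 f.1 g.2 f.2).

End ProdCat.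

(* The universal property of the Deligne product T of A and B: for every
   abelian linear category E, composition with box is an equivalence from right
   exact linear functors T -> E to bilinear bifunctors A x B -> E right exact in
   each variable. *)
Definition deligne_universal (k : fieldType) (A B T : lincat k)
    (box : bifunctor A B T) : Prop :=
  forall E : lincat k, abelian E ->
    (forall G : bifunctor A B E, right_exact2 G ->
       exists F : functor T E,
         [/\ linear_functor F, right_exact F
           & exists t : forall X : prod_lincat A B,
               Hom (comp_functor F (uncurry_bifunctor box) X)
                   (uncurry_bifunctor G X),
             natural t /\ forall X, is_iso (t X)]) /\
    (forall F F' : functor T E,
       linear_functor F -> right_exact F ->
       linear_functor F' -> right_exact F' ->
       forall t : forall X : prod_lincat A B,
           Hom (comp_functor F (uncurry_bifunctor box) X)
               (comp_functor F' (uncurry_bifunctor box) X),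
         natural t ->
         exists! s : forall Z, Hom (F Z) (F' Z),
           natural s /\ forall X : prod_lincat A B, s (box X.1 X.2) = t X).

(* T is the Deligne product of A and B; its tensor product and braiding are the
   componentwise ones since box is a braided monoidal functor from A x B. *)
Definition deligne_product (k : fieldType) (A B T : bmoncat k) : Prop :=
  exists box : bifunctor A B T,
    [/\ abelian T, right_exact2 box, deligne_universal box
      & exists J : @monoidal_structure k (prod_bmoncat A B) T
                     (uncurry_bifunctor box),
          @braided_structure k (prod_bmoncat A B) T _ J].

Section Pointed.
Variables (k : fieldType) (B : finZmodType).

Definition polar (q : B -> k) (a b : B) : k := q (a + b) / (q a * q b).

Definition nondegenerate_quadratic_form (q : B -> k) : Prop :=
  [/\ forall a, q a != 0,
      forall a, q (- a) = q a,
      forall a a' b, polar q (a + a') b = polar q a b * polar q a' b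
    & forall a, (forall b, polar q a b = 1) -> a = 0].

(* E is a model of C(B, q): the group of simple objects and their self-braiding
   determine a pointed braided fusion category up to braided equivalence
   (Joyal-Street). *)
Definition is_pointed_category (q : B -> k) (E : bmoncat k) : Prop :=
  fusion E /\ exists S : B -> E,
    [/\ forall b, simple (S b),
        forall X, simple X -> exists! b, isom X (S b),
        forall a b, isom (S a \ox S b) (S (a + b))
      & forall b, braid (S b) (S b) = q b *: idm (S b \ox S b)].

End Pointed.

Definition squarefree (d : nat) : Prop :=
  forall p, prime p -> ~~ (p ^ 2 %| d)%N.

(* Main.v *)
From HB Require Import structures.
From mathcomp Require Import all_boot all_order all_algebra all_field.
From mathcomp Require Import all_fingroup all_solvable boolp ring zify.
From mathcomp Require Import spectral sesquilinear.
Require Import Defs.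

(** Let [N i j l] be the fusion coefficients and [d i] the Frobenius-Perron
   dimensions of the simple objects [S_i]. For square roots [t_i] of the quotients of
   the two values of the loop coloured by [S_i], the operator [t_i t_j / t_l] times the
   double braiding on Hom(S_l, S_i (x) S_j) is an involution, so its trace [T i j l] is an
   integer with |T i j l| <= N i j l. Resolving a full rotation yields two systems of
   equations between the [T i j l] and the normalised loop values, and by
   Perron-Frobenius theory these values are the [d i] up to sign. After a choice of
   signs the double braiding is the scalar th_l / (th_i th_j).

   By nondegeneracy the characters chi_w of the fusion ring given by the S-matrix are
   orthogonal. A simple object on which no chi_w vanishes is invertible (AM-GM over
   Galois conjugates, as in Burnside's theorem). Hence, in the product of all the
   S_w (x) S_w^* in the fusion ring, the coefficient of 1 times FPdim(C) is the number of
   invertible objects times the product of the [d w ^+ 2]. The latter is prime to d, so d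
   divides the number of invertible objects and there is one, b, of order d. If
   the quadratic form were degenerate on the group of b, some power a of b of prime order
   p would centralize itself; a Lagrange theorem for the centralizer of a then shows that
   p^2 divides FPdim(C), contrary to the hypotheses. So the form is nondegenerate on the
   group of b, each simple object is S_x (x) Y for a unique power x of b and a unique Y
   centralizing b, and therefore (x) : D x D' -> C has the universal property of the
   Deligne product. *)

Set Implicit Arguments.
Unset Strict Implicit.
Unset Printing Implicit Defensive.

Import Order.TTheory GRing.Theory Num.Theory.
Local Open Scope ring_scope.
Local Open Scope cat_scope.

(** * Linear categories and semisimplicity *)

(** No pivotal structure is given and [k] carries no positivity: a circle has two values, according
    to the crossing that closes it, and these can be compared with the Frobenius-Perron dimensions
    only through a Galois number field embedded both in [k] and in the complex numbers. Let
    [delta i] be the normalised loop values and D = FPdim(C). The crucial fact is that the sum of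
    the [delta i ^+ 2], divided by D, is an algebraic integer: on spaces of loops the regular
    element of the fusion ring acts as D times an idempotent commuting with an involution, so the
    relevant traces are D times integers. At every complex embedding the [delta i] are real, nonzero
    and bounded by the dimensions; hence all conjugates of the quotient lie in ]0, 1], and its norm
    forces it to be 1. The Lagrange theorem rests on the same principle, with the powers of a in
    place of the regular element. Where positivity is wanted for the twists, which live in [k] only,
    determinants and row spaces of matrices over the number field are compared at the two
    embeddings. *)

Section Linear.
Variables (k : fieldType) (C : lincat k).
Implicit Types X Y Z W : C.

Lemma compDl X Y Z (g g' : Hom Y Z) (f : Hom X Y) :
  (g + g') \oc f = g \oc f + g' \oc f.
Proof. by have := compPl 1 g g' f; rewrite !scale1r. Qed.

Lemma compDr X Y Z (g : Hom Y Z) (f f' : Hom X Y) :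
  g \oc (f + f') = g \oc f + g \oc f'.
Proof. by have := compPr 1 g f f'; rewrite !scale1r. Qed.

Lemma compZl X Y Z a (g : Hom Y Z) (f : Hom X Y) :
  (a *: g) \oc f = a *: (g \oc f).
Proof. by have := compPl a g 0 f; rewrite comp0m !addr0. Qed.

Lemma compZr X Y Z a (g : Hom Y Z) (f : Hom X Y) :
  g \oc (a *: f) = a *: (g \oc f).
Proof. by have := compPr a g f 0; rewrite compm0 !addr0. Qed.

Lemma compNl X Y Z (g : Hom Y Z) (f : Hom X Y) : (- g) \oc f = - (g \oc f).
Proof. by rewrite -scaleN1r compZl scaleN1r. Qed.

Lemma compNr X Y Z (g : Hom Y Z) (f : Hom X Y) : g \oc (- f) = - (g \oc f).
Proof. by rewrite -scaleN1r compZr scaleN1r. Qed.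

Lemma compBr X Y Z (g : Hom Y Z) (f f' : Hom X Y) :
  g \oc (f - f') = g \oc f - g \oc f'.
Proof. by rewrite compDr compNr. Qed.

Lemma compBl X Y Z (g g' : Hom Y Z) (f : Hom X Y) :
  (g - g') \oc f = g \oc f - g' \oc f.
Proof. by rewrite compDl compNl. Qed.

Lemma comp_suml X Y Z I (r : seq I) (P : pred I) (g : I -> Hom Y Z) (f : Hom X Y) :
  (\sum_(i <- r | P i) g i) \oc f = \sum_(i <- r | P i) (g i \oc f).
Proof.
by elim/big_rec2: _ => [|i x y _ <-]; rewrite ?comp0m // compDl.
Qed.

Lemma comp_sumr X Y Z I (r : seq I) (P : pred I) (g : Hom Y Z) (f : I -> Hom X Y) :
  g \oc (\sum_(i <- r | P i) f i) = \sum_(i <- r | P i) (g \oc f i).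
Proof.
by elim/big_rec2: _ => [|i x y _ <-]; rewrite ?compm0 // compDr.
Qed.

Lemma isom_sym X Y : isom X Y -> isom Y X.
Proof. by case=> f [g [gf fg]]; exists g, f. Qed.

Lemma isom_refl X : isom X X.
Proof. by exists (idm X); apply: is_iso_id. Qed.

Lemma isom_trans X Y Z : isom X Y -> isom Y Z -> isom X Z.
Proof. by case=> f ff [g gg]; exists (g \oc f); apply: is_iso_comp. Qed.

Lemma is_iso_mono X Y (f : Hom X Y) : is_iso f -> mono f.
Proof.
by case=> f' [f'f _] W g h /(congr1 (comp f')); rewrite !compA f'f !comp1m.
Qed.

Lemma mono_comp X Y Z (f : Hom X Y) (g : Hom Y Z) :
  mono g -> mono f -> mono (g \oc f).
Proof. by move=> mg mf W a b; rewrite -!compA => /mg /mf. Qed.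

Lemma split_mono X Y (f : Hom X Y) (g : Hom Y X) : g \oc f = idm X -> mono f.
Proof. by move=> gf W a b /(congr1 (comp g)); rewrite !compA gf !comp1m. Qed.

Lemma isom_zero X Y : isom X Y -> is_zero X -> is_zero Y.
Proof.
case=> f [g [gf fg]] zX; rewrite /is_zero -fg -(compm1 f).
by rewrite [idm X]zX compm0 comp0m.
Qed.

Lemma isom_simple X Y : isom X Y -> simple X -> simple Y.
Proof.
move=> XY [nzX sX]; split; first by move=> /(isom_zero (isom_sym XY)).
case: (XY) => f [g [gf fg]] Z h mh.
have mono_gh : mono (g \oc h).
  by apply: mono_comp mh; apply: (@split_mono _ _ _ f).
case: (sX _ _ mono_gh) => [|[h' [h1 h2]]]; [by left | right].
exists (h' \oc g); split; first by rewrite -compA.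
have /(congr1 (fun u => f \oc u \oc g)) := h2.
by rewrite compm1 fg !compA fg comp1m.
Qed.

End Linear.

(** * Traces of idempotents and of commuting involutions *)

Section IdempotentTrace.
Variable (k : fieldType).

(** In a full-rank factorisation A = C R idempotency forces R C = 1, and tr(C R) = tr(R C) is then
    the trace of an identity matrix. *)
Lemma mxtrace_idempotent n (A : 'M[k]_n) :
  A *m A = A -> \tr A = (\rank A)%:R.
Proof.
move=> AA; rewrite -{1}(mulmx_base A) mxtrace_mulC.
suff -> : row_base A *m col_base A = 1%:M by rewrite mxtrace1.
have /row_freeP[B rB] := row_base_free A.
have /row_fullP[D Dc] := col_base_full A.
move: AA (mulmx_base A) rB Dc.
move: (row_base A) (col_base A) => R0 C0 AA CR rB Dc.
have : D *m (C0 *m R0 *m (C0 *m R0)) *m B = D *m (C0 *m R0) *m B by rewrite CR AA.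
by rewrite !mulmxA Dc !mul1mx -!mulmxA rB mulmx1.
Qed.

(** [U] splits the image of the idempotent [A] into eigenspaces for 1 and -1. The halves of A + U A
    and A - U A project onto them; their ranks add up, their traces are subtracted. *)
Lemma involution_trace (k2 : (2%:R : k) != 0) n (U A : 'M[k]_n) :
  U *m U = 1%:M -> A *m A = A -> U *m A = A *m U ->
  exists a b : nat, (a + b)%N = \rank A /\ \tr (U *m A) = a%:R - b%:R.
Proof.
move=> UU AA UA.
pose P := 2^-1 *: (A + U *m A); pose Q := 2^-1 *: (A - U *m A).
have UAUA : U *m A *m (U *m A) = A.
  by rewrite {2}UA mulmxA -(mulmxA U A A) AA -mulmxA -UA mulmxA UU mul1mx.
have AUA : A *m (U *m A) = U *m A by rewrite mulmxA -UA -mulmxA AA.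
have UAA : U *m A *m A = U *m A by rewrite -mulmxA AA.
have half (v : 'M[k]_n) : 2^-1 *: (v + v) = v.
  by rewrite -mulr2n -scaler_nat scalerA mulVf // scale1r.
have hP : P *m P = P.
  rewrite /P -scalemxAl -scalemxAr mulmxDl !mulmxDr AA AUA UAA UAUA.
  by rewrite (addrC (U *m A) A) half.
have hQ : Q *m Q = Q.
  rewrite /Q -scalemxAl -scalemxAr mulmxBl !mulmxBr AA AUA UAA UAUA.
  by rewrite opprB half.
have PQ : P + Q = A.
  by rewrite /P /Q -scalerDr addrACA subrr addr0 half.
have UPQ : P - Q = U *m A.
  by rewrite /P /Q -scalerBr opprB [A + _]addrC addrACA subrr addr0 half.
exists (\rank P), (\rank Q); split; last first.
  by rewrite -UPQ raddfB /= !mxtrace_idempotent.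
have PQ0 : P *m Q = 0.
  rewrite /P /Q -scalemxAl -scalemxAr mulmxDl !mulmxBr AA AUA UAA UAUA.
  by rewrite addrA subrK subrr !scaler0.
have QP0 : Q *m P = 0.
  rewrite /P /Q -scalemxAl -scalemxAr mulmxBl !mulmxDr AA AUA UAA UAUA.
  by rewrite [_ *m _ + A]addrC subrr !scaler0.
apply/eqP; rewrite eqn_leq; apply/andP; split; last first.
  by rewrite -PQ; apply: mxrank_add.
have PA : P = P *m A by rewrite -PQ mulmxDr hP PQ0 addr0.
have QA : Q = Q *m A by rewrite -PQ mulmxDr hQ QP0 add0r.
have sPQ : (P + Q <= A)%MS.
  by rewrite addsmx_sub {1}PA {1}QA !submxMl.
have cap0 : (P :&: Q = 0)%MS.
  apply/eqP; rewrite -submx0; apply/rV_subP => v; rewrite sub_capmx.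
  case/andP => /submxP[a va] /submxP[b vb].
  by rewrite va -hP mulmxA -va vb -mulmxA QP0 mulmx0 sub0mx.
by rewrite -(mxrank_disjoint_sum cap0); apply: mxrankS.
Qed.

(* The operators are given by their matrix coefficients. *)
Lemma involution_trace_int (k2 : (2%:R : k) != 0) (I : finType) (u p : I -> I -> k)
    (lam : k) (lam0 : lam != 0) :
  (forall x z, \sum_y u x y * u y z = (x == z)%:R) ->
  (forall x z, \sum_y p x y * p y z = lam * p x z) ->
  (forall x z, \sum_y u x y * p y z = \sum_y p x y * u y z) ->
  exists m : int, \sum_x \sum_y u x y * p y x = lam * m%:~R.
Proof.
move=> uu pp up.
pose M (a : I -> I -> k) : 'M[k]_#|I| := \matrix_(i, j) a (enum_val i) (enum_val j).
have MM a b : M a *m M b = M (fun x z => \sum_y a x y * b y z).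
  apply/matrixP => i j; rewrite !mxE [RHS](reindex _ (onW_bij _ (enum_val_bij I))).
  by apply: eq_bigr => l _; rewrite !mxE.
have eqM a b : (forall x z, a x z = b x z) -> M a = M b.
  by move=> ab; apply/matrixP => i j; rewrite !mxE.
have U1 : M u *m M u = 1%:M.
  rewrite MM (eqM _ _ uu); apply/matrixP => i j.
  by rewrite !mxE (inj_eq enum_val_inj).
have P1 : M p *m M p = lam *: M p.
  by rewrite MM (eqM _ _ pp); apply/matrixP => i j; rewrite !mxE.
have UP : M u *m M p = M p *m M u by rewrite !MM (eqM _ _ up).
have [||a [b [_ tab]]] :=
    @involution_trace k2 _ (M u) (lam^-1 *: M p) U1.
- by rewrite -scalemxAl -scalemxAr P1 !scalerA -mulrA mulVf ?mulr1.
- by rewrite -scalemxAl -scalemxAr UP.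
exists (a%:Z - b%:Z); rewrite intrB -!pmulrn -tab.
have -> : \sum_x \sum_y u x y * p y x = \tr (M u *m M p).
  rewrite MM /mxtrace [LHS](reindex _ (onW_bij _ (enum_val_bij I))) /=.
  by apply: eq_bigr => i _; rewrite mxE.
by rewrite -scalemxAr mxtraceZ mulrA divff ?mul1r.
Qed.

End IdempotentTrace.

(** * Schur's lemma and endomorphisms of simple objects *)

Section Scalar.
Variables (k : closedFieldType) (C : lincat k) (hC : finite_semisimple C).
Implicit Types X Y Z W : C.

Lemma kernel_mono K X Y (i : Hom K X) (f : Hom X Y) : is_kernel i f -> mono i.
Proof.
case=> fi ker W g h gh; have [|u [_ uniq_u]] := ker W (i \oc g).
  by rewrite compA fi comp0m.
by rewrite -(uniq_u g) // -(uniq_u h).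
Qed.

Lemma schur X Y (f : Hom X Y) : simple X -> simple Y -> f <> 0 -> is_iso f.
Proof.
move=> [nzX sX] [_ sY] nzf.
have [_ /(_ X Y f)[K [i ki]] _ _ _] := fss_abelian hC.
have [fi ker] := ki.
have [zK|[i' [_ ii']]] := sX _ _ (kernel_mono ki); last first.
  by case: nzf; rewrite -(compm1 f) -ii' compA fi comp0m.
have mf : mono f.
  move=> W g h fgh; apply/eqP; rewrite -subr_eq0; apply/eqP.
  have [|u [<- _]] := ker W (g - h); first by rewrite compBr fgh subrr.
  by rewrite -[u]comp1m [idm K]zK comp0m compm0.
by case: (sY _ _ mf).
Qed.

(** Left composition with [f] on the nonzero finite-dimensional space End X has an eigenvector v.
    Being nonzero, v is invertible by Schur's lemma and can be cancelled from f v = a v. *)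
Lemma simple_end X (f : Hom X X) : simple X -> exists a : k, f = a *: idm X.
Proof.
move=> sX; have [n [[v2r lin_v [r2v vK rK]]]] := fss_dim hC X X.
have n_gt0 : (0 < n)%N.
  case: n v2r lin_v r2v vK rK => // v2r _ r2v vK _; case: sX => nz _; case: nz.
  by apply: (can_inj vK); rewrite [LHS]thinmx0 [RHS]thinmx0.
have lin_r : linear r2v.
  by move=> a u v; apply: (can_inj vK); rewrite lin_v !rK.
pose g u := v2r (f \oc r2v u).
have lin_g : linear g.
  by move=> a u v; rewrite /g lin_r compDr compZr lin_v.
pose gL : {linear 'rV[k]_n -> 'rV[k]_n} := HB.pack g (GRing.isLinear.Build _ _ _ _ g lin_g).
have [a] : exists a, root (char_poly (lin1_mx gL)) a.
  by apply/closed_rootP; rewrite size_char_poly; case: (n) n_gt0.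
rewrite -eigenvalue_root_char => /eigenvalueP[v]; rewrite mul_rV_lin1 /= => gv nzv.
have fx : f \oc r2v v = a *: r2v v.
  apply: (can_inj vK); rewrite -[LHS]/(g v) gv.
  have := lin_v a (r2v v) 0; rewrite addr0 rK => ->.
  suff -> : v2r 0 = 0 by rewrite addr0.
  by have := lin_v (-1) 0 0; rewrite scaler0 addr0 scaleN1r addNr.
have [|x' [_ xx']] := @schur X X (r2v v) sX sX.
  move=> v0; case/eqP: nzv; rewrite -(rK v) v0.
  by have := lin_v (-1) 0 0; rewrite scaler0 addr0 scaleN1r addNr.
by exists a; rewrite -[f]compm1 -xx' compA fx compZl.
Qed.

(* Junk value 0 when f is not a multiple of the identity. *)
Definition sc X (f : Hom X X) : k :=
  if pselect (exists a, f = a *: idm X) is left h then sval (cid h) else 0.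

Lemma scE X (f : Hom X X) : simple X -> f = sc f *: idm X.
Proof.
move=> sX; rewrite /sc; case: pselect => [h|[]]; last exact: simple_end.
by case: (cid h).
Qed.

Lemma simple_id_neq0 X : simple X -> idm X != 0.
Proof. by case=> nz _; apply/eqP => z; apply: nz. Qed.

Lemma scP X a : simple X -> sc (a *: idm X) = a.
Proof.
move=> sX; have /esym/eqP := scE (a *: idm X) sX.
rewrite -subr_eq0 -scalerBl scaler_eq0 (negPf (simple_id_neq0 sX)) orbF subr_eq0.
by move=> /eqP.
Qed.

Lemma sc1 X : simple X -> sc (idm X) = 1.
Proof. by move=> sX; rewrite -[idm X]scale1r scP. Qed.

Lemma sc0 X : simple X -> sc (0 : Hom X X) = 0.
Proof. by move=> sX; rewrite -[0](scale0r (idm X)) scP. Qed.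

Lemma scM X (f g : Hom X X) : simple X -> sc (f \oc g) = sc f * sc g.
Proof.
move=> sX; rewrite {1}(scE f sX) {1}(scE g sX) compZl compZr comp1m scalerA.
exact: scP.
Qed.

Lemma scD X (f g : Hom X X) : simple X -> sc (f + g) = sc f + sc g.
Proof. by move=> sX; rewrite {1}(scE f sX) {1}(scE g sX) -scalerDl scP. Qed.

Lemma scZ X a (f : Hom X X) : simple X -> sc (a *: f) = a * sc f.
Proof. by move=> sX; rewrite {1}(scE f sX) scalerA scP. Qed.

Lemma sc_sum X I (r : seq I) (P : pred I) (f : I -> Hom X X) : simple X ->
  sc (\sum_(i <- r | P i) f i) = \sum_(i <- r | P i) sc (f i).
Proof.
by move=> sX; elim/big_rec2: _ => [|i x y _ <-]; rewrite ?sc0 // scD.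
Qed.

End Scalar.

(** * Multiplicity spaces and traces on them *)

Section Semisimple.
Variables (k : closedFieldType) (C : lincat k) (hC : finite_semisimple C).
Implicit Types X Y Z W : C.

Definition fss_enum : {n : nat & 'I_n -> C} := sval (cid (fss_simples hC)).
Local Notation r := (projT1 fss_enum).
Local Notation S := (projT2 fss_enum).

Lemma S_simple i : simple (S i).
Proof. by case: (svalP (cid (fss_simples hC))) => s _; apply: s. Qed.
Hint Resolve S_simple : core.

Lemma S_index X : simple X -> exists i, isom X (S i).
Proof.
by move=> sX; case: (svalP (cid (fss_simples hC))) => _ /(_ X sX)[i []]; exists i.
Qed.

Lemma S_inj X i j : simple X -> isom X (S i) -> isom X (S j) -> i = j.
Proof.
move=> sX Xi Xj; case: (svalP (cid (fss_simples hC))) => _ /(_ X sX)[l [_ u]].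
by rewrite -(u i Xi) (u j Xj).
Qed.

Lemma S_hom0 i j (f : Hom (S i) (S j)) : i != j -> f = 0.
Proof.
move=> ij; apply: contrapT => /(schur hC (S_simple i) (S_simple j)) isof.
case/eqP: ij; apply: (S_inj (S_simple i)); first exact: isom_refl.
by exists f.
Qed.

Record dual_bases X := DualBases {
  db_mult : 'I_r -> nat;
  db_inc : forall i, 'I_(db_mult i) -> Hom (S i) X;
  db_prj : forall i, 'I_(db_mult i) -> Hom X (S i);
  db_orth : forall i m m', db_prj m \oc db_inc m' = (m == m')%:R *: idm (S i);
  db_sum : \sum_i \sum_(m < db_mult i) db_inc m \oc db_prj m = idm X }.

Lemma dual_bases_exist X : inhabited (dual_bases X).
Proof.
have [n [T [sT [inj [prj [pi_id pi_0 ip]]]]]] := fss_semisimple hC X.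
pose J i := [pred j | `[<isom (S i) (T j)>]].
(* The summands isomorphic to [S i] index the i-th multiplicity space; for the other summands the
   chosen pair is the junk value (0, 0). *)
have iso_pair i j : exists p : Hom (S i) (T j) * Hom (T j) (S i),
    J i j -> p.2 \oc p.1 = idm _ /\ p.1 \oc p.2 = idm _.
  have [/asboolP[f [g fg]]|] := boolP (J i j); first by exists (f, g).
  by exists (0, 0).
pose phi i j := sval (cid (iso_pair i j)).
have phiP i j : J i j -> (phi i j).2 \oc (phi i j).1 = idm _ /\
                         (phi i j).1 \oc (phi i j).2 = idm _.
  exact: (svalP (cid (iso_pair i j))).
have JP i (m : 'I_#|J i|) : J i (enum_val m) by have := enum_valP m; rewrite inE.
split; apply: (@DualBases X (fun i => #|J i|)
  (fun i m => inj (enum_val m) \oc (phi i (enum_val m)).1)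
  (fun i m => (phi i (enum_val m)).2 \oc prj (enum_val m))).
- move=> i m m'; rewrite -compA (compA (prj _)).
  have [<-|mm'] := eqVneq m m'.
    by rewrite pi_id comp1m scale1r; case: (phiP _ _ (JP i m)).
  by rewrite pi_0 ?(inj_eq enum_val_inj) // comp0m compm0 scale0r.
- have -> : \sum_i \sum_(m < #|J i|) (inj (enum_val m) \oc (phi i (enum_val m)).1) \oc
      ((phi i (enum_val m)).2 \oc prj (enum_val m)) =
      \sum_i \sum_(j in J i) inj j \oc prj j.
    apply: eq_bigr => i _; rewrite (big_enum_val (fun j => inj j \oc prj j)).
    apply: eq_bigr => m _; have [_ e] := phiP _ _ (JP i m).
    by rewrite -compA (compA _ _ (prj _)) e comp1m.
  rewrite (exchange_big_dep xpredT) //= -ip; apply: eq_bigr => j _.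
  have [i0 Ti0] := S_index (sT j).
  rewrite (big_pred1 i0) // => i /=; apply/asboolP/eqP => [Ti|->].
    exact: (S_inj (sT j) (isom_sym Ti)).
  exact: isom_sym.
Qed.

Definition dual_basis X : dual_bases X := inhabited_witness (dual_bases_exist X).
Definition mult X i : nat := db_mult (dual_basis X) i.
Definition inc X i (m : 'I_(mult X i)) : Hom (S i) X := db_inc m.
Definition prj X i (m : 'I_(mult X i)) : Hom X (S i) := db_prj m.

Lemma prj_inc X i (m m' : 'I_(mult X i)) :
  prj m \oc inc m' = (m == m')%:R *: idm (S i).
Proof. exact: db_orth. Qed.

Lemma sum_inc_prj X : \sum_i \sum_(m < mult X i) inc m \oc prj m = idm X.
Proof. exact: db_sum. Qed.

Lemma inc_expand X i (f : Hom (S i) X) : f = \sum_m sc (prj m \oc f) *: inc m.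
Proof.
rewrite -[LHS]comp1m -sum_inc_prj comp_suml (bigD1 i) //= [X in _ + X]big1 ?addr0.
  rewrite comp_suml; apply: eq_bigr => m _.
  by rewrite -compA {1}(scE hC (prj m \oc f)) // compZr compm1.
move=> j ji; rewrite comp_suml big1 // => m _.
by rewrite -compA (S_hom0 (prj m \oc f)) ?compm0 // eq_sym.
Qed.

Lemma prj_expand X i (f : Hom X (S i)) : f = \sum_m sc (f \oc inc m) *: prj m.
Proof.
rewrite -[LHS]compm1 -sum_inc_prj comp_sumr (bigD1 i) //= [X in _ + X]big1 ?addr0.
  rewrite comp_sumr; apply: eq_bigr => m _.
  by rewrite compA {1}(scE hC (f \oc inc m)) // compZl comp1m.
move=> j ji; rewrite comp_sumr big1 // => m _.
by rewrite compA (S_hom0 (f \oc inc m)) ?comp0m // eq_sym.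
Qed.

Lemma hom_ext X Y (f g : Hom X Y) :
  (forall i (x : Hom (S i) X), f \oc x = g \oc x) -> f = g.
Proof.
move=> fg; rewrite -[f]compm1 -[g]compm1 -sum_inc_prj !comp_sumr.
apply: eq_bigr => i _; rewrite !comp_sumr; apply: eq_bigr => m _.
by rewrite !compA fg.
Qed.

(** The coordinates along [inc] and those of the given isomorphism with row vectors are related by
    mutually inverse matrices. This ties the chosen multiplicities to the dimensions that define
    FPdim. *)
Lemma mult_dim X i n : has_dim (Hom (S i) X) n -> n = mult X i.
Proof.
case=> [[v2r lin_v [r2v vK rK]]].
have lin_r : linear r2v.
  by move=> a u v; apply: (can_inj vK); rewrite lin_v !rK.
pose f (u : 'rV[k]_(mult X i)) := v2r (\sum_m u 0 m *: inc m).
pose g (v : 'rV[k]_n) : 'rV_(mult X i) := \row_m sc (prj m \oc r2v v).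
have lin_f : linear f.
  move=> a u v; rewrite /f -lin_v; congr v2r; rewrite scaler_sumr -big_split /=.
  by apply: eq_bigr => m _; rewrite !mxE scalerDl scalerA.
have lin_g : linear g.
  move=> a u v; apply/rowP => m; rewrite !mxE lin_r compDr compZr scD ?scZ //.
have fg u : f (g u) = u.
  rewrite /f -[RHS]rK; congr v2r; rewrite [RHS]inc_expand.
  by apply: eq_bigr => m _; rewrite mxE.
have gf u : g (f u) = u.
  apply/rowP => m; rewrite !mxE vK comp_sumr sc_sum // (bigD1 m) //= big1.
    by rewrite compZr prj_inc eqxx scale1r addr0 scP.
  by move=> m' /negPf mm'; rewrite compZr prj_inc eq_sym mm' scale0r scaler0 sc0.
pose fL : {linear 'rV[k]_(mult X i) -> 'rV[k]_n} :=
  HB.pack f (GRing.isLinear.Build _ _ _ _ f lin_f).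
pose gL : {linear 'rV[k]_n -> 'rV[k]_(mult X i)} :=
  HB.pack g (GRing.isLinear.Build _ _ _ _ g lin_g).
have e1 : lin1_mx fL *m lin1_mx gL = 1%:M.
  by apply/row_matrixP => j; rewrite !rowE mulmxA !mul_rV_lin1 mulmx1 /= gf.
have e2 : lin1_mx gL *m lin1_mx fL = 1%:M.
  by apply/row_matrixP => j; rewrite !rowE mulmxA !mul_rV_lin1 mulmx1 /= fg.
apply/eqP; rewrite eqn_leq; apply/andP; split.
  rewrite -[leqLHS](@mxrank1 k) -e2; apply: leq_trans (mxrankM_maxl _ _) _.
  exact: rank_leq_col.
rewrite -[leqLHS](@mxrank1 k) -e1; apply: leq_trans (mxrankM_maxl _ _) _.
exact: rank_leq_col.
Qed.

(* The trace of composition with h on Hom (S i) X. *)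
Definition tr X i (h : Hom X X) : k := \sum_(m < mult X i) sc (prj m \oc h \oc inc m).

Lemma trD X i (f g : Hom X X) : tr i (f + g) = tr i f + tr i g.
Proof.
rewrite -big_split /=; apply: eq_bigr => m _.
by rewrite compDr compDl scD.
Qed.

Lemma trZ X i a (f : Hom X X) : tr i (a *: f) = a * tr i f.
Proof.
by rewrite mulr_sumr; apply: eq_bigr => m _; rewrite compZr compZl scZ.
Qed.

Lemma tr0 X i : tr i (0 : Hom X X) = 0.
Proof. by rewrite -[0](scale0r (idm X)) trZ mul0r. Qed.

Lemma tr_sum X i I (s : seq I) (P : pred I) (f : I -> Hom X X) :
  tr i (\sum_(j <- s | P j) f j) = \sum_(j <- s | P j) tr i (f j).
Proof. by elim/big_rec2: _ => [|j x y _ <-]; rewrite ?tr0 // trD. Qed.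

Lemma tr1 X i : tr i (idm X) = (mult X i)%:R.
Proof.
rewrite /tr (eq_bigr (fun=> 1)) ?sumr_const ?card_ord // => m _.
by rewrite compm1 prj_inc eqxx scale1r sc1.
Qed.

Lemma sc_split X Y i (f : Hom (S i) X) (g : Hom X Y) (h : Hom Y (S i)) :
  sc (h \oc g \oc f) =
  \sum_(m < mult X i) sc (h \oc g \oc inc m) * sc (prj m \oc f).
Proof.
rewrite {1}(inc_expand f) comp_sumr sc_sum //; apply: eq_bigr => m _.
by rewrite compZr scZ // mulrC.
Qed.

(** Inserting dual bases between the two factors turns either side into the same double sum of
    products of matrix coefficients. *)
Lemma tr_cyc X Y i (f : Hom X Y) (g : Hom Y X) : tr i (g \oc f) = tr i (f \oc g).
Proof.
have split U V (u : Hom U V) (v : Hom V U) : tr i (v \oc u) =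
    \sum_(m < mult U i) \sum_(m' < mult V i)
      sc (prj m \oc v \oc inc m') * sc (prj m' \oc u \oc inc m).
  apply: eq_bigr => m _.
  have -> : prj m \oc (v \oc u) \oc inc m = prj m \oc v \oc (u \oc inc m).
    by rewrite !compA.
  rewrite [in LHS](inc_expand (u \oc inc m)) comp_sumr sc_sum //.
  by apply: eq_bigr => m' _; rewrite compZr scZ // mulrC compA.
rewrite !split exchange_big /=; apply: eq_bigr => m _; apply: eq_bigr => m' _.
by rewrite mulrC.
Qed.

Lemma mult_S i j : mult (S j) i = (i == j).
Proof.
have [<-|ij] := eqVneq i j; last first.
  case e : (mult (S j) i) => [|n] //.
  have m : 'I_(mult (S j) i) by rewrite e; exact: ord0.
  have := prj_inc m m; rewrite (S_hom0 (inc m)) // compm0 eqxx scale1r => /esym/eqP.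
  by rewrite (negPf (simple_id_neq0 (S_simple i))).
apply: (esym (mult_dim (n := 1) _)); split.
exists (fun f => (sc f)%:M); first by move=> a f g; rewrite scD // scZ // raddfD /= -scale_scalar_mx.
exists (fun v : 'rV[k]_1 => v 0 0 *: idm (S i)) => [f|v]; first by rewrite mxE eqxx mulr1n -scE.
by rewrite scP // -mx11_scalar.
Qed.

End Semisimple.

(** * String calculus in a braided category *)

(* Composites with a name are locked, as associativity would rewrite inside. *)
Fact str_key : unit. Proof. by []. Qed.

Section Iso.
Variables (k : fieldType) (C : lincat k).

Lemma iso_cancel_l (X Y Z : C) (f : Hom Y Z) (g h : Hom X Y) :
  is_iso f -> f \oc g = f \oc h -> g = h.
Proof. by move/is_iso_mono; apply. Qed.

Lemma iso_cancel_r (X Y Z : C) (f : Hom X Y) (g h : Hom Y Z) :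
  is_iso f -> g \oc f = h \oc f -> g = h.
Proof.
case=> f' [_ ff'] /(congr1 (fun u => u \oc f')).
by rewrite -!compA ff' !compm1.
Qed.

(* The inverse of an isomorphism, and 0 otherwise. *)
Definition isoV (X Y : C) (f : Hom X Y) : Hom Y X :=
  if pselect (is_iso f) is left h then sval (cid h) else 0.

Lemma isoVK (X Y : C) (f : Hom X Y) : is_iso f -> isoV f \oc f = idm X.
Proof. by rewrite /isoV; case: pselect => // h _; case: (cid h) => g []. Qed.

Lemma isoKV (X Y : C) (f : Hom X Y) : is_iso f -> f \oc isoV f = idm Y.
Proof. by rewrite /isoV; case: pselect => // h _; case: (cid h) => g []. Qed.

Lemma isoV_iso (X Y : C) (f : Hom X Y) : is_iso f -> is_iso (isoV f).
Proof. by move=> h; exists f; rewrite isoVK // isoKV. Qed.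

End Iso.

Section Monoidal.
Variables (k : fieldType) (C : moncat k).
Implicit Types V W X Y Z A : C.

Definition rwh W W' (f : Hom W W') X : Hom (W \ox X) (W' \ox X) := f \om idm X.
Definition lwh W X Y (g : Hom X Y) : Hom (W \ox X) (W \ox Y) := idm W \om g.
Local Notation "f |> X" := (rwh f X) (at level 30, X at level 20).
Local Notation "W <|| g" := (lwh W g) (at level 30, g at level 20).

Lemma rwhM W W' W'' (g : Hom W' W'') (f : Hom W W') X :
  (g \oc f) |> X = (g |> X) \oc (f |> X).
Proof. by rewrite /rwh -bmapM comp1m. Qed.

Lemma lwhM W X Y Z (g : Hom Y Z) (f : Hom X Y) :
  W <|| (g \oc f) = (W <|| g) \oc (W <|| f).
Proof. by rewrite /lwh -bmapM comp1m. Qed.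

Lemma rwh1 W X : idm W |> X = idm (W \ox X). Proof. exact: bmap1. Qed.
Lemma lwh1 W X : W <|| idm X = idm (W \ox X). Proof. exact: bmap1. Qed.

Lemma whC W W' X Y (f : Hom W W') (g : Hom X Y) :
  (f |> Y) \oc (W <|| g) = (W' <|| g) \oc (f |> X).
Proof. by rewrite /rwh /lwh -!bmapM !comp1m !compm1. Qed.

Lemma rwh_iso W W' (f : Hom W W') X : is_iso f -> is_iso (f |> X).
Proof. by move=> fi; apply: bmap_iso fi (is_iso_id _). Qed.

Lemma lwh_iso W X Y (g : Hom X Y) : is_iso g -> is_iso (W <|| g).
Proof. by move=> fi; apply: bmap_iso fi; apply: is_iso_id. Qed.

Lemma rwhP W W' a (f g : Hom W W') X : (a *: f + g) |> X = a *: (f |> X) + g |> X.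
Proof. exact: bmapPl. Qed.
Lemma lwhP W X Y a (f g : Hom X Y) : W <|| (a *: f + g) = a *: (W <|| f) + W <|| g.
Proof. exact: bmapPr. Qed.
Lemma rwhD W W' (f g : Hom W W') X : (f + g) |> X = f |> X + g |> X.
Proof. by have := rwhP 1 f g X; rewrite !scale1r. Qed.
Lemma lwhD W X Y (f g : Hom X Y) : W <|| (f + g) = W <|| f + W <|| g.
Proof. by have := lwhP W 1 f g; rewrite !scale1r. Qed.
Lemma rwh0 W W' X : (0 : Hom W W') |> X = 0.
Proof.
have := rwhD (0 : Hom W W') 0 X; rewrite addr0 => /eqP.
by rewrite -subr_eq0 opprD addrA subrr add0r oppr_eq0 => /eqP.
Qed.
Lemma lwh0 W X Y : W <|| (0 : Hom X Y) = 0.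
Proof.
have := lwhD W (0 : Hom X Y) 0; rewrite addr0 => /eqP.
by rewrite -subr_eq0 opprD addrA subrr add0r oppr_eq0 => /eqP.
Qed.
Lemma rwhZ W W' a (f : Hom W W') X : (a *: f) |> X = a *: (f |> X).
Proof. by have := rwhP a f 0 X; rewrite rwh0 !addr0. Qed.
Lemma lwhZ W X Y a (f : Hom X Y) : W <|| (a *: f) = a *: (W <|| f).
Proof. by have := lwhP W a f 0; rewrite lwh0 !addr0. Qed.
Lemma rwh_sum W W' I (s : seq I) (P : pred I) (f : I -> Hom W W') X :
  (\sum_(i <- s | P i) f i) |> X = \sum_(i <- s | P i) (f i |> X).
Proof. by elim/big_rec2: _ => [|i x y _ <-]; rewrite ?rwh0 // rwhD. Qed.
Lemma lwh_sum W X Y I (s : seq I) (P : pred I) (f : I -> Hom X Y) :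
  W <|| (\sum_(i <- s | P i) f i) = \sum_(i <- s | P i) (W <|| f i).
Proof. by elim/big_rec2: _ => [|i x y _ <-]; rewrite ?lwh0 // lwhD. Qed.

Lemma asso_iso X Y Z : is_iso (asso X Y Z).
Proof. by exists (assoV X Y Z); rewrite assoK assoVK. Qed.
Lemma assoV_iso X Y Z : is_iso (assoV X Y Z).
Proof. by exists (asso X Y Z); rewrite assoK assoVK. Qed.

Lemma asso_nat1 X X' Y Z (f : Hom X X') :
  asso X' Y Z \oc (f |> Y |> Z) = (f |> (Y \ox Z)) \oc asso X Y Z.
Proof. by rewrite /rwh asso_nat bmap1. Qed.
Lemma asso_nat2 X Y Y' Z (f : Hom Y Y') :
  asso X Y' Z \oc ((X <|| f) |> Z) = (X <|| (f |> Z)) \oc asso X Y Z.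
Proof. by rewrite /rwh /lwh asso_nat. Qed.
Lemma asso_nat3 X Y Z Z' (f : Hom Z Z') :
  asso X Y Z' \oc ((X \ox Y) <|| f) = (X <|| (Y <|| f)) \oc asso X Y Z.
Proof. by rewrite /rwh /lwh -asso_nat bmap1. Qed.

Lemma assoV_natE X X' Y Y' Z Z' (f : Hom ((X \ox Y) \ox Z) ((X' \ox Y') \ox Z'))
    (g : Hom (X \ox (Y \ox Z)) (X' \ox (Y' \ox Z'))) :
  asso X' Y' Z' \oc f = g \oc asso X Y Z -> assoV X' Y' Z' \oc g = f \oc assoV X Y Z.
Proof.
move=> e; rewrite -[f]comp1m -assoK -!compA; congr (_ \oc _).
by rewrite compA e -compA assoVK compm1.
Qed.

Lemma assoV_nat1 X X' Y Z (f : Hom X X') :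
  assoV X' Y Z \oc (f |> (Y \ox Z)) = (f |> Y |> Z) \oc assoV X Y Z.
Proof. exact: assoV_natE (asso_nat1 _ _ _). Qed.
Lemma assoV_nat2 X Y Y' Z (f : Hom Y Y') :
  assoV X Y' Z \oc (X <|| (f |> Z)) = ((X <|| f) |> Z) \oc assoV X Y Z.
Proof. exact: assoV_natE (asso_nat2 _ _ _). Qed.
Lemma assoV_nat3 X Y Z Z' (f : Hom Z Z') :
  assoV X Y Z' \oc (X <|| (Y <|| f)) = ((X \ox Y) <|| f) \oc assoV X Y Z.
Proof. exact: assoV_natE (asso_nat3 _ _ _). Qed.

Lemma rwh_unit_inj X Y (f g : Hom X Y) : f |> unit_ob C = g |> unit_ob C -> f = g.
Proof.
move=> fg; apply: (iso_cancel_r (run_iso X)).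
by rewrite -!run_nat; congr (_ \oc _).
Qed.

Lemma lwh_unit_inj X Y (f g : Hom X Y) : unit_ob C <|| f = unit_ob C <|| g -> f = g.
Proof.
move=> fg; apply: (iso_cancel_r (lun_iso X)).
by rewrite -!lun_nat; congr (_ \oc _).
Qed.

Lemma pentagonW X Y Z W :
  asso X Y (Z \ox W) \oc asso (X \ox Y) Z W
  = (X <|| asso Y Z W) \oc asso X (Y \ox Z) W \oc (asso X Y Z |> W).
Proof. exact: pentagon. Qed.

Lemma triangleW X Y : (X <|| lun Y) \oc asso X (unit_ob C) Y = run X |> Y.
Proof. exact: triangle. Qed.

Lemma triangleV X Y : (run X |> Y) \oc assoV X (unit_ob C) Y = X <|| lun Y.
Proof. by rewrite -triangleW -compA assoVK compm1. Qed.

(** Kelly's argument: tensoring with the unit is faithful, and after it the relation follows from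
    the pentagon and the triangle. *)
Lemma run_tens X Y : run (X \ox Y) = (X <|| run Y) \oc asso X Y (unit_ob C).
Proof.
apply: rwh_unit_inj; apply: (iso_cancel_l (asso_iso X Y (unit_ob C))).
rewrite rwhM [RHS]compA asso_nat2 -!triangleW compA asso_nat3 -compA pentagonW.
by rewrite lwhM !compA.
Qed.

Lemma lun_tens X Y : lun (X \ox Y) \oc asso (unit_ob C) X Y = lun X |> Y.
Proof.
apply: lwh_unit_inj.
apply: (iso_cancel_r (asso_iso (unit_ob C) (unit_ob C \ox X) Y)).
apply: (iso_cancel_r (rwh_iso Y (asso_iso (unit_ob C) (unit_ob C) X))).
rewrite lwhM -!compA (compA (_ <|| asso _ _ _)) -pentagonW compA triangleW.
rewrite -asso_nat1 -triangleW [in RHS]compA -asso_nat2 rwhM.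
by rewrite compA.
Qed.

Lemma lun_run_unit : lun (unit_ob C) = run (unit_ob C).
Proof.
apply: lwh_unit_inj.
apply: (iso_cancel_r (asso_iso (unit_ob C) (unit_ob C) (unit_ob C))).
rewrite triangleW -run_tens.
by apply: (iso_cancel_l (run_iso (unit_ob C))); rewrite run_nat.
Qed.

Definition runV X := isoV (run X).
Definition lunV X := isoV (lun X).
Lemma runK X : runV X \oc run X = idm _. Proof. exact: isoVK (run_iso X). Qed.
Lemma runVK X : run X \oc runV X = idm _. Proof. exact: isoKV (run_iso X). Qed.
Lemma lunK X : lunV X \oc lun X = idm _. Proof. exact: isoVK (lun_iso X). Qed.
Lemma lunVK X : lun X \oc lunV X = idm _. Proof. exact: isoKV (lun_iso X). Qed.

End Monoidal.

Notation "f |> X" := (rwh f X) (at level 30, X at level 20) : cat_scope.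
Notation "W <|| g" := (lwh W g) (at level 30, g at level 20) : cat_scope.

Section Braided.
Variables (k : fieldType) (B : bmoncat k).
Implicit Types V W X Y Z A : B.

Definition dbl X Y : Hom (X \ox Y) (X \ox Y) :=
  locked_with str_key (braid Y X \oc braid X Y).
Lemma dblE X Y : dbl X Y = braid Y X \oc braid X Y.
Proof. by rewrite /dbl locked_withE. Qed.
Definition braidV X Y : Hom (Y \ox X) (X \ox Y) := isoV (braid X Y).
Lemma braidK X Y : braidV X Y \oc braid X Y = idm _.
Proof. exact: isoVK (braid_iso X Y). Qed.
Lemma braidVK X Y : braid X Y \oc braidV X Y = idm _.
Proof. exact: isoKV (braid_iso X Y). Qed.

Lemma braid_natl X X' Y (f : Hom X X') :
  braid X' Y \oc (f |> Y) = (Y <|| f) \oc braid X Y.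
Proof. by rewrite /rwh /lwh braid_nat. Qed.
Lemma braid_natr X Y Y' (g : Hom Y Y') :
  braid X Y' \oc (X <|| g) = (g |> X) \oc braid X Y.
Proof. by rewrite /rwh /lwh braid_nat. Qed.

(** In the hexagon with two unit factors the composite g of braiding and unitor occurs once on one
    side and twice on the other; one invertible copy is cancelled. *)
Lemma lun_braid X : lun X \oc braid X (unit_ob B) = run X.
Proof.
set g := lun X \oc _.
have iso_g : is_iso g by apply: is_iso_comp (lun_iso X) (braid_iso _ _).
apply/esym/rwh_unit_inj/(iso_cancel_l iso_g).
have h := hexagon X (unit_ob B) (unit_ob B).
have : (unit_ob B <|| lun X) \oc (asso (unit_ob B) (unit_ob B) X \oc
    braid X (unit_ob B \ox unit_ob B) \oc asso X (unit_ob B) (unit_ob B)) =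
  (unit_ob B <|| g) \oc asso (unit_ob B) X (unit_ob B) \oc (braid X (unit_ob B) |> unit_ob B).
  by rewrite h !compA -/(lwh _ _) -lwhM.
rewrite !compA triangleW -lun_run_unit -braid_natr -compA triangleW => e.
rewrite {1}/g -compA e !compA [lun X \oc _]lun_nat -(compA g) lun_tens -compA.
by rewrite -rwhM.
Qed.

(* [brev B] has the same underlying monoidal category and the inverse braiding. *)
Fact brev_iso X Y : is_iso (braidV Y X).
Proof. exact: isoV_iso (braid_iso _ _). Qed.
Fact brev_nat X X' Y Y' (f : Hom X X') (g : Hom Y Y') :
  braidV Y' X' \oc (f \om g) = (g \om f) \oc braidV Y X.
Proof.
apply: (iso_cancel_l (braid_iso Y' X')); rewrite compA braidVK comp1m compA.
by rewrite braid_nat -compA braidVK compm1.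
Qed.
Fact brev_hexagon X Y Z :
  asso Y Z X \oc braidV (Y \ox Z) X \oc asso X Y Z
  = (idm Y \om braidV Z X) \oc asso Y X Z \oc (braidV Y X \om idm Z).
Proof.
have h := hexagonV Y Z X.
have e : assoV X Y Z \oc braid (Y \ox Z) X \oc assoV Y Z X \oc
   (asso Y Z X \oc braidV (Y \ox Z) X \oc asso X Y Z) = idm _.
  rewrite !compA -(compA _ (assoV Y Z X)) assoK compm1.
  by rewrite -(compA _ _ (braidV _ _)) braidVK compm1 assoK.
have iso_l : is_iso (assoV X Y Z \oc braid (Y \ox Z) X \oc assoV Y Z X).
  by do 2![apply: is_iso_comp; last exact: assoV_iso || exact: braid_iso];
     apply: assoV_iso.
apply: (iso_cancel_l iso_l); rewrite e h !compA.
rewrite -(compA _ (idm Y \om braid Z X)) -bmapM comp1m braidVK bmap1 compm1.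
by rewrite -(compA _ (assoV Y X Z)) assoK compm1 -bmapM comp1m braidVK bmap1.
Qed.
Fact brev_hexagonV X Y Z :
  assoV Z X Y \oc braidV Z (X \ox Y) \oc assoV X Y Z
  = (braidV Z X \om idm Y) \oc assoV X Z Y \oc (idm X \om braidV Z Y).
Proof.
have h := hexagon Z X Y.
have e : asso X Y Z \oc braid Z (X \ox Y) \oc asso Z X Y \oc
   (assoV Z X Y \oc braidV Z (X \ox Y) \oc assoV X Y Z) = idm _.
  rewrite !compA -(compA _ (asso Z X Y)) assoVK compm1.
  by rewrite -(compA _ _ (braidV _ _)) braidVK compm1 assoVK.
have iso_l : is_iso (asso X Y Z \oc braid Z (X \ox Y) \oc asso Z X Y).
  by do 2![apply: is_iso_comp; last exact: asso_iso || exact: braid_iso];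
     apply: asso_iso.
apply: (iso_cancel_l iso_l); rewrite e h !compA.
rewrite -(compA _ (braid Z X \om idm Y)) -bmapM comp1m braidVK bmap1 compm1.
by rewrite -(compA _ (asso X Z Y)) assoVK compm1 -bmapM comp1m braidVK bmap1.
Qed.
Definition brev : bmoncat k :=
  @BMonCat k B (fun X Y => braidV Y X) brev_iso brev_nat brev_hexagon brev_hexagonV.

Lemma dbl_natr X Y Y' (g : Hom Y Y') : dbl X Y' \oc (X <|| g) = (X <|| g) \oc dbl X Y.
Proof. by rewrite !dblE -!compA braid_natr !compA braid_natl. Qed.
Lemma dbl_natl X X' Y (g : Hom X X') : dbl X' Y \oc (g |> Y) = (g |> Y) \oc dbl X Y.
Proof. by rewrite !dblE -!compA braid_natl !compA braid_natr. Qed.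

End Braided.

Lemma compK (k : fieldType) (C : lincat k) (W X Y : C) (f : Hom X Y) (g : Hom Y X)
  (h : Hom W X) : g \oc f = idm X -> g \oc (f \oc h) = h.
Proof. by move=> gf; rewrite compA gf comp1m. Qed.

(** * String diagrams as families of morphisms *)

Section Strings.
Variables (k : fieldType) (B : bmoncat k).
Implicit Types V W X Y Z A : B.

(* Right tensoring by a string of objects, as an endofunctor W |-> (W A1)..An
   together with the crossing of a strand X over the string and the
   compatibility with left tensoring.  Working with families of morphisms
   indexed by W removes the associativity constraints from string diagrams. *)
Record strings (xo : B -> B) := Strings {
  xm : forall W W', Hom W W' -> Hom (xo W) (xo W');
  xc : forall W X, Hom (xo (W \ox X)) (xo W \ox X);
  xl : forall V W, Hom (V \ox xo W) (xo (V \ox W));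
  xm1 : forall W, xm (idm W) = idm (xo W);
  xmM : forall W W' W'' (g : Hom W' W'') (f : Hom W W'), xm (g \oc f) = xm g \oc xm f;
  xmZ : forall W W' a (f : Hom W W'), xm (a *: f) = a *: xm f;
  xc_nat : forall W W' X (f : Hom W W'), (xm f |> X) \oc xc W X = xc W' X \oc xm (f |> X);
  xl_nat : forall V W W' (f : Hom W W'), xl V W' \oc (V <|| xm f) = xm (V <|| f) \oc xl V W;
  xl_iso : forall V W, is_iso (xl V W) }.

Arguments xm {xo} s {W W'} f.

Lemma xm_iso F (s : strings F) W W' (f : Hom W W') : is_iso f -> is_iso (xm s f).
Proof. by case=> g [gf fg]; exists (xm s g); rewrite -!xmM gf fg !xm1. Qed.

Definition vfam X Y X' Y' (c : Hom (X \ox Y) (X' \ox Y')) W :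
    Hom ((W \ox X) \ox Y) ((W \ox X') \ox Y') :=
  locked_with str_key (assoV W X' Y' \oc (W <|| c) \oc asso W X Y).

Lemma vfamE X Y X' Y' (c : Hom (X \ox Y) (X' \ox Y')) W :
  vfam c W = assoV W X' Y' \oc (W <|| c) \oc asso W X Y.
Proof. by rewrite /vfam unlock. Qed.

Lemma vfamM X Y X' Y' X'' Y'' (d : Hom (X' \ox Y') (X'' \ox Y''))
    (c : Hom (X \ox Y) (X' \ox Y')) W : vfam (d \oc c) W = vfam d W \oc vfam c W.
Proof. by rewrite !vfamE lwhM !compA -(compA _ (asso _ _ _)) assoVK compm1. Qed.

Lemma vfam1 X Y W : vfam (idm (X \ox Y)) W = idm _.
Proof. by rewrite !vfamE lwh1 compm1 assoK. Qed.

Lemma vfam_nat X Y X' Y' (c : Hom (X \ox Y) (X' \ox Y')) W W' (f : Hom W W') :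
  vfam c W' \oc (f |> X |> Y) = (f |> X' |> Y') \oc vfam c W.
Proof.
by rewrite !vfamE -!compA asso_nat1 !compA -assoV_nat1 -(compA _ _ (W <|| c)) whC !compA.
Qed.

Lemma hexagonW X Y Z : asso Y Z X \oc braid X (Y \ox Z) \oc asso X Y Z
    = (Y <|| braid X Z) \oc asso Y X Z \oc (braid X Y |> Z).
Proof. exact: hexagon. Qed.

Definition str_id : strings id :=
  @Strings id (fun _ _ => id) (fun _ _ => idm _) (fun _ _ => idm _)
    (fun _ => erefl) (fun _ _ _ _ _ => erefl) (fun _ _ _ _ => erefl)
    (fun _ _ _ _ => etrans (compm1 _) (esym (comp1m _)))
    (fun _ _ _ _ => etrans (comp1m _) (esym (compm1 _)))
    (fun _ _ => is_iso_id _).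

Definition str_R A : strings (fun W => W \ox A) :=
  @Strings (fun W => W \ox A) (fun _ _ f => f |> A) (fun W X => vfam (braid X A) W)
    (fun V W => assoV V W A)
    (fun W => rwh1 W A) (fun _ _ _ g f => rwhM g f A) (fun _ _ a f => rwhZ a f A)
    (fun _ _ X f => esym (vfam_nat (braid X A) f))
    (fun V _ _ f => assoV_nat2 V A f) (fun V W => assoV_iso V W A).

Section Comp.
Variables (F G : B -> B) (a : strings F) (b : strings G).
Fact str_comp1 W : xm b (xm a (idm W)) = idm (G (F W)).
Proof. by rewrite !xm1. Qed.
Fact str_compM W W' W'' (g : Hom W' W'') (f : Hom W W') :
  xm b (xm a (g \oc f)) = xm b (xm a g) \oc xm b (xm a f).
Proof. by rewrite !xmM. Qed.
Fact str_compZ W W' c (f : Hom W W') : xm b (xm a (c *: f)) = c *: xm b (xm a f).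
Proof. by rewrite !xmZ. Qed.
Fact str_comp_nat W W' X (f : Hom W W') :
  (xm b (xm a f) |> X) \oc (xc b (F W) X \oc xm b (xc a W X))
  = (xc b (F W') X \oc xm b (xc a W' X)) \oc xm b (xm a (f |> X)).
Proof. by rewrite compA xc_nat -!compA -!xmM xc_nat. Qed.
Fact str_comp_lnat V W W' (f : Hom W W') :
  (xm b (xl a V W') \oc xl b V (F W')) \oc (V <|| xm b (xm a f))
  = xm b (xm a (V <|| f)) \oc (xm b (xl a V W) \oc xl b V (F W)).
Proof. by rewrite -compA xl_nat compA -xmM xl_nat xmM compA. Qed.
Fact str_comp_iso V W : is_iso (xm b (xl a V W) \oc xl b V (F W)).
Proof. by apply: is_iso_comp (xl_iso _ _ _); apply: xm_iso; apply: xl_iso. Qed.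
Definition str_comp : strings (G \o F) :=
  @Strings (G \o F) (fun _ _ f => xm b (xm a f))
    (fun W X => xc b (F W) X \oc xm b (xc a W X))
    (fun V W => xm b (xl a V W) \oc xl b V (F W))
    str_comp1 str_compM str_compZ str_comp_nat str_comp_lnat str_comp_iso.
End Comp.

(** A good family is a string diagram standing to the right of an arbitrary [W]. Only strands
    passing over it are recorded; passage below is the same condition in [brev B]. *)
Record good F G (a : strings F) (b : strings G) (t : forall W, Hom (F W) (G W)) : Prop := Good {
  good_nat : forall W W' (f : Hom W W'), t W' \oc xm a f = xm b f \oc t W;
  good_pass : forall W X, xc b W X \oc t (W \ox X) = (t W |> X) \oc xc a W X;
  good_left : forall V W, t (V \ox W) \oc xl a V W = xl b V W \oc (V <|| t W) }.

Lemma good_id F (a : strings F) : good a a (fun W => idm _).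
Proof.
split=> [W W' f|W X|V W]; rewrite ?comp1m ?compm1 //; first by rewrite rwh1 comp1m.
by rewrite lwh1 compm1.
Qed.

Lemma good_comp F G H (a : strings F) (b : strings G) (c : strings H) t s :
  good b c s -> good a b t -> good a c (fun W => s W \oc t W).
Proof.
move=> [sn sp sl] [tn tp tl]; split=> [W W' f|W X|V W].
- by rewrite -compA tn compA sn compA.
- by rewrite compA sp -compA tp compA rwhM.
- by rewrite -compA tl compA sl -compA lwhM.
Qed.

Lemma good_shift F G H (a : strings F) (b : strings G) (c : strings H) t :
  good a b t -> good (str_comp c a) (str_comp c b) (fun W => t (H W)).
Proof.
move=> [tn tp tl]; split=> [W W' f|W X|V W] /=.
- exact: tn.
- by rewrite -compA -tn compA tp compA.
- by rewrite compA tn -compA tl !compA.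
Qed.

Lemma good_whisk F G H (a : strings F) (b : strings G) (c : strings H) t :
  good a b t -> good (str_comp a c) (str_comp b c) (fun W => xm c (t W)).
Proof.
move=> [tn tp tl]; split=> [W W' f|W X|V W] /=.
- by rewrite -!xmM tn.
- by rewrite -compA -xmM tp xmM !compA xc_nat.
- by rewrite compA -xmM tl xmM -!compA -xl_nat.
Qed.

Lemma good_lwh Y Z (g : Hom Y Z) : good (str_R Y) (str_R Z) (fun W => W <|| g).
Proof.
split=> [W W' f|W X|V W] /=; first by rewrite whC.
  rewrite !vfamE !compA -(compA _ (asso _ _ _)) asso_nat3 !compA.
  rewrite -(compA _ (W <|| braid _ _)) -lwhM braid_natr lwhM !compA.
  by rewrite assoV_nat2.
by rewrite assoV_nat3.
Qed.

Lemma pentagonV X Y Z W :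
  asso (X \ox Y) Z W \oc (assoV X Y Z |> W) \oc assoV X (Y \ox Z) W =
  assoV X Y (Z \ox W) \oc (X <|| asso Y Z W).
Proof.
apply: (iso_cancel_r (asso_iso X (Y \ox Z) W)).
apply: (iso_cancel_r (rwh_iso W (asso_iso X Y Z))).
rewrite -!compA (compA (assoV _ _ _)) assoK comp1m -rwhM assoK rwh1 compm1.
by rewrite !compA -!compA [X in assoV _ _ _ \oc X]compA -pentagonW compA assoK comp1m.
Qed.

(** Up to pentagons, the compatibility with a crossing strand is the hexagon. *)
Lemma good_asso Y Z :
  good (str_comp (str_R Y) (str_R Z)) (str_R (Y \ox Z)) (fun W => asso W Y Z).
Proof.
split=> [W W' f|W X|V W] /=; first exact: asso_nat1.
- rewrite !vfamE !rwhM.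
  apply: (iso_cancel_l (asso_iso W (Y \ox Z) X)); rewrite !compA assoVK comp1m.
  apply: (iso_cancel_l (lwh_iso W (asso_iso Y Z X))).
  rewrite !compA -!lwhM.
  rewrite -(compA _ _ (asso (W \ox X) Y Z)).
  have -> : asso W X (Y \ox Z) \oc asso (W \ox X) Y Z =
     (W <|| asso X Y Z) \oc asso W (X \ox Y) Z \oc (asso W X Y |> Z) by apply: pentagonW.
  rewrite !compA -lwhM hexagonW !lwhM.
  have -> : (W <|| asso Y Z X) \oc asso W (Y \ox Z) X \oc (asso W Y Z |> X) =
     asso W Y (Z \ox X) \oc asso (W \ox Y) Z X by rewrite pentagonW.
  have e : (W <|| asso Y X Z) \oc asso W (Y \ox X) Z =
      asso W Y (X \ox Z) \oc asso (W \ox Y) X Z \oc (assoV W Y X |> Z).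
    by rewrite pentagonW -compA -rwhM assoVK rwh1 compm1.
  rewrite -(compA _ (asso (W \ox Y) Z X)) assoVK compm1.
  rewrite -(compA _ (W <|| (braid X Y |> Z))) -asso_nat2 !compA.
  by rewrite -(compA _ (W <|| asso Y X Z)) e !compA -asso_nat3.
- by rewrite compA pentagonV.
Qed.

Lemma good_inv F G (a : strings F) (b : strings G) t t' : good a b t ->
  (forall W, t' W \oc t W = idm _) -> (forall W, t W \oc t' W = idm _) -> good b a t'.
Proof.
move=> [tn tp tl] t't tt'.
have iso_t W : is_iso (t W) by exists (t' W).
split=> [W W' f|W X|V W]; apply: (iso_cancel_l (iso_t _)) || apply: (iso_cancel_r (iso_t _)).
- by rewrite !compA tt' comp1m tn -!compA tt' compm1.
- apply: (iso_cancel_l (rwh_iso _ (iso_t _))).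
  by rewrite !compA -tp -!compA t't !compA -rwhM tt' rwh1 comp1m compm1.
- by rewrite !compA tt' comp1m tl -!compA -lwhM tt' lwh1 compm1.
Qed.

Lemma good_assoV Y Z :
  good (str_R (Y \ox Z)) (str_comp (str_R Y) (str_R Z)) (fun W => assoV W Y Z).
Proof. by apply: good_inv (good_asso Y Z) _ _ => W; rewrite ?assoK ?assoVK. Qed.

Lemma good_run : good (str_R (unit_ob B)) str_id (fun W => run W).
Proof.
split=> [W W' f|W X|V W] /=; first exact: run_nat.
- rewrite comp1m !vfamE !compA triangleV -lwhM lun_braid.
  by rewrite run_tens.
- by rewrite comp1m run_tens -compA assoVK compm1.
Qed.

Lemma good_runV : good str_id (str_R (unit_ob B)) (fun W => runV W).
Proof. by apply: good_inv good_run _ _ => W; rewrite ?runK ?runVK. Qed.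

Lemma good_ext F G (a : strings F) (b : strings G) t t' : good a b t -> (forall W, t' W = t W) -> good a b t'.
Proof.
by move=> [tn tp tl] e; split=> [W W' f|W X|V W]; rewrite !e.
Qed.

(** Composites of strings have convertible maps on objects, but their structure is associative and
    unital only up to rewriting. [good_conv] transports good families along this pointwise
    equality. *)
Definition str_eq F (a a' : strings F) : Prop :=
  [/\ forall W W' (f : Hom W W'), xm a f = xm a' f,
      forall W X, xc a W X = xc a' W X & forall V W, xl a V W = xl a' V W].

Lemma good_conv F G (a a' : strings F) (b b' : strings G) t :
  str_eq a a' -> str_eq b b' -> good a b t -> good a' b' t.
Proof.
move=> [am ac al] [bm bc bl] [tn tp tl]; split=> [W W' f|W X|V W].
- by rewrite -am -bm.
- by rewrite -ac -bc.
- by rewrite -al -bl.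
Qed.

Lemma str_eq_refl F (a : strings F) : str_eq a a.
Proof. by []. Qed.

Lemma str_eq_comp F G (a a' : strings F) (b b' : strings G) :
  str_eq a a' -> str_eq b b' -> str_eq (str_comp a b) (str_comp a' b').
Proof.
move=> [am ac al] [bm bc bl]; split=> * /=.
- by rewrite bm am.
- by rewrite bc bm ac.
- by rewrite bl bm al.
Qed.

Lemma str_id_comp F (a : strings F) : str_eq (str_comp str_id a) a.
Proof. by split=> * /=; rewrite ?xm1 ?compm1 ?comp1m. Qed.

Lemma str_comp_id F (a : strings F) : str_eq (str_comp a str_id) a.
Proof. by split=> * /=; rewrite ?compm1 ?comp1m. Qed.

Lemma str_compA F G H (a : strings F) (b : strings G) (c : strings H) :
  str_eq (str_comp a (str_comp b c)) (str_comp (str_comp a b) c).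
Proof. by split=> * /=; rewrite ?xmM ?compA. Qed.

Lemma str_eq_trans F (a b c : strings F) : str_eq a b -> str_eq b c -> str_eq a c.
Proof.
move=> [am ac al] [bm bc bl]; split=> *.
- by rewrite am bm.
- by rewrite ac bc.
- by rewrite al bl.
Qed.

Lemma str_eq_sym F (a b : strings F) : str_eq a b -> str_eq b a.
Proof. by move=> [am ac al]; split=> *; rewrite ?am ?ac ?al. Qed.

Lemma good_vfam X Y X' Y' (c : Hom (X \ox Y) (X' \ox Y')) :
  good (str_comp (str_R X) (str_R Y)) (str_comp (str_R X') (str_R Y')) (vfam c).
Proof.
eapply good_ext; last (by move=> W; apply: vfamE); apply: good_comp (good_asso X Y).
by apply: good_comp (good_assoV X' Y') _; apply: good_lwh.
Qed.

Definition vout U X Y (c : Hom U (X \ox Y)) W : Hom (W \ox U) ((W \ox X) \ox Y) :=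
  locked_with str_key (assoV W X Y \oc (W <|| c)).
Definition vin U X Y (c : Hom (X \ox Y) U) W : Hom ((W \ox X) \ox Y) (W \ox U) :=
  locked_with str_key ((W <|| c) \oc asso W X Y).

Lemma voutE U X Y (c : Hom U (X \ox Y)) W : vout c W = assoV W X Y \oc (W <|| c).
Proof. by rewrite /vout unlock. Qed.
Lemma vinE U X Y (c : Hom (X \ox Y) U) W : vin c W = (W <|| c) \oc asso W X Y.
Proof. by rewrite /vin unlock. Qed.

Lemma good_vout U X Y (c : Hom U (X \ox Y)) :
  good (str_R U) (str_comp (str_R X) (str_R Y)) (vout c).
Proof.
eapply good_ext; last (by move=> W; apply: voutE); apply: good_comp (good_assoV X Y) _.
exact: good_lwh.
Qed.
Lemma good_vin U X Y (c : Hom (X \ox Y) U) :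
  good (str_comp (str_R X) (str_R Y)) (str_R U) (vin c).
Proof.
eapply good_ext; last (by move=> W; apply: vinE); apply: good_comp (good_asso X Y).
exact: good_lwh.
Qed.

Lemma vout_vfam U X Y X' Y' (d : Hom (X \ox Y) (X' \ox Y')) (c : Hom U (X \ox Y)) W :
  vfam d W \oc vout c W = vout (d \oc c) W.
Proof.
by rewrite !voutE vfamE lwhM -!compA (compA (asso _ _ _)) assoVK comp1m.
Qed.

Lemma vin_vout U U' X Y (d : Hom (X \ox Y) U') (c : Hom U (X \ox Y)) W :
  vin d W \oc vout c W = W <|| (d \oc c).
Proof. by rewrite voutE vinE lwhM -!compA (compA (asso _ _ _)) assoVK comp1m. Qed.

Lemma vout_vin U X Y X' Y' (d : Hom U (X' \ox Y')) (c : Hom (X \ox Y) U) W :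
  vout d W \oc vin c W = vfam (d \oc c) W.
Proof. by rewrite voutE vinE vfamE lwhM !compA. Qed.

(** W is isomorphic to W (x) 1, and compatibility with left tensoring expresses the component at W
    (x) 1 by the one at the unit. So proportionality of diagrams is checked at the unit only. *)
Lemma good_scalar F G (a : strings F) (b : strings G) s t c : good a b s -> good a b t ->
  t (unit_ob B) = c *: s (unit_ob B) -> forall W, t W = c *: s W.
Proof.
move=> [sn sp sl] [tn tp tl] ts W.
apply: (iso_cancel_r (xm_iso a (run_iso W))).
rewrite tn compZl sn -compZr; congr (_ \oc _).
apply: (iso_cancel_r (xl_iso a W (unit_ob B))).
by rewrite tl ts lwhZ compZr compZl sl.
Qed.

End Strings.

(** * Crossings of a strand with a diagram *)

Section Crossings.
Variables (k : fieldType) (B : bmoncat k).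
Implicit Types V W X Y Z A : B.

Definition xing A A' W : Hom ((W \ox A) \ox A') ((W \ox A') \ox A) := vfam (braid A A') W.
Definition xingV A A' W : Hom ((W \ox A') \ox A) ((W \ox A) \ox A') :=
  locked_with str_key (vfam (braidV A A') W).

Lemma xingE A A' W : xing A A' W = vfam (braid A A') W.
Proof. by rewrite /xing locked_withE. Qed.
Lemma xingVE A A' W : xingV A A' W = vfam (braidV A A') W.
Proof. by rewrite /xingV locked_withE. Qed.

Lemma xingK A A' W : xingV A A' W \oc xing A A' W = idm _.
Proof. by rewrite xingE xingVE -vfamM braidK vfam1. Qed.
Lemma xingVK A A' W : xing A A' W \oc xingV A A' W = idm _.
Proof. by rewrite xingE xingVE -vfamM braidVK vfam1. Qed.
Lemma xingKr A A' W Y : (xingV A A' W |> Y) \oc (xing A A' W |> Y) = idm _.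
Proof. by rewrite -rwhM xingK rwh1. Qed.
Lemma xingVKr A A' W Y : (xing A A' W |> Y) \oc (xingV A A' W |> Y) = idm _.
Proof. by rewrite -rwhM xingVK rwh1. Qed.
Lemma xing_iso A A' W : is_iso (xing A A' W).
Proof. by exists (xingV A A' W); rewrite xingK xingVK. Qed.
Lemma xing_nat A A' W W' (f : Hom W W') :
  xing A A' W' \oc (f |> A |> A') = (f |> A' |> A) \oc xing A A' W.
Proof. by rewrite !xingE vfam_nat. Qed.
Lemma xingV_nat A A' W W' (f : Hom W W') :
  xingV A A' W' \oc (f |> A' |> A) = (f |> A |> A') \oc xingV A A' W.
Proof. by rewrite !xingVE vfam_nat. Qed.

(** Passing below in [B] is passing above in [brev B], which has the same underlying monoidal
    category and therefore the same [vfam]. *)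
Lemma vfam_under X Y X' Y' (c : Hom (X \ox Y) (X' \ox Y')) W A :
  xingV Y' A (W \ox X') \oc (xingV X' A W |> Y') \oc vfam c (W \ox A) =
  (vfam c W |> A) \oc (xingV Y A (W \ox X) \oc (xingV X A W |> Y)).
Proof. by rewrite !xingVE; exact: (good_pass (@good_vfam k (brev B) X Y X' Y' c) W A). Qed.

Lemma vfam_over X Y X' Y' (c : Hom (X \ox Y) (X' \ox Y')) W A :
  xing A Y' (W \ox X') \oc (xing A X' W |> Y') \oc vfam c (W \ox A) =
  (vfam c W |> A) \oc (xing A Y (W \ox X) \oc (xing A X W |> Y)).
Proof. by rewrite !xingE; exact: (good_pass (@good_vfam k B X Y X' Y' c) W A). Qed.

(* A strand [A] starting right of the string moves left, below it. *)
Lemma vfam_left X Y X' Y' (c : Hom (X \ox Y) (X' \ox Y')) W A :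
  vfam c (W \ox A) \oc ((xing X A W |> Y) \oc xing Y A (W \ox X)) =
  (xing X' A W |> Y') \oc xing Y' A (W \ox X') \oc (vfam c W |> A).
Proof.
apply: (iso_cancel_l (is_iso_comp (isoV_iso (xing_iso Y' A (W \ox X')))
   (rwh_iso Y' (isoV_iso (xing_iso X' A W))))).
have eV P Q V : isoV (xing P Q V) = xingV P Q V.
  by apply: (iso_cancel_l (xing_iso P Q V)); rewrite isoKV ?xingVK //; apply: xing_iso.
rewrite !eV compA vfam_under -!compA.
by rewrite (compK _ (xingKr _ _ _ _)) xingK compm1 (compK _ (xingKr _ _ _ _)) (compK _ (xingK _ _ _)).
Qed.

Lemma vout_left U X Y (c : Hom U (X \ox Y)) W A :
  vout c (W \ox A) \oc xing U A W =
  (xing X A W |> Y) \oc xing Y A (W \ox X) \oc (vout c W |> A).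
Proof.
have h := good_pass (@good_vout k (brev B) U X Y c) W A.
have {h} h : xingV Y A (W \ox X) \oc (xingV X A W |> Y) \oc vout c (W \ox A) =
  (vout c W |> A) \oc xingV U A W by rewrite !xingVE.
have /(congr1 (fun u => (xing X A W |> Y) \oc xing Y A (W \ox X) \oc u \oc xing U A W)) := h.
rewrite -!compA xingK compm1 => <-.
by rewrite (compK _ (xingVK _ _ _)) (compK _ (xingVKr _ _ _ _)).
Qed.

End Crossings.

(** * Duals, caps, cups and partial traces *)

Record dual_data (k : fieldType) (C : moncat k) (P : C) := DualData {
  dd :> C;
  dev : Hom (dd \ox P) (unit_ob C);
  dcoev : Hom (unit_ob C) (P \ox dd);
  dzig1 : run P \oc (P <|| dev) \oc asso P dd P \oc (dcoev |> P) = lun P;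
  dzig2 : lun dd \oc (dev |> dd) \oc assoV dd P dd \oc (dd <|| dcoev) = run dd }.

Lemma dual_data_exist (k : fieldType) (C : moncat k) (hC : fusion C) (P : C) :
  inhabited (dual_data P).
Proof.
by have [Pd [ev [coev [z1 z2]]]] := fusion_ldual hC P; split; exists Pd ev coev.
Qed.

Section Duality.
Variables (k : fieldType) (B : bmoncat k).
Implicit Types V W X Y Z A : B.

Section Monoidal.
Variables (P : B) (Pd : dual_data P).

Definition cap W : Hom ((W \ox Pd) \ox P) W :=
  locked_with str_key (run W \oc (W <|| dev Pd) \oc asso W Pd P).
Definition cup W : Hom W ((W \ox P) \ox Pd) :=
  locked_with str_key (assoV W P Pd \oc (W <|| dcoev Pd) \oc runV W).

Lemma capE W : cap W = run W \oc (W <|| dev Pd) \oc asso W Pd P.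
Proof. by rewrite /cap locked_withE. Qed.
Lemma cupE W : cup W = assoV W P Pd \oc (W <|| dcoev Pd) \oc runV W.
Proof. by rewrite /cup locked_withE. Qed.

Lemma good_cap : good (str_comp (str_R (Pd : B)) (str_R P)) (str_id B) cap.
Proof.
eapply good_ext; last (by move=> W; apply: capE).
apply: good_comp (good_asso _ _); apply: good_comp (good_run _) _.
exact: good_lwh.
Qed.

Lemma good_cup : good (str_id B) (str_comp (str_R P) (str_R (Pd : B))) cup.
Proof.
eapply good_ext; last (by move=> W; apply: cupE).
apply: good_comp (good_runV _); apply: good_comp (good_assoV _ _) _.
exact: good_lwh.
Qed.

Lemma cap_nat W W' (f : Hom W W') : cap W' \oc (f |> Pd |> P) = f \oc cap W.
Proof. exact: (good_nat good_cap f). Qed.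
Lemma cup_nat W W' (f : Hom W W') : cup W' \oc f = (f |> P |> Pd) \oc cup W.
Proof. exact: (good_nat good_cup f). Qed.

Lemma cap_cup W : cap (W \ox P) \oc (cup W |> P) = idm (W \ox P).
Proof.
have := good_left good_cap W P; rewrite /= comp1m => capl.
have e : (cup W |> P) =
   (assoV W P Pd |> P) \oc assoV W (P \ox Pd) P \oc (W <|| (dcoev Pd |> P)) \oc
     asso W (unit_ob B) P \oc (runV W |> P).
  rewrite cupE !rwhM -(compA _ (W <|| _) (asso _ _ _)) -asso_nat2.
  by rewrite !compA -(compA _ (assoV W (P \ox Pd) P)) assoK compm1.
have e2 : cap P \oc (dcoev Pd |> P) = lun P by rewrite capE -(dzig1 Pd).
rewrite e !compA -(compA (cap _)) capl -lwhM e2 triangleW -rwhM runVK.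
exact: rwh1.
Qed.

Lemma cap_cup_dual W : (cap W |> Pd) \oc cup (W \ox Pd) = idm (W \ox Pd).
Proof.
have := good_left good_cup W Pd; rewrite /= compm1 => ->.
rewrite capE cupE !rwhM !lwhM !compA.
rewrite -(compA _ (asso W Pd P |> Pd)) -(rwhM (asso _ _ _)) assoVK rwh1 compm1.
rewrite -(compA _ ((W <|| dev Pd) |> Pd)) -assoV_nat2 !compA triangleV -!lwhM.
by rewrite (dzig2 Pd) runVK lwh1.
Qed.

End Monoidal.

Lemma cap_over P (Pd : dual_data P) W X :
  (cap Pd W |> X) \oc xing X P (W \ox Pd) \oc (xing X Pd W |> P) = cap Pd (W \ox X).
Proof.
have /= := good_pass (good_cap Pd) W X.
by rewrite comp1m => ->; rewrite !xingE compA.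
Qed.

Lemma cup_over P (Pd : dual_data P) W X :
  xing X Pd (W \ox P) \oc (xing X P W |> Pd) \oc cup Pd (W \ox X) = cup Pd W |> X.
Proof. by have /= := good_pass (good_cup Pd) W X; rewrite compm1 !xingE. Qed.

End Duality.

Section BraidedDuality.
Variables (k : fieldType) (B : bmoncat k).
Implicit Types V W X Y Z A : B.

Lemma cap_under P (Pd : dual_data P) W X :
  (cap Pd W |> X) \oc xingV P X (W \ox Pd) \oc (xingV Pd X W |> P) = cap Pd (W \ox X).
Proof. by have := @cap_over k (brev B) P Pd W X; rewrite !xingE !xingVE. Qed.

Lemma cup_under P (Pd : dual_data P) W X :
  xingV Pd X (W \ox P) \oc (xingV P X W |> Pd) \oc cup Pd (W \ox X) = cup Pd W |> X.
Proof. by have := @cup_over k (brev B) P Pd W X; rewrite !xingE !xingVE. Qed.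

Section RightDual.
Variables (P : B) (Pd : dual_data P).

(** Cap and cup of the opposite orientation, made from [cap] and [cup]. One uses a braiding and the
    other an inverse braiding, which is what makes them satisfy a zig-zag identity ([rcap_rcup]). *)
Definition rcap W : Hom ((W \ox P) \ox Pd) W :=
  locked_with str_key (cap Pd W \oc xing P Pd W).
Definition rcup W : Hom W ((W \ox Pd) \ox P) :=
  locked_with str_key (xingV Pd P W \oc cup Pd W).
Lemma rcapE W : rcap W = cap Pd W \oc xing P Pd W.
Proof. by rewrite /rcap locked_withE. Qed.
Lemma rcupE W : rcup W = xingV Pd P W \oc cup Pd W.
Proof. by rewrite /rcup locked_withE. Qed.

Lemma rcap_nat W W' (f : Hom W W') : rcap W' \oc (f |> P |> Pd) = f \oc rcap W.
Proof. by rewrite !rcapE -compA xing_nat compA cap_nat compA. Qed.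
Lemma rcup_nat W W' (f : Hom W W') : rcup W' \oc f = (f |> Pd |> P) \oc rcup W.
Proof. by rewrite !rcupE -compA cup_nat compA xingV_nat compA. Qed.

Lemma good_xing A A' : good (str_comp (str_R A) (str_R A'))
  (str_comp (str_R A') (str_R A)) (xing A A').
Proof. by eapply good_ext; last (by move=> W; apply: xingE); apply: good_vfam. Qed.

Lemma good_rcap : good (str_comp (str_R P) (str_R (Pd : B))) (str_id B) rcap.
Proof.
eapply good_ext; last (by move=> W; apply: rcapE).
exact: good_comp (good_cap Pd) (good_xing _ _).
Qed.

Lemma rcap_over W X :
  (rcap W |> X) \oc xing X Pd (W \ox P) \oc (xing X P W |> Pd) = rcap (W \ox X).
Proof.
have /= := good_pass good_rcap W X.
by rewrite comp1m => ->; rewrite !xingE compA.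
Qed.

Lemma rcap_rcup W : (rcap W |> P) \oc rcup (W \ox P) = idm (W \ox P).
Proof.
rewrite rcapE rcupE rwhM.
have := vfam_over (braid Pd P) W P; rewrite -!xingE !compA => yb.
have e : cap Pd W |> P = cap Pd (W \ox P) \oc (xing Pd P W |> P) \oc xing P P (W \ox Pd).
  rewrite -(cap_under Pd W P) -!compA (compA (xingV Pd P W |> P)).
  by rewrite xingKr comp1m xingK compm1.
rewrite e ?compA -!(compA (cap Pd (W \ox P))) -yb -!compA.
by rewrite (compK _ (xingVK _ _ _)) (compA (xing P Pd _)) cup_over cap_cup.
Qed.

(* The partial trace over [P]. *)
Definition ptr W W' (h : Hom (W \ox P) (W' \ox P)) : Hom W W' :=
  rcap W' \oc (h |> Pd) \oc cup Pd W.

Lemma ptr_nat W W' V V' (g : Hom W' V') (h : Hom (W \ox P) (W' \ox P)) (f : Hom V W) :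
  ptr ((g |> P) \oc h \oc (f |> P)) = g \oc ptr h \oc f.
Proof.
by rewrite /ptr !rwhM !compA rcap_nat -!compA -cup_nat.
Qed.

Lemma ptrZ W W' a (h : Hom (W \ox P) (W' \ox P)) : ptr (a *: h) = a *: ptr h.
Proof. by rewrite /ptr rwhZ compZr compZl. Qed.

Lemma ptr_sum W W' I (s : seq I) (Q : pred I) (h : I -> Hom (W \ox P) (W' \ox P)) :
  ptr (\sum_(i <- s | Q i) h i) = \sum_(i <- s | Q i) ptr (h i).
Proof. by rewrite /ptr rwh_sum comp_sumr comp_suml. Qed.

Lemma ptr_left V W W' (h : Hom (W \ox P) (W' \ox P)) :
  ptr (assoV V W' P \oc (V <|| h) \oc asso V W P) = V <|| ptr h.
Proof.
have cl := good_left (good_cup Pd) V W; rewrite /= compm1 in cl.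
have rl := good_left good_rcap V W'; rewrite /= comp1m in rl.
rewrite /ptr cl !rwhM !compA.
rewrite -(compA _ (asso V W P |> Pd)) -(rwhM (asso _ _ _)) assoVK rwh1 compm1.
rewrite -(compA _ ((V <|| h) |> Pd)) -assoV_nat2 !compA.
by rewrite -(compA (rcap _)) rl -!lwhM.
Qed.

End RightDual.

Section Pairing.
Variables (U Y Z : B) (Ud : dual_data U) (Yd : dual_data Y) (Zd : dual_data Z).
Variables (iota : Hom U (Y \ox Z)) (pi : Hom (Y \ox Z) U) (a : k).
Hypothesis pi_iota : pi \oc dbl Y Z \oc iota = a *: idm U.

Let E W : Hom ((((W \ox Y) \ox Z) \ox Zd) \ox Yd) W := rcap Yd W \oc (rcap Zd (W \ox Y) |> Yd).
Let caps W : Hom ((((W \ox Zd) \ox Yd) \ox Y) \ox Z) W :=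
  cap Zd W \oc (cap Yd (W \ox Zd) |> Z).

Lemma vfam_dbl (X X' : B) V : xing X' X V \oc xing X X' V = vfam (dbl X X') V.
Proof. by rewrite !xingE -vfamM dblE. Qed.

(** Right caps contain crossings and are not multiplicative. When Y and Z are moved across both
    duals, so that nested left caps can close them, the double braiding of Y and Z appears; it is
    the source of the double braiding in all later trace formulas. *)
Lemma nested_rcap W :
  E W = caps W \oc (xing Y Yd (W \ox Zd) |> Z) \oc (xing Y Zd W |> Yd |> Z)
    \oc xing Z Yd ((W \ox Y) \ox Zd) \oc (xing Z Zd (W \ox Y) |> Yd)
    \oc (vfam (dbl Y Z) W |> Zd |> Yd).
Proof.
pose V := W \ox Zd.
have e1 : (rcap Yd V |> Z) \oc xing Z Yd (V \ox Y) =
    rcap Yd (V \ox Z) \oc (xingV Z Y V |> Yd).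
  by rewrite -rcap_over -!compA xingVKr compm1.
have e2 : (cap Zd W |> Y) \oc xing Y Z V \oc (xing Y Zd W |> Z) = cap Zd (W \ox Y).
  exact: cap_over.
have vl := vfam_left (dbl Y Z) W Zd.
have -> : caps W \oc (xing Y Yd (W \ox Zd) |> Z) = cap Zd W \oc (rcap Yd V |> Z).
  by rewrite /caps rcapE rwhM !compA.
rewrite -(compA _ _ (xing Z Yd _)) -xing_nat compA -(compA (cap Zd W)) e1.
rewrite compA -rcap_nat /E -!compA; congr (_ \oc _).
rewrite -!rwhM; apply: (congr1 (fun f => rwh f Yd)).
rewrite [in RHS](compA (xing Y Zd W |> Z)) -vl !compA.
have -> : (cap Zd W |> Y) \oc xingV Z Y V \oc vfam (dbl Y Z) V = (cap Zd W |> Y) \oc xing Y Z V.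
  by rewrite -vfam_dbl -!compA (compK _ (xingK _ _ _)).
by rewrite rcapE -e2 -!compA.
Qed.

Let A W : Hom W (((W \ox U) \ox Zd) \ox Yd) :=
  (vin pi W |> Zd |> Yd) \oc (cup Zd (W \ox Y) |> Yd) \oc cup Yd W.

Let good_A : good (str_id B) (str_comp (str_comp (str_R U) (str_R (Zd : B))) (str_R (Yd : B))) A.
Proof.
have g2 := good_whisk (str_R (Yd : B)) (good_shift (str_R Y) (good_cup Zd)).
have g3 := good_whisk (str_R (Yd : B)) (good_whisk (str_R (Zd : B)) (good_vin pi)).
apply: good_comp (good_cup Yd); apply: good_comp g3 _.
apply: good_conv g2; apply: str_eq_comp => //; first exact: str_comp_id.
exact: str_compA.
Qed.

(** The transpose of [pi], from the dual of U to the duals of Z and Y. *)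
Let t W : Hom (W \ox Ud) ((W \ox Zd) \ox Yd) :=
  (cap Ud W |> Zd |> Yd) \oc A (W \ox Ud).

Let good_t : good (str_R (Ud : B)) (str_comp (str_R (Zd : B)) (str_R (Yd : B))) t.
Proof.
have g1 := good_shift (str_R (Ud : B)) good_A.
have g2 := good_whisk (str_R (Yd : B)) (good_whisk (str_R (Zd : B)) (good_cap Ud)).
apply: good_comp.
  apply: good_conv g2; first exact: str_eq_refl.
  by apply: str_eq_comp => //; apply: str_id_comp.
apply: good_conv g1; first exact: str_comp_id.
have e1 := str_compA (str_R (Ud : B)) (str_comp (str_R U) (str_R (Zd : B))) (str_R (Yd : B)).
have e2 := str_eq_comp (str_compA (str_R (Ud : B)) (str_R U) (str_R (Zd : B)))
  (str_eq_refl (str_R (Yd : B))).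
exact: (str_eq_trans e1 e2).
Qed.

(** The vertex [pi] is carried around the closure as its transpose until it meets [iota]. By
    [nested_rcap] they meet with a double braiding between them, and [pi_iota] evaluates the
    result. *)
Lemma ptr_vertices W W' (h : Hom (W \ox U) (W' \ox U)) :
  ptr Yd (ptr Zd (vout iota W' \oc h \oc vin pi W)) = a *: ptr Ud h.
Proof.
have tcup V : t (V \ox U) \oc cup Ud V = A V.
  have /= An := good_nat good_A (cup Ud V).
  by rewrite /t -compA An compA -!rwhM cap_cup !rwh1 comp1m.
have hA : (h |> Zd |> Yd) \oc A W = t (W' \ox U) \oc (h |> Ud) \oc cup Ud W.
  have /= -> := good_nat good_t h.
  by rewrite -tcup compA.
have {}hA : ptr Yd (ptr Zd (vout iota W' \oc h \oc vin pi W)) =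
    E W' \oc (vout iota W' |> Zd |> Yd) \oc (t (W' \ox U) \oc (h |> Ud) \oc cup Ud W).
  by rewrite -hA /ptr /E /A !rwhM !compA.
pose M V := xing U Yd (V \ox Zd) \oc (xing U Zd V |> Yd).
pose G V := caps V \oc vout (dbl Y Z \oc iota) ((V \ox Zd) \ox Yd).
(* The vertex is moved to the far side of the two dual strands, which exchanges the right caps for
   left caps. *)
have EG V : E V \oc (vout iota V |> Zd |> Yd) = G V \oc M V.
  set j := dbl Y Z \oc iota.
  have e0 : (vfam (dbl Y Z) V |> Zd |> Yd) \oc (vout iota V |> Zd |> Yd) =
      vout j V |> Zd |> Yd by rewrite -!rwhM vout_vfam.
  have e1 : vout j ((V \ox Zd) \ox Yd) \oc M V =
      (xing Y Yd (V \ox Zd) |> Z) \oc (xing Y Zd V |> Yd |> Z)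
      \oc xing Z Yd ((V \ox Y) \ox Zd) \oc (xing Z Zd (V \ox Y) |> Yd)
      \oc (vout j V |> Zd |> Yd).
    rewrite /M compA vout_left -(compA _ (vout j _ |> _)) -rwhM vout_left !rwhM.
    by rewrite !compA -(compA _ (xing Z Yd _)) xing_nat !compA.
  by rewrite nested_rcap -compA e0 /G -[RHS]compA e1 !compA.
have tM V : M V \oc t (V \ox U) = (t V |> U) \oc xing U Ud V.
  by have /= := good_pass good_t V U; rewrite -!xingE.
have Gt V : G V \oc (t V |> U) = a *: cap Ud V.
  have Gn V1 V2 (f : Hom V1 V2) : G V2 \oc (f |> Zd |> Yd |> U) = f \oc G V1.
    have vn := good_nat (good_vout (dbl Y Z \oc iota)) (f |> Zd |> Yd).
    rewrite /= in vn; rewrite /G -[LHS]compA vn /caps [LHS]compA -(compA (cap Zd V2)).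
    by rewrite -rwhM cap_nat rwhM [X in X \oc _]compA cap_nat -!compA.
  rewrite /t rwhM [LHS]compA Gn -[LHS]compA; set V0 := V \ox Ud.
  suff -> : G (V0 \ox U) \oc (A V0 |> U) = a *: idm _ by rewrite compZr compm1.
  have e1 : G ((V0 \ox Y) \ox Z) \oc ((cup Zd (V0 \ox Y) |> Yd |> U) \oc (cup Yd V0 |> U)) =
     vout (dbl Y Z \oc iota) V0.
    set j := dbl Y Z \oc iota.
    have v1 := good_nat (good_vout j) (cup Zd (V0 \ox Y) |> Yd).
    have v2 := good_nat (good_vout j) (cup Yd V0).
    rewrite /= in v1 v2; rewrite /G -[LHS]compA (compA (vout j _)) v1 -(compA _ (vout j _)) v2.
    rewrite /caps -/j -[LHS]compA [X in _ \oc X]compA -rwhM cap_nat rwhM !compA cap_cup comp1m.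
    by rewrite -rwhM cap_cup rwh1 comp1m.
  rewrite /A !rwhM -!(compA (vin pi V0 |> Zd |> Yd |> U)) compA Gn -compA e1.
  by rewrite vin_vout (compA pi (dbl Y Z)) pi_iota lwhZ lwh1.
rewrite hA EG -(compA (t _)) [LHS]compA -(compA (G W')) tM (compA (G W')) Gt.
by rewrite !compZl /ptr rcapE !compA.
Qed.

End Pairing.

End BraidedDuality.

(** * Traces and loops in a fusion category *)

Section Cyclicity.
Variables (k : fieldType) (B : bmoncat k) (U Z : B) (Ud : dual_data U) (Zd : dual_data Z).
Variable g : Hom U Z.

Let A W : Hom W ((W \ox Z) \ox Ud) := ((W <|| g) |> Ud) \oc cup Ud W.
Let t W : Hom (W \ox Zd) (W \ox Ud) := (cap Zd W |> Ud) \oc A (W \ox Zd).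

Let good_A : good (str_id B) (str_comp (str_R Z) (str_R (Ud : B))) A.
Proof. exact: good_comp (good_whisk (str_R (Ud : B)) (good_lwh g)) (good_cup Ud). Qed.

Let good_t : good (str_R (Zd : B)) (str_R (Ud : B)) t.
Proof.
have g1 := good_shift (str_R (Zd : B)) good_A.
have g2 := good_whisk (str_R (Ud : B)) (good_cap Zd).
apply: good_comp.
  by apply: good_conv g2; [apply: str_eq_refl | apply: str_id_comp].
by apply: good_conv g1; [apply: str_comp_id | apply: str_compA].
Qed.

(** [g] travels along the closed strand as its transpose [t] and returns on the other side. The
    chosen duals of U and of Z are unrelated. *)
Lemma ptr_cyc W W' (h : Hom (W \ox Z) (W' \ox U)) :
  ptr Zd ((W' <|| g) \oc h) = ptr Ud (h \oc (W <|| g)).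
Proof.
have e1 V : t (V \ox Z) \oc cup Zd V = A V.
  have /= An := good_nat good_A (cup Zd V).
  by rewrite /t -[LHS]compA An [LHS]compA -!rwhM cap_cup !rwh1 comp1m.
have e2 V : cap Ud V \oc (t V |> U) = cap Zd V \oc ((V \ox Zd) <|| g).
  rewrite /t rwhM [LHS]compA cap_nat -[LHS]compA; congr (_ \oc _).
  rewrite /A rwhM [LHS]compA cap_nat -[LHS]compA cap_cup compm1 //.
have e3 V : rcap Zd V \oc ((V <|| g) |> Zd) = rcap Ud V \oc t (V \ox U).
  have /= := good_pass good_t V U; rewrite -!xingE => tp.
  rewrite !rcapE -[RHS]compA tp [RHS]compA e2 -!compA; congr (_ \oc _).
  rewrite !xingE !vfamE !compA -(compA _ _ ((V <|| g) |> Zd)) asso_nat2 compA.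
  rewrite -(compA _ (V <|| braid Z Zd)) -lwhM braid_natl lwhM !compA.
  by rewrite assoV_nat3.
have e4 : (h |> Ud) \oc t (W \ox Z) = t (W' \ox U) \oc (h |> Zd).
  by have /= -> := good_nat good_t h.
rewrite /ptr !rwhM [X in X \oc cup Zd W]compA e3 -(compA (rcap Ud W')) -e4.
by rewrite -[LHS]compA -(compA (h |> Ud)) e1 /A !compA.
Qed.

End Cyclicity.

Section Rotation.
Variables (k : fieldType) (B : bmoncat k) (P : B) (Pd : dual_data P).

Definition sharp X W (g : Hom (X \ox P) W) : Hom X (W \ox Pd) := (g |> Pd) \oc cup Pd X.
Definition flat X W (f : Hom W (X \ox P)) : Hom (W \ox Pd) X := rcap Pd X \oc (f |> Pd).

Lemma sharpK X W (g : Hom (X \ox P) W) : cap Pd W \oc (sharp g |> P) = g.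
Proof. by rewrite /sharp rwhM compA cap_nat -compA cap_cup compm1. Qed.

Lemma unsharpK X W (f : Hom X (W \ox Pd)) : sharp (cap Pd W \oc (f |> P)) = f.
Proof.
by rewrite /sharp rwhM -compA -cup_nat compA cap_cup_dual comp1m.
Qed.

Lemma flatK X W (f : Hom W (X \ox P)) : (flat f |> P) \oc rcup Pd W = f.
Proof. by rewrite /flat rwhM -compA -rcup_nat compA rcap_rcup comp1m. Qed.

Lemma flat_sharp X W (f : Hom W (X \ox P)) (g : Hom (X \ox P) W) :
  flat f \oc sharp g = ptr Pd (f \oc g).
Proof. by rewrite /flat /sharp /ptr rwhM !compA. Qed.

End Rotation.

(** * Loop values and encircling loops *)

Section FusionNumbers.
Variables (k : closedFieldType) (B : bmoncat k) (hB : fusion B).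
Implicit Types V W X Y Z A : B.

Definition rk := projT1 (fss_enum (fusion_fss hB)).
Definition so : 'I_rk -> B := projT2 (fss_enum (fusion_fss hB)).
Notation hS := (fusion_fss hB).
Notation un := (unit_ob B).

Lemma so_simple i : simple (so i). Proof. exact: S_simple. Qed.
Hint Resolve so_simple : core.
Lemma unit_simple : simple un. Proof. exact: fusion_unit hB. Qed.
Hint Resolve unit_simple : core.

Definition du X : dual_data X := inhabited_witness (dual_data_exist hB X).

Lemma iso_prop X Y (f : Hom X Y) (g : Hom X Y) : is_iso f -> simple X ->
  exists c : k, g = c *: f.
Proof.
case=> f' [f'f ff'] sX; have [c e] := simple_end hS (f' \oc g) sX.
by exists c; rewrite -[g]comp1m -ff' -compA e compZr compm1.
Qed.

(** The two values of a circle, closed by a braiding ([tau]) and by an inverse braiding ([taum]). In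
    terms of the dimension and the twist found later they are d / th and d th ([tauE], [taumE]). *)
Definition tau X : k := sc (ptr (du X) (idm (un \ox X))).
Definition taum X : k := sc (cap (du X) un \oc rcup (du X) un).

Lemma ptr_id X W : ptr (du X) (idm (W \ox X)) = tau X *: idm W.
Proof.
have g1 : good (str_id B) (str_id B) (fun W => ptr (du X) (idm (W \ox X))).
  eapply good_ext; first exact: good_comp (good_rcap (du X)) (good_cup (du X)).
  by move=> V; rewrite /ptr rwh1 compm1.
apply: (good_scalar (good_id (str_id B)) g1).
by rewrite /tau -(scE hS _ unit_simple).
Qed.

Lemma good_rcup X : good (str_id B) (str_comp (str_R (du X : B)) (str_R X)) (rcup (du X)).
Proof.
eapply good_ext; last (by move=> W; apply: rcupE).
apply: good_comp (good_cup (du X)).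
by eapply good_ext; last (by move=> W; apply: xingVE); apply: good_vfam.
Qed.

Lemma cap_rcup X W : cap (du X) W \oc rcup (du X) W = taum X *: idm W.
Proof.
have g1 : good (str_id B) (str_id B) (fun W => cap (du X) W \oc rcup (du X) W).
  exact: good_comp (good_cap (du X)) (good_rcup X).
by apply: (good_scalar (good_id (str_id B)) g1); rewrite /taum -(scE hS _ unit_simple).
Qed.

Lemma ptr_tens_scalar X Y (h : Hom (X \ox Y) (X \ox Y)) : simple X ->
  ptr (du X) (ptr (du Y) (vfam h un)) = (sc (ptr (du Y) h) * tau X) *: idm un.
Proof.
move=> sX; rewrite vfamE ptr_left {1}(scE hS (ptr _ h) sX) lwhZ ptrZ lwh1 ptr_id.
by rewrite scalerA.
Qed.

(** Two evaluations of one closed diagram: the strand P is traced out before X, or the two vertices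
    are contracted by [ptr_vertices]. *)
Lemma pairing X P W (iota : Hom W (X \ox P)) (pi : Hom (X \ox P) W) :
  simple X -> simple W ->
  tau X * sc (ptr (du P) (iota \oc pi)) = tau W * sc (pi \oc dbl X P \oc iota).
Proof.
move=> sX sW; have e := scE hS (pi \oc dbl X P \oc iota) sW.
have := ptr_vertices (du W) (du X) (du P) e (idm (un \ox W)).
rewrite compm1 vout_vin ptr_tens_scalar // ptr_id scalerA.
move/(congr1 (@sc _ _ _)); rewrite !(scP hS) // => e1; by rewrite mulrC e1 mulrC.
Qed.

(* The encircling of [W] by a natural family of double crossings. *)
Lemma ptr_natural Z W W' (h : forall Y, Hom (W \ox Y) (W' \ox Y)) :
  (forall Y Y' (g : Hom Y Y'), h Y' \oc (W <|| g) = (W' <|| g) \oc h Y) ->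
  ptr (du Z) (h Z) = \sum_u (mult Z u)%:R *: ptr (du (so u)) (h (so u)).
Proof.
move=> hn; have {1}-> : h Z = \sum_u \sum_(m < mult Z u)
    (W' <|| inc m) \oc (h (so u) \oc (W <|| prj m)).
  rewrite -{1}[h Z]compm1 -lwh1 -(sum_inc_prj hS) lwh_sum comp_sumr.
  apply: eq_bigr => u _; rewrite lwh_sum comp_sumr; apply: eq_bigr => m _.
  by rewrite lwhM compA hn -compA.
rewrite ptr_sum; apply: eq_bigr => u _; rewrite ptr_sum.
rewrite (eq_bigr (fun=> ptr (du (so u)) (h (so u)))) => [|m _].
  by rewrite sumr_const card_ord scaler_nat.
rewrite (ptr_cyc (du (so u))) -compA -lwhM prj_inc eqxx scale1r lwh1.
by rewrite compm1.
Qed.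

(* The scalar by which a loop [Z] around [W] acts. *)
Definition ev_loop W Z : k := sc (ptr (du Z) (dbl W Z)).

Lemma ev_loopE W Z : simple W -> ptr (du Z) (dbl W Z) = ev_loop W Z *: idm W.
Proof. by move=> sW; rewrite /ev_loop -(scE hS _ sW). Qed.

Lemma ev_loop_sum W Z : simple W ->
  ev_loop W Z = \sum_u (mult Z u)%:R * ev_loop W (so u).
Proof.
move=> sW; rewrite {1}/ev_loop (@ptr_natural Z W W (dbl W)); last exact: dbl_natr.
rewrite (sc_sum hS) //; apply: eq_bigr => u _; by rewrite (scZ hS).
Qed.

Lemma dbl_tens W Y Z : assoV W Y Z \oc dbl W (Y \ox Z) \oc asso W Y Z =
  (braid Y W |> Z) \oc vfam (dbl W Z) Y \oc (braid W Y |> Z).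
Proof.
have h1 := hexagon W Y Z; have h2 := hexagonV Y Z W.
have {}h1 : braid W (Y \ox Z) \oc asso W Y Z = assoV Y Z W \oc
    (Y <|| braid W Z) \oc asso Y W Z \oc (braid W Y |> Z).
  by rewrite -[RHS]compA -[RHS]compA (compA (idm Y \om _)) -h1 !compA assoK comp1m.
have {}h2 : assoV W Y Z \oc braid (Y \ox Z) W = (braid Y W |> Z) \oc assoV Y W Z \oc
    (Y <|| braid Z W) \oc asso Y Z W.
  by rewrite -h2 -!compA assoK !compm1.
rewrite !dblE -!compA h1 !compA h2 vfamE lwhM.
by rewrite -!compA (compA (asso Y Z W)) assoVK comp1m.
Qed.

(** By the hexagons two nested loops around W are a loop coloured by Y (x) Z. Its simple
    constituents are closed up by [ptr_vertices], whence the double braiding in the coefficient. *)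
Lemma ev_loopM W Y Z : simple W ->
  ev_loop W Y * ev_loop W Z = \sum_u tr u (dbl Y Z) * ev_loop W (so u).
Proof.
move=> sW.
have e1 : ptr (du Y) (ptr (du Z) (assoV W Y Z \oc dbl W (Y \ox Z) \oc asso W Y Z)) =
    (ev_loop W Y * ev_loop W Z) *: idm W.
  rewrite dbl_tens ptr_nat vfamE ptr_left ev_loopE // lwhZ lwh1 compZr compZl.
  by rewrite compm1 ptrZ -dblE ev_loopE // scalerA mulrC.
have {}e1 : (ev_loop W Y * ev_loop W Z) *: idm W =
  \sum_u \sum_(m < mult (Y \ox Z) u) ptr (du Y) (ptr (du Z)
     (vout (inc m) W \oc dbl W (so u) \oc vin (prj m) W)).
  rewrite -e1 -{1}[dbl W _]compm1 -lwh1 -(sum_inc_prj hS) lwh_sum comp_sumr.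
  rewrite comp_sumr comp_suml !ptr_sum; apply: eq_bigr => u _.
  rewrite lwh_sum !comp_sumr comp_suml !ptr_sum; apply: eq_bigr => m _.
  congr (ptr _ (ptr _ _)); rewrite voutE vinE lwhM !compA; congr (_ \oc _ \oc _).
  by rewrite -!compA dbl_natr.
rewrite -[LHS](scP hS _ sW) e1 (sc_sum hS) //; apply: eq_bigr => u _.
rewrite (sc_sum hS) // /tr mulr_suml; apply: eq_bigr => m _.
have e := scE hS (prj m \oc dbl Y Z \oc inc m) (so_simple u).
by rewrite (ptr_vertices (du (so u)) (du Y) (du Z) e) (scZ hS).
Qed.

End FusionNumbers.

Section Units.
Variables (k : fieldType) (B : bmoncat k).

Lemma dbl_unit_l (X : B) : dbl (unit_ob B) X = idm _.
Proof.
apply: (iso_cancel_l (lun_iso X)); rewrite dblE compA lun_braid compm1.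
have := @lun_braid k (brev B) X; rewrite /= => <-.
by rewrite -compA braidK compm1.
Qed.

Lemma dbl_braid (X Y : B) : dbl Y X \oc braid X Y = braid X Y \oc dbl X Y.
Proof. by rewrite !dblE !compA. Qed.

Definition dblV (X Y : B) : Hom (X \ox Y) (X \ox Y) := @dbl k (brev B) X Y.

Lemma dblVE (X Y : B) : dblV X Y = braidV X Y \oc braidV Y X.
Proof. exact: (@dblE k (brev B)). Qed.

Lemma dblK (X Y : B) : dblV X Y \oc dbl X Y = idm _.
Proof. by rewrite dblVE dblE -!compA (compA (braidV Y X)) braidK comp1m braidK. Qed.
Lemma dblVK (X Y : B) : dbl X Y \oc dblV X Y = idm _.
Proof. by rewrite dblVE dblE -!compA (compA (braid X Y)) braidVK comp1m braidVK. Qed.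

Lemma dblV_natr (X Y Y' : B) (g : Hom Y Y') :
  dblV X Y' \oc (X <|| g) = (X <|| g) \oc dblV X Y.
Proof. exact: (@dbl_natr k (brev B)). Qed.
End Units.

(** * Duals of simple objects and nonvanishing of loop values *)

Section Rigid.
Variables (k : closedFieldType) (k0 : [pchar k] =i pred0).
Variables (B : bmoncat k) (hB : fusion B).
Implicit Types V W X Y Z A P : B.
Notation hS := (fusion_fss hB).
Notation un := (unit_ob B).
Notation so := (@so k B hB).
Notation du := (du hB).
Notation tau := (tau hB).
Notation taum := (taum hB).
Let sun : simple un := unit_simple hB.
Hint Resolve so_simple sun : core.

Lemma natr0_inj (a b : nat) : (a%:R : k) = b%:R -> a = b.
Proof.
wlog ab : a b / (a <= b)%N => [w|].
  by case: (leqP a b) => [/w//|/ltnW/w h] /esym/h.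
move=> e; have := natrB k ab; rewrite e subrr => /eqP.
by rewrite (pcharf0P k).1 // subn_eq0 => ba; apply/eqP; rewrite eqn_leq ab.
Qed.

Lemma natr0_neq0 n : ((n.+1)%:R : k) != 0.
Proof. by rewrite (pcharf0P k).1. Qed.

Lemma mult_isom X Y i : isom X Y -> @mult k B hS X i = mult Y i.
Proof.
case=> f [g [gf fg]]; apply: natr0_inj.
by rewrite -(tr1 X i) -(tr1 Y i) -gf -fg tr_cyc.
Qed.

Lemma tr_rwh X Y i (h : Hom X X) :
  @tr k B hS _ i (h |> Y) = \sum_u tr u h * (mult (so u \ox Y) i)%:R.
Proof.
rewrite -{1}[h]compm1 -(sum_inc_prj hS) comp_sumr rwh_sum tr_sum.
apply: eq_bigr => u _; rewrite comp_sumr rwh_sum tr_sum [X in X * _]/tr mulr_suml.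
apply: eq_bigr => m _; rewrite compA rwhM tr_cyc -rwhM compA.
rewrite {1}(scE hS (prj m \oc h \oc inc m) (so_simple u)) rwhZ trZ rwh1.
by rewrite tr1.
Qed.

Lemma mult_tens X Y i : @mult k B hS (X \ox Y) i =
  (\sum_u mult X u * mult (so u \ox Y) i)%N.
Proof.
apply: natr0_inj; rewrite -tr1 -rwh1 tr_rwh natr_sum.
by apply: eq_bigr => u _; rewrite tr1 natrM.
Qed.

Lemma isom_rwh X X' Y : isom X X' -> isom (X \ox Y) (X' \ox Y).
Proof. by case=> f fi; exists (f |> Y); apply: rwh_iso. Qed.
Lemma isom_lwh X Y Y' : isom Y Y' -> isom (X \ox Y) (X \ox Y').
Proof. by case=> f fi; exists (X <|| f); apply: lwh_iso. Qed.
Lemma isom_braid X Y : isom (X \ox Y) (Y \ox X).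
Proof. by exists (braid X Y); apply: braid_iso. Qed.
Lemma isom_asso X Y Z : isom ((X \ox Y) \ox Z) (X \ox (Y \ox Z)).
Proof. by exists (asso X Y Z); apply: asso_iso. Qed.

Lemma un_tens_simple P : simple P -> simple (un \ox P).
Proof. by apply: isom_simple; exists (lunV P); apply: isoV_iso (lun_iso P). Qed.

Definition i0 : 'I_(rk hB) := sval (cid (S_index hS (unit_simple hB))).
Lemma un_i0 : isom un (so i0). Proof. exact: svalP (cid (S_index _ _)). Qed.

Section SimpleDual.
Variables (P : B) (sP : simple P) (Pd : dual_data P).

(** Bending the dual strand identifies this space with the endomorphisms of a simple object. *)
Lemma cup_span (f : Hom un ((un \ox P) \ox Pd)) : exists c : k, f = c *: cup Pd un.
Proof.
have [c e] := simple_end hS (cap Pd _ \oc (f |> P)) (un_tens_simple sP).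
by exists c; rewrite -[f](unsharpK (Pd := Pd)) e /sharp rwhZ rwh1 compZl comp1m.
Qed.

Lemma cap_neq0 : idm P <> 0 -> idm (Pd : B) <> 0.
Proof.
move=> nz z; apply: nz; apply: lwh_unit_inj; rewrite lwh0 lwh1.
rewrite -(cap_cup Pd un) -[cup Pd un]comp1m -[idm _]lwh1 z lwh0 comp0m rwh0 compm0 //.
Qed.

Lemma dual_end (g : Hom (Pd : B) (Pd : B)) : exists c : k, g = c *: idm (Pd : B).
Proof.
have [c e] := cup_span (((un \ox P) <|| g) \oc cup Pd un).
exists c; apply: lwh_unit_inj.
have gf : good (str_id B) (str_comp (str_R P) (str_R (Pd : B)))
    (fun W => ((W \ox P) <|| g) \oc cup Pd W).
  apply: good_comp (good_cup Pd).
  exact: good_conv (str_eq_refl _) (str_eq_refl _) (good_shift (str_R P) (good_lwh g)).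
have {}e := good_scalar (good_cup Pd) gf e (un \ox Pd).
rewrite -[LHS]compm1 -(cap_cup_dual Pd un) compA -whC -compA e compZr.
by rewrite cap_cup_dual lwhZ lwh1.
Qed.

(** By [dual_end] the idempotent belonging to a simple summand is a scalar; it is nonzero, so it is
    the identity and the summand is everything. *)
Lemma dual_simple : simple (Pd : B).
Proof.
have nz : idm (Pd : B) <> 0.
  by apply: cap_neq0 => /eqP; rewrite (negPf (simple_id_neq0 sP)).
have [u [m _]] : exists u, exists m : 'I_(@mult k B hS Pd u), true.
  apply: contrapT => no; apply: nz; rewrite -(sum_inc_prj hS) big1 // => u _.
  by rewrite big1 // => m _; case: no; exists u, m.
have [c e] := dual_end (inc m \oc prj m).
have pi1 : prj m \oc inc m = idm (so u) by rewrite prj_inc eqxx scale1r.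
have c1 : c = 1.
  have := congr1 (fun f => prj m \oc f \oc inc m) e.
  rewrite compZr compZl compm1 !compA pi1 comp1m pi1 => /esym/(congr1 (@sc _ _ _)).
  by rewrite (scP hS) ?(sc1 hS (so_simple u)) //; apply: so_simple.
apply: isom_simple (so_simple u); exists (inc m), (prj m); split; first exact: pi1.
by rewrite e c1 scale1r.
Qed.

(** A nonzero f is nonzero on some simple subobject, which is then a copy of the unit; but the
    morphisms from the unit are multiples of [cup]. *)
Lemma cup_detect (f : Hom ((un \ox P) \ox Pd) un) : f \oc cup Pd un = 0 -> f = 0.
Proof.
move=> fc; apply: (hom_ext (hC := hS)) => i x; rewrite comp0m.
have [->|/eqP nz] := eqVneq (f \oc x) 0; first by [].
have [g [gf fg]] := schur hS (so_simple i) (unit_simple hB) nz.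
have [c e] := cup_span (x \oc g).
by rewrite -[f \oc x]compm1 -gf compA -(compA f) e compZr fc scaler0 comp0m.
Qed.

Lemma rcap_neq0 : rcap Pd un <> 0.
Proof.
move=> z; have := rcap_rcup Pd un; rewrite z rwh0 comp0m => /esym/eqP.
by rewrite (negPf (simple_id_neq0 (un_tens_simple sP))).
Qed.
End SimpleDual.

Lemma tau_neq0 P : simple P -> tau P != 0.
Proof.
move=> sP; apply/eqP => t0; case: (rcap_neq0 sP (Pd := du P)).
apply: (cup_detect sP); have := ptr_id hB P un.
by rewrite t0 scale0r /ptr rwh1 compm1.
Qed.

Lemma ptr_tens X Y (h : Hom (X \ox Y) (X \ox Y)) : simple X ->
  sc (ptr (du Y) h) * tau X = \sum_u tr u (h \oc dbl X Y) * tau (so u).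
Proof.
move=> sX; have := ptr_tens_scalar hB h sX.
move/(congr1 (@sc _ _ _)); rewrite (scP hS) // => <-.
have {1}-> : vfam h un = \sum_u \sum_(m < @mult k B hS (X \ox Y) u)
    vout (inc m) un \oc idm _ \oc vin (prj m \oc h) un.
  rewrite vfamE -{1}[h]comp1m -(sum_inc_prj hS) comp_suml lwh_sum comp_sumr comp_suml.
  apply: eq_bigr => u _; rewrite comp_suml lwh_sum comp_sumr comp_suml.
  by apply: eq_bigr => m _; rewrite compm1 vout_vin vfamE compA.
rewrite !ptr_sum (sc_sum hS) //; apply: eq_bigr => u _.
rewrite !ptr_sum (sc_sum hS) // /tr mulr_suml; apply: eq_bigr => m _.
have e := scE hS (prj m \oc h \oc dbl X Y \oc inc m) (so_simple u).
rewrite (ptr_vertices (du (so u)) (du X) (du Y) e) ptr_id scalerA (scP hS) //.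
by rewrite !compA.
Qed.

Lemma tauM Y Z : simple Y ->
  tau Y * tau Z = \sum_u tr u (dbl Y Z) * tau (so u).
Proof.
move=> sY; have := ptr_tens (idm (Y \ox Z)) sY.
rewrite ptr_id (scP hS) // mulrC => ->.
by apply: eq_bigr => u _; rewrite comp1m.
Qed.

Lemma ev_loop_unit Z : ev_loop hB un Z = tau Z.
Proof. by rewrite /ev_loop dbl_unit_l. Qed.

End Rigid.

(** * The mirror category and the square of the double braiding *)

Section Rotations.
Variables (k : closedFieldType) (k0 : [pchar k] =i pred0).
Variables (B : bmoncat k) (hB : fusion B).
Implicit Types V W X Y Z A P : B.
Notation hS := (fusion_fss hB).
Notation un := (unit_ob B).
Notation so := (@so k B hB).
Notation du := (du hB).
Notation tau_rev := (@tau k (brev B) hB).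
Notation tau := (tau hB).
Notation taum := (taum hB).
Notation mult := (@mult k B hS).
Notation omega P := (taum P / tau P).
Let sun : simple un := unit_simple hB.
Hint Resolve so_simple sun : core.

Lemma good_rcapV P (Pd : dual_data P) :
  good (str_comp (str_R P) (str_R (Pd : B))) (str_id B) (@rcap k (brev B) P Pd).
Proof.
have g : good (str_comp (str_R P) (str_R (Pd : B))) (str_comp (str_R (Pd : B)) (str_R P))
    (xingV (Pd : B) P).
  by eapply good_ext; last (by move=> W; apply: xingVE); apply: good_vfam.
eapply good_ext; first exact: good_comp (good_cap Pd) g.
by move=> W; rewrite (@rcapE k (brev B)) xingE xingVE.
Qed.

Lemma rcapV_cup P W : @rcap k (brev B) P (du P) W \oc cup (du P) W = taum P *: idm W.
Proof.
rewrite -cap_rcup rcupE (@rcapE k (brev B)) -compA; congr (_ \oc (_ \oc _)).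
by rewrite (@xingE k (brev B)) xingVE.
Qed.

(** By [cup_detect] a cap is determined by its value on [cup]; the two right caps take the values
    [taum P] and [tau P] there. *)
Lemma rcapVE P W : simple P ->
  @rcap k (brev B) P (du P) W = omega P *: rcap (du P) W.
Proof.
move=> sP; apply: (good_scalar (good_rcap (du P)) (good_rcapV (du P))).
apply/eqP; rewrite -subr_eq0; apply/eqP; apply: (cup_detect hB sP).
rewrite compBl rcapV_cup compZl; have := ptr_id hB P un.
rewrite /ptr rwh1 compm1 => ->.
by rewrite scalerA divfK ?subrr // tau_neq0.
Qed.

Lemma ptrVE P W W' (h : Hom (W \ox P) (W' \ox P)) : simple P ->
  @ptr k (brev B) P (du P) W W' h = omega P *: ptr (du P) h.
Proof. by move=> sP; rewrite /ptr rcapVE // !compZl. Qed.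

Lemma tauV P : simple P -> tau_rev P = taum P.
Proof.
move=> sP; rewrite /tau_rev ptrVE // ptr_id scalerA divfK ?tau_neq0 //.
exact: (scP hS).
Qed.

Lemma taum_neq0 P : simple P -> taum P != 0.
Proof. by move=> sP; rewrite -tauV //; apply: (@tau_neq0 k (brev B) hB). Qed.

(** [pairing] is read in [B] and in [brev B], where the circle values are exchanged and the partial
    traces differ by omega P. Consequently the square of the double braiding is a scalar on each
    multiplicity space. *)
Lemma dblV_scalar X P w (iota : Hom (so w) (X \ox P)) : simple X -> simple P ->
  dblV X P \oc iota =
  (omega X * omega P / omega (so w)) *: (dbl X P \oc iota).
Proof.
move=> sX sP; have sw := so_simple w.
rewrite [LHS](@inc_expand k B hS) [X in _ *: X](@inc_expand k B hS) scaler_sumr.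
apply: eq_bigr => m _; rewrite scalerA; congr (_ *: _).
have e1 := pairing hB iota (prj m) sX sw.
have := @pairing k (brev B) hB X P (so w) iota (prj m) sX sw.
rewrite !tauV // ptrVE // (scZ hS) // mulrCA -(compA (prj m)) => e2.
rewrite -(compA (prj m)) in e1.
have tw : tau (so w) != 0 by apply: tau_neq0.
have tX : tau X != 0 by apply: tau_neq0.
have mw : taum (so w) != 0 by apply: taum_neq0.
apply: (mulfI mw); rewrite -e2 -[sc (prj m \oc (dbl X P \oc iota))](mulKf tw) -e1.
by rewrite mulrAC; field; rewrite tw tX mw (tau_neq0 hB sP).
Qed.
End Rotations.

(** * Resolution of a full rotation *)

Section TraceRelation.
Variables (k : closedFieldType) (k0 : [pchar k] =i pred0).
Variables (B : bmoncat k) (hB : fusion B).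
Implicit Types V W X Y Z A P : B.
Notation hS := (fusion_fss hB).
Notation un := (unit_ob B).
Notation so := (@so k B hB).
Notation du := (du hB).
Notation tau := (tau hB).
Notation taum := (taum hB).
Notation mult := (@mult k B hS).
Let sun : simple un := unit_simple hB.
Hint Resolve so_simple sun : core.

(** Dual bases stay dual when rotated: by [pairing] a rotated pair composes to the old pairing,
    twisted by the double braiding and rescaled by tau (so j) / tau (so i). The factor [dblV] undoes
    the twisting. *)
Lemma rot_resolution j P :
  \sum_i tau (so i) *: \sum_(m < mult (so i \ox P) j)
    (sharp (du P) (prj m \oc dblV (so i) P) \oc flat (du P) (inc m))
  = tau (so j) *: idm (so j \ox du P).
Proof.
apply: (@hom_ext k B hS) => u x; rewrite compZl comp1m.
rewrite comp_suml (bigD1 u) //= [X in _ + X]big1 ?addr0 => [|i iu]; last first.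
  rewrite compZl comp_suml big1 ?scaler0 // => m _.
  by rewrite -compA [flat _ _ \oc x](S_hom0 (hC := hS)) ?compm0 // eq_sym.
pose y := cap (du P) (so j) \oc (x |> P).
have xy : x = sharp (du P) y by rewrite unsharpK.
have yE : y = \sum_(m < mult (so u \ox P) j)
    sc (y \oc dbl _ _ \oc inc m) *: (prj m \oc dblV (so u) P).
  have := @prj_expand k B hS _ _ (y \oc dbl (so u) P).
  move/(congr1 (fun f => f \oc dblV (so u) P)); rewrite -compA dblVK compm1 => {1}->.
  by rewrite comp_suml; apply: eq_bigr => m _; rewrite compZl.
rewrite {2}xy {1}yE [in RHS]/sharp rwh_sum comp_suml !scaler_sumr comp_suml.
apply: eq_bigr => m _; rewrite rwhZ !compZl scalerA -/(sharp _ _).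
rewrite -(pairing hB (inc m) y (so_simple u) (so_simple j)) -scalerA; congr (_ *: _).
rewrite -compA {1}xy flat_sharp {1}(scE hS (ptr _ _) (so_simple u)).
by rewrite compZr compm1.
Qed.

Section Slide.
Variables (P Z : B) (Pd : dual_data P).

(* [W -> (W (x) Pd) (x) P -> ((W (x) Pd) (x) P) (x) Z -> W (x) Z] *)
Definition slide (iota : Hom P (P \ox Z)) W : Hom W (W \ox Z) :=
  (cap Pd W |> Z) \oc vout iota (W \ox Pd) \oc rcup Pd W.

Lemma good_slide iota : good (str_id B) (str_R Z) (slide iota).
Proof.
apply: (good_comp (b := str_comp (str_R (Pd : B)) (str_R P))); last first.
  eapply good_ext; last (by move=> W; apply: rcupE).
  apply: good_comp (good_cup Pd).
  by eapply good_ext; last (by move=> W; apply: xingVE); apply: good_vfam.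
have g1 := good_whisk (str_R Z) (good_cap Pd).
have g2 := good_shift (str_R (Pd : B)) (good_vout iota).
apply: good_comp g2; apply: good_conv g1; last exact: str_id_comp.
by apply: str_eq_sym; apply (str_compA (str_R (Pd : B)) (str_R P) (str_R Z)).
Qed.
End Slide.

Lemma rot_slide P X Z (iota : Hom P (P \ox Z)) (f : Hom (X \ox P) P) (x : Hom P (X \ox P)) :
  (f |> Z) \oc assoV X P Z \oc (X <|| iota) \oc x =
  (cap (du P) P |> Z) \oc vout iota (P \ox du P) \oc
  ((sharp (du P) f \oc flat (du P) x) |> P) \oc rcup (du P) P.
Proof.
rewrite -{1}(flatK (du P) x) -{1}(sharpK (du P) f).
move: (sharp (du P) f) (flat (du P) x) => s r; rewrite !rwhM !compA.
rewrite !voutE; congr (_ \oc _ \oc _); rewrite -!compA; congr (_ \oc _).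
by rewrite compA -assoV_nat1 -!compA whC.
Qed.

(* The diagonal block of [f |-> f (x) Z] twisted by the inverse double braiding. *)
Definition rot_block i j z : k :=
  \sum_(m < mult (so i \ox so j) j) \sum_(n < mult (so j \ox so z) j)
    sc (prj n \oc ((prj m \oc dblV (so i) (so j)) |> so z) \oc
        assoV (so i) (so j) (so z) \oc (so i <|| inc n) \oc inc m).

(** Summed over i the rotated vectors resolve the identity, and the blocks become a [slide]. This is
    governed by a morphism from the unit to [so z], so it vanishes unless z is the unit, and then it
    is a circle of value [taum]. *)
Lemma trace_relation j z :
  \sum_i tau (so i) * rot_block i j z = (z == i0 hB)%:R * (tau (so j) * taum (so j)).
Proof.
have sj := so_simple j.
have -> : \sum_i tau (so i) * rot_block i j z = \sum_(n < mult (so j \ox so z) j)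
    sc (prj n \oc (tau (so j) *: slide (du (so j)) (inc n) (so j))).
  have e n : tau (so j) *: slide (du (so j)) (inc n) (so j) =
     \sum_i tau (so i) *: \sum_(m < mult (so i \ox so j) j)
        (((prj m \oc dblV (so i) (so j)) |> so z) \oc
        assoV (so i) (so j) (so z) \oc (so i <|| inc n) \oc inc m).
    rewrite /slide -[rcup _ _]comp1m -[idm _]rwh1 -compZr -compZl -rwhZ.
    rewrite -rot_resolution rwh_sum comp_suml comp_sumr; apply: eq_bigr => i _.
    rewrite rwhZ compZl compZr rwh_sum comp_suml comp_sumr; congr (_ *: _).
    by apply: eq_bigr => m _; rewrite rot_slide !compA.
  rewrite [RHS](eq_bigr _ (fun n _ => congr1 (fun f => sc (prj n \oc f)) (e n))).
  rewrite [RHS](eq_bigr (fun n => \sum_i tau (so i) * \sum_(m < mult (so i \ox so j) j)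
     sc (prj n \oc (((prj m \oc dblV (so i) (so j)) |> so z) \oc
        assoV (so i) (so j) (so z) \oc (so i <|| inc n) \oc inc m)))) => [|n _].
    rewrite exchange_big /=; apply: eq_bigr => i _; rewrite -mulr_sumr; congr (_ * _).
    rewrite /rot_block exchange_big /=; apply: eq_bigr => n _; apply: eq_bigr => m _.
    by rewrite !compA.
  rewrite comp_sumr (sc_sum hS) //; apply: eq_bigr => i _.
  rewrite compZr (scZ hS) // comp_sumr (sc_sum hS) //.
have [->|zn] := eqVneq z (i0 hB); last first.
  rewrite mul0r big1 // => n _.
  have gs := good_slide (du (so j)) (inc n : Hom (so j) (so j \ox so z)).
  rewrite (good_scalar (c := 0) gs gs) ?scale0r ?scaler0 ?compm0 ?(sc0 hS) //.
  apply: contrapT => nz.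
  have sz : simple (un \ox so z) by apply: un_tens_simple.
  have uz := schur hS (unit_simple hB) sz nz.
  case/eqP: zn; apply: (S_inj (hC := hS) (so_simple z)); first exact: isom_refl.
  apply: isom_trans (un_i0 hB); apply: isom_sym; apply: isom_trans.
    by exists (slide (du (so j)) (inc n) un).
  by exists (lun (so z)); apply: lun_iso.
have [u ui] := un_i0 hB.
(* [psi] trivialises tensoring with the representative of the unit; [inc n] is a multiple of it. *)
pose psi W : Hom W (W \ox so (i0 hB)) := (W <|| u) \oc runV W.
have psi_iso W : is_iso (psi W).
  by apply: is_iso_comp; [apply: lwh_iso | apply: isoV_iso (run_iso W)].
have gpsi : good (str_id B) (str_R (so (i0 hB))) psi.
  by apply: good_comp (good_runV B); apply: good_lwh.
have sl n : slide (du (so j)) (inc n) (so j) = taum (so j) *: (inc n : Hom _ (so j \ox so (i0 hB))).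
  have [c e] := iso_prop hB (inc n) (psi_iso (so j)) sj.
  have vp W : vout (psi (so j)) W = psi (W \ox so j).
    by have /= := good_left gpsi W (so j); rewrite compm1 voutE.
  rewrite /slide {1}e voutE lwhZ compZr -voutE vp !(compZr, compZl) e scalerA.
  have /= := good_nat gpsi (cap (du (so j)) (so j)); rewrite -/(psi _) => <-.
  by rewrite -compA cap_rcup compZr compm1 scalerA mulrC.
rewrite mul1r (eq_bigr (fun=> tau (so j) * taum (so j))) => [|n _].
  rewrite sumr_const card_ord; have -> : mult (so j \ox so (i0 hB)) j = 1%N; last by [].
  by rewrite -(mult_isom k0 j (ex_intro _ _ (psi_iso (so j)))) mult_S eqxx.
by rewrite sl scalerA compZr (scZ hS) // prj_inc eqxx scale1r (sc1 hS) ?mulr1.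
Qed.
End TraceRelation.

(** * Reversal of loops and the fusion rules *)

Section Duals.
Variables (k : closedFieldType) (k0 : [pchar k] =i pred0).
Variables (B : bmoncat k) (hB : fusion B).
Implicit Types V W X Y Z A P : B.
Notation hS := (fusion_fss hB).
Notation un := (unit_ob B).
Notation so := (@so k B hB).
Notation du := (du hB).
Notation tau := (tau hB).
Notation taum := (taum hB).
Notation mult := (@mult k B hS).
Let sun : simple un := unit_simple hB.
Hint Resolve so_simple sun S_simple : core.

Section SimpleObject.
Variables (P : B) (sP : simple P).
Let Q : B := du P.
Let sQ : simple Q := dual_simple hB sP (du P).

Lemma xing_cup W : xing P Q W \oc cup (du P) W = (tau P / taum P) *: rcup (du P) W.
Proof.
have g : good (str_id B) (str_comp (str_R Q) (str_R P)) (fun W => xing P Q W \oc cup (du P) W).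
  exact: good_comp (good_xing P Q) (good_cup (du P)).
apply: (good_scalar (good_rcup hB P) g).
have [c e] := cup_span hB sP (xing Q P un \oc (xing P Q un \oc cup (du P) un)).
have {}e : xing P Q un \oc cup (du P) un = c *: rcup (du P) un.
  by rewrite rcupE -compZr -e (compK _ (xingK _ _ _)).
rewrite e; congr (_ *: _).
have := congr1 (fun f => cap (du P) un \oc f) e.
rewrite compA -rcapE compZr cap_rcup.
have := ptr_id hB P un; rewrite /ptr rwh1 compm1 => ->.
rewrite scalerA => /(congr1 (@sc _ _ _)); rewrite !(scP hS) // => ->.
by rewrite mulfK // taum_neq0.
Qed.

(** Bending the right cap gives, up to unit factors, a nonzero morphism between two simple
    objects. *)
Lemma double_dual : exists g : Hom P (du Q), is_iso g.
Proof.
pose g0 := sharp (du Q) (rcap (du P) un).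
have nz : g0 <> 0.
  move=> z; case: (rcap_neq0 sP (Pd := du P)).
  by rewrite -[rcap _ _](sharpK (du Q)) -/g0 z rwh0 compm0.
have sP' : simple (un \ox P) by apply: un_tens_simple.
have sQ' : simple (un \ox du Q) by apply: un_tens_simple; apply: dual_simple.
have i0 : isom P (un \ox P) by exists (lunV P); apply: isoV_iso (lun_iso P).
have i1 : isom (un \ox P) (un \ox du Q) by exists g0; apply: (schur hS).
have i2 : isom (un \ox du Q) (du Q) by exists (lun (du Q : B)); apply: lun_iso.
exact: isom_trans (isom_trans i0 i1) i2.
Qed.

(** A left closure of Q becomes a right closure once P is identified with the dual of Q by some g.
    As g is not canonical, [c1] and [c2] compare cups and caps through it; only their product
    matters. *)
Lemma left_trace W W' (h : Hom (W \ox Q) (W' \ox Q)) :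
  cap (du P) W' \oc (h |> P) \oc rcup (du P) W =
  (taum P / taum Q) *: @ptr k (brev B) Q (du Q) W W' h.
Proof.
have [g gi] := double_dual.
have gc : good (str_id B) (str_comp (str_R Q) (str_R (du Q : B)))
    (fun W => ((W \ox Q) <|| g) \oc rcup (du P) W).
  apply: good_comp (good_rcup hB P).
  exact: good_conv (str_eq_refl _) (str_eq_refl _) (good_shift (str_R Q) (good_lwh g)).
have [c1 e1] := cup_span hB sQ (((un \ox Q) <|| g) \oc rcup (du P) un).
have {gc}e1 := good_scalar (good_cup (du Q)) gc e1.
have mP : taum P != 0 by apply: taum_neq0.
have mQ : taum Q != 0 by apply: taum_neq0.
have c1nz : c1 != 0.
  apply/eqP => c0; have := e1 un; rewrite c0 scale0r.
  have -> : 0 = ((un \ox Q) <|| g) \oc (0 : Hom un ((un \ox Q) \ox P)) by rewrite compm0.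
  move/(iso_cancel_l (lwh_iso (un \ox Q) gi)) => z.
  have := cap_rcup hB P un; rewrite z compm0 => /esym/eqP.
  by rewrite scaler_eq0 (negPf mP) (negPf (simple_id_neq0 sun)).
pose c2 := taum P / (c1 * taum Q).
have e2 V : cap (du P) V = c2 *: (@rcap k (brev B) Q (du Q) V \oc ((V \ox Q) <|| g)).
  have gr : good (str_comp (str_R Q) (str_R P)) (str_id B)
      (fun V => @rcap k (brev B) Q (du Q) V \oc ((V \ox Q) <|| g)).
    apply: good_comp (good_rcapV (du Q)) _.
    exact: good_conv (str_eq_refl _) (str_eq_refl _) (good_shift (str_R Q) (good_lwh g)).
  apply: (good_scalar gr (good_cap (du P))).
  set r := _ \oc _; apply/eqP; rewrite -subr_eq0; apply/eqP.
  have e3 : (cap (du P) un - c2 *: r) \oc rcup (du P) un = 0.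
    rewrite compBl cap_rcup compZl /r -compA e1 compZr rcapV_cup !scalerA.
    apply/eqP; rewrite subr_eq0; apply/eqP; congr (_ *: _).
    by rewrite /c2; field; rewrite c1nz mQ.
  rewrite rcupE compA in e3; have := cup_detect hB sP e3.
  move/(congr1 (fun f => f \oc xing Q P un)); rewrite -compA xingK compm1 => ->.
  exact: comp0m.
rewrite e2 !compZl -(compA _ (_ <|| g)) -whC compA -[_ \oc rcup _ _]compA e1 compZr scalerA.
by congr (_ *: _); rewrite /c2; field; rewrite c1nz mQ.
Qed.

Lemma loop_flip V W :
  ptr (du P) (vfam (dbl W P) V) =
  (tau P / taum P) *: (cap (du P) (V \ox W) \oc (vfam (dblV W Q) V |> P) \oc
                       rcup (du P) (V \ox W)).
Proof.
have ed : vfam (dbl W P) V = xing P W V \oc xing W P V by rewrite !xingE -vfamM dblE.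
have edV A : vfam (dblV W Q) A = xingV W Q A \oc xingV Q W A.
  by rewrite !xingVE -vfamM dblVE.
have e1 : (xing W P V |> Q) \oc cup (du P) (V \ox W) =
    vfam (dblV W Q) (V \ox P) \oc (xingV P W V |> Q) \oc cup (du P) (V \ox W).
  rewrite edV -!compA (compA (xingV Q W _)) cup_under -(cup_over (du P) V W).
  by rewrite !compA xingK comp1m.
rewrite /ptr ed rwhM -[LHS]compA -(compA (xing P W V |> Q)) e1 rcapE -!compA.
rewrite (compA (xing P W V |> Q)) (compA (xing P Q _)) (compA (xing P Q _)).
rewrite (vfam_over (dblV W Q) V P) -!compA (compA (xing P W V |> Q)) xingVKr comp1m.
by rewrite xing_cup !compZr.
Qed.

(** Turned over, a loop P around W becomes a loop of the dual object linked with W in the opposite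
    sense, which is a loop in [brev B]: [loop_flip] is the isotopy and [left_trace] the change of
    closure. *)
Lemma ev_loop_dual W : simple W ->
  ev_loop hB W P * taum Q = @ev_loop k (brev B) hB W Q * tau P.
Proof.
move=> sW; have := loop_flip un W; rewrite left_trace vfamE ptr_left ev_loopE // lwhZ lwh1.
have -> : @ptr k (brev B) Q (du Q) (un \ox W) (un \ox W) (vfam (dblV W Q) un) =
    @ev_loop k (brev B) hB W Q *: idm _.
  rewrite vfamE (@ptr_left k (brev B)) (@ev_loopE k (brev B) hB) // /dblV.
  by rewrite lwhZ lwh1.
rewrite !scalerA => /(congr1 (@sc _ _ _)).
rewrite !(scP hS); try exact: un_tens_simple.
have mP : taum P != 0 by apply: taum_neq0.
have mQ : taum Q != 0 by apply: taum_neq0.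
by move=> ->; field; rewrite mP mQ.
Qed.

End SimpleObject.

(** [sharp] identifies Hom(so x (x) P, so w), with its basis [prj], with Hom(so x, so w (x) du
    P). *)
Lemma frobenius P w x : mult (so w \ox du P) x = mult (so x \ox P) w.
Proof.
apply/esym; apply: (mult_dim (hC := hS)); split.
pose v2r (y : Hom (so x) (so w \ox du P)) : 'rV[k]_(mult (so x \ox P) w) :=
  \row_m sc (cap (du P) (so w) \oc (y |> P) \oc inc m).
pose r2v (r : 'rV[k]_(mult (so x \ox P) w)) : Hom (so x) (so w \ox du P) :=
  sharp (du P) (\sum_m r 0 m *: prj m).
have lin : linear v2r.
  move=> a f g; apply/rowP => m; rewrite !mxE rwhP compPr compPl (scD hS) ?(scZ hS) //; exact: so_simple.
exists v2r => //; exists r2v => [y|r].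
  rewrite /r2v -[RHS]unsharpK; apply: (congr1 (fun f => sharp (du P) f)).
  by rewrite [RHS](@prj_expand k B hS); apply: eq_bigr => m _; rewrite mxE.
apply/rowP => m; rewrite mxE /r2v sharpK comp_suml (sc_sum hS) // (bigD1 m) //=.
rewrite compZl prj_inc eqxx scale1r (scZ hS) // (sc1 hS) // mulr1 big1 ?addr0 // => n nm.
by rewrite compZl prj_inc (negPf nm) scale0r scaler0 (sc0 hS).
Qed.

Definition star i : 'I_(rk hB) :=
  sval (cid (S_index hS (dual_simple hB (so_simple i) (du (so i))))).
Lemma star_isom i : isom (du (so i)) (so (star i)).
Proof. exact: svalP (cid (S_index hS (dual_simple hB (so_simple i) (du (so i))))). Qed.

Definition N i j l : nat := mult (so i \ox so j) l.

Lemma N_comm i j l : N i j l = N j i l.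
Proof. exact: mult_isom (isom_braid _ _). Qed.

Lemma mult_tensr X Y i : mult (X \ox Y) i = (\sum_u mult Y u * mult (X \ox so u) i)%N.
Proof.
rewrite (mult_isom k0 i (isom_braid X Y)) mult_tens //; apply: eq_bigr => u _.
by rewrite (mult_isom k0 i (isom_braid _ _)).
Qed.

Lemma N_assoc i j l m : (\sum_u N i j u * N u l m = \sum_u N j l u * N i u m)%N.
Proof.
by rewrite -mult_tens // -mult_tensr; apply: mult_isom (isom_asso _ _ _).
Qed.

Lemma N_unit j l : N (i0 hB) j l = (j == l).
Proof.
have e : isom (so (i0 hB) \ox so j) (so j).
  apply: isom_trans (isom_rwh _ (isom_sym (un_i0 hB))) _.
  by exists (lun (so j)); apply: lun_iso.
by rewrite /N (mult_isom k0 l e) mult_S eq_sym.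
Qed.

Lemma N_frob w x y : N w (star x) y = N y x w.
Proof.
rewrite /N -(frobenius (so x)); apply/esym; apply: mult_isom => //.
exact: isom_lwh (star_isom x).
Qed.

End Duals.

Section FullTwist.
Variables (k : fieldType) (B : bmoncat k).
Implicit Types X Y Z S : B.

Lemma yang_baxter X Y Z :
  asso Z Y X \oc (braid Y Z |> X) \oc braid X (Y \ox Z) \oc asso X Y Z =
  (Z <|| braid X Y) \oc braid (X \ox Y) Z.
Proof.
rewrite -braid_natl.
have h1 := hexagonW X Y Z; have h2 := hexagonV Y X Z.
have {}h2 : braid (Y \ox X) Z = asso Z Y X \oc (braid Y Z |> X) \oc assoV Y Z X \oc
    (Y <|| braid X Z) \oc asso Y X Z.
  transitivity (asso Z Y X \oc (assoV Z Y X \oc braid (Y \ox X) Z \oc assoV Y X Z) \oc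
      asso Y X Z).
    by rewrite !compA assoVK comp1m -compA assoK compm1.
  by rewrite h2 !compA.
rewrite h2 -!compA; congr (_ \oc (_ \oc _)).
by rewrite (compA (Y <|| _)) -hexagonW -!compA (compA (assoV Y Z X)) assoK comp1m.
Qed.

(** Both sides are the full twist on three strands, with a different pair of neighbours twisted
    first; the half twists agree by Yang-Baxter. *)
Lemma full_twist S Y Z :
  (dbl S Y |> Z) \oc dbl (S \ox Y) Z =
  assoV S Y Z \oc (S <|| dbl Y Z) \oc dbl S (Y \ox Z) \oc asso S Y Z.
Proof.
have y1 := yang_baxter S Y Z; have y2 := yang_baxter Z Y S.
have e1 : (dbl S Y |> Z) \oc dbl (S \ox Y) Z =
   ((braid Y S |> Z) \oc braid Z (Y \ox S)) \oc ((Z <|| braid S Y) \oc braid (S \ox Y) Z).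
  rewrite (dblE (S \ox Y)) dblE rwhM -!compA; congr (_ \oc _).
  by rewrite !compA braid_natr.
have e2 : (S <|| dbl Y Z) \oc dbl S (Y \ox Z) =
   ((S <|| braid Z Y) \oc braid (Z \ox Y) S) \oc ((braid Y Z |> S) \oc braid S (Y \ox Z)).
  rewrite (dblE S) dblE lwhM -!compA; congr (_ \oc _).
  by rewrite !compA braid_natl.
rewrite e1 -(compA (assoV S Y Z)) e2 -y1 -y2 -!compA (compA (assoV S Y Z)) assoK comp1m.
by [].
Qed.
End FullTwist.

(** * Class spaces of loops and the operators on them *)

Section ClassSpaces.
Variables (k : closedFieldType) (k0 : [pchar k] =i pred0).
Variables (B : bmoncat k) (hB : fusion B).
Implicit Types V W X Y Z A P : B.
Notation hS := (fusion_fss hB).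
Notation un := (unit_ob B).
Notation so := (@so k B hB).
Notation tau := (tau hB).
Notation taum := (taum hB).
Notation mult := (@mult k B hS).
Let sun : simple un := unit_simple hB.
Hint Resolve so_simple sun S_simple : core.

Section OneObject.
Variable i : 'I_(rk hB).
Notation S := (so i).

Definition loops : finType := {j : 'I_(rk hB) & 'I_(mult (S \ox so j) j)}.
Implicit Types x : loops.

Definition linc x : Hom (so (tag x)) (S \ox so (tag x)) := inc (tagged x).
Definition lprj x : Hom (S \ox so (tag x)) (so (tag x)) := prj (tagged x).

(* The class of [F] in the zeroth Hochschild homology of the bimodule [Hom(S (x) -, -)]. *)
Definition class Y (F : Hom (S \ox Y) Y) x : k :=
  \sum_(n < mult Y (tag x)) sc (prj n \oc F \oc (S <|| inc n) \oc linc x).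

Lemma class_cyc Y Y' (F : Hom (S \ox Y) Y') (h : Hom Y' Y) x :
  class (h \oc F) x = class (F \oc (S <|| h)) x.
Proof.
rewrite /class.
pose G n n' := sc (prj n \oc h \oc inc n') *
  sc (prj n' \oc (F \oc (S <|| inc n) \oc linc x)).
transitivity (\sum_(n < mult Y (tag x)) \sum_(n' < mult Y' (tag x)) G n n').
  apply: eq_bigr => n _.
  by rewrite compA -2!(compA (prj n \oc h)) (sc_split (hC := hS)) // .
rewrite exchange_big; apply: eq_bigr => n' _ /=.
rewrite !compA -(compA _ (S <|| h)) -lwhM.
rewrite [X in S <|| X](@inc_expand k B hS) lwh_sum comp_sumr comp_suml (sc_sum hS) //.
apply: eq_bigr => n _; rewrite lwhZ compZr compZl (scZ hS) // !compA.
by rewrite /G !compA.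
Qed.

Lemma class_sum Y I (s : seq I) (P : pred I) (F : I -> Hom (S \ox Y) Y) x :
  class (\sum_(a <- s | P a) F a) x = \sum_(a <- s | P a) class (F a) x.
Proof.
rewrite /class exchange_big /=; apply: eq_bigr => n _.
by rewrite comp_sumr !comp_suml (sc_sum hS).
Qed.

Lemma classZ Y a (F : Hom (S \ox Y) Y) x : class (a *: F) x = a * class F x.
Proof.
rewrite /class mulr_sumr; apply: eq_bigr => n _.
by rewrite compZr !compZl (scZ hS).
Qed.

(* Every operation on loops that is linear and natural factors through classes. *)
Lemma class_expand Y (T : forall Y, Hom (S \ox Y) Y -> k) (F : Hom (S \ox Y) Y) :
  (forall Y I (s : seq I) (P : pred I) (F : I -> Hom (S \ox Y) Y),
     T Y (\sum_(a <- s | P a) F a) = \sum_(a <- s | P a) T Y (F a)) ->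
  (forall Y a (F : Hom (S \ox Y) Y), T Y (a *: F) = a * T Y F) ->
  (forall Y Y' (F : Hom (S \ox Y) Y') (h : Hom Y' Y),
     T Y (h \oc F) = T Y' (F \oc (S <|| h))) ->
  T Y F = \sum_x class F x * T (so (tag x)) (lprj x).
Proof.
move=> Ts TZ Tc; rewrite {1}(_ : F = \sum_j \sum_(n < mult Y j)
    (inc n \oc (prj n \oc F))); last first.
  rewrite -[LHS]comp1m -(sum_inc_prj hS) comp_suml; apply: eq_bigr => j _.
  by rewrite comp_suml; apply: eq_bigr => n _; rewrite compA.
rewrite Ts (eq_bigr (fun j => \sum_(m < mult (S \ox so j) j)
   class F (Tagged (fun j => 'I_(mult (S \ox so j) j)) m) * T _ (prj m))) => [|j _].
  by rewrite sig_big_dep.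
rewrite Ts (eq_bigr (fun n => \sum_(m < mult (S \ox so j) j)
   sc (prj n \oc F \oc (S <|| inc n) \oc inc m) * T _ (prj m))) => [|n _].
  by rewrite exchange_big; apply: eq_bigr => m _ /=; rewrite mulr_suml.
rewrite Tc [X in T _ X](@prj_expand k B hS) Ts; apply: eq_bigr => m _.
by rewrite TZ.
Qed.

(** Right tensoring with Z, which descends to classes by [class_rz] and makes the class space a
    module over the fusion ring ([lactM]). *)
Definition rz Y Z (F : Hom (S \ox Y) Y) : Hom (S \ox (Y \ox Z)) (Y \ox Z) :=
  (F |> Z) \oc assoV S Y Z.

Lemma rz_cyc Y Y' Z (F : Hom (S \ox Y) Y') (h : Hom Y' Y) x :
  class (rz Z (h \oc F)) x = class (rz Z (F \oc (S <|| h))) x.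
Proof.
rewrite /rz !rwhM -[in LHS]compA class_cyc -!compA; congr (class (_ \oc _) x).
by rewrite assoV_nat2.
Qed.

Lemma class_twist Y (F : Hom (S \ox Y) Y) x :
  class (F \oc dblV S Y) x =
  \sum_x' class F x' * class (lprj x' \oc dblV S (so (tag x'))) x.
Proof.
apply: (class_expand (T := fun Y F => class (F \oc dblV S Y) x)).
- by move=> ? I s P G; rewrite comp_suml class_sum.
- by move=> ? a G; rewrite compZl classZ.
- move=> U U' G h; rewrite -compA class_cyc -!compA; congr (class (_ \oc _) x).
  exact: dblV_natr.
Qed.

Lemma class_rz Y Z (F : Hom (S \ox Y) Y) x :
  class (rz Z F) x = \sum_x' class F x' * class (rz Z (lprj x')) x.
Proof.
apply: (class_expand (T := fun Y F => class (rz Z F) x)).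
- by move=> ? I s P G; rewrite /rz rwh_sum comp_suml class_sum.
- by move=> ? a G; rewrite /rz rwhZ compZl classZ.
- by move=> U U' G h; apply: rz_cyc.
Qed.

(** Here and in [ltwist]: matrices, in the basis given by [loops], of right tensoring with [so z]
    and of composition with the inverse double braiding. *)
Definition lact z x' x : k := class (rz (so z) (lprj x)) x'.
Definition ltwist x' x : k := class (lprj x \oc dblV S (so (tag x))) x'.

Lemma rz_sum Y Z (F : Hom (S \ox Y) Y) x :
  class (rz Z F) x = \sum_u (mult Z u)%:R * class (rz (so u) F) x.
Proof.
have -> : rz Z F = \sum_u \sum_(m < mult Z u) (Y <|| inc m) \oc
    (rz (so u) F \oc (S <|| (Y <|| prj m))).
  rewrite -[LHS]comp1m -lwh1 -(sum_inc_prj hS) lwh_sum comp_suml.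
  apply: eq_bigr => u _; rewrite lwh_sum comp_suml; apply: eq_bigr => m _.
  rewrite lwhM -compA; congr (_ \oc _); rewrite /rz compA -whC -!compA.
  by rewrite -assoV_nat3.
rewrite class_sum; apply: eq_bigr => u _; rewrite class_sum.
rewrite (eq_bigr (fun=> class (rz (so u) F) x)) => [|m _].
  by rewrite sumr_const card_ord mulr_natl.
by rewrite class_cyc -compA -!lwhM prj_inc eqxx scale1r !lwh1 compm1.
Qed.

Lemma rz_rz Y Z Z' (F : Hom (S \ox Y) Y) x :
  class (rz Z' (rz Z F)) x = class (rz (Z \ox Z') F) x.
Proof.
have e : rz (Z \ox Z') F \oc (S <|| asso Y Z Z') = asso Y Z Z' \oc rz Z' (rz Z F).
  rewrite /rz rwhM -!compA -pentagonV !compA; congr (_ \oc _ \oc _).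
  by rewrite asso_nat1.
rewrite -[rz (Z \ox Z') F]compm1 -lwh1 -(assoVK Y Z Z') lwhM (compA (rz _ F)) e.
by rewrite -(compA (asso _ _ _)) class_cyc -compA -lwhM assoK lwh1 compm1.
Qed.

(** By the full twist relation, twisting before and after tensoring differ by conjugation with the
    double braiding of Y and Z, to which classes are blind. *)
Lemma rz_twist Y Z (F : Hom (S \ox Y) Y) x :
  class (rz Z (F \oc dblV S Y)) x = class (rz Z F \oc dblV S (Y \ox Z)) x.
Proof.
have e : rz Z (F \oc dblV S Y) \oc (S <|| dbl Y Z) =
    dbl Y Z \oc (rz Z F \oc dblV S (Y \ox Z)).
  have ft : (dblV S Y |> Z) \oc assoV S Y Z \oc (S <|| dbl Y Z) =
      dbl (S \ox Y) Z \oc assoV S Y Z \oc dblV S (Y \ox Z).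
    have := congr1 (fun f => (dblV S Y |> Z) \oc f \oc (assoV S Y Z \oc dblV S (Y \ox Z)))
      (full_twist S Y Z).
    rewrite !compA -rwhM dblK rwh1 comp1m => ->.
    rewrite -(compA _ (asso S Y Z)) assoVK compm1 -(compA _ (dbl S (Y \ox Z))) dblVK.
    by rewrite compm1.
  by rewrite /rz rwhM -!(compA (F |> Z)) ft !compA dbl_natl.
rewrite -[rz Z (F \oc _)]compm1 -lwh1 -(dblVK Y Z) lwhM (compA (rz _ _)) e.
by rewrite -(compA (dbl Y Z)) class_cyc -compA -lwhM dblK lwh1 compm1.
Qed.

(** The scalar of [dblV_scalar] involves S and the two ends of the loop. The ends have the same
    colour and cancel. *)
Lemma class_twist2 Y (F : Hom (S \ox Y) Y) x :
  class (F \oc dblV S Y \oc dblV S Y) x = (taum S / tau S) * class F x.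
Proof.
rewrite -classZ /class; apply: eq_bigr => n _; congr (sc _).
have j := so_simple (tag x).
rewrite compZr !compZl -!compA; rewrite (compA (dblV S Y) (S <|| _)) dblV_natr -compA.
rewrite (compA (dblV S Y) (S <|| _)) dblV_natr -compA /linc.
rewrite (dblV_scalar (hB := hB)) // (compA (dbl S _)) dblVK comp1m !compZr.
rewrite mulfK //.
by rewrite mulf_neq0 ?invr_neq0 ?taum_neq0 ?tau_neq0.
Qed.

Lemma class_lprj x x' : class (lprj x) x' = (x' == x)%:R.
Proof.
case: x x' => j m [j' m']; rewrite /class /linc /lprj /=.
case: (eqVneq j' j) m' => [->|jj'] m'; last first.
  rewrite big1 => [|n _]; first by case: eqP => // [[/eqP]]; rewrite (negPf jj').
  have n0 : (0 < mult (so j) j')%N by apply: leq_ltn_trans (ltn_ord n).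
  by move: n0; rewrite mult_S (negPf jj').
rewrite -tag_eqE /tag_eq /= eqxx /= tagged_asE.
rewrite (eq_bigr (fun n => sc (prj n \oc (inc n : Hom (so j) (so j))) *
   (m' == m)%:R)) => [|n _].
  rewrite -mulr_suml (eq_bigr (fun=> 1)) => [|n _].
    by rewrite sumr_const card_ord mult_S eqxx mul1r.
  by rewrite prj_inc eqxx scale1r (sc1 hS).
rewrite -!compA; rewrite {1}(scE hS (inc n) (so_simple j)) lwhZ lwh1 compZl comp1m.
rewrite compZr prj_inc compZr (scZ hS) // compZr (scZ hS) //.
by rewrite compm1 (scM hS) // eq_sym; ring.
Qed.

Lemma lactM z z' x x' :
  \sum_y lact z' x y * lact z y x' = \sum_u (N z z' u)%:R * lact u x x'.
Proof.
rewrite /lact -rz_sum -rz_rz class_rz; apply: eq_bigr => y _.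
exact: mulrC.
Qed.

Lemma ltwist_lact z x x' :
  \sum_y ltwist x y * lact z y x' = \sum_y lact z x y * ltwist y x'.
Proof.
rewrite (eq_bigr (fun y => lact z y x' * ltwist x y)) => [|y _]; last exact: mulrC.
rewrite [RHS](eq_bigr (fun y => ltwist y x' * lact z x y)) => [|y _]; last exact: mulrC.
by rewrite /ltwist /lact -class_twist -class_rz rz_twist.
Qed.

Lemma ltwistM x x' :
  \sum_y ltwist x y * ltwist y x' = (taum S / tau S) * (x == x')%:R.
Proof.
rewrite (eq_bigr (fun y => ltwist y x' * ltwist x y)) => [|y _]; last exact: mulrC.
by rewrite /ltwist -class_twist class_twist2 class_lprj.
Qed.

Lemma rot_block_lact z :
  \sum_j rot_block i j z = \sum_x \sum_y lact z x y * ltwist y x.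
Proof.
rewrite [RHS](eq_bigr (fun x => class (rz (so z) (lprj x \oc dblV S (so (tag x)))) x))
  => [|x _]; last first.
  rewrite class_rz; apply: eq_bigr => y _; exact: mulrC.
transitivity (\sum_j \sum_(m < mult (S \ox so j) j)
  class (rz (so z) (prj m \oc dblV S (so j))) (Tagged (fun j => 'I_(mult (S \ox so j) j)) m));
  last by rewrite sig_big_dep.
apply: eq_bigr => j _; apply: eq_bigr => m _; rewrite /class; apply: eq_bigr => n _.
by rewrite /rz !compA.
Qed.
End OneObject.

Lemma trace_lact_twist z :
  \sum_i tau (so i) * (\sum_x \sum_y @lact i z x y * ltwist y x) =
  (z == i0 hB)%:R * \sum_j tau (so j) * taum (so j).
Proof.
rewrite mulr_sumr -(eq_bigr _ (fun j _ => trace_relation k0 j z)) exchange_big /=.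
by apply: eq_bigr => i _; rewrite -rot_block_lact mulr_sumr.
Qed.
End ClassSpaces.

(** * Perron-Frobenius theory and number fields *)

Section PerronFrobenius.
Variables (I : finType) (i0 : I).

Lemma real_max_exists (f : I -> algC) : (forall i, f i \is Num.real) ->
  exists j, forall i, f i <= f j.
Proof.
move=> fr; have [j _ jm] := @comparable_arg_maxP _ _ _ i0 xpredT f isT
  (fun i j _ _ => real_comparable (fr i) (fr j)).
by exists j => i; apply: jm.
Qed.
End PerronFrobenius.

Section Spectral.
Variables (n : nat) (B : 'M[algC]_n.+1).
Hypotheses (Bpos : forall i j, 0 < B i j) (Bsym : forall i j, B i j = B j i).
Local Open Scope sesquilinear_scope.
Implicit Types u v y : 'rV[algC]_n.+1.

Let form u : algC := (u *m B *m u ^t*) 0 0.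
Let nrm u : algC := (u *m u ^t*) 0 0.
Let absv u : 'rV[algC]_n.+1 := \row_i `|u 0 i|.

(** beta is the largest eigenvalue. In an orthonormal eigenbasis the difference of beta times the
    squared norm and the form is a sum of nonnegative terms, all zero only for an eigenvector of
    beta. *)
Lemma rayleigh : exists beta, (exists2 v : 'rV[algC]_n.+1, v != 0 & v *m B = beta *: v) /\
  forall u, form u <= beta * nrm u /\ (form u = beta * nrm u -> u *m B = beta *: u).
Proof.
have Bh : B \is hermsymmx.
  apply: realsym_hermsym.
    apply/is_hermitianmxP; rewrite expr0 scale1r; apply/matrixP => i j.
    by rewrite !mxE Bsym.
  by apply/mxOverP => i j; apply: gtr0_real.
have /orthomx_spectralP eB := hermitian_normalmx Bh.
have Pu := spectral_unitarymx B; set P := spectralmx B in eB Pu.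
have Xr := hermitian_spectral_diag_real Bh; set X := spectral_diag B in eB Xr.
have Xr' i : X 0 i \is Num.real by apply: (mxOverP Xr).
have [j jm] := real_max_exists ord0 Xr'.
rewrite invmx_unitary // in eB.
exists (X 0 j); split.
  exists (row j P).
    apply/eqP => z; have := congr1 (fun M : 'M_n.+1 => M j j) (unitarymxP Pu).
    have rz i : P j i = 0 by have := congr1 (fun u : 'rV_n.+1 => u 0 i) z; rewrite !mxE.
    rewrite !mxE eqxx big1 => [/eqP|i _]; first by rewrite eq_sym oner_eq0.
    by rewrite rz mul0r.
  rewrite -row_mul eB !mulmxA (unitarymxP Pu) mul1mx.
  by apply/rowP => i; rewrite mxE mul_diag_mx !mxE.
move=> u; pose c := u *m P ^t*.
have nE : nrm u = \sum_i `|c 0 i| ^+ 2.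
  have -> : nrm u = (c *m c ^t*) 0 0.
    rewrite /nrm /c trmx_mul map_mxM trmxCK mulmxA -(mulmxA u) -{1}[u]mulmx1.
    have -> : P ^t* *m P = 1%:M by rewrite -invmx_unitary // mulVmx // unitarymx_unit.
    by [].
  by rewrite mxE; apply: eq_bigr => i _; rewrite !mxE normCK.
have fE : form u = \sum_i X 0 i * `|c 0 i| ^+ 2.
  have -> : form u = (c *m diag_mx X *m c ^t*) 0 0.
    by rewrite /form {1}eB /c trmx_mul map_mxM trmxCK !mulmxA.
  rewrite mxE; apply: eq_bigr => i _; rewrite mul_mx_diag !mxE normCK.
  by rewrite mulrAC mulrC.
split; first by rewrite fE nE mulr_sumr ler_sum // => i _; rewrite ler_wpM2r ?exprn_ge0.
rewrite fE nE mulr_sumr => /eqP; rewrite eq_sym -subr_eq0 -sumrB.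
have tpos i : 0 <= X 0 j * `|c 0 i| ^+ 2 - X 0 i * `|c 0 i| ^+ 2.
  by rewrite -mulrBl mulr_ge0 ?exprn_ge0 // subr_ge0.
rewrite psumr_eq0 => [/allP ez|i _]; last exact: tpos.
have cz i : c 0 i * X 0 i = X 0 j * c 0 i.
  have := ez i (mem_index_enum i); rewrite -mulrBl mulf_eq0 subr_eq0 expf_eq0 /= normr_eq0.
  by case/orP => /eqP; [move=> ->; rewrite mulrC | move=> ->; rewrite mul0r mulr0].
have cP : c *m P = u.
  by rewrite /c -mulmxA -invmx_unitary // mulVmx ?mulmx1 // unitarymx_unit.
rewrite {1}eB !mulmxA -/c -[X in _ = _ *: X]cP scalemxAl; congr (_ *m _).
by apply/rowP => i; rewrite mul_mx_diag [LHS]mxE [RHS]mxE.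
Qed.

(** Taking absolute values of the entries does not lower the Rayleigh quotient, so it turns a top
    eigenvector into a top eigenvector, positive because [B] is. Were there an independent one, some
    nonzero combination would vanish at index 0, against this positivity. *)
Lemma perron : exists beta (v : 'rV[algC]_n.+1), [/\ 0 < beta, v *m B = beta *: v, forall i, 0 < v 0 i
  & forall y : 'rV[algC]_n.+1, y *m B = beta *: y -> exists c, y = c *: v].
Proof.
have [beta [[v0 v0n v0B] ray]] := rayleigh.
have nrm_pos u : u != 0 -> 0 < nrm u.
  move=> un; rewrite /nrm mxE (eq_bigr (fun i => `|u 0 i| ^+ 2)) => [|i _].
    rewrite lt0r sumr_ge0 ?andbT => [|i _]; last exact: exprn_ge0.
    apply: contraNneq un => /eqP; rewrite psumr_eq0 => [/allP z|i _]; last exact: exprn_ge0.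
    apply/eqP/rowP => i; rewrite mxE; have := z i (mem_index_enum i).
    by rewrite /= expf_eq0 normr_eq0 => /eqP.
  by rewrite !mxE normCK.
have nrm_abs u : nrm (absv u) = nrm u.
  rewrite /nrm !mxE; apply: eq_bigr => i _; rewrite !mxE -!normCK.
  by rewrite normr_id.
have abs_ge0 u i : 0 <= absv u 0 i by rewrite mxE.
have form_ge0 u : 0 <= form (absv u).
  rewrite /form mxE sumr_ge0 // => i _; rewrite mulr_ge0 // ?mxE.
    by rewrite sumr_ge0 // => j _; rewrite mulr_ge0 // ltW.
  by rewrite geC0_conj ?mxE ?normr_ge0.
have abs_eig u : u *m B = beta *: u -> absv u *m B = beta *: absv u.
  move=> uB; have [le eq] := ray (absv u); apply: eq; apply/eqP; rewrite eq_le le /= nrm_abs.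
  have <- : `|form u| = beta * nrm u.
    rewrite /form uB -scalemxAl mxE normrM -/(nrm u) (ger0_norm (_ : 0 <= nrm u)); last first.
      by have [->|/nrm_pos/ltW//] := eqVneq u 0; rewrite /nrm mul0mx mxE.
    congr (_ * _); rewrite ger0_norm //.
    have := le_trans (form_ge0 v0) (ray (absv v0)).1.
    by rewrite pmulr_lge0 // nrm_abs nrm_pos.
  rewrite /form !mxE; apply: le_trans (ler_norm_sum _ _ _) _; apply: ler_sum => i _.
  rewrite !mxE normrM norm_conjC (geC0_conj (normr_ge0 _)); apply: ler_wpM2r => //.
  apply: le_trans (ler_norm_sum _ _ _) _; apply: ler_sum => j _.
  by rewrite normrM mxE (gtr0_norm (Bpos _ _)).
have beta_gt0 : 0 < beta.
  have n0 : absv v0 != 0.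
    apply: contraNneq v0n => z; apply/eqP/rowP => i.
    by have := congr1 (fun u : 'rV_n.+1 => u 0 i) z; rewrite !mxE => /eqP; rewrite normr_eq0 => /eqP.
  have [i ui] : exists i, absv v0 0 i != 0.
    apply/existsP; rewrite -negb_forall; apply: contra n0 => /forallP z; apply/eqP/rowP => i.
    by rewrite [RHS]mxE; apply/eqP.
  have := congr1 (fun u : 'rV_n.+1 => u 0 i) (abs_eig _ v0B); rewrite [in RHS]mxE => e.
  have ui0 : 0 < absv v0 0 i by rewrite lt0r ui abs_ge0.
  rewrite -(pmulr_lgt0 _ ui0) -e mxE (bigD1 i) //= ltr_pwDl ?mulr_gt0 //.
  by rewrite sumr_ge0 // => j _; rewrite mulr_ge0 // ltW.
have abs_pos u : u *m B = beta *: u -> u != 0 -> forall i, 0 < absv u 0 i.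
  move=> uB un i; have [j uj] : exists j, u 0 j != 0.
    apply/existsP; rewrite -negb_forall; apply: contra un => /forallP z; apply/eqP/rowP => l.
    by rewrite [RHS]mxE; apply/eqP.
  have e := congr1 (fun u : 'rV_n.+1 => u 0 i) (abs_eig _ uB).
  rewrite -(pmulr_rgt0 _ beta_gt0); move: e; rewrite [in RHS]mxE => <-.
  rewrite mxE (bigD1 j) //= ltr_pwDl ?mulr_gt0 //; first by rewrite mxE normr_gt0.
  by rewrite sumr_ge0 // => l _; rewrite mulr_ge0 // ltW.
exists beta, (absv v0); split => //; first exact: abs_eig.
  exact: abs_pos.
move=> y yB; pose c := y 0 0 / absv v0 0 0; exists c.
apply/eqP; rewrite -subr_eq0; apply: contraT => nz.
have yB' : (y - c *: absv v0) *m B = beta *: (y - c *: absv v0).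
  by rewrite mulmxBl yB -scalemxAl abs_eig // scalerBr !scalerA mulrC.
have := abs_pos _ yB' nz 0; rewrite mxE normr_gt0 => /eqP; case.
rewrite !mxE /c mxE divfK ?subrr //.
by have := abs_pos _ v0B v0n 0; rewrite mxE => /lt0r_neq0.
Qed.
End Spectral.

Lemma perron_fun n (i0 : 'I_n) (B : 'I_n -> 'I_n -> algC) :
  (forall i j, 0 < B i j) -> (forall i j, B i j = B j i) ->
  exists beta (v : 'I_n -> algC), [/\ 0 < beta,
    forall i, \sum_j v j * B j i = beta * v i, forall i, 0 < v i
    & forall y : 'I_n -> algC, (forall i, \sum_j y j * B j i = beta * y i) ->
        exists c, forall i, y i = c * v i].
Proof.
case: n i0 B => [[]//|n] _ B Bpos Bsym.
have := @perron n (\matrix_(i, j) B i j).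
case=> [i j|i j|beta [v [b0 vB vpos vuniq]]]; rewrite ?mxE //.
exists beta, (fun i => v 0 i); split=> // [i|y yB].
  have := congr1 (fun u : 'rV_n.+1 => u 0 i) vB; rewrite !mxE => <-.
  by apply: eq_bigr => j _; rewrite mxE.
have [|c yc] := vuniq (\row_i y i).
  by apply/rowP => i; rewrite !mxE -yB; apply: eq_bigr => j _; rewrite !mxE.
by exists c => i; have := congr1 (fun u : 'rV_n.+1 => u 0 i) yc; rewrite !mxE.
Qed.

(** * Fusion rings and Frobenius-Perron dimensions *)

Record fusion_rules (r : nat) (N : 'I_r -> 'I_r -> 'I_r -> nat) (st : 'I_r -> 'I_r)
    (e : 'I_r) : Prop := FusionRules {
  fr_comm : forall i j l, N i j l = N j i l;
  fr_assoc : forall i j l m,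
    (\sum_u N i j u * N u l m = \sum_u N j l u * N i u m)%N;
  fr_unit : forall j l, N e j l = (j == l);
  fr_frob : forall w x y, N w (st x) y = N y x w }.

Section FusionRing.
Variables (r : nat) (N : 'I_r -> 'I_r -> 'I_r -> nat) (st : 'I_r -> 'I_r) (e : 'I_r).
Hypothesis FR : fusion_rules N st e.
Let NC := fr_comm FR.
Let NA := fr_assoc FR.
Let N1 := fr_unit FR.
Let NF := fr_frob FR.

Lemma N_st_e w x : N w (st x) e = (w == x).
Proof. by rewrite NF N1 eq_sym. Qed.

Lemma stK : involutive st.
Proof.
by move=> x; have := N_st_e (st x) (st x); rewrite eqxx NC N_st_e; case: eqP.
Qed.

Lemma N_swap i j a m : (\sum_u N i j u * N a u m = \sum_u N a j u * N i u m)%N.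
Proof.
rewrite -NA (eq_bigr (fun u => N i a u * N u j m)%N) ?NA // => u _.
by rewrite NC.
Qed.

Lemma N_rot i j l : N i j l = N l (st j) i. Proof. by rewrite NF. Qed.

Lemma N_e i j : N i j e = (j == st i).
Proof. by rewrite -{1}[j]stK N_st_e -(inj_eq (inv_inj stK) i) stK eq_sym. Qed.

Lemma st_e : st e = e.
Proof. by have := N_st_e e e; rewrite N1 eqxx; case: eqP. Qed.

Lemma sum_N_gt0 l j : (0 < \sum_i N i j l)%N.
Proof.
rewrite (eq_bigr (fun i => N l (st j) i)) => [|i _]; last by rewrite -N_rot.
rewrite lt0n; apply/negP; rewrite sum_nat_eq0 => /forallP z.
have := NA l (st j) j l; rewrite big1 => [|u _]; last by rewrite (eqP (z u)).
move/esym/eqP; rewrite sum_nat_eq0 => /forallP/(_ e).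
by rewrite NC N_st_e eqxx NC N1 eqxx.
Qed.

(** Multiplication by the sum of all simple objects has a positive symmetric matrix [B]. The
    operators of multiplication commute with it, so they preserve its Perron line and act there by a
    character. Duality transposes multiplication by i, which does not change the value of its
    quadratic form at the Perron vector; so i and [st i] have the same eigenvalue. *)
Lemma FP_exists : exists d : 'I_r -> algC, [/\ forall i, 0 < d i,
  forall i j, \sum_l (N i j l)%:R * d l = d i * d j, d e = 1 & forall i, d (st i) = d i].
Proof.
pose B j l : algC := (\sum_i N i j l)%:R.
have Bpos i j : 0 < B i j by rewrite ltr0n sum_N_gt0.
have Bsym i j : B i j = B j i.
  rewrite /B (reindex_inj (inv_inj stK)) /=; congr (_%:R); apply: eq_bigr => l _.
  by rewrite NC NF NC.
have [beta [v [b0 vB vpos vuniq]]] := perron_fun e Bpos Bsym.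
pose vN i l : algC := \sum_j v j * (N i j l)%:R.
have eig i : exists c, forall l, vN i l = c * v l.
  apply: vuniq => l; rewrite mulr_sumr.
  rewrite [RHS](eq_bigr (fun j => \sum_m v m * (B m j * (N i j l)%:R))) => [|j _]; last first.
    by rewrite mulrA -vB mulr_suml; apply: eq_bigr => m _; rewrite mulrA.
  rewrite [LHS](eq_bigr (fun j => \sum_m v m * ((N i m j)%:R * B j l))) => [|j _];
    last by rewrite /vN mulr_suml; apply: eq_bigr => m _; rewrite mulrA.
  rewrite exchange_big [RHS]exchange_big /=; apply: eq_bigr => m _.
  rewrite -!mulr_sumr; congr (_ * _).
  rewrite [LHS](eq_bigr (fun j => (\sum_a N i m j * N a j l)%N%:R)) => [|j _]; last first.
    by rewrite -natrM big_distrr.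
  rewrite [RHS](eq_bigr (fun j => (\sum_a N a m j * N i j l)%N%:R)) => [|j _]; last first.
    by rewrite -natrM big_distrl.
  rewrite -!natr_sum exchange_big [in RHS]exchange_big; congr (_%:R).
  by apply: eq_bigr => a _; apply: N_swap.
(* The eigenvalue is read off at the coordinate of the unit: [N i j e] is nonzero only for j =
   [st i]. *)
pose d i := v (st i) / v e.
have ve : v e != 0 by apply: lt0r_neq0.
have vNE i l : vN i l = d i * v l.
  have [c ci] := eig i; suff -> : d i = c by [].
  have := ci e; rewrite /vN (bigD1 (st i)) //= big1 => [|j ji].
    by rewrite addr0 N_e eqxx mulr1 /d => ->; rewrite mulfK.
  by rewrite N_e (negPf ji) mulr0.
have vd l : v l = d (st l) * v e by rewrite /d stK divfK.
have dch i l : \sum_j (N i l j)%:R * d j = d i * d l.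
  have := vNE i (st l); rewrite vd stK mulrA => /(canLR (mulfK ve)) <-.
  rewrite /vN mulr_suml (reindex_inj (inv_inj stK)) /=; apply: eq_bigr => j _.
  rewrite (vd j) mulrAC mulfK // mulrC; congr (_ * _%:R).
  by rewrite N_rot NC -N_rot.
have dst i : d (st i) = d i.
  apply/eqP; have sv : 0 < \sum_l v l * v l.
    rewrite (bigD1 e) //= ltr_pwDl ?mulr_gt0 // sumr_ge0 // => l _.
    by rewrite mulr_ge0 ?ltW.
  have key a : \sum_l \sum_j v j * (N a j l)%:R * v l = d a * \sum_l v l * v l.
    rewrite mulr_sumr; apply: eq_bigr => l _; rewrite -mulr_suml -/(vN a l) vNE.
    by rewrite mulrA.
  rewrite -subr_eq0 -(mulIr_eq0 _ (mulIf (lt0r_neq0 sv))) mulrBl -!key subr_eq0.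
  apply/eqP; rewrite exchange_big /=; apply: eq_bigr => j _; apply: eq_bigr => l _.
  by rewrite (NC (st i)) NF (NC l); ring.
exists d; split=> // [i|]; first by rewrite divr_gt0.
by rewrite /d st_e divff.
Qed.
End FusionRing.

Section FPBound.
Variables (r : nat) (N : 'I_r -> 'I_r -> 'I_r -> nat) (d : 'I_r -> algC).
Hypotheses (d_gt0 : forall i, 0 < d i).
Hypothesis dM : forall i j, \sum_l (N i j l)%:R * d l = d i * d j.

(** The eigenvector equation is estimated at an index j where |y j| / d j is largest. *)
Lemma FP_bound i (M : 'I_r -> 'I_r -> algC) (y : 'I_r -> algC) lam :
  (forall j l, `|M j l| <= (N i j l)%:R) -> (exists j, y j != 0) ->
  (forall j, \sum_l M j l * y l = lam * y j) -> `|lam| <= d i.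
Proof.
move=> MN [j0 yj0] yM.
have [j jm] := real_max_exists j0 (fun j => @ger0_real _ (`|y j| / d j)
  (divr_ge0 (normr_ge0 _) (ltW (d_gt0 j)))).
have yj l : `|y l| <= `|y j| / d j * d l by rewrite -ler_pdivrMr.
have yjpos : 0 < `|y j|.
  have := lt_le_trans (_ : 0 < `|y j0|) (yj j0); rewrite normr_gt0 => /(_ yj0).
  by rewrite pmulr_lgt0 // pmulr_lgt0 // invr_gt0.
rewrite -(ler_pM2r yjpos) -normrM -yM; apply: le_trans (ler_norm_sum _ _ _) _.
have -> : d i * `|y j| = \sum_l (N i j l)%:R * (`|y j| / d j * d l).
  rewrite (eq_bigr (fun l => `|y j| / d j * ((N i j l)%:R * d l))) => [|l _].
    by rewrite -mulr_sumr dM mulrCA divfK // lt0r_neq0.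
  by rewrite mulrCA.
apply: ler_sum => l _; rewrite normrM; apply: ler_pM => //.
Qed.
End FPBound.

(** * Number fields inside [k] and inside the complex numbers *)

Section RatEmbedding.
Variables (k : fieldType) (k0 : [pchar k] =i pred0).

Lemma intr_char0_eq0 (m : int) : (m%:~R == 0 :> k) = (m == 0).
Proof.
case: m => n; first by rewrite -pmulrn (pcharf0P k).1.
by rewrite NegzE rmorphN /= oppr_eq0 -pmulrn (pcharf0P k).1.
Qed.

Definition ratk (x : rat) : k := (numq x)%:~R / (denq x)%:~R.

Lemma denk_neq0 x : (denq x)%:~R != 0 :> k.
Proof. by rewrite intr_char0_eq0 denq_neq0. Qed.

Lemma ratk_frac (a b : int) : b != 0 -> ratk (a%:~R / b%:~R) = a%:~R / b%:~R.
Proof.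
move=> b0; set x := _ / _ : rat; rewrite /ratk.
apply/eqP; rewrite eqr_div ?denk_neq0 ?intr_char0_eq0 // -!intrM.
suff -> : numq x * b = a * denq x by [].
apply: (@intr_inj rat); rewrite !intrM numqE /x.
by rewrite mulrAC divfK ?intr_eq0.
Qed.

Fact ratk_is_zmod : zmod_morphism ratk.
Proof.
move=> x y.
have dx : denq x != 0 := denq_neq0 x; have dy : denq y != 0 := denq_neq0 y.
have -> : x - y = (numq x * denq y - numq y * denq x)%:~R / (denq x * denq y)%:~R.
  rewrite -{1}[x]divq_num_den -{1}[y]divq_num_den !(intrM, intrB, rmorphM, rmorphB) /=.
  by field; rewrite !intr_eq0 dx dy.
rewrite ratk_frac ?mulf_neq0 // /ratk !(intrM, intrB).
by field; rewrite !intr_char0_eq0 dx dy.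
Qed.

Fact ratk_is_monoid : monoid_morphism ratk.
Proof.
split=> [|x y]; first by rewrite /ratk divr1.
have dx : denq x != 0 := denq_neq0 x; have dy : denq y != 0 := denq_neq0 y.
have -> : x * y = (numq x * numq y)%:~R / (denq x * denq y)%:~R.
  rewrite -{1}[x]divq_num_den -{1}[y]divq_num_den !intrM.
  by field; rewrite !intr_eq0 dx dy.
rewrite ratk_frac ?mulf_neq0 // /ratk !intrM.
by field; rewrite !intr_char0_eq0 dx dy.
Qed.

Definition ratk_rmorphism : {rmorphism rat -> k} :=
  HB.pack ratk (GRing.isZmodMorphism.Build _ _ ratk ratk_is_zmod)
    (GRing.isMonoidMorphism.Build _ _ ratk ratk_is_monoid).
End RatEmbedding.

Section NumberField.
Variables (k : closedFieldType) (k0 : [pchar k] =i pred0).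

Section Extend.
Variables (L : fieldExtType rat) (psi : {rmorphism L -> algC}) (z1 : L).
Hypothesis gen : forall x, exists p : {poly rat}, x = (map_poly (in_alg L) p).[z1].

(** The generator [z1] is sent to a root in [k] of its minimal polynomial. Elements are represented
    by chosen polynomials in [z1], and [wd] is independence of the choice. *)
Lemma extend_to_closed : exists phi : {rmorphism L -> k}, True.
Proof.
have [m [em mm] mdv] := minCpolyP (psi z1).
have em' p : psi (map_poly (in_alg L) p).[z1] = (map_poly ratr p).[psi z1].
  rewrite -horner_map -map_poly_comp; congr (_.[_]); apply: eq_map_poly => a /=.
  by rewrite alg_num_field fmorph_rat.
pose rk := ratk_rmorphism k0.
have [zeta zr] : exists zeta, root (map_poly rk m) zeta.
  apply/closed_rootP; rewrite size_map_poly.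
  have := size_minCpoly (psi z1); rewrite em size_map_poly => s.
  by rewrite neq_ltn s orbT.
have wd (p q : {poly rat}) : (map_poly (in_alg L) p).[z1] = (map_poly (in_alg L) q).[z1] ->
    (map_poly rk p).[zeta] = (map_poly rk q).[zeta].
  move=> e; have : root (map_poly ratr (p - q)) (psi z1).
    by rewrite /root rmorphB hornerD hornerN -!em' e subrr.
  rewrite mdv => /dvdpP[u /(congr1 (map_poly rk))/(congr1 (fun f => f.[zeta]))].
  rewrite rmorphB rmorphM hornerD hornerN hornerM (eqP zr) mulr0 => /eqP.
  by rewrite subr_eq0 => /eqP.
pose P x := sval (cid (gen x)).
have PE x : x = (map_poly (in_alg L) (P x)).[z1] := svalP (cid (gen x)).
pose phi x := (map_poly rk (P x)).[zeta].
have phiz : zmod_morphism phi.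
  move=> x y; rewrite /phi -hornerN -hornerD -rmorphB; apply: wd.
  by rewrite -PE rmorphB hornerD hornerN -!PE.
have phim : monoid_morphism phi.
  split=> [|x y].
    have -> : 1 = (map_poly rk 1).[zeta] by rewrite rmorph1 hornerC.
    by apply: wd; rewrite -PE rmorph1 hornerC.
  rewrite /phi -hornerM -rmorphM; apply: wd.
  by rewrite -PE rmorphM hornerM -!PE.
pose f : {rmorphism L -> k} := HB.pack phi (GRing.isZmodMorphism.Build _ _ phi phiz)
  (GRing.isMonoidMorphism.Build _ _ phi phim).
by exists f.
Qed.
End Extend.

(** L is generated by the complex roots of [Q], through a primitive element. As [Q] splits over L,
    each of its roots in either big field is the image of a root in L. *)
Lemma number_field (Q : {poly int}) : Q \is monic ->
  exists (L : splittingFieldType rat) (psi : {rmorphism L -> algC}) (phi : {rmorphism L -> k}),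
  [/\ galois 1 {:L},
      forall x, root (map_poly intr Q) x -> exists2 y, psi y = x & root (map_poly intr Q) y
    & forall x, root (map_poly intr Q) x -> exists2 y, phi y = x & root (map_poly intr Q) y].
Proof.
move=> mQ.
have [s es] := closed_field_poly_normal (map_poly intr Q : {poly algC}).
rewrite (monicP (monic_map _ mQ)) scale1r in es.
have [z [a ez] [ps eps]] := algC_PET s.
have [L0 [psi0 [[//|z1 s1] [ez1 es1] gen1]]] := num_field_exists (z :: s).
have mapint (L : fieldExtType rat) (f : {rmorphism L -> algC}) :
    map_poly f (map_poly intr Q) = map_poly intr Q.
  by rewrite -map_poly_comp; apply: eq_map_poly => c /=; rewrite rmorph_int.
have splitL0 : map_poly intr Q = \prod_(y <- s1) ('X - y%:P) :> {poly L0}.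
  apply: (map_poly_inj psi0); rewrite mapint es rmorph_prod -es1 big_map.
  by apply: eq_bigr => y _; rewrite rmorphB /= map_polyX map_polyC.
have inpoly (p : {poly rat}) : psi0 (map_poly (in_alg L0) p).[z1] = (map_poly ratr p).[z].
  rewrite -ez1 -horner_map -map_poly_comp; congr (_.[_]); apply: eq_map_poly => c /=.
  by rewrite alg_num_field fmorph_rat.
have s1E y : y \in s1 -> exists p : {poly rat}, y = (map_poly (in_alg L0) p).[z1].
  move=> ys; have : psi0 y \in s by rewrite -es1 map_f.
  rewrite eps => /mapP[p _ pe]; exists p; apply: (fmorph_inj psi0).
  by rewrite inpoly pe.
have nthE (i : nat) : (i < size s)%N -> s`_i = psi0 s1`_i.
  by rewrite -es1 size_map => /(nth_map 0 0 psi0) ->.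
have zin (A : {subfield L0}) : {subset s1 <= A} -> z1 \in A.
  move=> sA; have -> : z1 = \sum_(i < size s) s1`_i *+ a i.
    apply: (fmorph_inj psi0); rewrite ez1 ez rmorph_sum; apply: eq_bigr => i _.
    by rewrite rmorphMn nthE.
  apply: memv_suml => i _; apply: rpredMn; apply: sA; apply: mem_nth.
  by rewrite -(size_map psi0) es1.
have gens1 : <<1 & s1>>%VS = {:L0}%VS.
  apply/eqP; rewrite eqEsubv subvf -gen1 /=; apply/Fadjoin_seqP; split.
    exact: sub1v.
  move=> y; rewrite inE => /orP[/eqP->|]; last exact: seqv_sub_adjoin.
  by apply: (zin <<1 & s1>>%AS) => u; apply: seqv_sub_adjoin.
have gen x : exists p : {poly rat}, x = (map_poly (in_alg L0) p).[z1].
  have : x \in <<1; z1>>%VS.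
    have : x \in <<1 & s1>>%VS by rewrite gens1 memvf.
    apply/subvP; apply/Fadjoin_seqP; split; first exact: sub1v.
    move=> y /s1E[p ->]; apply/Fadjoin_polyP; exists (map_poly (in_alg L0) p) => //.
    by apply/polyOver_poly => i _; apply: rpredZ; apply: mem1v.
  case/Fadjoin_polyP => p /polyOver1P[q ->] ->.
  by exists q.
have [phi _] := extend_to_closed psi0 gen.
have spl : splitting_field_axiom L0.
  exists (map_poly intr Q).
    by apply/polyOver_poly => i _; apply: rpred_int.
  by exists s1; rewrite ?splitL0 ?eqpxx.
pose L : splittingFieldType rat :=
  HB.pack L0 (FieldExt_isSplittingField.Build _ L0 spl).
exists L, psi0, phi; split.
- apply/and3P; split; first exact: sub1v.
    by apply/separableP => y _; apply: pcharf0_separable => p; rewrite pchar_lalg; apply: (pchar_num rat).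
  apply/splitting_normalField; first exact: sub1v.
  exact: spl.
- move=> x; rewrite es root_prod_XsubC -es1 => /mapP[y ys ->]; exists y => //.
  by rewrite splitL0 root_prod_XsubC.
move=> x; have -> : map_poly intr Q = map_poly phi (\prod_(y <- s1) ('X - y%:P)).
  rewrite -splitL0 -map_poly_comp; apply: eq_map_poly => c /=; by rewrite rmorph_int.
rewrite rmorph_prod (eq_bigr (fun y => 'X - (phi y)%:P)) => [|y _]; last first.
  by rewrite rmorphB /= map_polyX map_polyC.
rewrite -(big_map phi xpredT (fun y => 'X - y%:P)) root_prod_XsubC => /mapP[y ys ->].
by exists y; rewrite ?splitL0 ?root_prod_XsubC.
Qed.
End NumberField.

Section Norms.
Variables (L : splittingFieldType rat) (psi : {rmorphism L -> algC}).
Hypothesis gal : galois 1 {:L}.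

(** The norm is a nonzero rational integer, so has absolute value at least 1, while each of its
    factors has absolute value at most 1. *)
Lemma norm_ge1 x : x != 0 -> psi x \in Aint ->
  (forall f : {rmorphism L -> algC}, f x \in Aint) ->
  (forall f : {rmorphism L -> algC}, `|f x| <= 1) -> `|psi x| = 1.
Proof.
move=> x0 xA fA fle.
pose nx := galNorm 1 {:L} x.
have nQ : psi nx \in Crat.
  have : nx \in 1%VS by apply: mem_galNorm gal (memvf x).
  by case/vlineP => a ->; rewrite alg_num_field fmorph_rat Crat_rat.
have psiE : psi nx = \prod_(g in ('Gal({:L} / 1))%g) psi (g x) by rewrite rmorph_prod.
have comp (g : gal_of {:L}) : exists f : {rmorphism L -> algC}, f x = psi (g x).
  by exists (psi \o (g : {rmorphism L -> L})).
have nA : psi nx \in Aint.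
  by rewrite psiE rpred_prod // => g _; have [f <-] := comp g.
have nZ := Cint_rat_Aint nQ nA.
have n1 : 1 <= `|psi nx|.
  by rewrite norm_intr_ge1 // fmorph_eq0 galNorm_eq0.
apply/eqP; rewrite eq_le fle /=; apply: le_trans n1 _.
rewrite psiE normr_prod (bigD1 (1%g : gal_of {:L})) ?group1 //= gal_id ler_piMr //.
by apply: prodr_ile1 => g _; rewrite normr_ge0 /=; have [f <-] := comp g; apply: fle.
Qed.
End Norms.

(** * Twists, dimensions and characters *)

Section Numbers.
Variables (k : closedFieldType) (k0 : [pchar k] =i pred0).
Variables (B : bmoncat k) (hB : fusion B).
Notation hS := (fusion_fss hB).
Notation so := (@so k B hB).
Notation du := (du hB).
Notation tau := (tau hB).
Notation taum := (taum hB).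
Notation mult := (@mult k B hS).
Notation r := (rk hB).
Notation e := (i0 hB).
Notation omega i := (taum (so i) / tau (so i)).
Notation N := (@N k B hB).
Notation st := (@star k B hB).
Hint Resolve so_simple S_simple : core.

Lemma N_rules : fusion_rules N st e.
Proof.
split; [exact: N_comm | exact: N_assoc | exact: N_unit | exact: N_frob].
Qed.

Lemma so_tau_neq0 i : tau (so i) != 0. Proof. exact: tau_neq0. Qed.
Lemma so_taum_neq0 i : taum (so i) != 0. Proof. exact: taum_neq0. Qed.

Lemma dbl_sqr i j l (iota : Hom (so l) (so i \ox so j)) :
  dbl (so i) (so j) \oc (dbl (so i) (so j) \oc iota) =
  (omega l / (omega i * omega j)) *: iota.
Proof.
have := @dblV_scalar k B hB _ _ l iota (so_simple i) (so_simple j).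
move/(congr1 (fun f => dbl (so i) (so j) \oc f)); rewrite compA dblVK comp1m compZr.
move=> h; rewrite [in RHS]h scalerA -[LHS]scale1r; congr (_ *: _).
by field; rewrite !so_tau_neq0 !so_taum_neq0.
Qed.

(** The dual strand in [rot_resolution] is closed off with a cap and a right cup. *)
Lemma trace_dblV j p :
  \sum_i tau (so i) * tr j (dblV (so i) (so p)) = tau (so j) * taum (so p).
Proof.
have := congr1 (fun f => cap (du (so p)) (so j) \oc (f |> so p) \oc rcup (du (so p)) (so j))
  (rot_resolution j (so p)).
rewrite rwhZ rwh1 compZr compm1 compZl cap_rcup scalerA => /(congr1 (@sc _ _ _)).
rewrite [RHS](scP hS) // => <-.
rewrite rwh_sum comp_sumr comp_suml (sc_sum hS) //; apply: eq_bigr => i _.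
rewrite rwhZ compZr compZl (scZ hS) //; congr (_ * _).
rewrite rwh_sum comp_sumr comp_suml (sc_sum hS) //; apply: eq_bigr => m _.
by rewrite rwhM compA sharpK -(compA _ _ (rcup _ _)) flatK.
Qed.

Section Signs.
Variable t : 'I_r -> k.
Hypothesis t2 : forall i, t i ^+ 2 = omega i.
Let t0 i : t i != 0.
Proof. by rewrite -sqrf_eq0 t2 mulf_neq0 ?invr_eq0 ?so_tau_neq0 ?so_taum_neq0. Qed.

Let M i j l : 'M[k]_(mult (so i \ox so j) l) :=
  \matrix_(m, m') (t i * t j / t l * sc (prj m \oc dbl (so i) (so j) \oc inc m')).

Let M_invol i j l : M i j l *m M i j l = 1%:M.
Proof.
apply/matrixP => m m'; rewrite !mxE.
rewrite (eq_bigr (fun n => (t i * t j / t l) ^+ 2 *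
  (sc (prj m \oc dbl (so i) (so j) \oc inc n) *
   sc (prj n \oc (dbl (so i) (so j) \oc inc m'))))) => [|n _]; last first.
  by rewrite !mxE !compA; ring.
rewrite -mulr_sumr -(sc_split (hC := hS)) // -compA dbl_sqr compZr (scZ hS) // prj_inc.
rewrite (scZ hS) // (sc1 hS) // mulr1 [LHS]mulrA.
rewrite -[RHS]mul1r; congr (_ * _); rewrite -!t2; field; by rewrite !t0.
Qed.

(** [M] is an involution by [dbl_sqr], so its trace is a - b with a + b = [N i j l]. If the trace is
    maximal, the projection onto the eigenvalue -1 has trace, hence in characteristic zero rank,
    equal to 0, and [M] is the identity. *)
Lemma sign_trace i j l : {c : int | `|c| <= (N i j l)%:Z &
  tr l (dbl (so i) (so j)) = t l / (t i * t j) * c%:~R /\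
  (c = (N i j l)%:Z -> forall iota : Hom (so l) (so i \ox so j),
      dbl (so i) (so j) \oc iota = (t l / (t i * t j)) *: iota)}.
Proof.
have k2 : (2%:R : k) != 0 by apply: natr0_neq0.
apply: cid2.
have [a [b [ab trM]]] := involution_trace k2 (M_invol i j l) (mul1mx _) (etrans (mulmx1 _) (esym (mul1mx _))).
rewrite mxrank1 mulmx1 in ab trM.
have trE : \tr (M i j l) = t i * t j / t l * tr l (dbl (so i) (so j)).
  by rewrite /tr mulr_sumr; apply: eq_bigr => m _; rewrite mxE.
exists (a%:Z - b%:Z).
  rewrite /N -ab; apply: le_trans (ler_normB _ _) _.
  by rewrite !ger0_norm // PoszD.
split=> [|abN iota].
  rewrite rmorphB /= -!pmulrn -trM trE mulrA [X in X * _](_ : _ = 1) ?mul1r //.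
  by field; rewrite !t0.
have b0 : b = 0%N.
  apply/eqP; move: abN; rewrite /N -ab PoszD => /eqP.
  rewrite subr_eq -addrA -{1}[Posz a]addr0 (inj_eq (addrI _)) -PoszD eq_sym.
  by rewrite eqz_nat addn_eq0 andbb.
have M1 : M i j l = 1%:M.
  pose P := 2^-1 *: (1%:M - M i j l).
  have PP : P *m P = P.
    have QQ : (1%:M - M i j l) *m (1%:M - M i j l) = 2%:R *: (1%:M - M i j l).
      by rewrite mulmxBl !mulmxBr !mulmx1 !mul1mx M_invol opprB scaler_nat mulr2n.
    by rewrite /P -scalemxAl -scalemxAr QQ !scalerA; congr (_ *: _); field.
  have := mxtrace_idempotent PP.
  rewrite mxtraceZ raddfB /= mxtrace1 trM b0 subr0 -[in X in X%:R - _]ab b0 addn0 subrr mulr0.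
  move/esym/eqP; rewrite (pcharf0P k).1 // mxrank_eq0 scaler_eq0 invr_eq0 (negPf k2) /=.
  by rewrite subr_eq0 => /eqP.
rewrite [LHS](@inc_expand k B hS) [X in _ = _ *: X](@inc_expand k B hS) scaler_sumr.
apply: eq_bigr => m _; rewrite scalerA; congr (_ *: _).
rewrite compA (sc_split (hC := hS)) //.
rewrite (bigD1 m) //= big1 ?addr0 => [|n nm].
  congr (_ * _); have := congr1 (fun A : 'M_(_) => A m m) M1; rewrite !mxE eqxx => h.
  rewrite -[sc _]mul1r -[1 * _](_ : t l / (t i * t j) * (t i * t j / t l * sc (prj m \oc dbl (so i) (so j) \oc inc m)) = _).
    by rewrite h mulr1.
  by field; rewrite !t0.
have := congr1 (fun A : 'M_(_) => A m n) M1; rewrite !mxE eq_sym (negPf nm) => /eqP.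
by rewrite !mulf_eq0 invr_eq0 !(negPf (t0 _)) /= => /eqP->; rewrite mul0r.
Qed.

Definition T i j l : int := s2val (sign_trace i j l).
Lemma T_le i j l : `|T i j l| <= (N i j l)%:Z. Proof. exact: (s2valP (sign_trace i j l)). Qed.
Lemma T_tr i j l : tr l (dbl (so i) (so j)) = t l / (t i * t j) * (T i j l)%:~R.
Proof. exact: (s2valP' (sign_trace i j l)).1. Qed.
Lemma T_max i j l (iota : Hom (so l) (so i \ox so j)) : T i j l = (N i j l)%:Z ->
  dbl (so i) (so j) \oc iota = (t l / (t i * t j)) *: iota.
Proof. by move=> h; apply: (s2valP' (sign_trace i j l)).2. Qed.

Notation delta i := (t i * tau (so i)).

Lemma delta_mul i j : \sum_l (T i j l)%:~R * delta l = delta i * delta j.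
Proof.
have -> : delta i * delta j = t i * t j * (tau (so i) * tau (so j)) by ring.
rewrite tauM // mulr_sumr; apply: eq_bigr => l _; rewrite T_tr.
by field; rewrite !t0.
Qed.

(** The transpose of the system [delta_mul], obtained by rotation ([trace_dblV]). Both systems
    together make the values real at every complex embedding. *)
Lemma delta_mulT j p : \sum_i (T i p j)%:~R * delta i = delta j * delta p.
Proof.
have -> : delta j * delta p = t j / t p * (tau (so j) * taum (so p)).
  have -> : taum (so p) = t p ^+ 2 * tau (so p) by rewrite t2 divfK ?so_tau_neq0.
  by field; rewrite !t0.
rewrite -trace_dblV mulr_sumr; apply: eq_bigr => i _.
have -> : tr j (dblV (so i) (so p)) =
    omega i * omega p / omega j * tr j (dbl (so i) (so p)).
  rewrite /tr mulr_sumr; apply: eq_bigr => m _.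
  by rewrite -compA (dblV_scalar _ (so_simple i) (so_simple p)) compZr (scZ hS) // compA.
by rewrite T_tr -!t2; field; rewrite !t0.
Qed.

(** With D the sum of squares, the regular element, the sum of the d z [z], squares to D times
    itself and commutes with the involution ltwist / t i. So the trace of their product on the class
    space of [so i] is D times an integer [m i]. Weighting by tau (so i) and summing over i retains,
    by [trace_lact_twist], only the unit in the regular element. *)
Lemma delta_sqr (d : 'I_r -> k) : (forall i j, \sum_l (N i j l)%:R * d l = d i * d j) ->
  d e = 1 -> (forall i, d (st i) = d i) -> \sum_i d i ^+ 2 != 0 ->
  exists m : 'I_r -> int,
    \sum_i delta i ^+ 2 = (\sum_i d i ^+ 2) * \sum_i (m i)%:~R * delta i.
Proof.
move=> dM de dst D0; set D := \sum_i d i ^+ 2 in D0 *.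
have k2 : (2%:R : k) != 0 by apply: natr0_neq0.
have dd u : \sum_z \sum_z' d z * d z' * (N z z' u)%:R = D * d u.
  rewrite /D mulr_suml; apply: eq_bigr => z _.
  rewrite expr2 -{3}[d z]dst -mulrA -dM mulr_sumr; apply: eq_bigr => z' _.
  rewrite -mulrA; congr (_ * _); rewrite mulrC; congr (_%:R * _).
  by rewrite (N_comm k0 (st z)) N_frob // (N_comm k0 z).
have tr_int i : exists m : int,
    \sum_x \sum_y (ltwist x y / t i) * (\sum_z d z * @lact k B hB i z y x) = D * m%:~R.
  apply: (involution_trace_int k2 D0) => [x z|x z|x z].
  - rewrite (eq_bigr (fun y => (t i ^+ 2)^-1 * (ltwist x y * ltwist y z))) => [|y _].
      by rewrite -mulr_sumr ltwistM // -t2 mulKf // expf_neq0.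
    by field; rewrite t0.
  - rewrite (eq_bigr (fun y => \sum_z' \sum_z'' d z'' * d z' *
      (@lact k B hB i z' x y * lact z'' y z))) => [|y _]; last first.
      rewrite mulr_suml; apply: eq_bigr => z' _; rewrite mulr_sumr; apply: eq_bigr => z'' _.
      by ring.
    rewrite exchange_big mulr_sumr /=.
    rewrite (eq_bigr (fun z' => \sum_z'' \sum_u d z'' * d z' * ((N z'' z' u)%:R * @lact k B hB i u x z)))
      => [|z' _]; last first.
      rewrite exchange_big /=; apply: eq_bigr => z'' _.
      by rewrite -mulr_sumr lactM // mulr_sumr.
    rewrite exchange_big /=.
    rewrite (eq_bigr (fun z'' => \sum_u \sum_z' d z'' * d z' * (N z'' z' u)%:R * @lact k B hB i u x z)) => [|z'' _].
      rewrite exchange_big /=; apply: eq_bigr => u _; rewrite mulrA -dd mulr_suml.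
      by apply: eq_bigr => z'' _; rewrite mulr_suml.
    by rewrite exchange_big /=; apply: eq_bigr => u _; apply: eq_bigr => z' _; rewrite mulrA.
  rewrite (eq_bigr (fun y => \sum_z' d z' / t i * (ltwist x y * @lact k B hB i z' y z))) => [|y _];
    last by rewrite mulr_sumr; apply: eq_bigr => z' _; ring.
  rewrite [RHS](eq_bigr (fun y => \sum_z' d z' / t i * (@lact k B hB i z' x y * ltwist y z))) => [|y _];
    last by rewrite mulr_suml; apply: eq_bigr => z' _; ring.
  rewrite exchange_big [RHS]exchange_big /=; apply: eq_bigr => z' _.
  by rewrite -!mulr_sumr ltwist_lact.
pose m i := sval (cid (tr_int i)); exists m.
have mE i := svalP (cid (tr_int i)); rewrite -/(m _) in mE.
have -> : \sum_i delta i ^+ 2 = \sum_j tau (so j) * taum (so j).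
  apply: eq_bigr => j _; rewrite exprMn t2; field; exact: so_tau_neq0.
transitivity (\sum_z d z * ((z == e)%:R * \sum_j tau (so j) * taum (so j))).
  by rewrite [RHS](bigD1 e) //= eqxx de !mul1r [X in _ + X]big1 ?addr0 // => z /negPf->; rewrite mul0r mulr0.
rewrite (eq_bigr (fun z => \sum_i d z * (tau (so i) *
    \sum_x \sum_y @lact k B hB i z x y * ltwist y x))) => [|z _]; last first.
  by rewrite -trace_lact_twist // mulr_sumr.
rewrite exchange_big mulr_sumr /=; apply: eq_bigr => i _.
rewrite mulrA -mE mulr_suml (eq_bigr (fun z => \sum_x \sum_y tau (so i) * d z * (@lact k B hB i z x y * ltwist y x)))
  => [|z _]; last first.
  rewrite mulrA mulr_sumr; apply: eq_bigr => x _; rewrite mulr_sumr; apply: eq_bigr => y _.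
  by rewrite [d z * _]mulrC.
rewrite exchange_big /= (eq_bigr (fun x => \sum_y \sum_z tau (so i) * d z * (@lact k B hB i z x y * ltwist y x)))
  => [|x _]; last by rewrite exchange_big.
rewrite exchange_big /=; apply: eq_bigr => y _.
rewrite mulr_suml; apply: eq_bigr => x _; rewrite mulr_sumr mulr_suml; apply: eq_bigr => z _.
by field; rewrite t0.
Qed.
End Signs.
End Numbers.

Lemma eigen_root (F : fieldType) n (Z : 'I_n -> 'I_n -> int) (y : 'I_n -> F) lam :
  (exists j, y j != 0) -> (forall j, \sum_l (Z j l)%:~R * y l = lam * y j) ->
  root (map_poly intr (char_poly (\matrix_(l, j) Z j l))) lam.
Proof.
move=> [j0 yj0] yZ; rewrite map_char_poly /= -eigenvalue_root_char.
apply/eigenvalueP; exists (\row_j y j).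
  apply/rowP => j; rewrite !mxE -yZ; apply: eq_bigr => l _; rewrite !mxE; exact: mulrC.
by apply/eqP => /rowP/(_ j0)/eqP; rewrite !mxE (negPf yj0).
Qed.

Lemma monic_root_Aint (L : fieldType) (Q : {poly int}) (x : L) (f : {rmorphism L -> algC}) :
  Q \is monic -> root (map_poly intr Q) x -> f x \in Aint.
Proof.
move=> mQ Qx; apply: (@root_monic_Aint (map_poly intr Q)).
- have -> : map_poly intr Q = map_poly f (map_poly intr Q) :> {poly algC}.
    by rewrite -map_poly_comp; apply: eq_map_poly => c /=; rewrite rmorph_int.
  by rewrite fmorph_root.
- exact: monic_map.
- by apply/polyOver_poly => i _; apply: intr_int.
Qed.

Section FusionNumbers.
Variables (k : closedFieldType) (k0 : [pchar k] =i pred0).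
Variables (B : bmoncat k) (hB : fusion B).
Notation hS := (fusion_fss hB).
Notation so := (@so k B hB).
Notation tau := (tau hB).
Notation taum := (taum hB).
Notation r := (rk hB).
Notation e := (i0 hB).
Notation omega i := (taum (so i) / tau (so i)).
Notation N := (@N k B hB).
Notation st := (@star k B hB).
Hint Resolve so_simple S_simple : core.
Let FR := N_rules k0 hB.

(* The Frobenius-Perron dimensions [fd] live in a number field [fL], through which they are
   transported to [k]; [fth] is the twist. By [feig] the eigenvalues in [k] of the operators
   of multiplication by a simple object are images of algebraic integers of [fL]. *)
Record fusion_numbers := FusionNumbers {
  fL : splittingFieldType rat;
  fpsi : {rmorphism fL -> algC};
  fphi : {rmorphism fL -> k};
  fgal : galois 1 {:fL};
  fd : 'I_r -> algC;
  fd_gt0 : forall i, 0 < fd i;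
  fd_mul : forall i j, \sum_l (N i j l)%:R * fd l = fd i * fd j;
  fd_e : fd e = 1;
  fd_st : forall i, fd (st i) = fd i;
  fdL : 'I_r -> fL;
  fpsi_d : forall i, fpsi (fdL i) = fd i;
  fdL_int : forall i (f : {rmorphism fL -> algC}), f (fdL i) \in Aint;
  fth : 'I_r -> k;
  fth_tau : forall i, fth i * tau (so i) = fphi (fdL i);
  fth_sqr : forall i, fth i ^+ 2 = omega i;
  fdbl : forall i j l (iota : Hom (so l) (so i \ox so j)),
    dbl (so i) (so j) \oc iota = (fth l / (fth i * fth j)) *: iota;
  feig : forall i (y : 'I_r -> k) lam, (exists j, y j != 0) ->
    (forall j, \sum_l (N i j l)%:R * y l = lam * y j) ->
    exists2 x, fphi x = lam &
      forall f : {rmorphism fL -> algC}, f x \in Aint /\ `|f x| <= fd i }.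

(** Equality of the squares of loop values and dimensions comes from the norm argument. The signs
    are then absorbed into the choice of the square roots [th], and with that choice positivity of
    the dimensions gives T = N, so that [T_max] applies. *)
Lemma fusion_numbers_exist (D : nat) :
  (forall d : 'I_r -> algC, (forall i, 0 < d i) ->
    (forall i j, \sum_l (N i j l)%:R * d l = d i * d j) ->
    \sum_i d i ^+ 2 = D%:R) -> inhabited fusion_numbers.
Proof.
move=> dD; have [d [dp dM de dst]] := FP_exists FR; have {}dD := dD d dp dM.
have D0 : (0 < D)%N.
  by rewrite -(ltr0n algC) -dD (bigD1 e) //= ltr_pwDl ?exprn_gt0 // sumr_ge0 // => i _; rewrite exprn_ge0 // ltW.
have sqrt_ex (a : k) : exists b, b ^+ 2 = a.
  have [b rb] : exists b, root ('X^2 - a%:P) b by apply/closed_rootP; rewrite size_XnsubC.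
  by exists b; move: rb; rewrite /root !hornerE subr_eq0 => /eqP.
pose t i := sval (cid (sqrt_ex (omega i))).
have t2 i : t i ^+ 2 = omega i := svalP (cid (sqrt_ex (omega i))).
have t0 i : t i != 0 by rewrite -sqrf_eq0 t2 mulf_neq0 ?invr_eq0 ?so_tau_neq0 ?so_taum_neq0.
pose delta i := t i * tau (so i).
have delta0 i : delta i != 0 by rewrite mulf_neq0 ?so_tau_neq0.
pose Tm := T k0 t2.
pose PN i := char_poly (\matrix_(l, j) (N i j l)%:Z : 'M[int]_r).
pose PT p := char_poly (\matrix_(l, j) (Tm j p l) : 'M[int]_r).
(* The roots of [Q] include the eigenvalues of all matrices of [N] and of [Tm], so a single number
   field carries dimensions, loop values and characters. *)
pose Q : {poly int} := (\prod_i PN i) * \prod_p PT p.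
have mQ : Q \is monic.
  by rewrite /Q rpredM ?rpred_prod // => i _; apply: char_poly_monic.
have rootN (F : fieldType) i (y : 'I_r -> F) lam : (exists j, y j != 0) ->
    (forall j, \sum_l (N i j l)%:R * y l = lam * y j) -> root (map_poly intr Q) lam.
  move=> y0 yN; rewrite /Q rmorphM rootM (bigD1 i) //= rmorphM rootM.
  rewrite (@eigen_root F r (fun j l => (N i j l)%:Z) y) // => j.
have rootT (F : fieldType) p (y : 'I_r -> F) lam : (exists j, y j != 0) ->
    (forall j, \sum_l (Tm j p l)%:~R * y l = lam * y j) -> root (map_poly intr Q) lam.
  move=> y0 yN; rewrite /Q rmorphM rootM orbC (bigD1 p) //= rmorphM rootM.
  by rewrite (@eigen_root F r (fun j l => Tm j p l) y).
have [L [psi [phi [gal liftC liftk]]]] := number_field k0 mQ.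
have dex i : exists2 y, psi y = d i & root (map_poly intr Q) y.
  apply: liftC; apply: (rootN _ i d) => //; exists e; exact: lt0r_neq0.
pose dL i := s2val (cid2 (dex i)).
have dLE i : psi (dL i) = d i := s2valP (cid2 (dex i)).
have dLr i : root (map_poly intr Q) (dL i) := s2valP' (cid2 (dex i)).
have dLM i j : \sum_l (N i j l)%:R * dL l = dL i * dL j.
  apply: (fmorph_inj psi); rewrite rmorph_sum rmorphM /= !dLE -dM; apply: eq_bigr => l _.
  by rewrite rmorphM rmorph_nat dLE.
have dLe : dL e = 1 by apply: (fmorph_inj psi); rewrite dLE de rmorph1.
have dLst i : dL (st i) = dL i by apply: (fmorph_inj psi); rewrite !dLE dst.
have dLD : \sum_i dL i ^+ 2 = D%:R.
  apply: (fmorph_inj psi); rewrite rmorph_nat -dD rmorph_sum; apply: eq_bigr => i _.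
  by rewrite rmorphXn /= dLE.
have deltaM i j : \sum_l (Tm i j l)%:~R * delta l = delta i * delta j by apply: delta_mul.
have xex p : exists2 y, phi y = delta p & root (map_poly intr Q) y.
  apply: liftk; apply: (rootT _ p delta) => [|j]; first by exists e.
  by rewrite deltaM mulrC.
pose xL i := s2val (cid2 (xex i)).
have xLE i : phi (xL i) = delta i := s2valP (cid2 (xex i)).
have xLr i : root (map_poly intr Q) (xL i) := s2valP' (cid2 (xex i)).
have xLM i j : \sum_l (Tm i j l)%:~R * xL l = xL i * xL j.
  apply: (fmorph_inj phi); rewrite rmorph_sum rmorphM /= !xLE -deltaM; apply: eq_bigr => l _.
  by rewrite rmorphM rmorph_int xLE.
have xLMT j p : \sum_i (Tm i p j)%:~R * xL i = xL j * xL p.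
  apply: (fmorph_inj phi); rewrite rmorph_sum rmorphM /= !xLE -(delta_mulT k0 t2); apply: eq_bigr => i _.
  by rewrite rmorphM rmorph_int xLE.
have fx0 (f : {rmorphism L -> algC}) i : f (xL i) != 0.
  by rewrite fmorph_eq0 -(fmorph_eq0 phi) xLE.
have TN j p l : `|(Tm j p l)%:~R : algC| <= (N p j l)%:R.
  by rewrite -intr_norm [X in _ <= X]pmulrn -(N_comm k0) ler_int; apply: T_le.
have xle (f : {rmorphism L -> algC}) p : `|f (xL p)| <= d p.
  apply: (FP_bound dp dM (M := fun j l => (Tm j p l)%:~R) (y := fun j => f (xL j))).
  - by move=> j l; apply: TN.
  - by exists e.
  move=> j; rewrite mulrC -rmorphM -xLM rmorph_sum; apply: eq_bigr => l _.
  by rewrite rmorphM rmorph_int.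
(* Let s > 0 be the sum of the |x i|^2. The two systems express x p s and its complex conjugate by
   the same double sum. *)
have xreal (f : {rmorphism L -> algC}) p : f (xL p) \is Num.real.
  pose x i := f (xL i).
  have x1 j : \sum_l (Tm j p l)%:~R * x l = x j * x p.
    by rewrite /x -rmorphM -xLM rmorph_sum; apply: eq_bigr => l _; rewrite rmorphM rmorph_int.
  have x2 j : \sum_i (Tm i p j)%:~R * x i = x j * x p.
    by rewrite /x -rmorphM -xLMT rmorph_sum; apply: eq_bigr => l _; rewrite rmorphM rmorph_int.
  have s0 : \sum_i x i * (x i)^* != 0.
    apply: lt0r_neq0; rewrite (bigD1 e) //= ltr_pwDl // ?mul_conjC_gt0 ?fx0 //.
    by rewrite sumr_ge0 // => i _; apply: mul_conjC_ge0.
  have e1 : x p * \sum_i x i * (x i)^* = \sum_i \sum_l (Tm i p l)%:~R * x l * (x i)^*.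
    rewrite mulr_sumr; apply: eq_bigr => i _; rewrite -mulr_suml x1; ring.
  have e2 : x p * \sum_i x i * (x i)^* = \sum_i \sum_l (Tm i p l)%:~R * x i * (x l)^*.
    rewrite exchange_big mulr_sumr; apply: eq_bigr => l _; rewrite -mulr_suml x2; ring.
  have e3 : (x p)^* * \sum_i x i * (x i)^* = x p * \sum_i x i * (x i)^*.
    have sE : (\sum_i x i * (x i)^*)^* = \sum_i x i * (x i)^*.
      by rewrite rmorph_sum; apply: eq_bigr => i _; rewrite rmorphM /= conjCK mulrC.
    rewrite [RHS]e2 -{1}sE -rmorphM e1 rmorph_sum; apply: eq_bigr => i _.
    rewrite rmorph_sum; apply: eq_bigr => l _; rewrite !rmorphM /= conjCK rmorph_int; ring.
  by apply/CrealP; apply: (mulIf s0).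
pose dk i := phi (dL i).
have dkM i j : \sum_l (N i j l)%:R * dk l = dk i * dk j.
  by rewrite /dk -rmorphM -dLM rmorph_sum; apply: eq_bigr => l _; rewrite rmorphM rmorph_nat.
have dkD : \sum_i dk i ^+ 2 = D%:R.
  by rewrite -(rmorph_nat phi) -dLD rmorph_sum; apply: eq_bigr => i _; rewrite rmorphXn.
have Dk0 : (D%:R : k) != 0 by rewrite (pcharf0P k).1 // -lt0n.
have [m dm] : exists m : 'I_r -> int, \sum_i delta i ^+ 2 = (\sum_i dk i ^+ 2) * \sum_i (m i)%:~R * delta i.
  apply: (delta_sqr k0 t2 (d := dk)) => //; rewrite ?dkD //.
    by rewrite /dk dLe rmorph1.
  by move=> i; rewrite /dk dLst.
(* The quotient of the sum of the squared loop values by D, presented as an algebraic integer. *)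
pose x := \sum_i (m i)%:~R * xL i.
have xD : \sum_i xL i ^+ 2 = D%:R * x.
  apply: (fmorph_inj phi); rewrite rmorphM rmorph_nat /x !rmorph_sum -dkD.
  rewrite [RHS](_ : _ = (\sum_i dk i ^+ 2) * \sum_i (m i)%:~R * delta i).
    by rewrite -dm; apply: eq_bigr => i _; rewrite rmorphXn /= xLE.
  by congr (_ * _); apply: eq_bigr => i _; rewrite rmorphM rmorph_int /= xLE.
have Dpos : 0 < D%:R :> algC by rewrite ltr0n.
have fsq (f : {rmorphism L -> algC}) i : 0 < f (xL i) ^+ 2 /\ f (xL i) ^+ 2 <= d i ^+ 2.
  have s : f (xL i) ^+ 2 = `|f (xL i)| ^+ 2 by rewrite real_normK.
  by rewrite s exprn_gt0 ?normr_gt0 // ler_pXn2r ?nnegrE ?xle // ltW.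
have fxE (f : {rmorphism L -> algC}) : D%:R * f x = \sum_i f (xL i) ^+ 2.
  by rewrite -(rmorph_nat f) -rmorphM -xD rmorph_sum; apply: eq_bigr => i _; rewrite rmorphXn.
have fx_gt0 (f : {rmorphism L -> algC}) : 0 < f x.
  rewrite -(pmulr_rgt0 _ Dpos) fxE (bigD1 e) //= ltr_pwDl ?(fsq f _).1 //.
  by rewrite sumr_ge0 // => i _; rewrite ltW // (fsq f _).1.
have fx_le1 (f : {rmorphism L -> algC}) : `|f x| <= 1.
  rewrite gtr0_norm // -(ler_pM2l Dpos) fxE mulr1 -dD; apply: ler_sum => i _.
  exact: (fsq f i).2.
have fx_int (f : {rmorphism L -> algC}) : f x \in Aint.
  rewrite rmorph_sum rpred_sum // => i _; rewrite rmorphM rmorph_int rpredM ?Aint_int //.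
  exact: monic_root_Aint mQ (xLr i).
have x0 : x != 0 by rewrite -(fmorph_eq0 psi) lt0r_neq0.
have psix : psi x = 1 by rewrite -(norm_ge1 gal x0 (fx_int psi) fx_int fx_le1) gtr0_norm.
have xsq i : xL i ^+ 2 = dL i ^+ 2.
  apply: (fmorph_inj psi); rewrite !rmorphXn /= dLE; apply/eqP; rewrite eq_sym -subr_eq0.
  have : \sum_i (d i ^+ 2 - psi (xL i) ^+ 2) == 0 by rewrite sumrB dD -fxE psix mulr1 subrr.
  rewrite psumr_eq0 => [/allP/(_ i)|j _]; first by rewrite mem_index_enum; apply.
  by rewrite subr_ge0 (fsq psi j).2.
(* This is [t i] up to sign, normalised so that the loop value becomes the dimension itself. *)
pose th i := dk i / tau (so i).
have thE i : th i * tau (so i) = dk i by rewrite divfK ?so_tau_neq0.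
have th2 i : th i ^+ 2 = omega i.
  rewrite /th expr_div_n /dk -rmorphXn -xsq rmorphXn /= xLE /delta exprMn t2.
  by field; rewrite so_tau_neq0.
have dlt i : th i * tau (so i) = phi (dL i) by exact: thE.
(* The difference of the two product formulas pairs the nonnegative N - T with the positive
   dimensions to 0. *)
have TE i j l : T k0 th2 i j l = (N i j l)%:Z.
  have tM : \sum_l ((N i j l)%:R - (T k0 th2 i j l)%:~R) * dL l = 0.
    apply: (fmorph_inj phi); rewrite rmorph0 rmorph_sum.
    transitivity (\sum_l (N i j l)%:R * dk l - \sum_l (T k0 th2 i j l)%:~R * (th l * tau (so l))).
      rewrite -sumrB; apply: eq_bigr => l' _.
      by rewrite thE rmorphM rmorphB rmorph_nat rmorph_int mulrBl.
    by rewrite delta_mul dkM !thE subrr.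
  have : \sum_l ((N i j l)%:R - (T k0 th2 i j l)%:~R) * d l == 0.
    apply/eqP; transitivity (psi (\sum_l ((N i j l)%:R - (T k0 th2 i j l)%:~R) * dL l)).
      rewrite rmorph_sum; apply: eq_bigr => l' _.
      by rewrite rmorphM rmorphB rmorph_nat rmorph_int dLE.
    by rewrite tM rmorph0.
  rewrite psumr_eq0 => [/allP/(_ l)|l' _].
    rewrite mem_index_enum mulf_eq0 (gt_eqF (dp l)) orbF subr_eq0 => /(_ isT)/eqP h.
    by apply: (@intr_inj algC); rewrite -h.
  rewrite mulr_ge0 ?(ltW (dp _)) // subr_ge0 [X in _ <= X]pmulrn ler_int.
  by apply: le_trans (ler_norm _) _; apply: T_le.
constructor; apply: (@FusionNumbers L psi phi gal d dp dM de dst dL dLE _ th dlt th2).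
- by move=> i f; apply: monic_root_Aint mQ (dLr i).
- by move=> i j l iota; apply: (T_max (k0 := k0) (t2 := th2)).
(* Every complex image of a lift of the eigenvalue is an eigenvalue of the same integer matrix, so
   [FP_bound] applies to it. *)
move=> i y lam y0 yN; have [x' xl xr] := liftk _ (rootN _ i y lam y0 yN).
exists x' => // f; split; first exact: monic_root_Aint mQ xr.
have rk : root (map_poly intr (PN i)) lam by apply: (@eigen_root k r (fun j l => (N i j l)%:Z) y).
have mapint (F : fieldType) (g : {rmorphism L -> F}) :
    map_poly g (map_poly intr (PN i)) = map_poly intr (PN i).
  by rewrite -map_poly_comp; apply: eq_map_poly => c /=; rewrite rmorph_int.
have : root (map_poly intr (PN i)) (f x').
  by rewrite -(mapint _ f) fmorph_root -(fmorph_root phi) mapint xl.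
rewrite map_char_poly /= -eigenvalue_root_char => /eigenvalueP[v vE v0].
apply: (FP_bound dp dM (M := fun j l => (N i j l)%:R) (y := fun j => v 0 j)).
- by move=> j l; rewrite normr_nat.
- by apply/existsP; rewrite -negb_forall; apply: contra v0 => /forallP z; apply/eqP/rowP => a; rewrite mxE; apply/eqP.
move=> j; have := congr1 (fun u : 'rV_r => u 0 j) vE; rewrite !mxE => <-.
by apply: eq_bigr => a _; rewrite !mxE mulrC.
Qed.
End FusionNumbers.

(** * The S-matrix and the characters of the fusion ring *)

Section Characters.
Variables (k : closedFieldType) (k0 : [pchar k] =i pred0).
Variables (B : bmoncat k) (hB : fusion B).
Notation hS := (fusion_fss hB).
Notation so := (@so k B hB).
Notation du := (du hB).
Notation tau := (tau hB).
Notation taum := (taum hB).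
Notation r := (rk hB).
Notation e := (i0 hB).
Notation omega i := (taum (so i) / tau (so i)).
Notation N := (@N k B hB).
Notation st := (@star k B hB).
Hint Resolve so_simple S_simple : core.
Let FR := N_rules k0 hB.
Variable F : fusion_numbers hB.
Notation L := (fL F).
Notation psi := (fpsi F).
Notation phi := (fphi F).
Notation d := (fd F).
Notation dL := (fdL F).
Notation th := (fth F).
Let sun : simple (unit_ob B) := unit_simple hB.
Hint Resolve sun : core.

Definition dk i : k := phi (dL i).

Lemma dL_neq0 i : dL i != 0.
Proof. by rewrite -(fmorph_eq0 psi) fpsi_d; apply: lt0r_neq0; apply: fd_gt0. Qed.
Lemma dk_neq0 i : dk i != 0. Proof. by rewrite fmorph_eq0 dL_neq0. Qed.

Lemma dL_mul i j : \sum_l (N i j l)%:R * dL l = dL i * dL j.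
Proof.
apply: (fmorph_inj psi); rewrite rmorph_sum rmorphM /= !fpsi_d -fd_mul.
by apply: eq_bigr => l _; rewrite rmorphM rmorph_nat fpsi_d.
Qed.
Lemma dk_mul i j : \sum_l (N i j l)%:R * dk l = dk i * dk j.
Proof.
rewrite /dk -rmorphM -dL_mul rmorph_sum; apply: eq_bigr => l _.
by rewrite rmorphM rmorph_nat.
Qed.
Lemma dL_e : dL e = 1.
Proof. by apply: (fmorph_inj psi); rewrite fpsi_d fd_e rmorph1. Qed.
Lemma dk_e : dk e = 1. Proof. by rewrite /dk dL_e rmorph1. Qed.
Lemma dL_st i : dL (st i) = dL i.
Proof. by apply: (fmorph_inj psi); rewrite !fpsi_d fd_st. Qed.
Lemma dk_st i : dk (st i) = dk i. Proof. by rewrite /dk dL_st. Qed.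

Lemma th_neq0 i : th i != 0.
Proof. by have := dk_neq0 i; rewrite /dk -fth_tau mulf_eq0 negb_or => /andP[]. Qed.
Lemma tauE i : tau (so i) = dk i / th i.
Proof. by rewrite /dk -fth_tau; field; rewrite th_neq0. Qed.
Lemma taumE i : taum (so i) = dk i * th i.
Proof.
have -> : taum (so i) = th i ^+ 2 * tau (so i) by rewrite fth_sqr divfK ?so_tau_neq0.
by rewrite tauE; field; rewrite th_neq0.
Qed.

Lemma tr_dbl i j l : @tr k B hS _ l (dbl (so i) (so j)) = (N i j l)%:R * (th l / (th i * th j)).
Proof.
rewrite /tr (eq_bigr (fun=> th l / (th i * th j))) => [|m _].
  by rewrite sumr_const card_ord mulr_natl.
by rewrite -compA (fdbl F) compZr prj_inc eqxx scale1r (scZ hS) // (sc1 hS) // mulr1.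
Qed.

Lemma dblV_so i j l (iota : Hom (so l) (so i \ox so j)) :
  dblV (so i) (so j) \oc iota = (th i * th j / th l) *: iota.
Proof.
have := fdbl F iota; move/(congr1 (fun f => dblV (so i) (so j) \oc f)).
rewrite compA dblK comp1m compZr => h.
rewrite [in RHS]h scalerA -[LHS]scale1r; congr (_ *: _).
by field; rewrite !th_neq0.
Qed.

(** The unnormalised S-matrix, given by the balancing equation; [smxV] is its mirror image, with
    inverted twists. *)
Definition smx w z : k := \sum_l (N w z l)%:R * (th l / (th w * th z)) * dk l.
Definition smxV w z : k := \sum_l (N w z l)%:R * (th w * th z / th l) * dk l.

Lemma smx_sym w z : smx w z = smx z w.
Proof.
by apply: eq_bigr => l _; rewrite (N_comm k0) [th w * _]mulrC.
Qed.
Lemma smxV_sym w z : smxV w z = smxV z w.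
Proof.
by apply: eq_bigr => l _; rewrite (N_comm k0) [th w * _]mulrC.
Qed.

Lemma ev_loop_smx w z : ev_loop hB (so w) (so z) = smx w z / (dk w * th z).
Proof.
apply: (mulIf (so_tau_neq0 w)).
rewrite ptr_tens // [X in _ = _ / _ * X]tauE.
have -> : smx w z / (dk w * th z) * (dk w / th w) = smx w z * (th w * th z)^-1.
  by field; rewrite dk_neq0 !th_neq0.
rewrite /smx mulr_suml; apply: eq_bigr => l _.
have -> : tr l (dbl (so w) (so z) \oc dbl (so w) (so z)) =
    th l / (th w * th z) * @tr k B hS _ l (dbl (so w) (so z)).
  rewrite /tr mulr_sumr; apply: eq_bigr => m _.
  by rewrite -compA -compA (fdbl F) !compZr (scZ hS) // compA.
by rewrite tr_dbl tauE; field; rewrite !th_neq0.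
Qed.

Lemma ev_loop_smxV w z : @ev_loop k (brev B) hB (so w) (so z) = smxV w z * th z / dk w.
Proof.
have := @ptr_tens k (brev B) hB (so w) (so z) (dblV (so w) (so z)) (so_simple w).
rewrite -/(@ev_loop k (brev B) hB (so w) (so z)) (tauV hB) // => h.
apply: (mulIf (so_taum_neq0 w)); rewrite h taumE.
have -> : smxV w z * th z / dk w * (dk w * th w) = smxV w z * (th w * th z).
  by field; rewrite dk_neq0.
rewrite /smxV mulr_suml; apply: eq_bigr => l _.
have -> : @tr k B hS _ l (dblV (so w) (so z) \oc dblV (so w) (so z)) =
    (N w z l)%:R * (th w * th z / th l) ^+ 2.
  rewrite /tr (eq_bigr (fun=> (th w * th z / th l) ^+ 2)) => [|m _].
    by rewrite sumr_const card_ord mulr_natl.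
  rewrite -compA -compA dblV_so !compZr dblV_so compZr prj_inc eqxx scale1r.
  by rewrite !(scZ hS) // (sc1 hS) // mulr1.
by rewrite (tauV hB (so_simple l)) (taumE l); field; rewrite !th_neq0.
Qed.

(** The loop around [so w] is turned over by [ev_loop_dual]. *)
Lemma smx_dual w z : smx w z = smxV w (st z).
Proof.
have sW := so_simple w; have sZ := so_simple z.
have := ev_loop_dual hB sZ sW.
have -> : @ev_loop k (brev B) hB (so w) (du (so z)) =
    @ev_loop k (brev B) hB (so w) (so (st z)).
  rewrite !(@ev_loop_sum k (brev B) hB _ _ sW); apply: eq_bigr => u _.
  by rewrite (mult_isom k0 u (star_isom z)).
have -> : taum (du (so z)) = taum (so (st z)).
  have sd : simple (du (so z) : B) by apply: dual_simple.
  rewrite -(tauV hB sd) -(tauV hB (so_simple (st z))).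
  rewrite -!(@ev_loop_unit k (brev B) hB).
  rewrite !(@ev_loop_sum k (brev B) hB _ _ sun); apply: eq_bigr => u _.
  by rewrite (mult_isom k0 u (star_isom z)).
rewrite ev_loop_smx ev_loop_smxV tauE taumE dk_st => h.
have c0 : dk z * th (st z) / (dk w * th z) != 0.
  by rewrite !mulf_neq0 ?invr_eq0 ?mulf_neq0 ?dk_neq0 ?th_neq0.
apply: (mulIf c0).
have -> : smx w z * (dk z * th (st z) / (dk w * th z)) =
   smx w z / (dk w * th z) * (dk z * th (st z)) by rewrite mulrAC mulrA mulrAC; ring.
by rewrite h; field; rewrite dk_neq0 th_neq0.
Qed.

Definition chi w z : k := smx w z / dk w.

(** chi w u is th u times the value of a loop u around w. This factor absorbs the ratio of twists in
    [tr_dbl], so that [ev_loopM] is left with the coefficients [N]. *)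
Lemma chi_mul w y z : \sum_u (N y z u)%:R * chi w u = chi w y * chi w z.
Proof.
have chiE u : chi w u = th u * ev_loop hB (so w) (so u).
  by rewrite ev_loop_smx /chi; field; rewrite dk_neq0 th_neq0.
have := ev_loopM hB (so y) (so z) (so_simple w).
rewrite !chiE => h.
have -> : th y * ev_loop hB (so w) (so y) * (th z * ev_loop hB (so w) (so z)) =
  th y * th z * (ev_loop hB (so w) (so y) * ev_loop hB (so w) (so z)) by ring.
rewrite h mulr_sumr; apply: eq_bigr => u _; rewrite chiE tr_dbl.
by field; rewrite !th_neq0.
Qed.

Lemma chi_sym w z : chi w z * dk w = chi z w * dk z.
Proof. by rewrite /chi !divfK ?dk_neq0 // smx_sym. Qed.

Lemma smx_e w : smx w e = dk w / th e.
Proof.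
rewrite /smx (bigD1 w) //= (N_comm k0) (N_unit k0) eqxx mul1r big1 ?addr0 => [|l lw].
  by field; rewrite !th_neq0.
by rewrite (N_comm k0) (N_unit k0) // eq_sym (negPf lw) !mul0r.
Qed.

Lemma th_e : th e = 1.
Proof.
have X0 : chi e e != 0 by rewrite /chi smx_e !mulf_neq0 ?invr_eq0 ?dk_neq0 ?th_neq0.
have X1 : chi e e = 1.
  apply: (mulfI X0); rewrite mulr1 -chi_mul (bigD1 e) //= (N_unit k0) eqxx mul1r.
  by rewrite big1 ?addr0 // => u ue; rewrite (N_unit k0) eq_sym (negPf ue) mul0r.
have XE : chi e e = (th e)^-1 by rewrite /chi smx_e; field; rewrite dk_neq0 th_neq0.
by rewrite -[th e]invrK -XE X1 invr1.
Qed.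

Lemma chi_e w : chi w e = 1.
Proof. by rewrite /chi smx_e th_e divr1 divff ?dk_neq0. Qed.

Hypothesis nondeg : braiding_nondegenerate B.

(** The hypothesis makes the double braiding with [so l] trivial on every multiplicity space, so
    [so l] centralizes everything and lies in Vec by nondegeneracy. *)
Lemma transparent_unit l : (forall z u, (0 < N l z u)%N -> th u = th l * th z) -> l = e.
Proof.
move=> tl.
have d1 z : dbl (so l) (so z) = idm _.
  apply: (@hom_ext k B hS) => u x; rewrite comp1m (fdbl F).
  have [->|/eqP xn] := eqVneq x 0; first by rewrite scaler0.
  have Npos : (0 < N l z u)%N.
    rewrite lt0n; apply/eqP => n0; apply: xn.
    rewrite (@inc_expand k B hS _ _ x) big1 // => m _.
    by have := leq_ltn_trans (leq0n _) (ltn_ord m); rewrite -/(N l z u) n0.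
  by rewrite (tl _ _ Npos) divff ?scale1r // mulf_neq0 ?th_neq0.
have d2 (X : B) : simple X -> dbl X (so l) = idm _.
  move=> sX; have [z [f [g [gf fg]]]] := S_index hS sX.
  have h : dbl (so l) X = idm _.
    rewrite -[LHS]compm1 -lwh1 -gf lwhM compA dbl_natr (d1 z) compm1 -lwhM gf.
    by rewrite ?lwh1.
  apply: (iso_cancel_l (braid_iso X (so l))).
  by rewrite -dbl_braid h comp1m compm1.
have cl : centralizer (fun _ => True) (so l).
  move=> D hD; apply; split; first exact: so_simple.
  by move=> X _ sX; rewrite -dblE d2.
have /nondeg [n [i [p [pi1 pi0 ip]]]] := cl.
have [j ij] : exists j, i j <> 0.
  apply: contrapT => no; have := simple_id_neq0 (so_simple l); rewrite -ip big1 ?eqxx // => j _.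
  suff -> : i j = 0 by rewrite comp0m.
  by apply: contrapT => nz; apply: no; exists j.
have io := schur hS sun (so_simple l) ij.
apply: (S_inj (hC := hS) sun); first by exists (i j).
exact: un_i0.
Qed.

(** * Only the unit has the dimension function as its character *)

Section Flat.
Variable w : 'I_r.
Hypothesis flat_w : forall z, chi w z = dk z.

Let s1 z : smx w z = dk w * dk z.
Proof. by rewrite -(flat_w z) /chi mulrC divfK ?dk_neq0. Qed.
Let s2 z : smxV w z = dk w * dk z.
Proof. by rewrite -{1}(stK FR z) -smx_dual s1 dk_st. Qed.
Let s3 z : smx (st w) z = dk w * dk z.
Proof. by rewrite smx_sym smx_dual (stK FR) smxV_sym s2. Qed.
Let s4 z : smxV (st w) z = dk w * dk z.
Proof. by rewrite -{1}(stK FR z) -smx_dual s3 dk_st. Qed.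

Let eig1 v z : smx v z = dk v * dk z ->
  \sum_l (N v z l)%:R * (th l * dk l) = th v * dk v * (th z * dk z).
Proof.
move=> h; have -> : th v * dk v * (th z * dk z) = th v * th z * (dk v * dk z) by ring.
rewrite -h /smx mulr_sumr; apply: eq_bigr => l _.
by field; rewrite !th_neq0.
Qed.
Let eig2 v z : smxV v z = dk v * dk z ->
  \sum_l (N v z l)%:R * ((th l)^-1 * dk l) = (th v)^-1 * dk v * ((th z)^-1 * dk z).
Proof.
move=> h; have -> : (th v)^-1 * dk v * ((th z)^-1 * dk z) = (th v * th z)^-1 * (dk v * dk z).
  by rewrite invfM; ring.
rewrite -h /smxV mulr_sumr; apply: eq_bigr => l _.
by field; rewrite !th_neq0.
Qed.

(** x and y lift th v dk v and dk v / th v. Their product is [dL v ^+ 2], while both are bounded by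
    [d v] at [psi]; so both bounds are attained. *)
Let unit_mod v : (forall z, smx v z = dk v * dk z) -> (forall z, smxV v z = dk v * dk z) ->
  exists x, phi x = th v * dk v /\ `|psi x| = d v.
Proof.
move=> h1 h2.
have n1 : exists j, th j * dk j != 0 by exists e; rewrite mulf_neq0 ?th_neq0 ?dk_neq0.
have n2 : exists j, (th j)^-1 * dk j != 0.
  by exists e; rewrite mulf_neq0 ?invr_eq0 ?th_neq0 ?dk_neq0.
have [x xe xb] := feig F n1 (fun z => eig1 (h1 z)).
have [y ye yb] := feig F n2 (fun z => eig2 (h2 z)).
exists x; split=> //; apply/eqP; rewrite eq_le (xb psi).2 /=.
have xy : x * y = dL v ^+ 2.
  by apply: (fmorph_inj phi); rewrite rmorphM rmorphXn /= xe ye -/(dk v); field; rewrite th_neq0.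
have : `|psi x| * `|psi y| = d v ^+ 2.
  by rewrite -normrM -rmorphM xy rmorphXn /= fpsi_d ger0_norm // exprn_ge0 // ltW // fd_gt0.
move=> pxy; rewrite -(ler_pM2r (fd_gt0 F v)) -expr2 -pxy; apply: ler_wpM2l => //.
exact: (yb psi).2.
Qed.

(** Multiplication by the product of w and its dual ([M_st]), written as a Gram matrix and therefore
    positive semidefinite ([M_form]). *)
Let M (z u : 'I_r) : nat := (\sum_a N w a z * N w a u)%N.

Let M_sym z u : M z u = M u z.
Proof. by apply: eq_bigr => a _; rewrite mulnC. Qed.

Let M_st (z u : 'I_r) : M z u = (\sum_l N w (st w) l * N l z u)%N.
Proof.
rewrite N_assoc //; apply: eq_bigr => a _; congr (_ * _)%N.
by rewrite (N_comm k0 (st w)) N_frob // (N_comm k0).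
Qed.

Let M_eig (K : fieldType) (y : 'I_r -> K) (a b : K) :
  (forall z, \sum_l (N w z l)%:R * y l = a * y z) ->
  (forall z, \sum_l (N (st w) z l)%:R * y l = b * y z) ->
  forall z, \sum_u (M z u)%:R * y u = a * b * y z.
Proof.
move=> ya yb z; rewrite (eq_bigr (fun u => \sum_a0 (N w a0 z)%:R * ((N w a0 u)%:R * y u))) => [|u _].
  rewrite exchange_big /= (eq_bigr (fun l => a * ((N (st w) z l)%:R * y l))) => [|l _].
    by rewrite -mulr_sumr yb mulrA.
  rewrite -mulr_sumr ya mulrCA; congr (_ * (_%:R * _)).
  by rewrite (N_comm k0 (st w)) N_frob // (N_comm k0).
by rewrite natr_sum mulr_suml; apply: eq_bigr => l _; rewrite natrM mulrA.
Qed.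

Let M_form (y : 'I_r -> algC) :
  \sum_z \sum_u (M z u)%:R * y u * (y z)^* = \sum_a `|\sum_u (N w a u)%:R * y u| ^+ 2.
Proof.
rewrite (eq_bigr (fun z => \sum_a \sum_u (N w a z)%:R * (N w a u)%:R * y u * (y z)^*)) => [|z _].
  rewrite exchange_big /=; apply: eq_bigr => a _; rewrite normCK rmorph_sum mulr_sumr.
  apply: eq_bigr => z _; rewrite mulr_suml; apply: eq_bigr => u _.
  by rewrite rmorphM rmorph_nat; ring.
rewrite exchange_big /=; apply: eq_bigr => u _; rewrite natr_sum !mulr_suml.
by apply: eq_bigr => a _; rewrite natrM.
Qed.

Let M_d z : \sum_u (M z u)%:R * d u = d w ^+ 2 * d z.
Proof.
rewrite (M_eig (a := d w) (b := d w)) ?expr2 // => l; first exact: fd_mul.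
by rewrite fd_mul fd_st.
Qed.

(** The left side is the eigenvalue of [M] on the vector th dk. Its lift y is an eigenvalue at [psi]
    too, since a determinant over the number field vanishes. There semidefiniteness gives psi y >=
    0, and [unit_mod] gives the absolute value. *)
Let mulL : th w * dk w * (th (st w) * dk (st w)) = phi (dL w ^+ 2).
Proof.
have [x [xe xn]] := unit_mod s1 s2.
have s3' z : smx (st w) z = dk (st w) * dk z by rewrite s3 dk_st.
have s4' z : smxV (st w) z = dk (st w) * dk z by rewrite s4 dk_st.
have [x' [xe' xn']] := unit_mod s3' s4'.
have Mv := M_eig (fun z => eig1 (s1 z)) (fun z => eig1 (s3' z)).
rewrite -xe -xe' -rmorphM in Mv *; set y := x * x' in Mv *; congr (phi _).
pose ML (K : fieldType) (c : K) : 'M[K]_r := \matrix_(a, b) (M a b)%:R - c%:M.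
have mapML (K : fieldType) (f : {rmorphism L -> K}) : map_mx f (ML L y) = ML K (f y).
  apply/matrixP => a b; rewrite !mxE rmorphB rmorph_nat; congr (_ - _).
  by rewrite rmorphMn.
have : \det (ML k (phi y)) == 0.
  apply/det0P; exists (\row_z (th z * dk z)).
    apply/eqP => /rowP/(_ e)/eqP; rewrite !mxE mulf_eq0.
    by rewrite (negPf (th_neq0 e)) (negPf (dk_neq0 e)).
  apply/rowP => z; rewrite mulmxBr mul_mx_scalar !mxE -Mv.
  apply/eqP; rewrite subr_eq0; apply/eqP/eq_bigr => u _; rewrite !mxE mulrC.
  by rewrite M_sym.
rewrite -mapML det_map_mx fmorph_eq0 -(fmorph_eq0 psi) -det_map_mx mapML => /det0P[v v0].
move/rowP => vM.
have vM' z : \sum_u (M z u)%:R * v 0 u = psi y * v 0 z.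
  have := vM z; rewrite mulmxBr mul_mx_scalar [LHS]mxE [X in _ + X]mxE [RHS]mxE => /eqP.
  rewrite subr_eq0 => /eqP; rewrite mxE [RHS]mxE => <-.
  by apply: eq_bigr => u _; rewrite !mxE M_sym mulrC.
have vpos : 0 < \sum_z v 0 z * (v 0 z)^*.
  rewrite lt0r sumr_ge0 ?andbT => [|z _]; last exact: mul_conjC_ge0.
  apply: contraNneq v0 => /eqP; rewrite psumr_eq0 => [/allP h|z _]; last exact: mul_conjC_ge0.
  apply/eqP/rowP => z; rewrite mxE; have := h z (mem_index_enum z).
  by rewrite /= mul_conjC_eq0 => /eqP.
have ypos : 0 <= psi y.
  rewrite -(pmulr_lge0 _ vpos) mulr_sumr.
  rewrite (eq_bigr (fun z => \sum_u (M z u)%:R * v 0 u * (v 0 z)^*)) => [|z _].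
    by rewrite M_form sumr_ge0 // => a _; apply: exprn_ge0.
  by rewrite mulrA -vM' mulr_suml.
apply: (fmorph_inj psi); rewrite rmorphXn /= fpsi_d -(ger0_norm ypos) /y rmorphM normrM.
by rewrite xn xn' fd_st expr2.
Qed.

(** At [psi] the Dirichlet form shows that eigenvectors of [M] for d w ^+ 2 are proportional to [d]
    along edges. For the edge from z to l this says that the row vector [g] lies in the row space of
    M - d w ^+ 2. Such membership does not depend on the field, so it holds in [k], where it is
    applied to the eigenvector th dk. *)
Let th_edge z l : (0 < M z l)%N -> th l = th z.
Proof.
move=> Mzl.
pose ML (K : fieldType) (c : K) : 'M[K]_r := \matrix_(a, b) (M a b)%:R - c%:M.
pose g (K : fieldType) (dd : 'I_r -> K) : 'rV[K]_r := \row_u (dd z * (u == l)%:R - dd l * (u == z)%:R).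
have mapML (K : fieldType) (f : {rmorphism L -> K}) (c : L) : map_mx f (ML L c) = ML K (f c).
  apply/matrixP => a b; rewrite !mxE rmorphB rmorph_nat; congr (_ - _).
  by rewrite rmorphMn.
have mapg (K : fieldType) (f : {rmorphism L -> K}) : map_mx f (g L dL) = g K (fun i => f (dL i)).
  by apply/rowP => a; rewrite !mxE rmorphB !rmorphM !rmorph_nat.
have gy (K : fieldType) (dd y : 'I_r -> K) : \sum_u g K dd 0 u * y u = dd z * y l - dd l * y z.
  rewrite (eq_bigr (fun u => dd z * ((u == l)%:R * y u) - dd l * ((u == z)%:R * y u))) => [|u _].
    rewrite sumrB -!mulr_sumr (bigD1 l) //= eqxx mul1r big1 ?addr0 => [|u /negPf->]; last by rewrite mul0r.
    by rewrite (bigD1 z) //= eqxx mul1r big1 ?addr0 // => u /negPf->; rewrite mul0r.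
  by rewrite !mxE; ring.
have : (g L dL <= ML L (dL w ^+ 2))%MS.
  rewrite -(map_submx psi) mapML mapg submxE; apply/eqP/matrixP => i j.
  have := mulmx_coker (ML algC (psi (dL w ^+ 2))).
  set A := ML _ _; move: (cokermx A) i j => K i j AK; pose y u := K u j.
  have yM a : \sum_u (M a u)%:R * y u = d w ^+ 2 * y a.
    have := congr1 (fun X : 'M_r => X a j) AK; rewrite [RHS]mxE /A mulmxBl mul_scalar_mx.
    rewrite !mxE rmorphXn /= fpsi_d => /eqP; rewrite subr_eq0 => /eqP <-.
    by apply: eq_bigr => u _; rewrite mxE.
  have dir : \sum_a \sum_u (M a u)%:R * d a * d u * `|y a / d a - y u / d u| ^+ 2 = 0.
    have E a u : (M a u)%:R * d a * d u * `|y a / d a - y u / d u| ^+ 2 =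
       (y a * (y a)^* / d a * ((M a u)%:R * d u) - (M a u)%:R * y u * (y a)^*) +
       (y u * (y u)^* / d u * ((M a u)%:R * d a) - (M a u)%:R * y a * (y u)^*).
      rewrite normCK rmorphB !rmorphM /= !fmorphV /= !(geC0_conj (ltW (fd_gt0 F _))).
      by field; rewrite !(lt0r_neq0 (fd_gt0 F _)).
    pose G a u := y a * (y a)^* / d a * ((M a u)%:R * d u) - (M a u)%:R * y u * (y a)^*.
    pose H a u := y u * (y u)^* / d u * ((M a u)%:R * d a) - (M a u)%:R * y a * (y u)^*.
    transitivity (\sum_a (\sum_u G a u + \sum_u H a u)).
      by apply: eq_bigr => a _; rewrite -big_split; apply: eq_bigr => u _; apply: E.
    rewrite big_split /= [X in _ + X]exchange_big /=.
    have z0 : \sum_a \sum_u G a u = 0.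
      rewrite big1 // => a _; rewrite sumrB -mulr_sumr -mulr_suml M_d yM.
      by field; rewrite (lt0r_neq0 (fd_gt0 F _)).
    rewrite z0 add0r -[RHS]z0; apply: eq_bigr => u _; apply: eq_bigr => a _.
    by rewrite /G /H M_sym.
  have nn a u : 0 <= (M a u)%:R * d a * d u * `|y a / d a - y u / d u| ^+ 2.
    by rewrite mulr_ge0 ?exprn_ge0 // mulr_ge0 ?(ltW (fd_gt0 F _)) // mulr_ge0 ?ler0n // ltW ?fd_gt0.
  have yz : d z * y l = d l * y z.
    move/eqP: dir; rewrite psumr_eq0 => [/allP/(_ z)|a _]; last exact: sumr_ge0.
    rewrite mem_index_enum /= psumr_eq0 => [/(_ isT)/allP/(_ l)|//].
    rewrite mem_index_enum => /(_ isT); rewrite /= !mulf_eq0 pnatr_eq0 (gtn_eqF Mzl).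
    rewrite !(gt_eqF (fd_gt0 F _)) /= ?expf_eq0 /= ?orbb normr_eq0 subr_eq0 => /eqP h.
    have -> : y l = y z / d z * d l by rewrite h divfK ?(lt0r_neq0 (fd_gt0 F _)).
    by field; rewrite (lt0r_neq0 (fd_gt0 F _)).
  rewrite [RHS]mxE mxE (eq_bigr (fun u => g algC (fun i => psi (dL i)) 0 u * y u)) => [|u _].
    by rewrite gy !fpsi_d yz subrr.
  by rewrite (ord1 i).
rewrite -(map_submx phi) mapML mapg => /submxP[D gD].
have Mv := M_eig (fun z => eig1 (s1 z)) (fun z => eig1 (etrans (s3 z) (congr1 (fun c => c * _) (esym (dk_st w))))).
rewrite mulL in Mv.
have := gy k (fun i => phi (dL i)) (fun u => th u * dk u).
have -> : \sum_u g k (fun i => phi (dL i)) 0 u * (th u * dk u) = 0.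
  transitivity ((g k (fun i => phi (dL i)) *m \col_u (th u * dk u)) 0 0).
    by rewrite mxE; apply: eq_bigr => u _; rewrite !mxE.
  rewrite gD -mulmxA [X in D *m X](_ : _ = 0) ?mulmx0 ?mxE //.
  apply/colP => a; rewrite mulmxBl mul_scalar_mx !mxE -Mv; apply/eqP; rewrite subr_eq0.
  by apply/eqP/eq_bigr => u _; rewrite !mxE.
rewrite -/(dk z) -/(dk l) => /esym/eqP; rewrite subr_eq0 => /eqP h.
apply: (mulfI (_ : dk z * dk l != 0)); first by rewrite mulf_neq0 ?dk_neq0.
by rewrite -[LHS]mulrA [dk l * _]mulrC h; ring.
Qed.

(** By [th_edge] every constituent l of w (x) st w has th l = 1 and th u = th z for all u in l (x)
    z, so it is transparent, hence the unit. So w is invertible, and the S-matrix entry, now a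
    single term, makes w transparent as well. *)
Lemma flat_unit : w = e.
Proof.
have wl l : (0 < N w (st w) l)%N -> l = e.
  move=> Nl; apply: transparent_unit => z u Nu.
  have Mzu : (0 < M z u)%N by rewrite M_st (bigD1 l) //= addn_gt0 muln_gt0 Nl Nu.
  rewrite (th_edge Mzu) (th_edge (z := e) (l := l)) ?th_e ?mul1r //.
  by rewrite M_st (bigD1 l) //= addn_gt0 muln_gt0 Nl (N_comm k0) (N_unit k0) // eqxx.
have dw1 : dk w ^+ 2 = 1.
  rewrite expr2 -{2}(dk_st w) -dk_mul (bigD1 e) //= big1 ?addr0 => [|l le].
    by rewrite (N_st_e FR) eqxx dk_e mul1r.
  by case: posnP (wl l) => [->|_ /(_ isT) le']; [rewrite mul0r | rewrite le' eqxx in le].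
have Nww l : N w (st w) l = (l == e).
  have [->|le] := eqVneq l e; first by rewrite (N_st_e FR) eqxx.
  by apply/eqP; rewrite -leqn0 leqNgt; apply/negP => /wl l'; rewrite l' eqxx in le.
apply: transparent_unit => z u Nu.
have Nuniq : (\sum_u' N w z u' * N w z u')%N = 1%N.
  have -> : (\sum_u' N w z u' * N w z u' = \sum_u' N z w u' * N u' (st w) z)%N.
    by apply: eq_bigr => a _; rewrite N_frob // (N_comm k0 z).
  rewrite N_assoc // (bigD1 e) //= Nww eqxx (N_comm k0 z) (N_unit k0) eqxx big1 // => l /negPf le.
  by rewrite Nww le.
have Nw u' : N w z u' = (u' == u).
  have := Nuniq; rewrite (bigD1 u) //= => h.
  have [-> |uu] := eqVneq u' u; first by lia.
  have h0 : (\sum_(i < r | i != u) N w z i * N w z i == 0)%N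
    by apply/eqP; move: Nu h; move: (N w z u) (\sum_(i < r | _) _)%N => a S; nia.
  move: h0; rewrite sum_nat_eq0 => /forallP/(_ u'); rewrite uu /= muln_eq0 orbb.
  by move/eqP.
have := s1 z; rewrite /smx (bigD1 u) //= Nw eqxx big1 ?addr0 => [|l /negPf lu]; last first.
  by rewrite Nw lu !mul0r.
have := dk_mul w z; rewrite (bigD1 u) //= Nw eqxx big1 ?addr0 => [|l /negPf lu]; last first.
  by rewrite Nw lu !mul0r.
rewrite !mul1r => <- h; have {}h : th u / (th w * th z) = 1.
  by apply: (mulIf (dk_neq0 u)); rewrite mul1r.
by rewrite -[RHS]mul1r -h divfK // mulf_neq0 ?th_neq0.
Qed.
End Flat.

End Characters.

(** * Orthogonality, integral squared dimensions and the number of invertible objects *)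

Section Invertibles.
Variables (k : closedFieldType) (k0 : [pchar k] =i pred0).
Variables (B : bmoncat k) (hB : fusion B).
Notation hS := (fusion_fss hB).
Notation so := (@so k B hB).
Notation r := (rk hB).
Notation e := (i0 hB).
Notation N := (@N k B hB).
Notation st := (@star k B hB).
Let FR := N_rules k0 hB.
Variable F : fusion_numbers hB.
Notation L := (fL F).
Notation psi := (fpsi F).
Notation phi := (fphi F).
Notation d := (fd F).
Notation dL := (fdL F).
Notation th := (fth F).
Notation dk := (dk F).
Notation chi := (chi F).
Hypothesis nondeg : braiding_nondegenerate B.
Variable D : nat.
Hypothesis dD : \sum_i d i ^+ 2 = D%:R.

Lemma D_gt0 : (0 < D)%N.
Proof.
rewrite -(ltr0n algC) -dD (bigD1 e) //= ltr_pwDl ?exprn_gt0 ?fd_gt0 // sumr_ge0 // => i _.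
by rewrite exprn_ge0 // ltW // fd_gt0.
Qed.

Lemma dL_D : \sum_i dL i ^+ 2 = D%:R.
Proof.
apply: (fmorph_inj psi); rewrite rmorph_nat -dD rmorph_sum; apply: eq_bigr => i _.
by rewrite rmorphXn /= fpsi_d.
Qed.

Lemma chi_lift w z : exists2 x, phi x = chi w z &
  forall f : {rmorphism L -> algC}, f x \in Aint.
Proof.
have [|j|x xe xf] := @feig _ _ _ F z (chi w) (chi w z).
- by exists e; rewrite chi_e ?oner_neq0.
- by rewrite chi_mul.
by exists x => // f; have [] := xf f.
Qed.

Definition chiL w z : L := s2val (cid2 (chi_lift w z)).
Lemma chiLE w z : phi (chiL w z) = chi w z. Proof. exact: (s2valP (cid2 (chi_lift w z))). Qed.
Lemma chiL_int w z (f : {rmorphism L -> algC}) : f (chiL w z) \in Aint.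
Proof. exact: (s2valP' (cid2 (chi_lift w z))). Qed.

Lemma chiL_mul w y z : \sum_u (N y z u)%:R * chiL w u = chiL w y * chiL w z.
Proof.
apply: (fmorph_inj phi); rewrite rmorph_sum rmorphM /= !chiLE -chi_mul //.
by apply: eq_bigr => l _; rewrite rmorphM rmorph_nat chiLE.
Qed.
Lemma chiL_sym w z : chiL w z * dL w = chiL z w * dL z.
Proof. by apply: (fmorph_inj phi); rewrite !rmorphM /= !chiLE; apply: chi_sym. Qed.
Lemma chiL_e w : chiL w e = 1.
Proof. by apply: (fmorph_inj phi); rewrite chiLE chi_e // rmorph1. Qed.
Lemma chiL_flat w : (forall z, chiL w z = dL z) -> w = e.
Proof. by move=> h; apply: (flat_unit k0 (F := F) nondeg) => z; rewrite -chiLE h. Qed.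

(** Multiplication by st z is the transpose of multiplication by z, so both sides agree after
    multiplication by the sum of the |x j|^2. *)
Lemma character_conj (x : 'I_r -> algC) : x e != 0 ->
  (forall y z, \sum_u (N y z u)%:R * x u = x y * x z) -> forall z, x (st z) = (x z)^*.
Proof.
move=> xe xM z; have s0 : \sum_j x j * (x j)^* != 0.
  apply: lt0r_neq0; rewrite (bigD1 e) //= ltr_pwDl ?mul_conjC_gt0 //.
  by rewrite sumr_ge0 // => i _; apply: mul_conjC_ge0.
apply: (mulIf s0); rewrite !mulr_sumr.
rewrite (eq_bigr (fun j => \sum_l (N z l j)%:R * x l * (x j)^*)) => [|j _].
  rewrite exchange_big /=; apply: eq_bigr => l _.
  rewrite mulrCA -rmorphM -xM rmorph_sum mulr_sumr; apply: eq_bigr => j _.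
  by rewrite rmorphM rmorph_nat; ring.
rewrite mulrA -xM mulr_suml; apply: eq_bigr => l _; congr (_%:R * _ * _).
by rewrite (N_comm k0 (st z)) N_frob // (N_comm k0).
Qed.

Lemma chiL_conj (f : {rmorphism L -> algC}) w z : f (chiL w (st z)) = (f (chiL w z))^*.
Proof.
apply: (character_conj (x := fun z => f (chiL w z))) => [|y u]; first by rewrite chiL_e rmorph1 oner_neq0.
by rewrite -rmorphM -chiL_mul rmorph_sum; apply: eq_bigr => l _; rewrite rmorphM rmorph_nat.
Qed.

(** By symmetry of the S-matrix the sum is dL i times [A], the value of the character of i on the
    regular element. That element absorbs x up to the factor dL x, so [A] vanishes unless the
    character is the dimension, which by [chiL_flat] happens only at the unit. *)
Lemma chiL_orth i : \sum_v dL v ^+ 2 * chiL v i = D%:R * (i == e)%:R.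
Proof.
pose A := \sum_v dL v * chiL i v.
have -> : \sum_v dL v ^+ 2 * chiL v i = dL i * A.
  rewrite /A mulr_sumr; apply: eq_bigr => v _.
  by rewrite expr2 -mulrA [dL v * chiL v i]mulrC chiL_sym; ring.
have Ax x : chiL i x * A = dL x * A.
  rewrite mulr_sumr (eq_bigr (fun v => \sum_l dL v * ((N x v l)%:R * chiL i l))) => [|v _].
    rewrite exchange_big /A mulr_sumr /=; apply: eq_bigr => l _.
    rewrite mulrA -(dL_st F x) -(dL_mul F (st x) l) mulr_suml; apply: eq_bigr => v _.
    by rewrite (N_comm k0 (st x)) N_frob // (N_comm k0 v); ring.
  by rewrite mulrCA -chiL_mul mulr_sumr.
have [ie|ne] := eqVneq i e.
  rewrite ie dL_e // mul1r mulr1 -dL_D /A ie; apply: eq_bigr => v _.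
  have := chiL_sym e v; rewrite dL_e mulr1 chiL_e mul1r => ->; exact: expr2.
have [->|A0] := eqVneq A 0; first by rewrite !mulr0.
case/eqP: ne; apply: chiL_flat => z; exact: (mulIf A0).
Qed.

(** A conjugate of the dimension function is a real character, bounded by [d] and with the same sum
    of squares, so no single square can be smaller. *)
Lemma fdL_sqr (f : {rmorphism L -> algC}) i : f (dL i) ^+ 2 = d i ^+ 2.
Proof.
have fM y z : \sum_u (N y z u)%:R * f (dL u) = f (dL y) * f (dL z).
  by rewrite -rmorphM -dL_mul rmorph_sum; apply: eq_bigr => l _; rewrite rmorphM rmorph_nat.
have fe : f (dL e) != 0 by rewrite dL_e rmorph1 oner_neq0.
have fr j : f (dL j) \is Num.real.
  by apply/CrealP; rewrite -(character_conj fe fM) dL_st.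
have fle j : f (dL j) ^+ 2 <= d j ^+ 2.
  have -> : f (dL j) ^+ 2 = `|f (dL j)| ^+ 2 by rewrite real_normK.
  rewrite ler_pXn2r ?nnegrE // ?(ltW (fd_gt0 F _)) //.
  apply: (FP_bound (fd_gt0 F) (fd_mul F) (M := fun a l => (N j a l)%:R) (y := fun a => f (dL a))).
  - by move=> a l; rewrite normr_nat.
  - by exists e.
  by move=> a; rewrite fM.
have fD : \sum_j f (dL j) ^+ 2 = D%:R.
  by rewrite -(rmorph_nat f) -dL_D rmorph_sum; apply: eq_bigr => j _; rewrite rmorphXn.
apply/eqP; rewrite eq_sym -subr_eq0.
have : \sum_j (d j ^+ 2 - f (dL j) ^+ 2) == 0 by rewrite sumrB dD fD subrr.
rewrite psumr_eq0 => [/allP/(_ i)|j _]; first by rewrite mem_index_enum; apply.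
by rewrite subr_ge0.
Qed.

Lemma dsq_ex i : exists n : nat, d i ^+ 2 = n%:R.
Proof.
have : dL i ^+ 2 \in fixedField ('Gal({:L} / 1))%g.
  apply/fixedFieldP; first exact: memvf.
  move=> g _; apply: (fmorph_inj psi); rewrite rmorphXn [RHS]rmorphXn /= fpsi_d.
  have := fdL_sqr (psi \o (g : {rmorphism L -> L})) i.
  by rewrite rmorphXn.
have /galois_fixedField -> := fgal F.
case/vlineP => a; rewrite alg_num_field => /(congr1 psi).
rewrite fmorph_rat rmorphXn /= fpsi_d => da.
have : d i ^+ 2 \in Num.int.
  apply: Cint_rat_Aint; first by rewrite da Crat_rat.
  by rewrite -fpsi_d rpredX // fdL_int.
rewrite intrE => /orP[/natrP[n ->]|]; first by exists n.
move=> /natrP[n h]; exists 0%N; apply/eqP; rewrite eq_le exprn_ge0 ?andbT ?(ltW (fd_gt0 F i)) //.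
by rewrite -oppr_ge0 h ler0n.
Qed.

Definition dsq i : nat := sval (cid (dsq_ex i)).
Lemma dsqE i : d i ^+ 2 = (dsq i)%:R. Proof. exact: svalP (cid (dsq_ex i)). Qed.
Lemma dL_dsq i : dL i ^+ 2 = (dsq i)%:R.
Proof. by apply: (fmorph_inj psi); rewrite rmorphXn /= fpsi_d dsqE rmorph_nat. Qed.
Lemma dsq_gt0 i : (0 < dsq i)%N.
Proof. by rewrite -(ltr0n algC) -dsqE exprn_gt0 // fd_gt0. Qed.
Lemma dsq_sum : (\sum_i dsq i = D)%N.
Proof.
apply/eqP; rewrite -(eqr_nat algC) natr_sum -dD; apply/eqP/eq_bigr => i _.
by rewrite dsqE.
Qed.

Lemma norm_orth (f : {rmorphism L -> algC}) x :
  \sum_v (dsq v)%:R * `|f (chiL v x)| ^+ 2 = D%:R.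
Proof.
have -> : \sum_v (dsq v)%:R * `|f (chiL v x)| ^+ 2 =
    f (\sum_v dL v ^+ 2 * (chiL v x * chiL v (st x))).
  rewrite rmorph_sum; apply: eq_bigr => v _.
  by rewrite dL_dsq !rmorphM /= rmorph_nat chiL_conj normCK.
rewrite (eq_bigr (fun v => \sum_l (N x (st x) l)%:R * (dL v ^+ 2 * chiL v l))) => [|v _].
  rewrite exchange_big /= (bigD1 e) //= -mulr_sumr chiL_orth eqxx (N_st_e FR) eqxx mulr1 mul1r.
  rewrite big1 ?addr0 ?rmorph_nat // => l /negPf le.
  by rewrite -mulr_sumr chiL_orth le !mulr0.
by rewrite -chiL_mul mulr_sumr; apply: eq_bigr => l _; ring.
Qed.

(* Norms of nonzero algebraic integers are at least 1, so AM-GM over the Galois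
   conjugates meets the upper bound given by orthogonality. *)
Lemma nowhere_zero_invertible x : (forall v, chiL v x != 0) -> dsq x = 1%N.
Proof.
(* Each v is repeated [dsq v] times, which makes D indices and turns the weighted orthogonality
   relation into a plain mean. *)
move=> xnz; pose I : finType := {v : 'I_r & 'I_(dsq v)}%type.
have cI : #|I| = D by rewrite card_tagged sumnE big_map -dsq_sum big_enum /=; apply: eq_bigr => v _; rewrite card_ord.
have D0 : (D%:R : algC) != 0 by rewrite pnatr_eq0 -lt0n D_gt0.
pose E (f : {rmorphism L -> algC}) (i : I) : algC := `|f (chiL (tag i) x)| ^+ 2 / D%:R.
have sumI (G : 'I_r -> algC) : \sum_(i : I) G (tag i) = \sum_v (dsq v)%:R * G v.
  transitivity (\sum_v \sum_(m < dsq v) G v); first by rewrite sig_big_dep.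
  by apply: eq_bigr => v _; rewrite sumr_const card_ord mulr_natl.
have prodI (G : 'I_r -> algC) : \prod_(i : I) G (tag i) = \prod_v G v ^+ dsq v.
  transitivity (\prod_v \prod_(m < dsq v) G v); first by rewrite sig_big_dep.
  by apply: eq_bigr => v _; rewrite prodr_const card_ord.
have En f i : E f i *+ #|I| = `|f (chiL (tag i) x)| ^+ 2.
  by rewrite cI -mulr_natr /E divfK.
have AG f := @leif_AGM_scaled _ I I (E f) (fun i _ => etrans (congr1 (fun u => 0 <= u) (En f i)) (exprn_ge0 2 (normr_ge0 _))).
have sE f : \sum_(i in I) E f i = 1.
  rewrite /E -mulr_suml (sumI (fun v => `|f (chiL v x)| ^+ 2)) norm_orth divff //.
pose y := \prod_v chiL v x ^+ dsq v.
have pE (f : {rmorphism L -> algC}) : \prod_(i in I) (E f i *+ #|I|) = `|f y| ^+ 2.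
  rewrite (eq_bigr (fun i => `|f (chiL (tag i) x)| ^+ 2)) => [|i _]; last exact: En.
  rewrite (prodI (fun v => `|f (chiL v x)| ^+ 2)) /y rmorph_prod normr_prod -prodrXl.
  by apply: eq_bigr => v _; rewrite rmorphXn normrX -!exprM mulnC.
have y0 : y != 0 by apply/prodf_neq0 => v _; rewrite expf_neq0.
have fy (f : {rmorphism L -> algC}) : `|f y| <= 1.
  by have [+ _] := AG f; rewrite sE pE expr1n expr_le1.
have fA (f : {rmorphism L -> algC}) : f y \in Aint.
  by rewrite rmorph_prod rpred_prod // => v _; rewrite rmorphXn rpredX // chiL_int.
have y1 := norm_ge1 (fgal F) y0 (fA psi) fA fy.
(* Equality in AM-GM makes all the terms equal, and at v = e the term is the squared dimension of
   x. *)
have [_] := AG psi; rewrite sE pE y1 !expr1n eqxx => /esym/forall_inP h.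
have ev v : `|psi (chiL v x)| ^+ 2 = (dsq x)%:R.
  have ce : psi (chiL e x) = d x.
    by have := chiL_sym e x; rewrite dL_e mulr1 chiL_e mul1r => ->; rewrite fpsi_d.
  pose iv : I := Tagged (fun v => 'I_(dsq v)) (Ordinal (dsq_gt0 v)).
  pose ie : I := Tagged (fun v => 'I_(dsq v)) (Ordinal (dsq_gt0 e)).
  have /forall_inP/(_ ie isT)/eqP := h iv isT.
  rewrite /E /= => /(mulIf (_ : D%:R^-1 != 0)) -> //; last by rewrite invr_eq0.
  by rewrite ce ger0_norm ?(ltW (fd_gt0 F _)) // dsqE.
have := norm_orth psi x; rewrite (eq_bigr (fun v => (dsq v)%:R * (dsq x)%:R)) => [|v _].
  rewrite -mulr_suml -natr_sum dsq_sum => /eqP; rewrite -natrM eqr_nat => /eqP.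
  by rewrite -{2}[D]muln1 => /eqP; rewrite eqn_pmul2l ?D_gt0 // => /eqP.
by rewrite ev.
Qed.

Lemma invertible_N a l : dsq a = 1%N -> N a (st a) l = (l == e).
Proof.
move=> da; have := fd_mul F a (st a); rewrite fd_st -expr2 dsqE da (bigD1 e) //=.
rewrite (N_st_e FR) eqxx fd_e mul1r => /eqP; rewrite -subr_eq0 addrAC subrr add0r.
rewrite psumr_eq0 => [/allP/(_ l)|i _]; last by rewrite mulr_ge0 // ltW // fd_gt0.
rewrite mem_index_enum => /(_ isT); have [->|le] := eqVneq l e.
  by rewrite (N_st_e FR) eqxx.
by rewrite /= mulf_eq0 (gt_eqF (fd_gt0 F l)) orbF pnatr_eq0 => /eqP.
Qed.

Lemma character_products (s : seq 'I_r) : exists c : 'I_r -> nat, forall v,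
  \prod_(w <- s) (chiL v w * chiL v (st w)) = \sum_l (c l)%:R * chiL v l.
Proof.
have mul1 (w : 'I_r) (c : 'I_r -> nat) : exists c' : 'I_r -> nat, forall v,
    chiL v w * (\sum_l (c l)%:R * chiL v l) = \sum_l (c' l)%:R * chiL v l.
  exists (fun u => (\sum_l c l * N w l u)%N) => v; rewrite mulr_sumr.
  rewrite (eq_bigr (fun l => \sum_u (c l * N w l u)%:R * chiL v u)) => [|l _].
    by rewrite exchange_big /=; apply: eq_bigr => u _; rewrite natr_sum mulr_suml.
  by rewrite mulrCA -chiL_mul mulr_sumr; apply: eq_bigr => u _; rewrite natrM mulrA.
elim: s => [|w s [c IH]].
  exists (fun l => (l == e) : nat) => v; rewrite big_nil (bigD1 e) //= eqxx chiL_e mulr1.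
  by rewrite big1 ?addr0 // => l /negPf->; rewrite mul0r.
have [c1 h1] := mul1 (st w) c; have [c2 h2] := mul1 w c1.
by exists c2 => v; rewrite big_cons IH -mulrA h1 h2.
Qed.

Lemma count_invertibles m : (forall i, coprime (dsq i) m) -> (m %| D)%N ->
  (m %| #|[set a | dsq a == 1%N]|)%N.
Proof.
move=> cop mD; have [c cE] := character_products (index_enum 'I_r).
have h : (#|[set a | dsq a == 1%N]| * \prod_w dsq w = c e * D)%N.
  apply/eqP; rewrite -(eqr_nat algC) !natrM; apply/eqP.
  transitivity (psi (\sum_v dL v ^+ 2 * \prod_w (chiL v w * chiL v (st w)))); last first.
    rewrite (eq_bigr (fun v => \sum_l (c l)%:R * (dL v ^+ 2 * chiL v l))) => [|v _].
      rewrite exchange_big (bigD1 e) //= -mulr_sumr chiL_orth eqxx mulr1 big1 ?addr0.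
        by rewrite rmorphM !rmorph_nat.
      by move=> l /negPf le; rewrite -mulr_sumr chiL_orth le !mulr0.
    by rewrite cE mulr_sumr; apply: eq_bigr => l _; ring.
  (* For v not invertible some character vanishes at v; by symmetry the character of v then vanishes
     somewhere and kills the product. For v invertible each factor is [dsq w]. *)
  rewrite rmorph_sum [RHS](bigID (fun v => dsq v == 1%N)) /= [X in _ + X]big1 ?addr0 => [|v v1]; last first.
    have [w vw] : exists w, chiL w v = 0.
      apply: contrapT => no; case/negP: v1; apply/eqP/nowhere_zero_invertible => u.
      by apply/eqP => h; apply: no; exists u.
    rewrite (bigD1 w) //= (_ : chiL v w = 0) ?mul0r ?mulr0 ?rmorph0 //.
    by apply: (mulIf (dL_neq0 F v)); rewrite chiL_sym vw !mul0r.
  rewrite -sum1dep_card natr_sum mulr_suml; apply: eq_bigr => v /eqP v1.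
  rewrite mul1r rmorphM /= dL_dsq v1 rmorph1 mul1r natr_prod rmorph_prod.
  apply: eq_bigr => w _; rewrite rmorphM /= chiL_conj -normCK.
  have dv : d v = 1.
    by apply/eqP; rewrite -(@pexpr_eq1 _ (d v) 2) ?dsqE ?v1 // ltW // fd_gt0.
  have -> : psi (chiL v w) = psi (chiL w v) * d w.
    by have := congr1 psi (chiL_sym v w); rewrite !rmorphM /= !fpsi_d dv mulr1.
  rewrite normrM exprMn (ger0_norm (ltW (fd_gt0 F w))) dsqE normCK -chiL_conj -rmorphM -chiL_mul.
  rewrite (bigD1 e) //= big1 => [|l /negPf le]; last by rewrite invertible_N // le mul0r.
  by rewrite invertible_N // eqxx chiL_e mulr1 addr0 rmorph1 mul1r.
have : (m %| #|[set a | dsq a == 1%N]| * \prod_w dsq w)%N by rewrite h dvdn_mull.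
rewrite Gauss_dvdl // coprime_sym; apply: (big_ind (fun u => coprime u m)) => //.
- by rewrite /coprime gcd1n.
- by move=> a b ca cb; rewrite coprimeMl ca cb.
Qed.
End Invertibles.

(** * Invertible simple objects *)

(** Some element has the exponent of G as its order, and the exponent has the same prime divisors as
    the order of G; for square-free m this makes m divide the exponent. *)
Lemma abelian_order_squarefree (gT : finGroupType) (G : {group gT}) m :
  fingroup.abelian G -> squarefree m -> (0 < m)%N -> (m %| #|G|)%N -> exists2 x, x \in G & #[x]%g = m.
Proof.
move=> aG sm m0 mG.
have [x xG xe] := exponent_witness (abelian_nil aG).
have mE : (m %| #[x]%g)%N.
  rewrite -xe; apply/dvdn_partP => // p; rewrite mem_primes => /and3P[pp _ pm].
  have l1 : logn p m = 1%N.
    apply/eqP; rewrite eqn_leq logn_gt0 mem_primes pp m0 pm !andbT leqNgt.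
    by apply: contra (sm p pp) => h; rewrite pfactor_dvdn.
  rewrite p_part l1 expn1.
  have : p \in \pi(G) by rewrite mem_primes pp cardG_gt0 (dvdn_trans pm mG).
  by rewrite -pi_of_exponent mem_primes => /and3P[].
exists (x ^+ (#[x]%g %/ m))%g; first by rewrite groupX.
by rewrite orderXdiv ?dvdn_div // divnA ?dvdn_div // mulKn // order_gt0.
Qed.

Section Invertibles.
Variables (k : closedFieldType) (k0 : [pchar k] =i pred0).
Variables (B : bmoncat k) (hB : fusion B).
Notation hS := (fusion_fss hB).
Notation so := (@so k B hB).
Notation du := (du hB).
Notation tau := (tau hB).
Notation taum := (taum hB).
Notation mult := (@mult k B hS).
Notation r := (rk hB).
Notation e := (i0 hB).
Notation N := (@N k B hB).
Notation st := (@star k B hB).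
Hint Resolve so_simple S_simple : core.
Let FR := N_rules k0 hB.
Variable F : fusion_numbers hB.
Notation L := (fL F).
Notation psi := (fpsi F).
Notation phi := (fphi F).
Notation d := (fd F).
Notation dL := (fdL F).
Notation th := (fth F).
Notation dk := (dk F).
Notation chi := (chi F).
Hypothesis nondeg : braiding_nondegenerate B.
Variable D : nat.
Hypothesis dD : \sum_i d i ^+ 2 = D%:R.
Notation dsq := (dsq k0 dD).
Notation chiL := (chiL k0 F).

(** Used for invertible a, when exactly one u occurs; the default j is a junk value. *)
Definition act a j : 'I_r := odflt j [pick u | N a j u != 0%N].

Lemma inv_dL a : dsq a = 1%N -> dL a = 1.
Proof.
move=> da; apply: (fmorph_inj psi); rewrite fpsi_d rmorph1.
by apply/eqP; rewrite -(@pexpr_eq1 _ (d a) 2) ?(dsqE k0 dD) ?da // ltW // fd_gt0.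
Qed.
Lemma inv_dk a : dsq a = 1%N -> dk a = 1.
Proof. by move=> da; rewrite /dk inv_dL ?rmorph1. Qed.

Section OneInvertible.
Variables (a : 'I_r) (da : dsq a = 1%N).

(** The sum over u of the squares of [N a j u] is the multiplicity of j in j (x) a (x) st a, which
    is 1. *)
Lemma N_act j u : N a j u = (u == act a j).
Proof.
have S1 : (\sum_u N a j u * N a j u)%N = 1%N.
  have -> : (\sum_u' N a j u' * N a j u' = \sum_u' N j a u' * N u' (st a) j)%N.
    by apply: eq_bigr => v _; rewrite (N_frob k0) (N_comm k0 j).
  rewrite (N_assoc k0) (bigD1 e) //= (invertible_N _ da) eqxx (N_comm k0 j) (N_unit k0) eqxx big1 // => l /negPf le.
  by rewrite (invertible_N _ da) le.
rewrite /act; case: pickP => [v vn|no] /=; last first.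
  by move: S1; rewrite big1 // => v _; have /eqP-> := negbFE (no v).
have [-> |uv] := eqVneq u v; first by move: S1; rewrite (bigD1 v) //=; nia.
have : (\sum_(i < r | i != v) N a j i * N a j i == 0)%N.
  by apply/eqP; move: S1 vn; rewrite (bigD1 v) //=; move: (N a j v) (\sum_(i < r | _) _)%N => x S; nia.
by rewrite sum_nat_eq0 => /forallP/(_ u); rewrite uv /= muln_eq0 orbb => /eqP.
Qed.

Lemma sum_act (K : pzRingType) j (x : 'I_r -> K) : \sum_u (N a j u)%:R * x u = x (act a j).
Proof.
rewrite (bigD1 (act a j)) //= N_act eqxx mul1r big1 ?addr0 // => u /negPf uj.
by rewrite N_act uj mul0r.
Qed.

Lemma dL_act j : dL (act a j) = dL j.
Proof. by rewrite -sum_act dL_mul inv_dL // mul1r. Qed.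
Lemma dsq_act j : dsq (act a j) = dsq j.
Proof.
by apply/eqP; rewrite -(eqr_nat algC) -!(dsqE k0 dD) -!fpsi_d dL_act.
Qed.
Lemma chi_act w j : chi w (act a j) = chi w a * chi w j.
Proof. by rewrite -sum_act chi_mul. Qed.

Lemma chi_inv i : chi i a = th (act a i) / (th a * th i).
Proof.
rewrite /chi /smx (eq_bigr (fun l => (N a i l)%:R * (th l / (th i * th a) * dk l))) => [|l _].
  by rewrite sum_act /dk dL_act; field; rewrite !th_neq0 dk_neq0.
by rewrite (N_comm k0 a); ring.
Qed.

Lemma dbl_act i : dbl (so a) (so i) = chi i a *: idm _.
Proof.
apply: (@hom_ext k B hS) => u x; rewrite compZl comp1m (fdbl F) chi_inv.
have [->|/eqP xn] := eqVneq x 0; first by rewrite !scaler0.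
suff ui : u = act a i by congr (_ *: _); rewrite ui.
apply: contrapT => ui; apply: xn; rewrite (@inc_expand k B hS _ _ x) big1 // => m _.
have := leq_ltn_trans (leq0n _) (ltn_ord m); rewrite -/(N a i u) N_act.
by case: eqP ui.
Qed.

Lemma isom_act i : isom (so a \ox so i) (so (act a i)).
Proof.
have N1 : mult (so a \ox so i) (act a i) = 1%N by have := N_act i (act a i); rewrite eqxx.
have lt0 : (0 < mult (so a \ox so i) (act a i))%N by rewrite N1.
have ord m : m = Ordinal lt0.
  apply: val_inj => /=; have : (m < 1)%N by have := ltn_ord m; rewrite {2}N1.
  by case: (nat_of_ord m).
exists (prj (Ordinal lt0)), (inc (Ordinal lt0)); split; last first.
  by rewrite prj_inc eqxx scale1r.
apply: (@hom_ext k B hS) => u x; rewrite comp1m.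
have [ui|ui] := eqVneq u (act a i).
  rewrite ui in x *; rewrite [RHS](@inc_expand k B hS) (bigD1 (Ordinal lt0)) //= big1 ?addr0 => [|m].
    rewrite -compA {1}(scE hS (prj _ \oc x)) ?compZr ?compm1 //.
  by rewrite (ord m) eqxx.
rewrite [x](@inc_expand k B hS) big1 ?compm0 // => m _.
by have := leq_ltn_trans (leq0n _) (ltn_ord m); rewrite -/(N a i u) N_act (negPf ui).
Qed.

Lemma simple_act i : simple (so a \ox so i).
Proof. exact: isom_simple (isom_sym (isom_act i)) (so_simple _). Qed.

(** Closing one strand of the self-crossing gives a kink, removed by [cup_over] and a zig-zag. The
    scalar is therefore inverse to tau (so a) = 1 / th a. *)
Lemma braid_act : braid (so a) (so a) = th a *: idm _.
Proof.
have [c ce] := simple_end hS (braid (so a) (so a)) (simple_act a).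
have h : ptr (du (so a)) (vfam (braid (so a) (so a)) (unit_ob B)) = idm _.
  have := cup_over (du (so a)) (unit_ob B) (so a).
  rewrite /ptr -xingE rcapE => h1.
  by rewrite -[LHS]compA -[LHS]compA [X in _ \oc X]compA h1 cap_cup.
have ve : vfam (braid (so a) (so a)) (unit_ob B) = c *: idm _.
  by rewrite vfamE ce lwhZ lwh1 compZr compZl compm1 assoK.
rewrite ve ptrZ ptr_id scalerA in h.
have := congr1 (@sc _ _ _) h; rewrite (scP hS) ?(sc1 hS); try exact: un_tens_simple.
rewrite (tauE F) inv_dk // mul1r => c1; rewrite ce; congr (_ *: _).
by rewrite -[c](mulfK (th_neq0 F a)) mulrAC c1 mul1r.
Qed.
End OneInvertible.

Lemma dsq_e : dsq e = 1%N.
Proof. by apply/eqP; rewrite -(eqr_nat algC) -(dsqE k0 dD) fd_e expr1n. Qed.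
Lemma dsq_st a : dsq (st a) = dsq a.
Proof. by apply/eqP; rewrite -(eqr_nat algC) -!(dsqE k0 dD) fd_st. Qed.

Lemma act_e j : act e j = j.
Proof.
by have := N_act dsq_e j j; rewrite (N_unit k0) eqxx; case: eqP.
Qed.
Lemma act_comm a b : dsq a = 1%N -> dsq b = 1%N -> act a b = act b a.
Proof.
move=> da db; have := N_act db a (act a b); rewrite (N_comm k0) (N_act da) eqxx.
by case: eqP.
Qed.
Lemma act_act a b j : dsq a = 1%N -> dsq b = 1%N -> act (act a b) j = act a (act b j).
Proof.
move=> da db; have dab : dsq (act a b) = 1%N by rewrite dsq_act.
have := N_assoc k0 a b j (act (act a b) j).
rewrite [in LHS](bigD1 (act a b)) //= (N_act da) (N_act dab) !eqxx mul1n.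
rewrite (_ : \sum_u _ = (act (act a b) j == act a (act b j)) :> nat)%N.
  by case: eqP => // _; rewrite addSn.
rewrite (bigD1 (act b j)) //= (N_act db) (N_act da) eqxx mul1n big1 ?addn0 // => u /negPf uj.
by rewrite (N_act db) uj.
Qed.
Lemma act_ae a : dsq a = 1%N -> act a e = a.
Proof. by move=> da; rewrite act_comm ?dsq_e // act_e. Qed.
Lemma act_st a : dsq a = 1%N -> act (st a) a = e.
Proof.
move=> da; have := invertible_N e da; rewrite eqxx (N_comm k0) N_act ?dsq_st //.
by case: eqP.
Qed.
Lemma act_inj a : dsq a = 1%N -> injective (act a).
Proof.
move=> da; apply: (can_inj (g := act (st a))) => j.
by rewrite -act_act ?dsq_st // act_st // act_e.
Qed.

Definition pw b m := iter m (act b) e.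

Section Powers.
Variables (b : 'I_r) (db : dsq b = 1%N).

Lemma dsq_pw m : dsq (pw b m) = 1%N.
Proof. by elim: m => [|m IH] /=; rewrite ?dsq_e // dsq_act. Qed.
Lemma act_pw m l : act (pw b m) (pw b l) = pw b (m + l).
Proof.
elim: m => [|m IH]; first by rewrite act_e.
by rewrite /= act_act ?dsq_pw // IH.
Qed.
Lemma pw_muln p m : pw b p = e -> pw b (p * m) = e.
Proof. by move=> bp; elim: m => [|m IH]; rewrite ?muln0 // mulnS -act_pw bp act_e. Qed.
Lemma chi_pw w m : chi w (pw b m) = chi w b ^+ m.
Proof. by elim: m => [|m IH] /=; rewrite ?(chi_e k0 F) // chi_act // IH exprS. Qed.
Lemma chi_bb : chi b b = th b ^+ 2.
Proof.
have sb := simple_act db b.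
have := dbl_act db b; rewrite dblE braid_act // compZl compZr comp1m scalerA.
by move/(congr1 (@sc _ _ _)); rewrite !(scP hS) // expr2.
Qed.
(** chi is the polarisation of th by [chi_inv], and chi b b = th b ^+ 2. *)
Lemma th_pw m : th (pw b m) = th b ^+ (m * m).
Proof.
elim: m => [|m IH]; first by rewrite (th_e k0 F).
have := chi_inv db (pw b m); have := chi_sym k0 F b (pw b m).
rewrite !inv_dk ?dsq_pw // !mulr1 => <-; rewrite chi_pw chi_bb IH => h.
have -> : th (pw b m.+1) = th b ^+ 2 ^+ m * (th b * th b ^+ (m * m)).
  by rewrite h divfK // mulf_neq0 ?expf_neq0 ?th_neq0.
by rewrite -exprM -exprS -exprD; congr (_ ^+ _); lia.
Qed.
End Powers.

(** The invertible indices act on all indices by permutations, and the image of e recovers the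
    index; this realises them as a finite abelian group. *)
Lemma element_of_order m : squarefree m -> (0 < m)%N ->
  (m %| #|[set a | dsq a == 1%N]|)%N ->
  exists2 b, dsq b = 1%N & forall j, (pw b j == e) = (m %| j)%N.
Proof.
move=> sm m0 mG; set G0 := [set a | _] in mG.
have inj a : injective (if dsq a == 1%N then act a else id).
  by case: eqP => [da|_]; [apply: (act_inj da) | ].
pose pa a := perm (inj a).
have paE a j : dsq a = 1%N -> pa a j = act a j by move=> da; rewrite permE da.
have pae a : dsq a = 1%N -> pa a e = a by move=> da; rewrite paE // act_ae.
pose H := [set pa a | a in G0].
have inH a : dsq a = 1%N -> pa a \in H by move=> da; apply: imset_f; rewrite inE da.
have mulP a b : dsq a = 1%N -> dsq b = 1%N -> (pa a * pa b)%g = pa (act b a).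
  by move=> da db; apply/permP => j; rewrite permM !paE ?dsq_act // act_act.
have gH : group_set H.
  apply/group_setP; split.
    have -> : (1%g : {perm 'I_r}) = pa e; last by apply: inH; apply: dsq_e.
    by apply/permP => j; rewrite perm1 paE ?dsq_e // act_e.
  move=> _ _ /imsetP[a + ->] /imsetP[b + ->]; rewrite !inE => /eqP da /eqP db.
  by rewrite mulP // inH // dsq_act.
have cH : #|Group gH| = #|G0|.
  apply: card_in_imset => a b; rewrite !inE => /eqP da /eqP db pab.
  by rewrite -(pae a) // pab pae.
have aH : fingroup.abelian (Group gH).
  apply/centsP => _ /imsetP[a + ->] _ /imsetP[b + ->]; rewrite !inE => /eqP da /eqP db.
  by rewrite /commute !mulP // act_comm.
have [x /imsetP[b + xb] xm] := abelian_order_squarefree aH sm m0 (etrans (congr1 (dvdn m) cH) mG).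
rewrite inE => /eqP db; exists b => // j.
have pj : pa (pw b j) = (x ^+ j)%g.
  elim: j => [|j IH]; first by apply/permP => i; rewrite expg0 perm1 paE ?dsq_e // act_e.
  by rewrite expgSr -IH xb mulP ?dsq_pw.
rewrite -xm order_dvdn -pj; apply/eqP/eqP => [->|h].
  by apply/permP => i; rewrite perm1 paE ?dsq_e // act_e.
by rewrite -(pae (pw b j)) ?dsq_pw // h perm1.
Qed.

(** The orthogonality relation is summed over the powers of a: only the trivial power contributes D,
    while for fixed i the powers of the p-th root of unity chi i a add up to p or to 0. *)
Lemma card_kernel (p : nat) a : prime p -> dsq a = 1%N -> pw a p = e -> a <> e ->
  (p * \sum_(i | chi i a == 1%R) dsq i = D)%N.
Proof.
move=> pp da ap ae.
have am j : (j < p)%N -> (pw a j == e) = (j == 0)%N.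
  case: j => [|j] jp; first by rewrite /pw /= !eqxx.
  apply/negP => /eqP aj; apply: ae.
  have cop : coprime j.+1 p by rewrite coprime_sym prime_coprime // gtnNdvd.
  have [u uE] : exists u, (u * j.+1 = 1 %[mod p])%N.
    have [[u v] h] := coprimeP _ (ltn0Sn j) cop.
    exists u => /=; have : (u * j.+1 = v * p + 1)%N by move: h => /=; lia.
    by move=> ->; rewrite modnMDl.
  have [v vE] : exists v, (u * j.+1 = v * p + 1)%N.
    exists (u * j.+1 %/ p)%N; rewrite {1}(divn_eq (u * j.+1) p) uE.
    by rewrite modn_small ?prime_gt1.
  have := pw_muln da u aj; rewrite mulnC vE -act_pw // mulnC pw_muln // act_e /=.
  by rewrite act_ae.
have pk : (p%:R : k) != 0 by rewrite (pcharf0P k).1 // -lt0n prime_gt0.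
apply: (natr0_inj k0); rewrite natrM natr_sum.
have -> : (D%:R : k) = \sum_(m < p) \sum_i dk i ^+ 2 * chi i (pw a m).
  have orth x : \sum_i dk i ^+ 2 * chi i x = D%:R * (x == e)%:R.
    have := congr1 phi (chiL_orth k0 nondeg dD x); rewrite rmorphM !rmorph_nat => <-.
    by rewrite rmorph_sum; apply: eq_bigr => i _; rewrite rmorphM rmorphXn /= chiLE.
  have p0 := prime_gt0 pp; rewrite (bigD1 (Ordinal p0)) //= orth eqxx mulr1.
  rewrite big1 ?addr0 // => m m0; rewrite orth am // (_ : (m == 0 :> nat) = false) ?mulr0 //.
  by apply/negP => /eqP h; case/eqP: m0; apply: val_inj.
rewrite exchange_big /= mulr_sumr [RHS](bigID (fun i => chi i a == 1)) /=.
rewrite [X in _ = _ + X]big1 ?addr0 => [|i ia].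
  apply: eq_bigr => i /eqP ia; rewrite (eq_bigr (fun=> dk i ^+ 2)) => [|m _].
    by rewrite sumr_const card_ord mulr_natl -(rmorph_nat phi) -(dL_dsq k0 dD) rmorphXn.
  by rewrite chi_pw // ia expr1n mulr1.
rewrite -mulr_sumr; have : (chi i a - 1) * \sum_(m < p) chi i (pw a m) = 0.
  rewrite (eq_bigr (fun m : 'I_p => chi i a ^+ m)) => [|m _]; last by rewrite chi_pw.
  by rewrite -subrX1 -chi_pw // ap (chi_e k0 F) subrr.
by move/eqP; rewrite mulf_eq0 subr_eq0 (negPf ia) /= => /eqP->; rewrite mulr0.
Qed.

Lemma lprj_twist i (x : loops i) : lprj x \oc dblV (so i) (so (tag x)) = th i *: lprj x.
Proof.
rewrite [LHS](@prj_expand k B hS) [X in _ *: X](@prj_expand k B hS) scaler_sumr.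
apply: eq_bigr => m _; rewrite scalerA; congr (_ *: _).
rewrite -compA (dblV_so F) compZr (scZ hS) //; congr (_ * _).
by field; rewrite th_neq0.
Qed.

(** [trace_relation] freed of the twist: by [lprj_twist] the inverse double braiding acts on these
    loops as th i, which cancels against tau (so i) = dk i / th i. *)
Lemma trace_lact j z :
  \sum_i dk i * \sum_(x : loops i | tag x == j) lact z x x = (z == e)%:R * dk j ^+ 2.
Proof.
have -> : (z == e)%:R * dk j ^+ 2 = (z == e)%:R * (tau (so j) * taum (so j)).
  by rewrite (tauE F) (taumE F); congr (_ * _); field; rewrite th_neq0.
rewrite -(trace_relation k0 j z); apply: eq_bigr => i _.
rewrite (tauE F) -mulrA; congr (_ * _).
rewrite (_ : rot_block i j z = th i * \sum_(x : loops i | tag x == j) lact z x x); last first.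
  rewrite mulr_sumr /rot_block.
  transitivity (\sum_(m < mult (so i \ox so j) j) th i *
     @lact k B hB i z (Tagged (fun j => 'I_(mult (so i \ox so j) j)) m)
       (Tagged (fun j => 'I_(mult (so i \ox so j) j)) m)).
    apply: eq_bigr => m _; rewrite /lact -classZ /class /=.
    apply: eq_bigr => n _; congr (sc _).
    have -> : prj m \oc dblV (so i) (so j) = th i *: prj m.
      exact: (lprj_twist (Tagged (fun j => 'I_(mult (so i \ox so j) j)) m)).
    by rewrite /rz rwhZ /lprj /linc /= !(compZl, compZr, compA).
  have -> : \sum_(x : loops i | tag x == j) th i * lact z x x =
     \sum_(j' | j' == j) \sum_(m < mult (so i \ox so j') j') th i *
     @lact k B hB i z (Tagged (fun j => 'I_(mult (so i \ox so j) j)) m)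
       (Tagged (fun j => 'I_(mult (so i \ox so j) j)) m).
    by rewrite sig_big_dep /=; apply: eq_big => [[? ?]|[? ?] _] //=; rewrite andbT.
  by rewrite big_pred1_eq.
by rewrite mulKf ?th_neq0.
Qed.

Lemma lact_support a i (x y : loops i) : dsq a = 1%N -> tag x != act a (tag y) ->
  lact a x y = 0.
Proof.
move=> da xy; rewrite /lact /class big1 // => n _.
have := leq_ltn_trans (leq0n _) (ltn_ord n); rewrite -/(N (tag y) a (tag x)).
by rewrite (N_comm k0) N_act // (negPf xy).
Qed.

(* The powers of [a] act on the class spaces of the loops with colours in the centralizer
   of [a]; their averages are idempotents, so have integral traces, and the trace relation
   expresses the dimension of the centralizer as p times an algebraic integer. *)
Lemma lagrange p a : prime p -> dsq a = 1%N -> pw a p = e -> a <> e -> chi a a = 1 ->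
  (p ^ 2 %| D)%N.
Proof.
move=> pp da ap ae aa; have p0 := prime_gt0 pp.
rewrite -(card_kernel pp da ap ae) expnS expn1 dvdn_pmul2l //.
pose J := [pred i | chi i a == 1%R].
have pk : (p%:R : k) != 0 by rewrite (pcharf0P k).1 // -lt0n.
have k2 : (2%:R : k) != 0 by apply: (natr0_neq0 k0 1).
have Jact i m : (act (pw a m) i \in J) = (i \in J).
  rewrite !inE; have h : chi (act (pw a m) i) a = chi i a.
    have dki : dk (act (pw a m) i) = dk i by rewrite /dk dL_act ?dsq_pw.
    apply: (mulIf (dk_neq0 F i)); rewrite -{1}dki !(chi_sym k0 F _ a).
    by rewrite chi_act ?dsq_pw // chi_pw // aa expr1n mul1r.
  by rewrite h.
have shift (G : 'I_r -> k) l : \sum_(m < p) G (pw a (m + l)) = \sum_(m < p) G (pw a m).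
  elim: l => [|l IH]; first by apply: eq_bigr => m _; rewrite addn0.
  rewrite -IH; case: p p0 ap {pp pk} => // q _ ap in IH *.
  rewrite big_ord_recr [RHS]big_ord_recl /= addrC; congr (_ + _).
    by rewrite add0n addnS -addSn -act_pw // ap act_e.
  by apply: eq_bigr => m _; rewrite add0n addnS.
(* The sum of the powers of a, cut down to loops with colour in [J]; [J] is stable under a because
   chi a a = 1, so [P i] squares to p times itself. *)
pose P i (x y : loops i) : k := if tag y \in J then \sum_(m < p) lact (pw a m) x y else 0.
have trI i : exists m : int, \sum_(x : loops i | tag x \in J) \sum_(m < p) lact (pw a m) x x = p%:R * m%:~R.
  have [||x z|m mE] := @involution_trace_int k k2 (loops i) (fun x y => (x == y)%:R) (P i) p%:R pk.
  - move=> x z; rewrite (bigD1 x) //= eqxx mul1r big1 ?addr0 // => y /negPf yx.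
    by rewrite eq_sym yx mul0r.
  - move=> x z; rewrite /P; case: ifP => zJ; last first.
      by rewrite mulr0 big1 // => y _; rewrite mulr0.
    rewrite (eq_bigr (fun y => \sum_(m < p) \sum_(l < p) lact (pw a m) x y * lact (pw a l) y z)) => [|y _].
      rewrite exchange_big /= (eq_bigr (fun m : 'I_p => \sum_(l < p) lact (pw a l) x z)) => [|m _].
        by rewrite sumr_const card_ord mulr_natl.
      rewrite exchange_big /= -(shift (fun u => lact u x z) m); apply: eq_bigr => l _.
      by rewrite lactM (sum_act (dsq_pw da l)) act_pw.
    case: ifP => yJ; first by rewrite mulr_suml; apply: eq_bigr => m _; rewrite mulr_sumr.
    rewrite mul0r exchange_big big1 //= => l _; rewrite big1 // => m _.
    rewrite (lact_support (x := y)) ?dsq_pw ?mulr0 //.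
    by apply/negP => /eqP yz; rewrite yz Jact zJ in yJ.
  - rewrite (bigD1 x) //= eqxx mul1r big1 ?addr0 => [|y /negPf yx]; last by rewrite eq_sym yx mul0r.
    rewrite (bigD1 z) //= eqxx mulr1 big1 ?addr0 // => y /negPf yz; by rewrite yz mulr0.
  exists m; rewrite -mE big_mkcond; apply: eq_bigr => x _.
  rewrite [RHS](bigD1 x) //= eqxx mul1r [X in _ = _ + X]big1 ?addr0 // => y /negPf yx.
  by rewrite eq_sym yx mul0r.
pose c i := sval (cid (trI i)); have cE i := svalP (cid (trI i)); rewrite -/(c _) in cE.
(* In [trace_lact], summed over the powers of a, only the trivial power contributes; the integral
   traces [c i] bring in the factor p. *)
have sumk : \sum_(j in J) dk j ^+ 2 = p%:R * \sum_i (c i)%:~R * dk i.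
  transitivity (\sum_(j in J) \sum_(m < p) (pw a m == e)%:R * dk j ^+ 2).
    apply: eq_bigr => j _; rewrite (bigD1 (Ordinal p0)) //= eqxx mul1r big1 ?addr0 // => m m0.
    suff -> : (pw a m == e) = false by rewrite mul0r.
    apply/negP => /eqP am; apply: ae.
    have m0' : (0 < m)%N by rewrite lt0n; apply/negP => /eqP h; case/eqP: m0; apply: val_inj.
    have cop : coprime m p by rewrite coprime_sym prime_coprime // gtnNdvd.
    have [[u v] h] := coprimeP _ m0' cop.
    have vE : (m * u = p * v + 1)%N by move: h => /=; lia.
    by have := pw_muln da u am; rewrite vE -act_pw // pw_muln // act_e /= act_ae.
  rewrite exchange_big /= mulr_sumr.
  rewrite (eq_bigr (fun m : 'I_p => \sum_i dk i * \sum_(x : loops i | tag x \in J) lact (pw a m) x x)) => [|m _].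
    rewrite exchange_big /=; apply: eq_bigr => i _.
    by rewrite -mulr_sumr exchange_big /= cE; ring.
  rewrite (eq_bigr (fun j => \sum_i dk i * \sum_(x : loops i | tag x == j) lact (pw a m) x x)) => [|j _].
    rewrite exchange_big /=; apply: eq_bigr => i _; rewrite -mulr_sumr; congr (_ * _).
    by rewrite [RHS](partition_big (fun x : loops i => tag x) (mem J)) //=; apply: eq_bigr => j jJ; apply: eq_bigl => x; case: eqP => [->|]; rewrite ?andbT ?andbF.
  by rewrite trace_lact.
have sumL : (\sum_(j in J) dsq j)%:R = p%:R * \sum_i (c i)%:~R * dL i :> L.
  apply: (fmorph_inj phi); rewrite rmorph_nat natr_sum rmorphM rmorph_nat [phi (\sum_i _)]rmorph_sum.
  rewrite [X in _ = _ * X](_ : _ = \sum_i (c i)%:~R * dk i).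
    by rewrite -sumk; apply: eq_bigr => j _; rewrite -(rmorph_nat phi) -(dL_dsq k0 dD) rmorphXn.
  by apply: eq_bigr => i _; rewrite rmorphM rmorph_int.
have := congr1 psi sumL; rewrite rmorph_nat rmorphM rmorph_nat => sC.
have pC : (p%:R : algC) != 0 by rewrite pnatr_eq0 -lt0n.
have xA : psi (\sum_i (c i)%:~R * dL i) \in Aint.
  by rewrite rmorph_sum rpred_sum // => i _; rewrite rmorphM rmorph_int rpredM ?Aint_int ?fdL_int.
have xq : psi (\sum_i (c i)%:~R * dL i) = (\sum_(j in J) dsq j)%:R / p%:R by rewrite sC mulrC mulKf.
have : psi (\sum_i (c i)%:~R * dL i) \in Num.int.
  apply: Cint_rat_Aint xA; rewrite xq; apply: rpred_div; exact: rpred_nat.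
rewrite xq => h; have : (\sum_(j in J) dsq j)%:R / p%:R \in (Num.nat : {pred algC}).
  by rewrite natrEint h divr_ge0 ?ler0n.
by case/natrP => u uE; apply/dvdnP; exists u; apply/eqP; rewrite -(eqr_nat algC) natrM -uE divfK.
Qed.

Theorem cyclic_part (n m : nat) : (0 < m)%N -> squarefree m -> D = (n * m)%N -> coprime n m ->
  (forall i, coprime (dsq i) m) ->
  exists b : 'I_r, [/\ dsq b = 1%N, forall j, (pw b j == e) = (m %| j)%N
    & forall j, (chi b b ^+ j == 1) = (m %| j)%N].
Proof.
move=> m0 sm Dnm nm cop.
have mD : (m %| D)%N by rewrite Dnm dvdn_mull.
have [b db bo] := element_of_order sm m0 (count_invertibles nondeg cop mD).
exists b; split=> // j; apply/idP/idP => [/eqP bj|mj]; last first.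
  by rewrite -chi_pw //; have := bo j; rewrite mj => /eqP->; rewrite (chi_e k0 F).
apply: contrapT => /negP mj.
have bm : chi b b ^+ m = 1 by rewrite -chi_pw //; have := bo m; rewrite dvdnn => /eqP->; rewrite (chi_e k0 F).
(* If j is not a multiple of m, then g is a proper divisor of m with chi b b ^+ g = 1. For a prime p
   dividing m / g the power a = b^(m / p) has order p, and chi a a = 1 because g divides m / p. *)
pose g := gcdn j m.
have g0 : (0 < g)%N by rewrite gcdn_gt0 m0 orbT.
have bg : chi b b ^+ g = 1.
  have j0 : (0 < j)%N by rewrite lt0n; apply/negP => /eqP h; rewrite h dvdn0 in mj.
  have [u v h _] := egcdnP m j0.
  have : chi b b ^+ (u * j) = 1 by rewrite mulnC exprM bj expr1n.
  by rewrite h exprD mulnC exprM bm expr1n mul1r.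
have gm : (g %| m)%N by rewrite dvdn_gcdr.
have gltm : (1 < m %/ g)%N.
  rewrite ltnNge; apply: contra mj => h.
  have : (m %/ g = 1)%N by apply/eqP; rewrite eqn_leq h divn_gt0 // dvdn_leq.
  by move=> h1; move: (divnK gm); rewrite h1 mul1n => <-; apply: dvdn_gcdl.
pose p := pdiv (m %/ g); have pp : prime p := pdiv_prime gltm.
have pm : (p %| m)%N by apply: dvdn_trans (pdiv_dvd _) _; rewrite -{2}(divnK gm) dvdn_mulr.
pose s := (m %/ p)%N; have ps : (p * s = m)%N by rewrite mulnC divnK.
have gs : (g %| s)%N.
  have [t tE] := dvdnP (pdiv_dvd (m %/ g)); rewrite -/p in tE.
  apply/dvdnP; exists t; apply/eqP; rewrite -(eqn_pmul2l (prime_gt0 pp)) ps.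
  by rewrite -{1}(divnK gm) tE; apply/eqP; lia.
pose a := pw b s.
have da : dsq a = 1%N by apply: dsq_pw.
have s0 : (0 < s)%N by rewrite -(ltn_pmul2l (prime_gt0 pp)) ps muln0.
have pwa l : pw a l = pw b (s * l).
  by elim: l => [|l IH]; rewrite ?muln0 // mulnS -act_pw // -IH.
have ae : a <> e.
  move/eqP; rewrite bo => /dvdn_leq; rewrite s0 => /(_ isT); rewrite -ps.
  by have := prime_gt1 pp; nia.
have ap : pw a p = e by rewrite pwa mulnC ps; apply/eqP; rewrite bo.
have aa : chi a a = 1.
  rewrite chi_pw //.
  have := chi_sym k0 F a b; rewrite !inv_dk // !mulr1 => ->; rewrite chi_pw // -exprM.
  by have [t ->] := dvdnP gs; rewrite -mulnA mulnC -mulnA exprM bg expr1n.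
have := lagrange pp da ap ae aa; rewrite Dnm => h.
have cpn : coprime (p ^ 2) n.
  by rewrite coprimeXl // coprime_sym (coprime_dvdr pm).
by case/negP: (sm p pp); rewrite -(Gauss_dvdr _ cpn).
Qed.
End Invertibles.

(** * Frobenius-Perron dimensions as largest nonnegative eigenvalues *)

Lemma big_max_eq (R : numDomainType) (s : seq R) (M : R) : 0 <= M -> M \in s ->
  (forall z, z \in s -> 0 <= z -> z <= M) -> \big[Num.max/0]_(z <- s | 0 <= z) z = M.
Proof.
move=> M0 Ms sM.
have bM (t : seq R) : {subset t <= s} -> \big[Num.max/0]_(z <- t | 0 <= z) z <= M.
  elim: t => [|z t IH] ts; first by rewrite big_nil.
  have {}IH := IH (fun y h => ts y (mem_behead (s := z :: t) h)).
  rewrite big_cons; case: ifP => // z0; rewrite maxEle; case: ifP => // _.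
  by apply: sM => //; apply: ts; apply: mem_head.
elim: s Ms sM bM => // z t IH; rewrite inE => Ms sM bM; rewrite big_cons.
have zt : {subset t <= z :: t} by move=> y h; rewrite inE h orbT.
have [Mt|Mt] := boolP (M \in t).
  rewrite IH // => [|y h|u ut]; last by apply: bM => y /ut /zt.
    case: ifP => // z0; rewrite maxEle; case: ifP => // zM.
    by rewrite sM ?mem_head in zM.
  by apply: sM; apply: zt.
rewrite (negPf Mt) orbF in Ms; rewrite -(eqP Ms) M0 maxEle.
case: ifP => // h; apply/eqP; rewrite eq_le h andbT.
exact: bM.
Qed.

Section FPdimSimple.
Variables (k : closedFieldType) (k0 : [pchar k] =i pred0).
Variables (B : bmoncat k) (hB : fusion B).
Notation hS := (fusion_fss hB).
Notation so := (@so k B hB).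
Notation r := (rk hB).
Notation N := (@N k B hB).
Variable d : 'I_r -> algC.
Hypothesis d_gt0 : forall i, 0 < d i.
Hypothesis dM : forall i j, \sum_l (N i j l)%:R * d l = d i * d j.

Lemma fusion_mxE i j l : fusion_mx hB (so i) l j = (N i j l)%:R.
Proof.
rewrite mxE; congr (_%:R); apply: (@mult_dim k B hS (so i \ox so j) l).
exact: svalP (cid (fss_dim (fusion_fss hB) _ _)).
Qed.

(** [d] is itself an eigenvector for d i, and [FP_bound] bounds every other eigenvalue. The default
    0 of the maximum does no harm because d i > 0. *)
Lemma FPdim_so i : FPdim hB (so i) = d i.
Proof.
have ev z : (z \in Defs.eigenvalues (fusion_mx hB (so i))) = eigenvalue (fusion_mx hB (so i)) z.
  rewrite eigenvalue_root_char /Defs.eigenvalues.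
  case: closed_field_poly_normal => s /= sE.
  by rewrite sE rootZ ?root_prod_XsubC // (eqP (char_poly_monic _)) oner_neq0.
apply: big_max_eq; first exact: ltW (d_gt0 i).
  rewrite ev; apply/eigenvalueP; exists (\row_l d l).
    apply/rowP => j; rewrite !mxE -dM; apply: eq_bigr => l _.
    by rewrite fusion_mxE mxE mulrC.
  apply/eqP => /rowP/(_ (i0 hB)); rewrite !mxE => /eqP.
  by rewrite gt_eqF.
move=> z; rewrite ev => /eigenvalueP[v vA /rV0Pn[j0 vj]] z0.
have := @FP_bound _ N d d_gt0 dM i (fun j l => (N i j l)%:R) (fun l => v 0 l) z.
rewrite ger0_norm //; apply.
- by move=> j l; rewrite normr_nat.
- by exists j0.
move=> j; have /rowP/(_ j) := vA; rewrite !mxE => <-; apply: eq_bigr => l _.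
by rewrite fusion_mxE mulrC.
Qed.
End FPdimSimple.

(** * Fusion subcategories *)

Section Split.
Variables (k : fieldType) (C : lincat k).
Implicit Types X Y Z : C.

Lemma split_cokernel X Y Q (f : Hom X Y) (p : Hom Y Q) (s : Hom Q Y) (v : Hom Y X) :
  p \oc f = 0 -> p \oc s = idm Q -> s \oc p = idm Y - f \oc v -> is_cokernel p f.
Proof.
move=> pf ps sp; split=> // W g gf; exists (g \oc s); split=> [|h <-].
  by rewrite -compA sp compBr compm1 compA gf comp0m subr0.
by rewrite -compA ps compm1.
Qed.

Lemma split_kernel K X Y (f : Hom X Y) (i : Hom K X) (p : Hom X K) (v : Hom Y X) :
  f \oc i = 0 -> p \oc i = idm K -> i \oc p = idm X - v \oc f -> is_kernel i f.
Proof.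
move=> fi pi ip; split=> // W g fg; exists (p \oc g); split=> [|h <-].
  by rewrite compA ip compBl comp1m -compA fg compm0 subr0.
by rewrite compA pi comp1m.
Qed.
End Split.

Section Regular.
Variables (k : closedFieldType) (C : lincat k) (hC : finite_semisimple C).
Notation S := (projT2 (fss_enum hC)).
Notation mult := (@mult k C hC).
Implicit Types X Y Z : C.

(** A generalised inverse matrix is taken on each multiplicity space. This von Neumann regularity
    splits monomorphisms, epimorphisms and cokernels, and makes linear functors right exact. *)
Lemma regular X Y (f : Hom X Y) : exists v : Hom Y X, f \oc v \oc f = f.
Proof.
pose M i : 'M[k]_(mult Y i, mult X i) := \matrix_(a, b) sc (prj a \oc f \oc inc b).
pose v : Hom Y X := \sum_i \sum_(b < mult X i) \sum_(a < mult Y i)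
  pinvmx (M i) b a *: (inc b \oc prj a).
have fE i b : f \oc inc b = \sum_a M i a b *: inc a.
  by rewrite [LHS](@inc_expand k C hC); apply: eq_bigr => a _; rewrite mxE compA.
have vE i a : v \oc inc a = \sum_b pinvmx (M i) b a *: inc b.
  rewrite /v comp_suml (bigD1 i) //= [X in _ + X]big1 ?addr0 => [|j ji].
    rewrite comp_suml; apply: eq_bigr => b _; rewrite comp_suml (bigD1 a) //= big1 ?addr0.
      by rewrite compZl -compA prj_inc eqxx scale1r compm1.
    by move=> c /negPf ca; rewrite compZl -compA prj_inc ca scale0r compm0 scaler0.
  rewrite comp_suml big1 // => b _; rewrite comp_suml big1 // => c _.
  by rewrite compZl -compA (S_hom0 (prj c \oc inc a)) ?compm0 ?scaler0 // eq_sym.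
move: v vE => v vE; exists v; apply: (@hom_ext k C hC) => i x; rewrite [x](@inc_expand k C hC) !comp_sumr.
apply: eq_bigr => b _; rewrite !compZr; congr (_ *: _).
transitivity (\sum_a' (M i *m pinvmx (M i) *m M i) a' b *: (inc a' : Hom (S i) Y)).
  rewrite -compA fE comp_sumr.
  rewrite (eq_bigr (fun a => \sum_b' \sum_a' (M i a b * pinvmx (M i) b' a * M i a' b') *: (inc a' : Hom (S i) Y))); last first.
    move=> a _; rewrite compZr -compA vE comp_sumr scaler_sumr; apply: eq_bigr => b' _.
    rewrite compZr fE !scaler_sumr; apply: eq_bigr => a' _.
    by rewrite !scalerA.
  rewrite (eq_bigr (fun a => \sum_a' \sum_b' (M i a b * pinvmx (M i) b' a * M i a' b') *: (inc a' : Hom (S i) Y))); last first.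
    by move=> a _; rewrite exchange_big.
  rewrite exchange_big /=; apply: eq_bigr => a' _; rewrite mxE scaler_suml.
  apply: eq_bigr => a _; rewrite -scaler_suml [(_ *m pinvmx _) a' a]mxE mulr_suml; congr (_ *: _).
  by apply: eq_bigr => b' _; rewrite [RHS]mulrC mulrA mulrAC.
by rewrite mulmxKpV ?submx_refl // fE.
Qed.

Lemma mono_split X Y (f : Hom X Y) :
  (forall g h : Hom X X, f \oc g = f \oc h -> g = h) -> exists r, r \oc f = idm X.
Proof.
by move=> mf; have [v fvf] := regular f; exists v; apply: mf; rewrite compA fvf compm1.
Qed.

Lemma epi_split X Y (f : Hom X Y) :
  (forall g h : Hom Y Y, g \oc f = h \oc f -> g = h) -> exists s, f \oc s = idm Y.
Proof.
by move=> ef; have [v fvf] := regular f; exists v; apply: ef; rewrite fvf comp1m.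
Qed.

Lemma cokernel_split X Y Q (f : Hom X Y) (p : Hom Y Q) : is_cokernel p f ->
  exists s v, p \oc s = idm Q /\ s \oc p = idm Y - f \oc v.
Proof.
case=> pf up; have [v fvf] := regular f.
have [|s [sp _]] := up Y (idm Y - f \oc v); first by rewrite compBl fvf comp1m subrr.
exists s, v; split=> //; have [h [_ hu]] := up _ _ pf.
rewrite -(hu (idm Q)) ?comp1m // -(hu (p \oc s)) //.
by rewrite -compA sp compBr compm1 compA pf comp0m subr0.
Qed.

Lemma linear0 (E : lincat k) (F : functor C E) X Y : linear_functor F ->
  fmap F (0 : Hom X Y) = 0.
Proof.
by move=> lF; have := lF _ _ (-1) (0 : Hom X Y) 0; rewrite scaler0 addr0 scaleN1r addNr.
Qed.

Lemma linear_right_exact (E : lincat k) (F : functor C E) :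
  linear_functor F -> right_exact F.
Proof.
move=> lF X Y Q f p pf; have [s [v [ps sp]]] := cokernel_split pf.
apply: (@split_cokernel _ _ _ _ _ _ _ (fmap F s) (fmap F v)); rewrite -!fmapM.
- by rewrite pf.1 linear0.
- by rewrite ps fmap1.
by rewrite sp -[_ - _]addrC -scaleN1r lF scaleN1r fmap1 addrC.
Qed.

Lemma mult_gt0P X i : reflect (exists x : Hom (S i) X, x <> 0) (0 < mult X i)%N.
Proof.
apply: (iffP idP) => [mi|[x x0]].
  exists (inc (Ordinal mi)) => h; have := prj_inc (Ordinal mi) (Ordinal mi).
  rewrite h compm0 eqxx scale1r => /esym/eqP.
  by rewrite (negPf (simple_id_neq0 (S_simple i))).
rewrite lt0n; apply/negP => /eqP m0; apply: x0.
by rewrite [x](@inc_expand k C hC) big1 // => m; have := ltn_ord m; rewrite {2}m0.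
Qed.
End Regular.

Section Sub.
Variables (k : closedFieldType) (B : bmoncat k) (hB : fusion B).
Notation hS := (fusion_fss hB).
Notation so := (@so k B hB).
Variables (D : B -> Prop) (hD : fusion_subcat D).
Notation E := (sub_cat hD).

(** Splitting tests [f] only against endomorphisms of its source, which belong to the full
    subcategory. *)
Lemma sub_mono (X Y : E) (f : Hom X Y) : mono f -> @mono k B (sval X) (sval Y) f.
Proof.
move=> mf; have [|v vf] := @mono_split k B hS (sval X) (sval Y) f.
  by move=> g h; apply: (mf X).
exact: split_mono vf.
Qed.

Lemma sub_simple (X : E) : @simple k E X <-> @simple k B (sval X).
Proof.
split=> -[X0 sX]; split=> // Y f mf; last exact: sX _ _ (sub_mono mf).
by apply: (sX (exist D Y (fsub_sub hD mf (svalP X)))) => W; apply: mf.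
Qed.

Lemma sub_abelian : abelian E.
Proof.
have [bi ke co _ _] := fss_abelian hS; split.
- move=> n T; have [X bX] := bi n (fun j => sval (T j)).
  by exists (exist D X (fsub_sum hD (fun j => svalP (T j)) bX)).
- move=> X Y f; have [K [i ki]] := ke (sval X) (sval Y) f.
  exists (exist D K (fsub_sub hD (kernel_mono ki) (svalP X))), i; split; first exact: ki.1.
  by move=> W g; apply: ki.2.
- move=> X Y f; have [Q [p cp]] := co (sval X) (sval Y) f.
  have [s [v [ps _]]] := cokernel_split hS cp.
  exists (exist D Q (fsub_sub hD (split_mono ps) (svalP Y))), p; split; first exact: cp.1.
  by move=> W g; apply: cp.2.
- move=> X Y f mf; have [|r rf] := @mono_split k B hS (sval X) (sval Y) f.
    by move=> g h; apply: (mf X).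
  exists Y, (idm (sval Y) - f \oc r : Hom (sval Y) (sval Y)).
  apply: (@split_kernel k E _ _ _ _ _ r (idm Y)) => //=.
    by rewrite compBl comp1m -compA rf compm1 subrr.
  by rewrite comp1m subKr.
move=> X Y f ef; have [|s fs] := @epi_split k B hS (sval X) (sval Y) f.
  by move=> g h; apply: (ef Y).
exists X, (idm (sval X) - s \oc f : Hom (sval X) (sval X)).
apply: (@split_cokernel k E _ _ _ _ _ s (idm X)) => //=.
  by rewrite compBr compm1 compA fs comp1m subrr.
by rewrite compm1 subKr.
Qed.

Lemma sub_fusion : fusion E.
Proof.
split; first split.
- exact: sub_abelian.
- move=> X; have [n [T [sT bT]]] := fss_semisimple hS (sval X).
  have [i [p [pi _ _]]] := bT.
  have DT j : D (T j) by exact: (fsub_sub hD (split_mono (pi j)) (svalP X)).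
  exists n, (fun j => exist D (T j) (DT j)); split=> // j.
  by apply/sub_simple; apply: sT.
- by move=> X Y; apply: (fss_dim hS (sval X) (sval Y)).
- pose A := [pred i | `[<D (so i)>]].
  have DA (j : 'I_#|A|) : D (so (enum_val j)).
    by have := enum_valP j; rewrite inE => /asboolP.
  exists (existT (fun n => 'I_n -> E) #|A| (fun j => exist D _ (DA j))); split=> /=.
    by move=> j; apply/sub_simple; apply: so_simple.
  move=> X /sub_simple sX; have [i Xi] := S_index hS sX.
  have iA : i \in A by rewrite inE; apply/asboolP; exact: (fsub_isom hD Xi (svalP X)).
  exists (enum_rank_in iA i); split.
    change (@isom k B (sval X) (so (enum_val (enum_rank_in iA i)))).
    by rewrite enum_rankK_in.
  move=> j Xj; apply: enum_val_inj; rewrite enum_rankK_in //.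
  exact: (S_inj sX Xi).
- by move=> X; have [Xd XX] := fusion_ldual hB (sval X);
    exists (exist D Xd (fsub_ldual hD XX (svalP X))).
- by move=> X; have [Xd XX] := fusion_rdual hB (sval X);
    exists (exist D Xd (fsub_rdual hD XX (svalP X))).
by apply/sub_simple; apply: fusion_unit hB.
Qed.
End Sub.

Section Generated.
Variables (k : closedFieldType) (k0 : [pchar k] =i pred0).
Variables (B : bmoncat k) (hB : fusion B).
Notation hS := (fusion_fss hB).
Notation so := (@so k B hB).
Notation mult := (@mult k B hS).
Notation r := (rk hB).
Notation e := (i0 hB).
Notation N := (@N k B hB).
Notation st := (@star k B hB).
Hint Resolve so_simple S_simple : core.

Lemma tens_expand X Y : idm (X \ox Y) = \sum_i \sum_(m < mult X i) \sum_j \sum_(n < mult Y j)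
  ((inc m : Hom (so i) X) \om (inc n : Hom (so j) Y)) \oc (prj m \om prj n).
Proof.
rewrite -rwh1 -(sum_inc_prj hS X) rwh_sum; apply: eq_bigr => i _.
rewrite rwh_sum; apply: eq_bigr => m _.
rewrite -[LHS]comp1m -lwh1 -(sum_inc_prj hS Y) lwh_sum comp_suml; apply: eq_bigr => j _.
rewrite lwh_sum comp_suml; apply: eq_bigr => n _.
by rewrite /lwh /rwh -bmapM comp1m compm1 bmapM.
Qed.

Lemma tens_support X Y l (x : Hom (so l) (X \ox Y)) : x <> 0 ->
  exists i j, [/\ 0 < mult X i, 0 < mult Y j & 0 < N i j l]%N.
Proof.
move=> x0; apply: contrapT => no; apply: x0; rewrite -[x]comp1m tens_expand.
rewrite comp_suml big1 // => i _; rewrite comp_suml big1 // => m _.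
rewrite comp_suml big1 // => j _; rewrite comp_suml big1 // => n _; rewrite -compA.
apply: contrapT => xn; apply: no; exists i, j; split.
- exact: leq_ltn_trans (ltn_ord m).
- exact: leq_ltn_trans (ltn_ord n).
apply/mult_gt0P; exists ((prj m \om prj n) \oc x) => h.
by apply: xn; rewrite h compm0.
Qed.

Lemma hom_unit_index i (x : Hom (so i) (unit_ob B)) : x <> 0 -> i = e.
Proof.
move=> x0; have ix := schur hS (so_simple i) (unit_simple hB) x0.
apply: (S_inj (so_simple i)); first exact: isom_refl.
apply: isom_trans (un_i0 hB); by exists x.
Qed.

Lemma N_unit_star i j : (0 < N i j e)%N -> i = st j.
Proof.
have := N_frob k0 i (st j) e; rewrite (stK (N_rules k0 hB)) => ->.
by rewrite (N_unit k0); case: eqP => // ->.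
Qed.

Lemma pairing_support X i (h : Hom (so i \ox X) (unit_ob B)) : h <> 0 ->
  exists j, (0 < mult X j)%N /\ i = st j.
Proof.
move=> h0; have [l [y yn]] : exists l, exists y : Hom (so l) (so i \ox X), h \oc y <> 0.
  apply: contrapT => no; apply: h0; apply: (@hom_ext k B hS) => l y; rewrite comp0m.
  by apply: contrapT => hy; apply: no; exists l, y.
have [|i' [j [ii' mj nj]]] := @tens_support _ _ _ y.
  by move=> y0; apply: yn; rewrite y0 compm0.
exists j; split=> //; apply: N_unit_star.
have -> : i = i' by move: ii'; rewrite mult_S; case: eqP.
by rewrite -(hom_unit_index yn).
Qed.

(** If the evaluation restricted along x were zero, the zig-zag identity would give x = 0; so [so i]
    pairs nontrivially with X. *)
Lemma ldual_support Xd X i (x : Hom (so i) Xd) : is_dual Xd X -> x <> 0 ->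
  exists j, (0 < mult X j)%N /\ i = st j.
Proof.
move=> [ev [co [_ zz]]] x0.
apply: (@pairing_support X i (ev \oc (x |> X))) => h; apply: x0.
apply: rwh_unit_inj; rewrite rwh0.
apply: (iso_cancel_l (run_iso Xd)); rewrite compm0 -[in LHS]zz.
rewrite -/(lwh Xd co) -[LHS]compA -whC [LHS]compA -[X in X \oc _]compA assoV_nat1.
by rewrite [X in X \oc _]compA -[X in X \oc _ \oc _]compA -/(rwh ev Xd) -rwhM h rwh0 compm0 !comp0m.
Qed.

Lemma rdual_support Xd X i (x : Hom (so i) Xd) : is_dual X Xd -> x <> 0 ->
  exists j, (0 < mult X j)%N /\ i = st j.
Proof.
move=> [ev [co [zz _]]] x0.
apply: (@pairing_support X i (ev \oc (X <|| x) \oc braid (so i) X)) => h; apply: x0.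
have {}h : ev \oc (X <|| x) = 0.
  by apply: (iso_cancel_r (braid_iso (so i) X)); rewrite h comp0m.
apply: lwh_unit_inj; rewrite lwh0.
apply: (iso_cancel_l (lun_iso Xd)); rewrite compm0 -[in LHS]zz.
rewrite -/(rwh co Xd) -[LHS]compA whC [LHS]compA -[X in X \oc _]compA asso_nat3.
by rewrite [X in X \oc _]compA -[X in X \oc _ \oc _]compA -/(lwh Xd ev) -lwhM h lwh0 compm0 !comp0m.
Qed.

Variable P : 'I_r -> Prop.
(** Stated through the constituents, so that being a fusion subcategory becomes three conditions on
    the fusion rules. *)
Definition objs (X : B) : Prop := forall i, (0 < mult X i)%N -> P i.
Hypothesis Pe : P e.
Hypothesis PN : forall i j l, P i -> P j -> (0 < N i j l)%N -> P l.
Hypothesis Pst : forall i, P i -> P (st i).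

Lemma objs_subcat : fusion_subcat objs.
Proof.
have sub X Y (f : Hom Y X) : mono f -> objs X -> objs Y.
  move=> mf oX i /mult_gt0P[x x0]; apply: oX; apply/mult_gt0P.
  by exists (f \oc x) => h; apply: x0; apply: mf; rewrite h compm0.
split=> //.
- by move=> X Y /isom_sym[f fi]; apply: sub (is_iso_mono fi).
- move=> n T X oT [i [p [_ _ ip]]] l /mult_gt0P[x x0].
  have [j jx] : exists j, p j \oc x <> 0.
    apply: contrapT => no; apply: x0; rewrite -[x]comp1m -ip comp_suml big1 // => j _.
    rewrite -compA; suff -> : p j \oc x = 0 by rewrite compm0.
    by apply: contrapT => h; apply: no; exists j.
  by apply: (oT j); apply/mult_gt0P; exists (p j \oc x).
- by move=> i /mult_gt0P[x /hom_unit_index->].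
- move=> X Y oX oY l /mult_gt0P[x /tens_support[i [j [mi mj ml]]]].
  exact: PN (oX i mi) (oY j mj) ml.
- by move=> X Xd XX oX i /mult_gt0P[x /(ldual_support XX)[j [mj ->]]]; apply/Pst/oX.
by move=> X Xd XX oX i /mult_gt0P[x /(rdual_support XX)[j [mj ->]]]; apply/Pst/oX.
Qed.
End Generated.

Lemma dbl_tens_scalar (k : fieldType) (B : bmoncat k) (A X Y : B) (a b : k) :
  dbl A X = a *: idm _ -> dbl A Y = b *: idm _ -> dbl A (X \ox Y) = (a * b) *: idm _.
Proof.
rewrite !dblE => hX hY.
have : assoV A X Y \oc (braid (X \ox Y) A \oc braid A (X \ox Y)) \oc asso A X Y = (a * b) *: idm _.
  transitivity ((assoV A X Y \oc braid (X \ox Y) A \oc assoV X Y A) \oc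
     (asso X Y A \oc braid A (X \ox Y) \oc asso A X Y)).
    by rewrite !compA -(compA _ (assoV X Y A)) assoK compm1.
  rewrite hexagon hexagonV -!/(lwh _ _) -!/(rwh _ _).
  rewrite !compA -(compA _ (X <|| _) (X <|| _)) -lwhM hY lwhZ lwh1 compZr compm1 !compZl.
  rewrite -(compA _ (assoV _ _ _)) assoK compm1 -rwhM hX rwhZ rwh1.
  by rewrite scalerA mulrC.
move/(congr1 (fun f => asso A X Y \oc f \oc assoV A X Y)).
rewrite !compA assoVK comp1m -!compA assoVK compm1.
by rewrite compA compZr compm1 compZl assoVK.
Qed.

(** * The cyclic pointed subcategory and its centralizer *)

Section Pointed.
Variables (k : closedFieldType) (k0 : [pchar k] =i pred0).
Variables (B : bmoncat k) (hB : fusion B).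
Notation hS := (fusion_fss hB).
Notation so := (@so k B hB).
Notation mult := (@mult k B hS).
Notation r := (rk hB).
Notation e := (i0 hB).
Notation N := (@N k B hB).
Notation st := (@star k B hB).
Hint Resolve so_simple S_simple : core.
Variable F : fusion_numbers hB.
Notation d := (fd F).
Notation th := (fth F).
Notation dk := (dk F).
Notation chi := (chi F).
Hypothesis nondeg : braiding_nondegenerate B.
Variable D : nat.
Hypothesis dD : \sum_i d i ^+ 2 = D%:R.
Notation dsq := (dsq k0 dD).
Variables (b : 'I_r) (m : nat).
Hypotheses (m0 : (0 < m)%N) (db : dsq b = 1%N).
Hypothesis bo : forall j, (pw b j == e) = (m %| j)%N.
Hypothesis bchi : forall j, (chi b b ^+ j == 1) = (m %| j)%N.
Let FR := N_rules k0 hB.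

Lemma pw_mod j : pw b (j %% m) = pw b j.
Proof.
rewrite [in RHS](divn_eq j m) -(act_pw db).
have -> : pw b (j %/ m * m) = e by apply/eqP; rewrite bo dvdn_mull.
by rewrite (act_e k0 dD).
Qed.

Lemma chi_pp x y : chi (pw b x) (pw b y) = chi b b ^+ (x * y).
Proof.
rewrite (chi_pw db) exprM; congr (_ ^+ _).
by have := chi_sym k0 F (pw b x) b; rewrite !(inv_dk (dD := dD)) ?dsq_pw // !mulr1 => ->; rewrite (chi_pw db).
Qed.

Lemma expr_eq_mod x y : chi b b ^+ x = chi b b ^+ y -> x = y %[mod m].
Proof.
wlog xy : x y / (x <= y)%N.
  by move=> h; case/orP: (leq_total x y) => xy xyE; [apply: h|apply: esym; apply: h].
have cb : chi b b != 0 by rewrite (chi_bb db) expf_neq0 // th_neq0.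
move=> h; apply/eqP; rewrite eq_sym eqn_mod_dvd // -bchi.
by apply/eqP; apply: (mulIf (expf_neq0 x cb)); rewrite -exprD subnK // mul1r h.
Qed.

Definition cycP (i : 'I_r) : Prop := exists x, i = pw b x.
Definition perpP (i : 'I_r) : Prop := chi i b = 1.

(** The double braiding with the invertible b is a scalar on each simple object; by the hexagons and
    naturality this scalar grades the fusion rules. *)
Lemma chi_N i j l : (0 < N i j l)%N -> chi l b = chi i b * chi j b.
Proof.
move=> Nl; pose x : Hom (so l) (so i \ox so j) := inc (Ordinal Nl).
have hx := dbl_natr (so b) x.
rewrite (dbl_tens_scalar (dbl_act db i) (dbl_act db j)) (dbl_act db l) in hx.
rewrite compZl comp1m compZr compm1 in hx.
apply/eqP; rewrite eq_sym -subr_eq0; apply: contrapT => /negP ne.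
have := congr1 (fun f => (so b <|| prj (Ordinal Nl)) \oc f) hx.
rewrite !compZr -lwhM prj_inc eqxx scale1r lwh1 => /(congr1 (@sc _ _ _)).
by have sl := simple_act db l; rewrite !(scP hS) // => h; rewrite h subrr eqxx in ne.
Qed.

Lemma cyc_subcat : fusion_subcat (objs (hB := hB) cycP).
Proof.
apply: (objs_subcat k0).
- by exists 0%N.
- move=> _ _ l [x ->] [y ->]; rewrite (N_act (dsq_pw db x)) (act_pw db).
  by case: eqP => // -> _; exists (x + y)%N.
move=> _ [x ->]; exists (m.-1 * x)%N.
apply: (act_inj (dsq_pw db x)).
rewrite (act_comm (dsq_pw db x)) ?dsq_st ?dsq_pw // (act_st (dsq_pw db x)).
rewrite (act_comm (dsq_pw db x)) ?dsq_pw // (act_pw db); by apply/esym/eqP; rewrite bo addnC -mulSn prednK // dvdn_mulr.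
Qed.

Lemma perp_e : perpP e.
Proof.
have := chi_sym k0 F e b.
by rewrite (chi_e k0 F) (inv_dk (dsq_e k0 dD)) (inv_dk db) !mulr1.
Qed.

Lemma perp_subcat : fusion_subcat (objs (hB := hB) perpP).
Proof.
apply: (objs_subcat k0).
- exact: perp_e.
- by move=> i j l; rewrite /perpP => pi pj /chi_N->; rewrite pi pj mulr1.
move=> i pi; have ei : (0 < N i (st i) e)%N by rewrite (N_st_e FR) eqxx.
have := chi_N ei; rewrite pi mul1r => h; rewrite /perpP -h.
exact: perp_e.
Qed.

Notation DP := (objs (hB := hB) cycP).

Lemma objs_so (P : 'I_r -> Prop) i : P i -> objs (hB := hB) P (so i).
Proof. by move=> Pi j; rewrite mult_S; case: eqP => // ->. Qed.

Lemma simple_isom_so Y i : simple Y -> (0 < mult Y i)%N -> isom (so i) Y.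
Proof.
move=> sY /mult_gt0P[x x0]; exists x; exact: (schur hS (so_simple i) sY x0).
Qed.

Lemma perp_centralizing j : perpP j -> centralizing DP (so j).
Proof.
move=> pj; split=> // X oX sX.
have [i iX] := S_index hS sX; have mi : (0 < mult X i)%N.
  have [f [g [fg gf]]] := isom_sym iX; apply/mult_gt0P; exists f => f0.
  by have := simple_id_neq0 (so_simple i); rewrite -fg f0 compm0 eqxx.
have [x ix] := oX i mi; have [f fi] := isom_sym iX.
rewrite -dblE; apply: (iso_cancel_r (rwh_iso (so j) fi)).
rewrite dbl_natl comp1m; rewrite ix in f fi *.
by rewrite (dbl_act (dsq_pw db x)) (chi_pw db) pj expr1n scale1r compm1.
Qed.

(** One inclusion tests a centralizing object against [so b] alone; conversely trivial double
    braiding with b entails the same with all its powers. *)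
Lemma centralizer_perp X : centralizer DP X <-> objs (hB := hB) perpP X.
Proof.
split=> [cX|oX].
  apply: (cX _ perp_subcat) => Y [sY cY] i mi.
  have [f fi] := simple_isom_so sY mi.
  have bD : DP (so b) by apply: objs_so; exists 1%N; rewrite /pw /= (act_ae db).
  have := cY _ bD (so_simple b); rewrite -dblE => dE.
  have := dbl_natr (so b) f; rewrite dE comp1m (dbl_act db) compZr compm1.
  have [g [gf _]] := fi.
  move/(congr1 (fun h => (so b <|| g) \oc h)); rewrite compZr -lwhM gf lwh1.
  by have sb := simple_act db i; move/(congr1 (@sc _ _ _)); rewrite (scP hS) // (sc1 hS).
have hc := centralizer_fusion_subcat DP.
have [n [T [sT bT]]] := fss_semisimple hS X.
apply: (fsub_sum hc _ bT) => j; have [i [p [pi _ _]]] := bT.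
have [l lT] := S_index hS (sT j).
apply: (fsub_isom hc (isom_sym lT)) => D' hD' sub; apply: sub; apply: perp_centralizing.
apply: oX; apply/mult_gt0P; have [f [g [fg gf]]] := isom_sym lT.
exists (i j \oc f) => h; have := simple_id_neq0 (so_simple l).
by rewrite -fg -[f]comp1m -pi -!compA h !compm0 eqxx.
Qed.

Lemma cyc_perp_simple i j : cycP i -> perpP j -> simple (so i \ox so j).
Proof. by move=> [x ->] _; apply: (simple_act (dsq_pw db x)). Qed.

Lemma chi_actb i j : cycP i -> chi (act i j) b = chi i b * chi j b.
Proof.
by move=> [x ->]; apply: chi_N; rewrite (N_act (dsq_pw db x)) eqxx.
Qed.

Lemma cyc_perp_inj i i' j j' : cycP i -> cycP i' -> perpP j -> perpP j' ->
  isom (so i \ox so j) (so i' \ox so j') -> i = i' /\ j = j'.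
Proof.
move=> [x ->] [x' ->] pj pj' ij.
have aE : act (pw b x) j = act (pw b x') j'.
  apply: (S_inj (simple_act (dsq_pw db x) j)); first exact: isom_act (dsq_pw db x) j.
  exact: isom_trans ij (isom_act (dsq_pw db x') j').
have xx : pw b x = pw b x'.
  have := congr1 (fun l => chi l b) aE; rewrite !chi_actb; [| by exists x'| by exists x].
  rewrite pj pj' !mulr1 => h.
  have h1 y : chi (pw b y) b = chi b b ^+ y.
    by have := chi_pp y 1; rewrite muln1 /pw /= (act_ae db).
  rewrite !h1 in h; rewrite -(pw_mod x) -(pw_mod x'); congr (pw b _).
  exact: expr_eq_mod.
by split=> //; apply: (act_inj (dsq_pw db x)); rewrite aE xx.
Qed.

(** chi l b is an m-th root of unity, hence the x-th power of the primitive root chi b b for some x;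
    multiplying l by the inverse of b^x makes it centralize b. *)
Lemma cyc_perp_dense l : exists i j, [/\ cycP i, perpP j & isom (so i \ox so j) (so l)].
Proof.
have pr : m.-primitive_root (chi b b).
  apply/andP; split=> //; apply/forallP => i; apply/eqP.
  rewrite unity_rootE bchi; apply/idP/eqP => [h|->] //.
  by apply/eqP; rewrite eqn_leq ltn_ord /= dvdn_leq.
have lm : chi l b ^+ m = 1.
  rewrite -(chi_pw db); have := bo m; rewrite dvdnn => /eqP->; exact: (chi_e k0 F).
have [x xE] := prim_rootP pr lm.
pose y := (m - x)%N; have yx : (x + y = m)%N by rewrite subnKC // ltnW.
have h1 z : chi (pw b z) b = chi b b ^+ z.
  by have := chi_pp z 1; rewrite muln1 /pw /= (act_ae db).
exists (pw b x), (act (pw b y) l); split; first by exists x.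
  rewrite /perpP chi_actb; last by exists y.
  by rewrite h1 xE -exprD addnC yx; apply/eqP; rewrite bchi.
have lE : act (pw b x) (act (pw b y) l) = l.
  rewrite -(act_act l (dsq_pw db x) (dsq_pw db y)) (act_pw db) yx.
  have -> : pw b m = e by apply/eqP; rewrite bo.
  exact: (act_e k0 dD).
rewrite -{2}lE; exact: (isom_act (dsq_pw db x)).
Qed.

Lemma cyc_perp_dbl X Y : DP X -> objs (hB := hB) perpP Y -> dbl X Y = idm _.
Proof.
move=> dX pY; rewrite -[LHS]compm1 [in LHS](tens_expand hB) [RHS](tens_expand hB).
rewrite comp_sumr; apply: eq_bigr => i _; rewrite comp_sumr; apply: eq_bigr => n _.
rewrite comp_sumr; apply: eq_bigr => j _; rewrite comp_sumr; apply: eq_bigr => n' _.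
rewrite compA; congr (_ \oc _).
have [x ix] := dX i (leq_ltn_trans (leq0n n) (ltn_ord n)).
have pj := pY j (leq_ltn_trans (leq0n n') (ltn_ord n')).
have -> : (inc n : Hom (so i) X) \om (inc n' : Hom (so j) Y) = (inc n |> Y) \oc (so i <|| inc n').
  by rewrite /rwh /lwh -bmapM comp1m compm1.
rewrite compA dbl_natl -[LHS]compA dbl_natr.
suff -> : dbl (so i) (so j) = idm _ by rewrite compm1.
by rewrite ix (dbl_act (dsq_pw db x)) (chi_pw db) pj expr1n scale1r.
Qed.

Notation G := 'I_m.-1.+1.
Definition quad (x : G) : k := th (pw b x).

Lemma ord_m (x : G) : (x < m)%N. Proof. by rewrite -{2}(prednK m0) ltn_ord. Qed.
Lemma modm z : (z %% m.-1.+1 = z %% m)%N. Proof. by rewrite prednK. Qed.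
Lemma subm z : (m.-1.+1 - z = m - z)%N. Proof. by rewrite prednK. Qed.
Lemma addG (x y : G) : pw b (x + y)%R = pw b (x + y)%N.
Proof. by rewrite /= modm pw_mod. Qed.

Lemma polar_quad (x y : G) : polar quad x y = chi b b ^+ (x * y).
Proof.
rewrite /polar /quad addG -chi_pp (chi_inv (dsq_pw db y)) (act_pw db).
by rewrite addnC; congr (_ / _); rewrite mulrC.
Qed.

Lemma quad_nondegenerate : nondegenerate_quadratic_form quad.
Proof.
have cm x y : x = y %[mod m] -> chi b b ^+ x = chi b b ^+ y.
  have h z : chi b b ^+ (z %% m) = chi b b ^+ z.
    rewrite [in RHS](divn_eq z m) exprD.
    suff /eqP-> : chi b b ^+ (z %/ m * m) == 1 by rewrite mul1r.
    by rewrite bchi dvdn_mull.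
  by move=> xy; rewrite -(h x) -(h y) xy.
split.
- by move=> x; apply: th_neq0.
- move=> x; rewrite /quad.
  have xm := ltnW (ord_m x).
  have -> : pw b (- x)%R = pw b (m - x) by rewrite /= modm pw_mod subm.
  (* The extra factor clears the subtraction m - x from the exponents. *)
  rewrite !(th_pw db); apply: (mulIf (expf_neq0 (2 * m * x) (th_neq0 F b))).
  rewrite -exprD.
  have -> : ((m - x) * (m - x) + 2 * m * x = m * m + x * x)%N by nia.
  have t1 : th b ^+ (m * m) = 1.
    by rewrite -(th_pw db); have := bo m; rewrite dvdnn => /eqP->; exact: (th_e k0 F).
  rewrite exprD t1 mul1r -mulnA (exprM _ 2) -(chi_bb db).
  suff /eqP-> : chi b b ^+ (m * x) == 1 by rewrite mulr1.
  by rewrite bchi dvdn_mulr.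
- move=> x x' y; rewrite !polar_quad -exprD -mulnDl; apply: cm.
  by rewrite /= modm modnMml.
move=> x h; have := h (inZp 1); rewrite polar_quad => /eqP; rewrite bchi /= modm => hm.
have : (m %| x)%N.
  by move: hm; rewrite /dvdn modnMmr muln1.
rewrite /dvdn modn_small ?ord_m // => /eqP x0; exact: val_inj.
Qed.

Lemma cyc_pointed : is_pointed_category quad (sub_cat cyc_subcat).
Proof.
split; first exact: sub_fusion.
have DS (x : G) : DP (so (pw b x)) by apply: objs_so; exists x.
exists (fun x : G => exist DP (so (pw b x)) (DS x)); split.
- by move=> x; apply/(sub_simple hB); apply: so_simple.
- move=> X /(sub_simple hB) sX; have [i iX] := S_index hS sX.
  have mi : (0 < mult (sval X) i)%N.
    have [f [g [fg gf]]] := isom_sym iX; apply/mult_gt0P; exists f => f0.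
    by have := simple_id_neq0 (so_simple i); rewrite -fg f0 compm0 eqxx.
  have [x ix] := svalP X i mi.
  have xm : (x %% m < m.-1.+1)%N by rewrite prednK // ltn_mod.
  exists (Ordinal xm); split.
    change (@isom k B (sval X) (so (pw b (x %% m)))).
    by rewrite pw_mod -ix.
  move=> y Xy; have iy : i = pw b y by apply: (S_inj sX iX).
  apply: val_inj => /=; rewrite -(modn_small (ord_m y)).
  by apply: expr_eq_mod; have := congr1 (chi b) ix; rewrite {1}iy !(chi_pw db).
- move=> x y; change (@isom k B (so (pw b x) \ox so (pw b y)) (so (pw b (x + y)%R))).
  by rewrite addG -(act_pw db); apply: (isom_act (dsq_pw db x)).
by move=> x; apply: (braid_act (dsq_pw db x)).
Qed.
End Pointed.

(** * The Deligne product *)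

Section BifunctorSums.
Variables (k : fieldType) (A B T : lincat k) (G : bifunctor A B T).

Lemma bmap0l X X' Y Y' (g : Hom Y Y') : bmap G (0 : Hom X X') g = 0.
Proof. by have := bmapPl G (-1) (0 : Hom X X') 0 g; rewrite scaler0 addr0 scaleN1r addNr. Qed.
Lemma bmap0r X X' Y Y' (f : Hom X X') : bmap G f (0 : Hom Y Y') = 0.
Proof. by have := bmapPr G (-1) f (0 : Hom Y Y') 0; rewrite scaler0 addr0 scaleN1r addNr. Qed.
Lemma bmapZl X X' Y Y' a (f : Hom X X') (g : Hom Y Y') : bmap G (a *: f) g = a *: bmap G f g.
Proof. by have := bmapPl G a f 0 g; rewrite !addr0 bmap0l addr0. Qed.
Lemma bmapZr X X' Y Y' a (f : Hom X X') (g : Hom Y Y') : bmap G f (a *: g) = a *: bmap G f g.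
Proof. by have := bmapPr G a f g 0; rewrite !addr0 bmap0r addr0. Qed.
Lemma bmap_suml X X' Y Y' I (s : seq I) (P : pred I) (f : I -> Hom X X') (g : Hom Y Y') :
  bmap G (\sum_(i <- s | P i) f i) g = \sum_(i <- s | P i) bmap G (f i) g.
Proof.
elim/big_rec2: _ => [|i y1 y2 _ <-]; first exact: bmap0l.
by rewrite -[f i]scale1r bmapPl !scale1r.
Qed.
Lemma bmap_sumr X X' Y Y' I (s : seq I) (P : pred I) (f : Hom X X') (g : I -> Hom Y Y') :
  bmap G f (\sum_(i <- s | P i) g i) = \sum_(i <- s | P i) bmap G f (g i).
Proof.
elim/big_rec2: _ => [|i y1 y2 _ <-]; first exact: bmap0r.
by rewrite -[g i]scale1r bmapPr !scale1r.
Qed.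
Lemma bmapBl X X' Y Y' (f f' : Hom X X') (g : Hom Y Y') : bmap G (f - f') g = bmap G f g - bmap G f' g.
Proof. by rewrite addrC -scaleN1r bmapPl scaleN1r addrC. Qed.
Lemma bmapBr X X' Y Y' (f : Hom X X') (g g' : Hom Y Y') : bmap G f (g - g') = bmap G f g - bmap G f g'.
Proof. by rewrite addrC -scaleN1r bmapPr scaleN1r addrC. Qed.
End BifunctorSums.

Section LinearFunctor.
Variables (k : fieldType) (A B : lincat k) (F : functor A B) (lF : linear_functor F).
Lemma fmapD X Y (f g : Hom X Y) : fmap F (f + g) = fmap F f + fmap F g.
Proof. by rewrite -[f]scale1r lF !scale1r. Qed.
Lemma fmap0 X Y : fmap F (0 : Hom X Y) = 0.
Proof. by have := lF (-1) (0 : Hom X Y) 0; rewrite scaler0 addr0 scaleN1r addNr. Qed.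
Lemma fmap_sum X Y I (s : seq I) (P : pred I) (f : I -> Hom X Y) :
  fmap F (\sum_(i <- s | P i) f i) = \sum_(i <- s | P i) fmap F (f i).
Proof.
elim/big_rec2: _ => [|i y1 y2 _ <-]; first exact: fmap0.
by rewrite fmapD.
Qed.
End LinearFunctor.

Section Coordinates.
Variables (k : closedFieldType) (C : lincat k) (hC : finite_semisimple C).
Notation S := (projT2 (fss_enum hC)).
Notation mult := (@mult k C hC).

Definition coord_index (X X' : C) : finType :=
  {i : 'I_(projT1 (fss_enum hC)) & ('I_(mult X i) * 'I_(mult X' i))%type}.
Definition elem X X' (p : coord_index X X') : Hom X X' :=
  inc (tagged p).2 \oc prj (tagged p).1.
Definition coord X X' (p : coord_index X X') (f : Hom X X') : k :=
  sc (prj (tagged p).2 \oc f \oc inc (tagged p).1).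

Lemma coord_expand X X' (f : Hom X X') : f = \sum_p coord p f *: elem p.
Proof.
transitivity (\sum_i \sum_(m : 'I_(mult X i) * 'I_(mult X' i))
   sc (prj m.2 \oc f \oc inc m.1) *: (inc m.2 \oc prj m.1)); last first.
  by rewrite sig_big_dep.
rewrite -[LHS]compm1 -(sum_inc_prj hC X) comp_sumr; apply: eq_bigr => i _.
rewrite comp_sumr -(pair_bigA _ (fun m m' =>
  sc (prj m' \oc f \oc inc m) *: (inc m' \oc prj m))) /=.
apply: eq_bigr => m _; rewrite compA {1}[f \oc _](@inc_expand k C hC) comp_suml.
by apply: eq_bigr => m' _; rewrite compZl compA.
Qed.
End Coordinates.

Section Deligne.
Variables (k : closedFieldType) (B : bmoncat k) (hB : fusion B).
Notation hS := (fusion_fss hB).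
Notation so := (@so k B hB).
Notation mult := (@mult k B hS).
Notation r := (rk hB).
Variables (D1 D2 : B -> Prop) (h1 : fusion_subcat D1) (h2 : fusion_subcat D2).
Variables (P1 P2 : 'I_r -> Prop).
Hypothesis D1P : forall X, D1 X -> objs (hB := hB) P1 X.
Hypothesis D2P : forall X, D2 X -> objs (hB := hB) P2 X.
Hypothesis P1D : forall i, P1 i -> D1 (so i).
Hypothesis P2D : forall i, P2 i -> D2 (so i).
Hypothesis H1 : forall i j, P1 i -> P2 j -> simple (so i \ox so j).
Hypothesis H2 : forall i i' j j', P1 i -> P1 i' -> P2 j -> P2 j' ->
  isom (so i \ox so j) (so i' \ox so j') -> i = i' /\ j = j'.
Hypothesis H3 : forall l, exists i j, [/\ P1 i, P2 j & isom (so i \ox so j) (so l)].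
Notation E1 := (sub_cat h1).
Notation E2 := (sub_cat h2).
Implicit Types (X : E1) (Y : E2).

Definition box : bifunctor E1 E2 B :=
  @Bifunctor k E1 E2 B (fun X Y => sval X \ox sval Y) (fun X X' Y Y' f g => @bmap k B B B tens (sval X) (sval X') (sval Y) (sval Y') f g)
    (fun X Y => bmap1 tens (sval X) (sval Y))
    (fun X X' X'' Y Y' Y'' => @bmapM k B B B tens
       (sval X) (sval X') (sval X'') (sval Y) (sval Y') (sval Y''))
    (fun X X' Y Y' => @bmapPl k B B B tens (sval X) (sval X') (sval Y) (sval Y'))
    (fun X X' Y Y' => @bmapPr k B B B tens (sval X) (sval X') (sval Y) (sval Y')).

Lemma P1X X i : 'I_(mult (sval X) i) -> P1 i.
Proof. by move=> m; apply: (D1P (svalP X)); apply: leq_ltn_trans (ltn_ord m). Qed.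
Lemma P2Y Y i : 'I_(mult (sval Y) i) -> P2 i.
Proof. by move=> m; apply: (D2P (svalP Y)); apply: leq_ltn_trans (ltn_ord m). Qed.

(** Expanded into simple constituents, a morphism between boxes has, by [H1] and [H2], only scalar
    entries between equal pairs of indices. So the tensor products f (x) g span. *)
Lemma tens_ind X X' Y Y' (Q : Hom (box X Y) (box X' Y') -> Prop) : Q 0 ->
  (forall u v, Q u -> Q v -> Q (u + v)) -> (forall f g, Q (bmap box f g)) -> forall h, Q h.
Proof.
move=> Q0 QD Qt h.
have key i i' j j' (u : Hom (so i') (sval X')) (w : Hom (so j') (sval Y'))
    (p : Hom (sval X) (so i)) (q : Hom (sval Y) (so j))
    (t : Hom (so i \ox so j) (so i' \ox so j')) :
    P1 i -> P1 i' -> P2 j -> P2 j' -> Q ((u \om w) \oc (t \oc (p \om q))).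
  move=> pi pi' pj pj'.
  have s := H1 pi pj; have s' := H1 pi' pj'.
  have [->|/eqP tn] := eqVneq t 0; first by rewrite comp0m compm0.
  have [ii jj] := H2 pi pi' pj pj' (ex_intro _ t (schur hS s s' tn)).
  move: u w t tn {s' pi' pj'}; rewrite -ii -jj => u w t _.
  rewrite (scE hS t s) compZl comp1m compZr -bmapM -bmapZl; exact: Qt.
rewrite -[h]comp1m -[h]compm1.
rewrite (tens_expand hB (sval X')) comp_suml; apply: big_ind => // i' _.
rewrite comp_suml; apply: big_ind => // m' _; rewrite comp_suml; apply: big_ind => // j' _.
rewrite comp_suml; apply: big_ind => // n' _.
rewrite (tens_expand hB (sval X)) !comp_sumr; apply: big_ind => // i _.
rewrite !comp_sumr; apply: big_ind => // m _; rewrite !comp_sumr; apply: big_ind => // j _.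
rewrite !comp_sumr; apply: big_ind => // n _.
rewrite -[X in Q X]compA (compA h) (compA (prj m' \om prj n')) (compA (prj m' \om prj n')).
exact: key (P1X m) (P1X m') (P2Y n) (P2Y n').
Qed.

Section Extension.
Variables (E : lincat k) (G : bifunctor E1 E2 E).

(** [G] on arbitrary morphisms between boxes, computed from coordinates; [gext_tens] shows that it
    extends [G], whence functoriality by [tens_ind]. *)
Definition gext X X' Y Y' (h : Hom (box X Y) (box X' Y')) : Hom (G X Y) (G X' Y') :=
  locked_with str_key
  (\sum_(p : coord_index hS (sval X) (sval X')) \sum_(q : coord_index hS (sval Y) (sval Y'))
    sc ((prj (tagged p).2 \om prj (tagged q).2) \oc h \oc (inc (tagged p).1 \om inc (tagged q).1))
    *: @bmap _ _ _ _ G X X' Y Y' (elem p) (elem q)).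

Lemma simple_pq X X' Y Y' (p : coord_index hS (sval X) (sval X'))
  (q : coord_index hS (sval Y) (sval Y')) : simple (so (tag p) \ox so (tag q)).
Proof. exact: H1 (P1X (tagged p).1) (P2Y (tagged q).1). Qed.

Lemma gextP X X' Y Y' a (h h' : Hom (box X Y) (box X' Y')) :
  gext (a *: h + h') = a *: gext h + gext h'.
Proof.
rewrite /gext !locked_withE scaler_sumr -big_split; apply: eq_bigr => p _ /=.
rewrite scaler_sumr -big_split; apply: eq_bigr => q _ /=.
have s := simple_pq p q.
by rewrite compPr compPl (scD hS) // (scZ hS) // scalerDl scalerA.
Qed.

Lemma gext0 X X' Y Y' : gext (0 : Hom (box X Y) (box X' Y')) = 0.
Proof.
by have := gextP (-1) (0 : Hom (box X Y) (box X' Y')) 0; rewrite scaler0 addr0 scaleN1r addNr.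
Qed.

Lemma gextD X X' Y Y' (h h' : Hom (box X Y) (box X' Y')) : gext (h + h') = gext h + gext h'.
Proof. by rewrite -[h]scale1r gextP !scale1r. Qed.

Lemma gext_sum X X' Y Y' I (s : seq I) (P : pred I) (h : I -> Hom (box X Y) (box X' Y')) :
  gext (\sum_(i <- s | P i) h i) = \sum_(i <- s | P i) gext (h i).
Proof. by elim/big_rec2: _ => [|i y1 y2 _ <-]; rewrite ?gext0 ?gextD. Qed.

Lemma gext_tens X X' Y Y' (f : Hom X X') (g : Hom Y Y') : gext (bmap box f g) = bmap G f g.
Proof.
rewrite /gext locked_withE [f in RHS](@coord_expand k B hS) [g in RHS](@coord_expand k B hS).
rewrite [RHS](@bmap_suml _ _ _ _ G X X' Y Y'); apply: eq_bigr => p _.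
rewrite [RHS](@bmap_sumr _ _ _ _ G X X' Y Y'); apply: eq_bigr => q _.
rewrite [RHS](@bmapZl _ _ _ _ G X X' Y Y') [X in _ = _ *: X](@bmapZr _ _ _ _ G X X' Y Y') scalerA.
have scT (u : Hom (so (tag p)) (so (tag p))) (w : Hom (so (tag q)) (so (tag q))) :
    sc (u \om w) = sc u * sc w.
  rewrite {1}(scE hS u (so_simple _)) {1}(scE hS w (so_simple _)).
  by rewrite bmapZl bmapZr scalerA bmap1 (scP hS) //; exact: (simple_pq p q).
have hE (f' : Hom (sval X) (sval X')) (g' : Hom (sval Y) (sval Y')) :
    (prj (tagged p).2 \om prj (tagged q).2) \oc (f' \om g') \oc (inc (tagged p).1 \om inc (tagged q).1)
    = (prj (tagged p).2 \oc f' \oc inc (tagged p).1) \om (prj (tagged q).2 \oc g' \oc inc (tagged q).1).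
  by rewrite -!bmapM.
congr (_ *: _); exact: etrans (congr1 (@sc _ _ _) (hE f g)) (scT _ _).
Qed.

Lemma gext1 X Y : gext (idm (box X Y)) = idm (G X Y).
Proof. by rewrite -bmap1 gext_tens bmap1. Qed.

Lemma gextM X X' X'' Y Y' Y'' (h' : Hom (box X' Y') (box X'' Y'')) (h : Hom (box X Y) (box X' Y')) :
  gext (h' \oc h) = gext h' \oc gext h.
Proof.
move: h'; apply: tens_ind => [|u v hu hv|f' g']; first by rewrite comp0m !gext0 comp0m.
  by rewrite compDl !gextD compDl hu hv.
move: h; apply: tens_ind => [|u v hu hv|f g]; first by rewrite compm0 !gext0 compm0.
  by rewrite compDr !gextD compDr hu hv.
by rewrite -bmapM !gext_tens bmapM.
Qed.
End Extension.

(** A decomposition of [Z] as a direct sum of boxes, which exists by [H3]. One is fixed for each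
    object in [cover]. *)
Record dense_data (Z : B) := DenseData {
  dn : nat;
  dX : 'I_dn -> E1;
  dY : 'I_dn -> E2;
  di : forall a, Hom (box (dX a) (dY a)) Z;
  dp : forall a, Hom Z (box (dX a) (dY a));
  dpi : forall a, dp a \oc di a = idm _;
  dpi0 : forall a a', a != a' -> dp a \oc di a' = 0;
  dip : \sum_a di a \oc dp a = idm Z }.

Arguments dX [Z] d a.
Arguments dY [Z] d a.
Arguments di [Z] d a.
Arguments dp [Z] d a.
Arguments dpi [Z] d a.
Arguments dpi0 [Z] d a a'.

Lemma dense_data_exist Z : inhabited (dense_data Z).
Proof.
have ex l : exists p : 'I_r * 'I_r, [/\ P1 p.1, P2 p.2 & isom (so p.1 \ox so p.2) (so l)].
  by have [i [j h]] := H3 l; exists (i, j).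
pose x l := sval (cid (ex l)); have xP l := svalP (cid (ex l)); rewrite -/(x _) in xP.
have ex2 l : exists f : Hom (so (x l).1 \ox so (x l).2) (so l) * Hom (so l) (so (x l).1 \ox so (x l).2),
  f.2 \oc f.1 = idm _ /\ f.1 \oc f.2 = idm _.
  by have [_ _ [f [g fg]]] := xP l; exists (f, g).
pose f l := sval (cid (ex2 l)); have fP l := svalP (cid (ex2 l)); rewrite -/(f _) in fP.
have x1 l : P1 (x l).1 by case: (xP l).
have x2 l : P2 (x l).2 by case: (xP l).
pose I : finType := {l : 'I_r & 'I_(mult Z l)}.
pose v (a : 'I_#|I|) : I := enum_val a.
split; apply: (@DenseData Z #|I|
  (fun a => exist D1 (so (x (tag (v a))).1) (P1D (x1 (tag (v a)))))
  (fun a => exist D2 (so (x (tag (v a))).2) (P2D (x2 (tag (v a)))))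
  (fun a => inc (tagged (v a)) \oc (f (tag (v a))).1)
  (fun a => (f (tag (v a))).2 \oc prj (tagged (v a)))).
- move=> a; rewrite -compA (compA (prj _)) prj_inc eqxx scale1r comp1m.
  by case: (fP (tag (v a))).
- move=> a a' aa; rewrite -compA (compA (prj _)).
  suff -> : prj (tagged (v a)) \oc inc (tagged (v a')) = 0 by rewrite comp0m compm0.
  have : v a != v a' by rewrite (inj_eq enum_val_inj).
  case: (v a) => l m; case: (v a') => l' m' /=.
  have [ll|ll _] := eqVneq l l'; last by rewrite (S_hom0 (prj m \oc inc m')) // eq_sym.
  case: _ / ll m' => m'; rewrite prj_inc; have [->|mm _] := eqVneq m m'; last by rewrite scale0r.
  by rewrite eqxx.
rewrite -(sum_inc_prj hS Z).
rewrite (eq_bigr (fun a => inc (tagged (v a)) \oc prj (tagged (v a)))) => [|a _].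
  rewrite -(big_enum_val (A := I) (fun p : I => inc (tagged p) \oc prj (tagged p))).
  by rewrite sig_big_dep.
by rewrite -compA (compA _ _ (prj _)) (fP _).2 comp1m.
Qed.
Definition cover Z : dense_data Z := inhabited_witness (dense_data_exist Z).

Section Existence.
Variables (E : lincat k) (hE : abelian E) (G : bifunctor E1 E2 E).

Record image_data (Z : B) := ImageData {
  iO : E;
  ii : forall a, Hom (G (dX (cover Z) a) (dY (cover Z) a)) iO;
  ip : forall a, Hom iO (G (dX (cover Z) a) (dY (cover Z) a));
  ipi : forall a, ip a \oc ii a = idm _;
  ipi0 : forall a a', a != a' -> ip a \oc ii a' = 0;
  iip : \sum_a ii a \oc ip a = idm iO }.

Lemma image_data_exist Z : inhabited (image_data Z).
Proof.
have [bi _ _ _ _] := hE; have [X [i [p [h1' h2' h3']]]] := bi _ (fun a => G (dX (cover Z) a) (dY (cover Z) a)).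
by split; apply: ImageData h1' h2' h3'.
Qed.
Definition im Z : image_data Z := inhabited_witness (image_data_exist Z).

(** Between covers a morphism is a matrix of morphisms of boxes, to whose entries [gext] applies. *)
Definition ext_map Z Z' (f : Hom Z Z') : Hom (iO (im Z)) (iO (im Z')) :=
  \sum_a' \sum_a ii (im Z') a' \oc gext G (dp (cover Z') a' \oc f \oc di (cover Z) a) \oc ip (im Z) a.

Lemma ext_map_ip Z Z' (f : Hom Z Z') a' :
  ip (im Z') a' \oc ext_map f = \sum_a gext G (dp (cover Z') a' \oc f \oc di (cover Z) a) \oc ip (im Z) a.
Proof.
rewrite /ext_map comp_sumr (bigD1 a') //= [X in _ + X]big1 ?addr0 => [|a aa].
  by rewrite comp_sumr; apply: eq_bigr => a _; rewrite -[X in _ \oc X]compA compA ipi comp1m.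
by rewrite comp_sumr big1 // => a'' _; rewrite -[X in _ \oc X]compA compA ipi0 1?eq_sym // comp0m.
Qed.

Fact ext_map1 Z : ext_map (idm Z) = idm (iO (im Z)).
Proof.
rewrite -iip; apply: eq_bigr => a _; rewrite (bigD1 a) //= big1 ?addr0 => [|a' aa].
  by rewrite compm1 dpi gext1 compm1.
by rewrite compm1 dpi0 1?eq_sym // gext0 compm0 comp0m.
Qed.

Fact ext_mapM Z Z' Z'' (g : Hom Z' Z'') (f : Hom Z Z') :
  ext_map (g \oc f) = ext_map g \oc ext_map f.
Proof.
rewrite [in LHS]/ext_map [X in _ = X \oc _]/ext_map comp_suml; apply: eq_bigr => a'' _.
rewrite comp_suml.
under [RHS]eq_bigr => a' _ do rewrite -compA ext_map_ip comp_sumr.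
rewrite exchange_big /=; apply: eq_bigr => a _.
have -> : dp (cover Z'') a'' \oc (g \oc f) \oc di (cover Z) a =
   \sum_a' (dp (cover Z'') a'' \oc g \oc di (cover Z') a') \oc (dp (cover Z') a' \oc f \oc di (cover Z) a).
  rewrite -[g in LHS]compm1 -(dip (cover Z')) comp_sumr comp_suml comp_sumr comp_suml.
  by apply: eq_bigr => a' _; rewrite !compA.
rewrite gext_sum comp_sumr comp_suml; apply: eq_bigr => a' _.
by rewrite gextM !compA.
Qed.

Definition extF : functor B E := Functor ext_map1 ext_mapM.

Lemma extF_linear : linear_functor extF.
Proof.
move=> Z Z' c f g; rewrite /= /ext_map scaler_sumr -big_split; apply: eq_bigr => a' _ /=.
rewrite scaler_sumr -big_split; apply: eq_bigr => a _ /=.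
by rewrite compPr compPl gextP compPr compPl.
Qed.

Definition ext_iso X Y : Hom (iO (im (box X Y))) (G X Y) :=
  \sum_a gext G (di (cover (box X Y)) a) \oc ip (im (box X Y)) a.

Lemma ext_iso_nat X X' Y Y' (h : Hom (box X Y) (box X' Y')) :
  ext_iso X' Y' \oc ext_map h = gext G h \oc ext_iso X Y.
Proof.
rewrite /ext_iso comp_suml comp_sumr.
under eq_bigr => a' _ do rewrite -compA ext_map_ip comp_sumr.
rewrite exchange_big /=; apply: eq_bigr => a _.
rewrite compA -gextM -[h in RHS]comp1m -(dip (cover (box X' Y'))) !comp_suml gext_sum comp_suml.
by apply: eq_bigr => a' _; rewrite compA -gextM !compA.
Qed.

Lemma ext_iso_iso X Y : is_iso (ext_iso X Y).
Proof.
pose Z := box X Y.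
have pa a : ext_iso X Y \oc ii (im Z) a = gext G (di (cover Z) a).
  rewrite /ext_iso comp_suml (bigD1 a) //= big1 ?addr0 => [|a' aa]; rewrite -compA.
    by rewrite ipi compm1.
  by rewrite ipi0 // compm0.
exists (\sum_a ii (im Z) a \oc gext G (dp (cover Z) a)); split.
  rewrite -iip /ext_iso comp_suml; apply: eq_bigr => a _.
  rewrite comp_sumr (bigD1 a) //= big1 ?addr0 => [|a' aa].
    by rewrite -compA (compA (gext G _)) -gextM dpi gext1 comp1m.
  by rewrite -compA (compA (gext G _)) -gextM dpi0 1?eq_sym // gext0 comp0m compm0.
rewrite comp_sumr -gext1 -(dip (cover Z)) gext_sum; apply: eq_bigr => a _.
by rewrite compA pa gextM.
Qed.
End Existence.

Lemma box_right_exact : right_exact2 box.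
Proof.
have f1 := fusion_fss (sub_fusion hB h1); have f2 := fusion_fss (sub_fusion hB h2).
split=> [X X' Q Y f p pf|X Y Y' Q f p pf].
  have [s [v [ps sp]]] := cokernel_split f1 pf.
  apply: (@split_cokernel _ _ _ _ _ _ _ (bmap box s (idm Y)) (bmap box v (idm Y)));
    rewrite -!bmapM comp1m.
  - by rewrite pf.1 bmap0l.
  - by rewrite ps bmap1.
  by rewrite sp bmapBl bmap1.
have [s [v [ps sp]]] := cokernel_split f2 pf.
apply: (@split_cokernel _ _ _ _ _ _ _ (bmap box (idm X) s) (bmap box (idm X) v));
  rewrite -!bmapM comp1m.
- by rewrite pf.1 bmap0r.
- by rewrite ps bmap1.
by rewrite sp bmapBr bmap1.
Qed.

(** Existence is [extF]. For the second half, [tens_ind] makes t natural for all morphisms between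
    boxes, and it then extends uniquely because every object is a direct sum of boxes. *)
Lemma box_universal : deligne_universal box.
Proof.
move=> E hE; split=> [G _|F F' lF _ lF' _ t tn].
  exists (extF hE G); split; first exact: extF_linear.
    exact: (linear_right_exact hS (extF_linear hE G)).
  exists (fun X : prod_lincat E1 E2 => ext_iso hE G X.1 X.2); split=> [X X' f|X]; last exact: ext_iso_iso.
  have := ext_iso_nat hE G (bmap box f.1 f.2); rewrite gext_tens; exact.
have tN X X' Y Y' (h : Hom (box X Y) (box X' Y')) :
    t (X', Y') \oc fmap F h = fmap F' h \oc t (X, Y).
  move: h; apply: tens_ind => [|u v hu hv|f g].
  - by rewrite !fmap0 // comp0m compm0.
  - by rewrite !fmapD // compDl compDr hu hv.
  exact: (tn (X, Y) (X', Y') (f, g)).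
pose s Z : Hom (F Z) (F' Z) :=
  \sum_a fmap F' (di (cover Z) a) \oc t (dX (cover Z) a, dY (cover Z) a) \oc fmap F (dp (cover Z) a).
have sN X Y Z (h : Hom (box X Y) Z) : s Z \oc fmap F h = fmap F' h \oc t (X, Y).
  rewrite /s comp_suml -[h in RHS]comp1m -(dip (cover Z)) comp_suml fmap_sum // comp_suml.
  apply: eq_bigr => a _; rewrite -[LHS]compA -fmapM -[LHS]compA tN compA -fmapM.
  by rewrite compA.
exists s; split.
  split=> [Z Z' h|X]; last first.
    have := sN X.1 X.2 _ (idm (box X.1 X.2)); rewrite !fmap1 compm1 comp1m => ->.
    by case: X.
  rewrite {2}/s comp_sumr -[h in LHS]compm1 -(dip (cover Z)) comp_sumr fmap_sum // comp_sumr.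
  apply: eq_bigr => a _; rewrite (compA h) fmapM (compA (s Z')) sN !compA; congr (_ \oc _ \oc _).
  by rewrite fmapM.
move=> s' [s'n s't]; apply: functional_extensionality_dep => Z.
rewrite -[RHS]compm1 -fmap1 -(dip (cover Z)) fmap_sum // comp_sumr; apply: eq_bigr => a _.
rewrite fmapM compA s'n -(s't (dX (cover Z) a, dY (cover Z) a)) //.
Qed.
End Deligne.

(** * Coherence for the interchange of the middle factors *)

Section Coherence.
Variables (k : fieldType) (B : bmoncat k).

Inductive word := Letter of B | Empty | Cat of word & word.
Implicit Types (s t u : word) (W X Y Z : B).

Fixpoint ob t : B :=
  match t with Letter X => X | Empty => unit_ob B | Cat s t => ob s \ox ob t end.
Fixpoint fl t (W : B) : B :=
  match t with Letter X => W \ox X | Empty => W | Cat s t => fl t (fl s W) end.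
Fixpoint flm t W W' (f : Hom W W') : Hom (fl t W) (fl t W') :=
  match t with Letter X => f |> X | Empty => f | Cat s t => flm t (flm s f) end.
Fixpoint fm t W : Hom (W \ox ob t) (fl t W) :=
  match t with
  | Letter X => idm _
  | Empty => run W
  | Cat s t => fm t (fl s W) \oc (fm s W |> ob t) \oc assoV W (ob s) (ob t)
  end.

Lemma flm1 t W : flm t (idm W) = idm (fl t W).
Proof. by elim: t W => [X|//|s IHs t IHt] W /=; rewrite ?rwh1 // IHs IHt. Qed.
Lemma fm_nat t W W' (f : Hom W W') : fm t W' \oc (f |> ob t) = flm t f \oc fm t W.
Proof.
elim: t W W' f => [X|//|s IHs t IHt] W W' f /=; first by rewrite comp1m compm1.
  exact: run_nat.
by rewrite -[LHS]compA assoV_nat1 compA -(compA _ (fm s W' |> ob t)) -rwhM IHs rwhM !compA IHt.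
Qed.

Lemma fm_iso t W : is_iso (fm t W).
Proof.
elim: t W => [X W|W|s IHs t IHt W] /=; [exact: is_iso_id|exact: (run_iso W)|].
exact: is_iso_comp (is_iso_comp (IHt _) (rwh_iso _ (IHs _))) (assoV_iso _ _ _).
Qed.

(* In the left-normed words [fl s W] all associators and unitors disappear. *)
Definition rep s t (f : Hom (ob s) (ob t)) (p : forall W, Hom (fl s W) (fl t W)) : Prop :=
  forall W, fm t W \oc (W <|| f) = p W \oc fm s W.

Lemma rep_inj s t f f' g g' p p' : @rep s t f p -> @rep s t f' p' ->
  g = f -> g' = f' -> (forall W, p W = p' W) -> g = g'.
Proof.
move=> rf rf' -> -> pp; apply: lwh_unit_inj; apply: (iso_cancel_l (fm_iso t _)).
by rewrite rf rf' pp.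
Qed.

Lemma rep_ext s t f f' p p' : @rep s t f p -> f' = f -> (forall W, p W = p' W) ->
  @rep s t f' p'.
Proof. by move=> rf -> pp W; rewrite -pp. Qed.

Lemma rep_id s : @rep s s (idm (ob s)) (fun W => idm _).
Proof. by move=> W; rewrite lwh1 comp1m compm1. Qed.

Lemma rep_comp s t u f g p q : @rep s t f p -> @rep t u g q ->
  @rep s u (g \oc f) (fun W => q W \oc p W).
Proof. by move=> rf rg W; rewrite lwhM compA rg -compA rf compA. Qed.

Lemma rep_inv s t f g p : @rep s t f p -> f \oc g = idm _ ->
  forall q, (forall W, q W \oc p W = idm _) -> @rep t s g q.
Proof.
move=> rf fg q qp W; rewrite -[LHS]comp1m -qp -compA (compA (p W)) -rf -compA -lwhM fg.
by rewrite lwh1 compm1.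
Qed.

Lemma rep_tens s s' t t' f g p q : @rep s s' f p -> @rep t t' g q ->
  @rep (Cat s t) (Cat s' t') (f \om g) (fun W => q (fl s' W) \oc flm t (p W)).
Proof.
move=> rf rg W /=.
have -> : f \om g = (ob s' <|| g) \oc (f |> ob t) by rewrite /lwh /rwh -bmapM comp1m compm1.
rewrite lwhM -[LHS]compA (compA (assoV _ _ _)) assoV_nat3 -[X in _ \oc X]compA assoV_nat2.
rewrite [LHS]compA -(compA _ (fm s' W |> _)) whC (compA _ (_ <|| g)) rg.
rewrite compA -(compA _ (fm s' W |> _)) -rwhM rf rwhM -!compA; congr (_ \oc _).
by rewrite !compA fm_nat.
Qed.

Lemma rep_asso s t u : @rep (Cat (Cat s t) u) (Cat s (Cat t u)) (asso (ob s) (ob t) (ob u)) (fun W => idm _).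
Proof.
move=> W /=; rewrite comp1m.
rewrite !rwhM -(compA _ (assoV (fl s W) _ _)) assoV_nat1.
rewrite -!compA; congr (_ \oc (_ \oc (_ \oc _))).
by rewrite -pentagonV !compA assoK comp1m.
Qed.

Lemma rep_assoV s t u : @rep (Cat s (Cat t u)) (Cat (Cat s t) u) (assoV (ob s) (ob t) (ob u)) (fun W => idm _).
Proof. by apply: (rep_inv (@rep_asso s t u) (assoVK _ _ _)) => W; rewrite comp1m. Qed.

Lemma rep_run t : @rep (Cat t Empty) t (run (ob t)) (fun W => idm _).
Proof.
move=> W /=; rewrite comp1m run_nat -[RHS]compA run_tens -compA assoVK compm1 //.
Qed.

Lemma rep_lun t : @rep (Cat Empty t) t (lun (ob t)) (fun W => idm _).
Proof. by move=> W /=; rewrite comp1m -[RHS]compA triangleV. Qed.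

Lemma rep_runV t : @rep t (Cat t Empty) (runV (ob t)) (fun W => idm _).
Proof. by apply: (rep_inv (@rep_run t) (runVK _)) => W; rewrite comp1m. Qed.

Lemma rep_lunV t : @rep t (Cat Empty t) (lunV (ob t)) (fun W => idm _).
Proof. by apply: (rep_inv (@rep_lun t) (lunVK _)) => W; rewrite comp1m. Qed.

Lemma rep_braid X Y : @rep (Cat (Letter X) (Letter Y)) (Cat (Letter Y) (Letter X))
  (braid X Y) (fun W => xing X Y W).
Proof.
move=> W; rewrite xingE vfamE /= !rwh1 !comp1m.
by rewrite -[RHS]compA assoVK compm1.
Qed.

Lemma rep_braid_catl s s' t p q : @rep (Cat s t) (Cat t s) (braid (ob s) (ob t)) p ->
  @rep (Cat s' t) (Cat t s') (braid (ob s') (ob t)) q ->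
  @rep (Cat (Cat s s') t) (Cat t (Cat s s')) (braid (ob s \ox ob s') (ob t))
    (fun W => flm s' (p W) \oc q (fl s W)).
Proof.
move=> rp rq.
have -> : braid (ob s \ox ob s') (ob t) = asso (ob t) (ob s) (ob s') \oc
   ((braid (ob s) (ob t) \om idm (ob s')) \oc assoV (ob s) (ob t) (ob s') \oc
    (idm (ob s) \om braid (ob s') (ob t))) \oc asso (ob s) (ob s') (ob t).
  by rewrite -hexagonV !compA assoVK comp1m -compA assoK compm1.
apply: (rep_ext (rep_comp (rep_comp (@rep_asso s s' t) (rep_comp (rep_comp
  (rep_tens (@rep_id s) rq) (@rep_assoV s t s')) (rep_tens rp (@rep_id s')))) (@rep_asso t s s'))); first by rewrite !compA.
by move=> W /=; rewrite !flm1 !compm1 !comp1m.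
Qed.

Lemma rep_braid_catr s t t' p q : @rep (Cat s t) (Cat t s) (braid (ob s) (ob t)) p ->
  @rep (Cat s t') (Cat t' s) (braid (ob s) (ob t')) q ->
  @rep (Cat s (Cat t t')) (Cat (Cat t t') s) (braid (ob s) (ob t \ox ob t'))
    (fun W => q (fl t W) \oc flm t' (p W)).
Proof.
move=> rp rq.
have -> : braid (ob s) (ob t \ox ob t') = assoV (ob t) (ob t') (ob s) \oc
   ((idm (ob t) \om braid (ob s) (ob t')) \oc asso (ob t) (ob s) (ob t') \oc
    (braid (ob s) (ob t) \om idm (ob t'))) \oc assoV (ob s) (ob t) (ob t').
  by rewrite -hexagon !compA assoK comp1m -compA assoVK compm1.
apply: (rep_ext (rep_comp (rep_comp (@rep_assoV s t t') (rep_comp (rep_comp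
  (rep_tens rp (@rep_id t')) (@rep_asso t s t')) (rep_tens (@rep_id t) rq))) (@rep_assoV t t' s))); first by rewrite !compA.
by move=> W /=; rewrite !flm1 !compm1 !comp1m.
Qed.

Lemma rep_braid_unitr t : @rep (Cat t Empty) (Cat Empty t) (braid (ob t) (unit_ob B)) (fun W => idm _).
Proof.
have -> : braid (ob t) (unit_ob B) = lunV (ob t) \oc run (ob t).
  by rewrite -lun_braid compA lunK comp1m.
by move=> W; have := rep_comp (@rep_run t) (@rep_lunV t) W; rewrite comp1m.
Qed.
Lemma rep_braid_unitl t : @rep (Cat Empty t) (Cat t Empty) (braid (unit_ob B) (ob t)) (fun W => idm _).
Proof.
have -> : braid (unit_ob B) (ob t) = runV (ob t) \oc lun (ob t).
  have h : lun (ob t) \oc braidV (unit_ob B) (ob t) = run (ob t).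
    exact: (@lun_braid k (brev B) (ob t)).
  have e : run (ob t) \oc braid (unit_ob B) (ob t) = lun (ob t).
    by rewrite -h -compA braidK compm1.
  by rewrite -e compA runK comp1m.
by move=> W; have := rep_comp (@rep_lun t) (@rep_runV t) W; rewrite comp1m.
Qed.

(** The interchange of the middle factors, which is the monoidal structure of the tensor product
    functor. *)
Definition swap X1 X2 Y1 Y2 : Hom ((X1 \ox X2) \ox (Y1 \ox Y2)) ((X1 \ox Y1) \ox (X2 \ox Y2)) :=
  assoV X1 Y1 (X2 \ox Y2) \oc
  (idm X1 \om (asso Y1 X2 Y2 \oc (braid X2 Y1 \om idm Y2) \oc assoV X2 Y1 Y2)) \oc
  asso X1 X2 (Y1 \ox Y2).

Lemma rep_swap s1 s2 t1 t2 p : @rep (Cat s2 t1) (Cat t1 s2) (braid (ob s2) (ob t1)) p ->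
  @rep (Cat (Cat s1 s2) (Cat t1 t2)) (Cat (Cat s1 t1) (Cat s2 t2)) (swap (ob s1) (ob s2) (ob t1) (ob t2))
    (fun W => flm t2 (p (fl s1 W))).
Proof.
move=> rp.
apply: (rep_ext (rep_comp (rep_comp (@rep_asso s1 s2 (Cat t1 t2)) (rep_tens (@rep_id s1)
  (rep_comp (rep_comp (@rep_assoV s2 t1 t2) (rep_tens rp (@rep_id t2))) (@rep_asso t1 s2 t2))))
  (@rep_assoV s1 t1 (Cat s2 t2)))); first by rewrite /swap !compA.
by move=> W /=; rewrite !flm1 !compm1 !comp1m.
Qed.

Lemma swap_iso X1 X2 Y1 Y2 : is_iso (swap X1 X2 Y1 Y2).
Proof.
apply: is_iso_comp (asso_iso _ _ _); apply: is_iso_comp (assoV_iso _ _ _) _.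
apply: bmap_iso; first exact: is_iso_id.
apply: is_iso_comp (assoV_iso _ _ _); apply: is_iso_comp (asso_iso _ _ _) _.
by apply: bmap_iso; [exact: braid_iso|exact: is_iso_id].
Qed.

Lemma swap_nat X1 X1' X2 X2' Y1 Y1' Y2 Y2' (f1 : Hom X1 X1') (f2 : Hom X2 X2')
    (g1 : Hom Y1 Y1') (g2 : Hom Y2 Y2') :
  swap X1' X2' Y1' Y2' \oc ((f1 \om f2) \om (g1 \om g2)) =
  ((f1 \om g1) \om (f2 \om g2)) \oc swap X1 X2 Y1 Y2.
Proof.
have assoV_nat X X' Y Y' Z Z' (f : Hom X X') (g : Hom Y Y') (h : Hom Z Z') :
  assoV X' Y' Z' \oc (f \om (g \om h)) = ((f \om g) \om h) \oc assoV X Y Z.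
  exact: assoV_natE (asso_nat _ _ _).
have inner : (asso Y1' X2' Y2' \oc (braid X2' Y1' \om idm Y2') \oc assoV X2' Y1' Y2') \oc (f2 \om (g1 \om g2)) =
    (g1 \om (f2 \om g2)) \oc (asso Y1 X2 Y2 \oc (braid X2 Y1 \om idm Y2) \oc assoV X2 Y1 Y2).
  rewrite -[LHS]compA assoV_nat [LHS]compA -(compA (asso _ _ _)) -bmapM braid_nat comp1m.
  have -> : (g1 \om f2 \oc braid X2 Y1) \om g2 = ((g1 \om f2) \om g2) \oc (braid X2 Y1 \om idm Y2).
    by rewrite -bmapM compm1.
  by rewrite [X in X \oc _]compA asso_nat -!compA.
rewrite /swap; move: inner; move: (asso Y1' X2' Y2' \oc _ \oc _) (asso Y1 X2 Y2 \oc _ \oc _) => m' m inner.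
rewrite -[LHS]compA asso_nat [LHS]compA -(compA (assoV _ _ _)) -bmapM comp1m inner.
have -> : f1 \om ((g1 \om (f2 \om g2)) \oc m) = (f1 \om (g1 \om (f2 \om g2))) \oc (idm X1 \om m).
  by rewrite -bmapM compm1.
by rewrite [X in X \oc _]compA assoV_nat -!compA.
Qed.

(** On both sides X2 crosses Y1 and Z1, and Y2 crosses Z1. In left-normed words it only remains to
    commute the crossings of X2 with Y1 and of Y2 with Z1, which are disjoint. *)
Lemma swap_asso X1 X2 Y1 Y2 Z1 Z2 :
  (asso X1 Y1 Z1 \om asso X2 Y2 Z2) \oc swap (X1 \ox Y1) (X2 \ox Y2) Z1 Z2
    \oc (swap X1 X2 Y1 Y2 \om idm (Z1 \ox Z2))
  = swap X1 X2 (Y1 \ox Z1) (Y2 \ox Z2) \oc (idm (X1 \ox X2) \om swap Y1 Y2 Z1 Z2)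
    \oc asso (X1 \ox X2) (Y1 \ox Y2) (Z1 \ox Z2).
Proof.
pose x1 := Letter X1; pose x2 := Letter X2; pose y1 := Letter Y1; pose y2 := Letter Y2.
pose z1 := Letter Z1; pose z2 := Letter Z2.
have rX2Y1 := rep_braid X2 Y1; have rY2Z1 := rep_braid Y2 Z1; have rX2Z1 := rep_braid X2 Z1.
apply: (rep_inj
  (rep_comp (rep_comp
    (rep_tens (@rep_swap x1 x2 y1 y2 _ rX2Y1) (@rep_id (Cat z1 z2)))
    (@rep_swap (Cat x1 y1) (Cat x2 y2) z1 z2 _ (rep_braid_catl rX2Z1 rY2Z1)))
    (rep_tens (@rep_asso x1 y1 z1) (@rep_asso x2 y2 z2)))
  (rep_comp (rep_comp (@rep_asso (Cat x1 x2) (Cat y1 y2) (Cat z1 z2))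
    (rep_tens (@rep_id (Cat x1 x2)) (@rep_swap y1 y2 z1 z2 _ rY2Z1)))
    (@rep_swap x1 x2 (Cat y1 z1) (Cat y2 z2) _ (rep_braid_catr rX2Y1 rX2Z1)))); try by rewrite ?compA.
move=> W /=; rewrite !rwh1 !comp1m !compm1 !rwhM -!compA; congr (_ \oc _).
by rewrite -!rwhM xing_nat.
Qed.

Lemma swap_lun X1 X2 :
  (lun X1 \om lun X2) \oc swap (unit_ob B) (unit_ob B) X1 X2 \oc
    (runV (unit_ob B) \om idm (X1 \ox X2)) = lun (X1 \ox X2).
Proof.
pose x1 := Letter X1; pose x2 := Letter X2.
apply: (rep_inj (rep_comp (rep_comp (rep_tens (@rep_runV Empty) (@rep_id (Cat x1 x2)))
   (@rep_swap Empty Empty x1 x2 _ (@rep_braid_unitl x1)))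
   (rep_tens (@rep_lun x1) (@rep_lun x2))) (@rep_lun (Cat x1 x2))); try by rewrite ?compA.
by move=> W /=; rewrite !rwh1 !comp1m.
Qed.

Lemma swap_run X1 X2 :
  (run X1 \om run X2) \oc swap X1 X2 (unit_ob B) (unit_ob B) \oc
    (idm (X1 \ox X2) \om runV (unit_ob B)) = run (X1 \ox X2).
Proof.
pose x1 := Letter X1; pose x2 := Letter X2.
apply: (rep_inj (rep_comp (rep_comp (rep_tens (@rep_id (Cat x1 x2)) (@rep_runV Empty))
   (@rep_swap x1 x2 Empty Empty _ (@rep_braid_unitr x2)))
   (rep_tens (@rep_run x1) (@rep_run x2))) (@rep_run (Cat x1 x2))); try by rewrite ?compA.
by move=> W /=; rewrite !rwh1 !comp1m.
Qed.

(** The two braids differ by a double crossing of X1 with Y2, which is why the second factor has to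
    centralize the first. *)
Lemma swap_braid X1 X2 Y1 Y2 : dbl X1 Y2 = idm _ ->
  (braid X1 Y1 \om braid X2 Y2) \oc swap X1 X2 Y1 Y2 =
  swap Y1 Y2 X1 X2 \oc braid (X1 \ox X2) (Y1 \ox Y2).
Proof.
move=> d1; pose x1 := Letter X1; pose x2 := Letter X2; pose y1 := Letter Y1; pose y2 := Letter Y2.
apply: (rep_inj (rep_comp (@rep_swap x1 x2 y1 y2 _ (rep_braid X2 Y1))
    (rep_tens (rep_braid X1 Y1) (rep_braid X2 Y2)))
  (rep_comp (rep_braid_catl (rep_braid_catr (rep_braid X1 Y1) (rep_braid X1 Y2))
    (rep_braid_catr (rep_braid X2 Y1) (rep_braid X2 Y2)))
    (@rep_swap y1 y2 x1 x2 _ (rep_braid Y2 X1))) _ _); try by rewrite ?compA.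
have xx W : xing Y2 X1 W \oc xing X1 Y2 W = idm _.
  by rewrite !xingE -vfamM -dblE d1 vfam1.
move=> W /=; rewrite [RHS]compA -rwhM [X in X |> X2 \oc _]compA xx comp1m.
by rewrite !compA -xing_nat.
Qed.
End Coherence.

Section BoxMonoidal.
Variables (k : closedFieldType) (B : bmoncat k).
Variables (D1 D2 : B -> Prop) (h1 : fusion_subcat D1) (h2 : fusion_subcat D2).
Hypothesis D12 : forall X Y, D1 X -> D2 Y -> dbl X Y = idm _.

Lemma box_braided : exists J : @monoidal_structure k (prod_bmoncat (sub_cat h1) (sub_cat h2)) B
   (uncurry_bifunctor (box h1 h2)), @braided_structure k (prod_bmoncat (sub_cat h1) (sub_cat h2)) B _ J.
Proof.
unshelve eexists.
  apply: (@MonoidalStructure k (prod_bmoncat (sub_cat h1) (sub_cat h2)) B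
    (uncurry_bifunctor (box h1 h2))
    (fun X Y => swap (sval X.1) (sval X.2) (sval Y.1) (sval Y.2))
    (runV (unit_ob B))).
  - by move=> X Y; apply: swap_iso.
  - exact: isoV_iso (run_iso _).
  - by move=> X X' Y Y' f g; apply: swap_nat.
  - by move=> X Y Z; apply: swap_asso.
  - by move=> X; apply: swap_lun.
  - by move=> X; apply: swap_run.
move=> X Y; apply: swap_braid; apply: D12; [exact: svalP|exact: svalP].
Qed.
End BoxMonoidal.

Lemma braided_equivalent_refl (k : fieldType) (C : bmoncat k) : braided_equivalent C C.
Proof.
exists (id_functor C).
unshelve eexists.
  apply: (@MonoidalStructure k C C (id_functor C) (fun X Y => idm (X \ox Y)) (idm (unit_ob C))) => //=.
  - by move=> X Y; apply: is_iso_id.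
  - exact: is_iso_id.
  - by move=> X X' Y Y' f g; rewrite comp1m compm1.
  - by move=> X Y Z; rewrite !bmap1 !compm1 comp1m.
  - by move=> X; rewrite bmap1 !compm1.
  - by move=> X; rewrite bmap1 !compm1.
split=> //.
  split; first by move=> X Y; exists id.
  by move=> Z; exists Z; apply: isom_refl.
by move=> X Y /=; rewrite comp1m compm1.
Qed.

(* The group Z/d is 'I_d.-1.+1 (as d > 0), which unlike 'Z_d is right for d = 1. *)
Theorem corollary4p7 (k : closedFieldType) (k_char0 : [pchar k] =i pred0)
    (C : bmoncat k) (C_fusion : fusion C)
    (C_wgt : weakly_group_theoretical C) (C_nondeg : braiding_nondegenerate C)
    (d n : nat) (d_gt0 : (0 < d)%N) (d_sqfree : squarefree d)
    (n_gt0 : (0 < n)%N) (C_dim : FPdim_cat C_fusion = (n * d)%:R)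
    (nd_coprime : coprime n d)
    (simple_dim : forall X : C, simple X ->
       forall m : nat, FPdim C_fusion X ^+ 2 = m%:R -> coprime m d) :
  exists q : 'I_d.-1.+1 -> k, nondegenerate_quadratic_form q /\
    exists (D : C -> Prop) (hD : fusion_subcat D),
      is_pointed_category q (sub_cat hD) /\
      exists T : bmoncat k,
        deligne_product (sub_cat hD) (sub_cat (centralizer_fusion_subcat D)) T /\
        braided_equivalent C T.
Proof.
(* By [FPdim_so] every positive character of the fusion ring consists of the Frobenius-Perron
   dimensions, so the hypothesis on FPdim(C) gives its sum of squares. *)
have hdim (x : 'I_(rk C_fusion) -> algC) : (forall i, 0 < x i) ->
    (forall i j, \sum_l (N i j l)%:R * x l = x i * x j) -> \sum_i x i ^+ 2 = (n * d)%:R.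
  move=> x0 xM; rewrite -C_dim; apply: eq_bigr => i _.
  by rewrite -(FPdim_so x0 xM).
have [F] := fusion_numbers_exist k_char0 hdim.
have dD := hdim (fd F) (fd_gt0 F) (fd_mul F).
have cop i : coprime (dsq k_char0 dD i) d.
  apply: (simple_dim (so i) (so_simple i)).
  by rewrite (FPdim_so (fd_gt0 F) (fd_mul F)) (dsqE k_char0 dD).
have [b [db bo bchi]] := cyclic_part C_nondeg d_gt0 d_sqfree (erefl _) nd_coprime cop.
exists (@quad _ _ _ F b d); split; first exact: (quad_nondegenerate d_gt0 db bo bchi).
pose hD := cyc_subcat d_gt0 db bo; exists _, hD.
split; first exact: (cyc_pointed d_gt0 db bo bchi).
(* The product is realised by [C] itself, so the equivalence is the identity. *)
exists C; split; last exact: braided_equivalent_refl.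
pose h2 := centralizer_fusion_subcat (objs (hB := C_fusion) (cycP b)).
have D2P Y : centralizer (objs (hB := C_fusion) (cycP b)) Y -> objs (hB := C_fusion) (perpP F b) Y.
  by move/(centralizer_perp db).
have P2D j : perpP F b j -> centralizer (objs (hB := C_fusion) (cycP b)) (so j).
  by move=> pj; apply/(centralizer_perp db); apply: objs_so.
exists (box hD h2); split.
- exact: fss_abelian (fusion_fss C_fusion).
- exact: (box_right_exact C_fusion).
- apply: (@box_universal k C C_fusion _ _ hD h2 (cycP b) (perpP F b)) => //.
  + by move=> i ci; apply: objs_so.
  + exact: (cyc_perp_simple db).
  + exact: (cyc_perp_inj db bo bchi).
  + exact: (cyc_perp_dense d_gt0 db bo bchi).
apply: box_braided => X Y dX /D2P; exact: (cyc_perp_dbl db).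
Qed.
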